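(* Let $\mathbb G=(A,\Delta_A)$ be a $C^*$-quantum group with reduced bicharacter $W\in\mathcal U(\hat A\otimes A)$, write $\boxtimes=\boxtimes_W$, and let $(B,\Delta_B)$ be a braided $C^*$-bialgebra in the category of $\mathbb G$-Yetter–Drinfeld $C^*$-algebras (equivalently, over the quantum codouble of $\mathbb G$). Let $C:=A\boxtimes B$ and $\Delta_C:=\Psi\circ(\mathrm{id}_A\boxtimes\Delta_B)\colon C\to C\otimes C$. Then $(C,\Delta_C)$ is a bisimplifiable $C^*$-bialgebra whenever $(B,\Delta_B)$ is a bisimplifiable braided $C^*$-bialgebra. If $\Delta_B$ is injective, then so is $\Delta_C$, and vice versa.
   Context: Conventions: $\otimes$ is the minimal $C^*$-tensor product, $\mathcal U(A)$ the unitary group of the multiplier algebra, $\sigma$ the flip; a morphism $A\to B$ is a nondegenerate $*$-homomorphism $A\to\mathcal M(B)$; $X\cdot Y$ is the closed linear span of products; leg numbering notation is used. A $C^*$-bialgebra is a $C^*$-algebra $C$ with a morphism $\Delta_C\colon C\to C\otimes C$ with $(\Delta_C\otimes\mathrm{id})\Delta_C=(\mathrm{id}\otimes\Delta_C)\Delta_C$; it is bisimplifiable if $\Delta_C(C)\cdot(1\otimes C)=C\otimes C=\Delta_C(C)\cdot(C\otimes1)$. A $C^*$-quantum group is a pair $(A,\Delta_A)$ obtained from a manageable (in Woronowicz's sense) multiplicative unitary $\mathbb W\in\mathcal U(\mathcal L\otimes\mathcal L)$, $\mathbb W_{23}\mathbb W_{12}=\mathbb W_{12}\mathbb W_{13}\mathbb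 W_{23}$, $\mathcal L$ separable: $A$ and $\hat A$ are the closed linear spans of the slices $(\omega\otimes\mathrm{id})\mathbb W$ and $(\mathrm{id}\otimes\omega)\mathbb W$, $\omega\in\mathbb B(\mathcal L)_*$; $W\in\mathcal U(\hat A\otimes A)$ is $\mathbb W$ viewed as a multiplier; $(\mathrm{id}\otimes\Delta_A)W=W_{12}W_{13}$, $(\hat\Delta_A\otimes\mathrm{id})W=W_{23}W_{13}$. The dual is $\hat{\mathbb G}=(\hat A,\hat\Delta_A)$ with reduced bicharacter $\hat W=\sigma(W^* )\in\mathcal U(A\otimes\hat A)$; the dual of $\hat{\mathbb G}$ is $\mathbb G$. Corepresentation of $(A,\Delta_A)$ on $\mathcal H$: $U\in\mathcal U(\mathbb K(\mathcal H)\otimes A)$ with $(\mathrm{id}\otimes\Delta_A)U=U_{12}U_{13}$. Continuous coaction on $C$: injective morphism $\gamma\colon C\to C\otimes A$ with $(\mathrm{id}\otimes\Delta_A)\gamma=(\gamma\otimes\mathrm{id})\gamma$ and $\gamma(C)\cdot(1\otimes A)=C\otimes A$; similarly for $\hat A$. A morphism $f$ is equivariant if $\delta f=(f\otimes\mathrm{id})\gamma$. Covariant representation: $(\varphi,U)$ with $(\varphi\otimes\mathrm{id})\gamma(c)=U(\varphi(c)\otimes1)U^*$; faithful ones always exist. Universal dual: $\hat A^{u}$ comes with $\tilde{\mathcal V}\in\mathcal U(\hat A^{u}\otimes A)$ whose slices span $\hat A^{u}$, such that each corepresentation $U$ on $\mathcal H$ is $(\rho^{\mathcal H}\otimes\mathrm{id})\tilde{\mathcal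 V}$ for a unique representation $\rho^{\mathcal H}$ of $\hat A^{u}$; $(\hat\Delta^{u}\otimes\mathrm{id})\tilde{\mathcal V}=\tilde{\mathcal V}_{23}\tilde{\mathcal V}_{13}$; the reducing map satisfies $(\hat\Lambda\otimes\mathrm{id})\tilde{\mathcal V}=W$. Applied to $\hat{\mathbb G}$ this gives $A^{u}$, and corepresentations $V\in\mathcal U(\mathbb K(\mathcal K)\otimes\hat A)$ of $\hat{\mathbb G}$ correspond to representations $\pi^{\mathcal K}$ of $A^{u}$. Twisted tensor product $\boxtimes=\boxtimes_W$: let $W^{u}\in\mathcal U(\hat A^{u}\otimes A^{u})$ be the unique bicharacter lifting $W$. For $C$ with continuous $A$-coaction and $D$ with continuous $\hat A$-coaction, with faithful covariant representations $(\varphi,U^{\mathcal H})$ and $(\psi,V^{\mathcal K})$, put $Z:=(\rho^{\mathcal H}\otimes\pi^{\mathcal K})(W^{u})^*$, $\iota_C(c)=\varphi(c)\otimes1$, $\iota_D(d)=Z(1\otimes\psi(d))Z^*$ and $C\boxtimes D:=\iota_C(C)\cdot\iota_D(D)\subseteq\mathbb B(\mathcal H\otimes\mathcal K)$, a $C^*$-algebra independent of the choices up to isomorphism intertwining $\iota_C,\iota_D$. For equivariant $f\colon C_1\to C_2$, $g\colon D_1\to D_2$, $f\boxtimes g\colon C_1\boxtimes D_1\to C_2\boxtimes D_2$ is the unique morphism with $(f\boxtimes g)\iota_{C_1}=\iota_{C_2}f$, $(f\boxtimes g)\iota_{D_1}=\iota_{D_2}g$. A $\mathbb G$-Yetter–Drinfeld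 $C^*$-algebra is a $C^*$-algebra $B$ with continuous coactions $\beta\colon B\to B\otimes A$ and $\hat\beta\colon B\to B\otimes\hat A$ with $\sigma^W_{23}((\beta\otimes\mathrm{id}_{\hat A})\hat\beta)=(\hat\beta\otimes\mathrm{id}_A)\beta$, where $\sigma^W(a\otimes\hat a)=W(\hat a\otimes a)W^*$. For such $B,B'$, $B\boxtimes B'$ carries the unique Yetter–Drinfeld structure for which the embeddings of $B,B'$ are equivariant for both coactions; $\boxtimes$ is associative up to the unique isomorphism intertwining the embeddings of the factors. A braided $C^*$-bialgebra is a $\mathbb G$-Yetter–Drinfeld $C^*$-algebra $B$ with a morphism $\Delta_B\colon B\to B\boxtimes B$ that is equivariant for both coactions and coassociative: $(\Delta_B\boxtimes\mathrm{id}_B)\Delta_B=(\mathrm{id}_B\boxtimes\Delta_B)\Delta_B$. It is bisimplifiable if $\Delta_B(B)\cdot\iota_1(B)=B\boxtimes B=\Delta_B(B)\cdot\iota_2(B)$, where $\iota_1,\iota_2\colon B\rightrightarrows B\boxtimes B$ are the canonical morphisms. $A$ carries the $A$-coaction $\Delta_A$, which suffices to form $A\boxtimes B$ and $A\boxtimes B\boxtimes B:=A\boxtimes(B\boxtimes B)$. The morphism $\mathrm{id}_A\boxtimes\Delta_B\colon A\boxtimes B\to A\boxtimes B\boxtimes B$ restricts to $\iota_A$ on $A$ and to $\iota_{B\boxtimes B}\circ\Delta_B$ on $B$. The morphism $\Psi\colon A\boxtimes B\boxtimes B\to(A\boxtimes B)\otimes(A\boxtimes B)$ is the unique (injective) one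 with $\Psi(\iota_A(a))=(\iota_A\otimes\iota_A)\Delta_A(a)$, $\Psi(b)=(\iota_B\otimes\iota_A)\beta(b)$ for $b$ in the first copy of $B$, and $\Psi(b)=1\otimes\iota_B(b)$ for $b$ in the second copy of $B$. *)

(* Defs.v *)
From mathcomp Require Import all_boot all_order all_algebra finmap complex.
From mathcomp Require Import all_classical all_reals all_analysis.
Set Implicit Arguments.
Unset Strict Implicit.
Unset Printing Implicit Defensive.
Import Order.TTheory GRing.Theory Num.Theory.
Local Open Scope classical_set_scope.
Local Open Scope complex_scope.
Local Open Scope ring_scope.

(* Every Hilbert space has an orthonormal basis, so Hilbert spaces are taken in
   the form l^2(I) over C = R[i], for an arbitrary index type I; separable ones
   are those with I a countType.  Then l^2(I) (x) l^2(J) = l^2(I * J), the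
   conjugate of l^2(I) is l^2(I) itself through entrywise conjugation, and an
   operator is its matrix, with entries <e_i, T e_j>.  Inner products are linear
   in the second variable.  C*-algebras act faithfully and nondegenerately on
   such Hilbert spaces; then A (x) B is the spatial tensor product and M(A) is
   the idealizer of A in the bounded operators. *)

Section Operators.
Variable R : realType.

Definition vec (I : choiceType) : Type := I -> R[i].
Definition op (I : choiceType) : Type := I -> I -> R[i].

Definition sqn (z : R[i]) : R := complex.Re z ^+ 2 + complex.Im z ^+ 2.

(* Sum of an absolutely summable family. *)
Definition rsum (I : choiceType) (f : I -> R) : R :=
  fine (\esum_(i in [set: I]) (Num.max (f i) 0)%:E) -
  fine (\esum_(i in [set: I]) (Num.max (- f i) 0)%:E).
Definition csum (I : choiceType) (f : I -> R[i]) : R[i] :=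
  rsum (fun i => complex.Re (f i)) +i* rsum (fun i => complex.Im (f i)).

Definition l2sq (I : choiceType) (x : vec I) : \bar R :=
  \esum_(i in [set: I]) (sqn (x i))%:E.
Definition l2 (I : choiceType) : set (vec I) := [set x | (l2sq x < +oo)%E].
Definition inner (I : choiceType) (x y : vec I) : R[i] :=
  csum (fun i => conjc (x i) * y i).
Definition vconj (I : choiceType) (x : vec I) : vec I := fun i => conjc (x i).
Definition vtens (I J : choiceType) (x : vec I) (y : vec J) : vec (I * J)%type :=
  fun p => x p.1 * y p.2.

Definition opnorm_le (I : choiceType) (T : op I) (M : R) : Prop :=
  forall (F : {fset I}) (x y : vec I),
    sqn (\sum_(i <- F) \sum_(j <- F) conjc (y i) * T i j * x j)
    <= M ^+ 2 * (\sum_(i <- F) sqn (x i)) * (\sum_(i <- F) sqn (y i)).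
Definition bounded_op (I : choiceType) : set (op I) :=
  [set T | exists M, opnorm_le T M].

Definition op1 (I : choiceType) : op I := fun i j => (i == j)%:R.
Definition opmul (I : choiceType) (S T : op I) : op I :=
  fun i k => csum (fun j => S i j * T j k).
Definition opadj (I : choiceType) (T : op I) : op I := fun i j => conjc (T j i).
Definition optens (I J : choiceType) (S : op I) (T : op J) : op (I * J)%type :=
  fun p q => S p.1 q.1 * T p.2 q.2.
Definition opapp (I : choiceType) (T : op I) (x : vec I) : vec I :=
  fun i => csum (fun j => T i j * x j).

Definition flip (I J : choiceType) (T : op (I * J)%type) : op (J * I)%type :=
  fun p q => T (p.2, p.1) (q.2, q.1).
Definition assoc (I J K : choiceType) (T : op ((I * J) * K)%type) :
    op (I * (J * K))%type :=
  fun p q => T ((p.1, p.2.1), p.2.2) ((q.1, q.2.1), q.2.2).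

End Operators.

Arguments op1 {R I}.
Notation "S ** T" := (opmul S T) (at level 40, left associativity).
Notation "T ^†" := (opadj T) (at level 1, format "T ^†").
Notation "S ⊗ T" := (optens S T) (at level 38, left associativity).

Section Algebras.
Variable R : realType.
Local Notation op := (op R).

(* X . Y below, the closed linear span of products, is cdot X Y; the C*-algebra
   A (x) B is atens A B. *)

(* Leg numbering on a triple tensor product, bracketed as I * (J * K). *)
Definition leg12 (I J K : choiceType) (T : op (I * J)%type) :
  op (I * (J * K))%type := assoc (T ⊗ (op1 : op K)).
Definition leg23 (I J K : choiceType) (T : op (J * K)%type) :
  op (I * (J * K))%type := (op1 : op I) ⊗ T.
Definition leg13 (I J K : choiceType) (T : op (I * K)%type) :
    op (I * (J * K))%type :=
  fun p q => T (p.1, p.2.2) (q.1, q.2.2) * (op1 : op J) p.2.1 q.2.1.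

Definition lspan (I : choiceType) (S : set (op I)) : set (op I) :=
  [set T | exists n (c : 'I_n -> R[i]) (t : 'I_n -> op I),
    (forall k, S (t k)) /\ T = fun i j => \sum_(k < n) c k * t k i j].
Definition cspan (I : choiceType) (S : set (op I)) : set (op I) :=
  [set T | forall e : R, 0 < e -> exists2 T', lspan S T' &
    opnorm_le (fun i j => T i j - T' i j) e].
Definition cdot (I : choiceType) (X Y : set (op I)) : set (op I) :=
  cspan [set T | exists2 S, X S & exists2 S', Y S' & T = S ** S'].

(* The last condition is nondegeneracy: A has no nonzero common null vector. *)
Definition is_cstar (I : choiceType) (A : set (op I)) : Prop :=
  [/\ A `<=` @bounded_op R I,
      cspan A `<=` A,
      (forall S T, A S -> A T -> A (S ** T)),
      (forall T, A T -> A (T^†)) &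
      (forall x, l2 x -> (forall T, A T -> opapp T x = fun=> 0) -> x = fun=> 0)].

Definition atens (I J : choiceType) (A : set (op I)) (B : set (op J)) :
    set (op (I * J)%type) :=
  cspan [set T | exists2 a, A a & exists2 b, B b & T = a ⊗ b].

Definition compacts (H : choiceType) : set (op H) :=
  cspan [set T | exists x y : vec R H,
    [/\ l2 x, l2 y & T = fun i j => x i * conjc (y j)]].

Definition mult (I : choiceType) (A : set (op I)) : set (op I) :=
  [set T | @bounded_op R I T /\ forall a, A a -> A (T ** a) /\ A (a ** T)].
Definition unitary (I : choiceType) (T : op I) : Prop :=
  [/\ @bounded_op R I T, T ** T^† = op1 & T^† ** T = op1].
Definition umult (I : choiceType) (A : set (op I)) : set (op I) :=
  [set T | mult A T /\ unitary T].

(* Morphisms A -> B are represented by functions op I -> op J, of which only the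
   values on A matter. *)
Definition is_mor (I J : choiceType) (A : set (op I)) (B : set (op J))
    (f : op I -> op J) : Prop :=
  [/\ (forall a, A a -> mult B (f a)),
      (forall c a a', A a -> A a' ->
         f (fun i j => c * a i j + a' i j) = fun i j => c * f a i j + f a' i j),
      (forall a a', A a -> A a' -> f (a ** a') = f a ** f a'),
      (forall a, A a -> f (a^†) = (f a)^†) &
      cdot (f @` A) B = B].

Definition inj_on (I J : choiceType) (A : set (op I)) (f : op I -> op J) : Prop :=
  forall a a', A a -> A a' -> f a = f a' -> a = a'.

(* The unital extension M(A) -> M(B) of a morphism f from A to B; the composition
   of f : A -> B with g : B -> C is fun a => ext B C g (f a). *)
Definition ext (I J : choiceType) (A : set (op I)) (B : set (op J))
    (f : op I -> op J) (m : op I) : op J :=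
  xget (fun _ _ => 0)
    [set T | mult B T /\ forall a, A a -> T ** f a = f (m ** a)].

(* f (x) g : A (x) C -> B (x) D, by its values on elementary tensors. *)
Definition tmor (I J K L : choiceType) (A : set (op I)) (C : set (op J))
    (B : set (op K)) (D : set (op L)) (f : op I -> op K) (g : op J -> op L) :
    op (I * J)%type -> op (K * L)%type :=
  xget (fun _ _ _ => 0)
    [set h | is_mor (atens A C) (atens B D) h /\
             forall a c, A a -> C c -> h (a ⊗ c) = f a ⊗ g c].

(* f (x) g, extended to multipliers. *)
Definition text (I J K L : choiceType) (A : set (op I)) (C : set (op J))
    (B : set (op K)) (D : set (op L)) (f : op I -> op K) (g : op J -> op L) :
    op (I * J)%type -> op (K * L)%type :=
  ext (atens A C) (atens B D) (tmor A C B D f g).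

Definition is_bialgebra (I : choiceType) (C : set (op I))
    (D : op I -> op (I * I)%type) : Prop :=
  [/\ is_cstar C, is_mor C (atens C C) D &
      forall c, C c -> assoc (text C C (atens C C) C D id (D c))
                     = text C C C (atens C C) id D (D c)].

Definition bisimplifiable (I : choiceType) (C : set (op I))
    (D : op I -> op (I * I)%type) : Prop :=
  cdot (D @` C) (optens op1 @` C) = atens C C /\
  cdot (D @` C) ((fun c => c ⊗ op1) @` C) = atens C C.

End Algebras.

Arguments compacts {R} H.
Arguments leg12 {R I J} K T.
Arguments leg13 {R I} J {K} T.
Arguments leg23 {R} I {J K} T.

Section QuantumGroups.
Variable R : realType.
Local Notation op := (op R).
Local Notation vec := (vec R).

(* B(l^2(I))_* : the functionals T |-> \sum_n <x_n, T y_n> with x, y square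
   summable families of vectors. *)
Definition normal (I : choiceType) : set (op I -> R[i]) :=
  [set w | exists x y : vec (nat * I)%type, [/\ l2 x, l2 y &
    w = fun T => inner x (fun p => csum (fun j => T p.2 j * y (p.1, j)))]].

Definition lslices (I J : choiceType) (X : op (I * J)%type) : set (op J) :=
  cspan [set T | exists2 w, @normal I w &
    T = fun j j' => w (fun i i' => X (i, j) (i', j'))].
Definition rslices (I J : choiceType) (X : op (I * J)%type) : set (op I) :=
  cspan [set T | exists2 w, @normal J w &
    T = fun i i' => w (fun j j' => X (i, j) (i', j'))].

(* Unbounded operators are given by their graphs. *)
Definition strictly_positive (I : choiceType) (Q : set (vec I * vec I)) : Prop :=
  [/\ (forall x y, Q (x, y) -> l2 x /\ l2 y),
      (forall x (e : R), l2 x -> 0 < e -> exists u v,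
         Q (u, v) /\ (l2sq (fun i => x i - u i)%R < e%:E)%E),
      (forall x y, l2 x -> l2 y ->
         (Q (x, y) <-> forall u v, Q (u, v) -> inner v x = inner u y)),
      (forall u v, Q (u, v) -> 0 <= inner u v) &
      (forall u, Q (u, fun=> 0) -> u = fun=> 0)].

(* The graph of Q (x) Q, the closure of the algebraic tensor product. *)
Definition graph_tens (I : choiceType) (Q : set (vec I * vec I)) :
    set (vec (I * I)%type * vec (I * I)%type) :=
  [set pq | [/\ l2 pq.1, l2 pq.2 & forall e : R, 0 < e ->
    exists n (u v u' v' : 'I_n -> vec I),
      [/\ (forall k, Q (u k, v k) /\ Q (u' k, v' k)),
          (l2sq (fun i => pq.1 i - \sum_(k < n) vtens (u k) (u' k) i)%R < e%:E)%E &
          (l2sq (fun i => pq.2 i - \sum_(k < n) vtens (v k) (v' k) i)%R < e%:E)%E]]].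

Definition multiplicative_unitary (I : choiceType) (W : op (I * I)%type) : Prop :=
  unitary W /\
  leg23 I W ** leg12 I W = leg12 I W ** leg13 I W ** leg23 I W.

(* In the last condition v = Q u and t = Q^-1 y. *)
Definition manageable (I : choiceType) (W : op (I * I)%type) : Prop :=
  exists (Q : set (vec I * vec I)) (Wt : op (I * I)%type),
  [/\ strictly_positive Q,
      unitary Wt,
      (forall p q, l2 p -> l2 q ->
         (graph_tens Q (opapp W p, opapp W q) <-> graph_tens Q (p, q))) &
      (forall x z u v t y, l2 x -> l2 z -> Q (u, v) -> Q (t, y) ->
         inner (vtens x u) (opapp W (vtens z y))
         = inner (vtens (vconj z) v) (opapp Wt (vtens (vconj x) t)))].

(* A C*-quantum group (qA, qDA) with its dual (qAh, qDAh), obtained from the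
   manageable multiplicative unitary qW.  The equations qDA_W and qDAh_W
   determine the comultiplications.  That qA and qAh are C*-algebras, that qW
   belongs to U(qAh (x) qA) and that the comultiplications exist follows from
   manageability (Woronowicz). *)
Record qgroup := QGroup {
  qI : countType;
  qW : op (qI * qI)%type;
  qA := lslices qW;
  qAh := rslices qW;
  qDA : op qI -> op (qI * qI)%type;
  qDAh : op qI -> op (qI * qI)%type;
  qW_mult : multiplicative_unitary qW;
  qW_man : manageable qW;
  qA_cstar : is_cstar qA;
  qAh_cstar : is_cstar qAh;
  qW_umult : umult (atens qAh qA) qW;
  qDA_mor : is_mor qA (atens qA qA) qDA;
  qDAh_mor : is_mor qAh (atens qAh qAh) qDAh;
  qDA_W : text qAh qA qAh (atens qA qA) id qDA qW = leg12 qI qW ** leg13 qI qW;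
  qDAh_W : assoc (text qAh qA (atens qAh qAh) qA qDAh id qW)
           = leg23 qI qW ** leg13 qI qW }.

Arguments qW : clear implicits.
Arguments qA : clear implicits.
Arguments qAh : clear implicits.
Arguments qDA : clear implicits.
Arguments qDAh : clear implicits.

Definition qWh (G : qgroup) : op (qI G * qI G)%type := flip ((qW G)^†).

Arguments qWh : clear implicits.

Definition corep (H I : choiceType) (A : set (op I)) (DA : op I -> op (I * I)%type)
    (U : op (H * I)%type) : Prop :=
  umult (atens (compacts H) A) U /\
  text (compacts H) A (compacts H) (atens A A) id DA U = leg12 I U ** leg13 I U.

Definition coaction (I J : choiceType) (A : set (op I)) (DA : op I -> op (I * I)%type)
    (C : set (op J)) (g : op J -> op (J * I)%type) : Prop :=
  [/\ is_mor C (atens C A) g,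
      inj_on C g,
      (forall c, C c -> text C A C (atens A A) id DA (g c)
                        = assoc (text C A (atens C A) A g id (g c))) &
      cdot (g @` C) (optens op1 @` A) = atens C A].

Definition equivariant (I J K : choiceType) (A : set (op I))
    (C : set (op J)) (g : op J -> op (J * I)%type)
    (D : set (op K)) (d : op K -> op (K * I)%type) (f : op J -> op K) : Prop :=
  forall c, C c -> ext D (atens D A) d (f c) = text C A D A f id (g c).

Definition faithful_covariant (I J H : choiceType) (A : set (op I))
    (DA : op I -> op (I * I)%type) (C : set (op J)) (g : op J -> op (J * I)%type)
    (phi : op J -> op H) (U : op (H * I)%type) : Prop :=
  [/\ is_mor C (compacts H) phi, inj_on C phi, corep A DA U &
      forall c, C c ->
        text C A (compacts H) A phi id (g c) = U ** (phi c ⊗ op1) ** U^†].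

(* The universal dual (Au, V, Du) of (A, DA), with reducing map Lam onto the
   reduced dual, where W is the reduced bicharacter. *)
Definition universal_dual (I J K : choiceType) (A : set (op I))
    (DA : op I -> op (I * I)%type) (Ah : set (op J)) (W : op (J * I)%type)
    (Au : set (op K)) (V : op (K * I)%type) (Du : op K -> op (K * K)%type)
    (Lam : op K -> op J) : Prop :=
  (is_cstar Au /\ umult (atens Au A) V /\ rslices V = Au) /\
  (text Au A Au (atens A A) id DA V = leg12 I V ** leg13 I V) /\
  (forall (H : choiceType) (U : op (H * I)%type), corep A DA U ->
     exists rho : op K -> op H,
       [/\ is_mor Au (compacts H) rho,
           text Au A (compacts H) A rho id V = U &
           forall rho', is_mor Au (compacts H) rho' ->
             text Au A (compacts H) A rho' id V = U ->
             forall a, Au a -> rho' a = rho a]) /\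
  (is_mor Au (atens Au Au) Du /\
   assoc (text Au A (atens Au Au) A Du id V) = leg23 K V ** leg13 K V) /\
  (is_mor Au Ah Lam /\ text Au A Ah A Lam id V = W).

Record universal_data (G : qgroup) := UniversalData {
  uhI : choiceType;
  uhA : set (op uhI);
  uhV : op (uhI * qI G)%type;
  uhD : op uhI -> op (uhI * uhI)%type;
  uhL : op uhI -> op (qI G);
  uI : choiceType;
  uA : set (op uI);
  uV : op (uI * qI G)%type;
  uD : op uI -> op (uI * uI)%type;
  uL : op uI -> op (qI G);
  uW : op (uhI * uI)%type;
  uhA_univ : universal_dual (qA G) (qDA G) (qAh G) (qW G) uhA uhV uhD uhL;
  uA_univ : universal_dual (qAh G) (qDAh G) (qA G) (qWh G) uA uV uD uL;
  uW_umult : umult (atens uhA uA) uW;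
  uW_bichar_r : text uhA uA uhA (atens uA uA) id uD uW
                = leg12 uI uW ** leg13 uI uW;
  uW_bichar_l : assoc (text uhA uA (atens uhA uhA) uA uhD id uW)
                = leg23 uhI uW ** leg13 uhI uW;
  uW_lift : text uhA uA (qAh G) (qA G) uhL uL uW = qW G }.


End QuantumGroups.

Arguments qW {R} _.
Arguments qWh {R} _.
Arguments qA {R} _.
Arguments qAh {R} _.
Arguments qDA {R} _.
Arguments qDAh {R} _.
Arguments uhA {R G} _.
Arguments uA {R G} _.
Arguments uhV {R G} _.
Arguments uhD {R G} _.
Arguments uhL {R G} _.
Arguments uV {R G} _.
Arguments uD {R G} _.
Arguments uL {R G} _.
Arguments uW {R G} _.

Section TwistedTensor.
Variables (R : realType) (G : qgroup R) (Un : universal_data G).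
Local Notation op := (op R).
Local Notation A := (qA G).
Local Notation Ah := (qAh G).
Local Notation DA := (qDA G).
Local Notation DAh := (qDAh G).

(* The choices of faithful covariant representations (on l^2(twH), l^2(twK)) from
   which the twisted tensor product of (C, g) and (D, d) is built. *)
Record twisted (I J : choiceType) (C : set (op I)) (g : op I -> op (I * qI G)%type)
    (D : set (op J)) (d : op J -> op (J * qI G)%type) := Twisted {
  twH : choiceType;
  twK : choiceType;
  tw_phi : op I -> op twH;
  tw_U : op (twH * qI G)%type;
  tw_psi : op J -> op twK;
  tw_V : op (twK * qI G)%type;
  tw_rho : op (uhI Un) -> op twH;
  tw_pi : op (uI Un) -> op twK;
  tw_cov_l : faithful_covariant A DA C g tw_phi tw_U;
  tw_cov_r : faithful_covariant Ah DAh D d tw_psi tw_V;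
  tw_rho_mor : is_mor (uhA Un) (compacts twH) tw_rho;
  tw_rho_U : text (uhA Un) A (compacts twH) A tw_rho id (uhV Un) = tw_U;
  tw_pi_mor : is_mor (uA Un) (compacts twK) tw_pi;
  tw_pi_V : text (uA Un) Ah (compacts twK) Ah tw_pi id (uV Un) = tw_V }.

Arguments tw_phi {I J C g D d} t.
Arguments tw_psi {I J C g D d} t.
Arguments tw_rho {I J C g D d} t.
Arguments tw_pi {I J C g D d} t.

Section Constructions.
Variables (I J : choiceType) (C : set (op I)) (g : op I -> op (I * qI G)%type).
Variables (D : set (op J)) (d : op J -> op (J * qI G)%type).
Variable T : twisted C g D d.

Definition twI : choiceType := (twH T * twK T)%type.
Definition twZ : op twI :=
  (text (uhA Un) (uA Un) (compacts (twH T)) (compacts (twK T))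
     (tw_rho T) (tw_pi T) (uW Un))^†.
Definition tw_inl (c : op I) : op twI := tw_phi T c ⊗ op1.
Definition tw_inr (x : op J) : op twI :=
  twZ ** (op1 ⊗ tw_psi T x) ** twZ^†.
Definition tw_alg : set (op twI) := cdot (tw_inl @` C) (tw_inr @` D).

End Constructions.

Arguments tw_alg {I J C g D d} T.
Arguments tw_inl {I J C g D d} T c.
Arguments tw_inr {I J C g D d} T x.

(* h = f \boxtimes k *)
Definition is_twmap (I1 J1 I2 J2 : choiceType)
    (C1 : set (op I1)) (g1 : op I1 -> op (I1 * qI G)%type)
    (D1 : set (op J1)) (d1 : op J1 -> op (J1 * qI G)%type)
    (C2 : set (op I2)) (g2 : op I2 -> op (I2 * qI G)%type)
    (D2 : set (op J2)) (d2 : op J2 -> op (J2 * qI G)%type)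
    (T1 : twisted C1 g1 D1 d1) (T2 : twisted C2 g2 D2 d2)
    (f : op I1 -> op I2) (k : op J1 -> op J2) (h : op (twI T1) -> op (twI T2)) :
    Prop :=
  [/\ is_mor (tw_alg T1) (tw_alg T2) h,
      (forall c, C1 c -> ext (tw_alg T1) (tw_alg T2) h (tw_inl T1 c)
                         = ext C2 (tw_alg T2) (tw_inl T2) (f c)) &
      (forall x, D1 x -> ext (tw_alg T1) (tw_alg T2) h (tw_inr T1 x)
                         = ext D2 (tw_alg T2) (tw_inr T2) (k x))].

Arguments is_twmap {I1 J1 I2 J2 C1 g1 D1 d1 C2 g2 D2 d2} T1 T2 f k h.

Definition yetter_drinfeld (J : choiceType) (B : set (op J))
    (b bh : op J -> op (J * qI G)%type) : Prop :=
  [/\ is_cstar B, coaction A DA B b, coaction Ah DAh B bh &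
      forall x, B x ->
        leg23 J (qW G)
          ** (fun p q => assoc (text B Ah (atens B A) Ah b id (bh x))
                (p.1, (p.2.2, p.2.1)) (q.1, (q.2.2, q.2.1)))
          ** (leg23 J (qW G))^†
        = assoc (text B A (atens B Ah) A bh id (b x))].

Section Braided.
Variables (J : choiceType) (B : set (op J)) (b bh : op J -> op (J * qI G)%type).
Variable BB : twisted B b B bh.
Variables (bBB bhBB : op (twI BB) -> op (twI BB * qI G)%type).
Local Notation BoxB := (tw_alg BB).
Local Notation i1 := (tw_inl BB).
Local Notation i2 := (tw_inr BB).

Definition yd_product : Prop :=
  [/\ yetter_drinfeld BoxB bBB bhBB,
      equivariant A B b BoxB bBB i1,
      equivariant A B b BoxB bBB i2,
      equivariant Ah B bh BoxB bhBB i1 &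
      equivariant Ah B bh BoxB bhBB i2].

(* The canonical isomorphism (B \boxtimes B) \boxtimes B -> B \boxtimes (B \boxtimes B). *)
Definition is_associator (L : twisted BoxB bBB B bh) (M : twisted B b BoxB bhBB)
    (F : op (twI L) -> op (twI M)) : Prop :=
  [/\ is_mor (tw_alg L) (tw_alg M) F,
      inj_on (tw_alg L) F,
      F @` tw_alg L = tw_alg M &
      forall x, B x ->
        [/\ ext (tw_alg L) (tw_alg M) F (ext BoxB (tw_alg L) (tw_inl L) (i1 x))
              = tw_inl M x,
            ext (tw_alg L) (tw_alg M) F (ext BoxB (tw_alg L) (tw_inl L) (i2 x))
              = ext BoxB (tw_alg M) (tw_inr M) (i1 x) &
            ext (tw_alg L) (tw_alg M) F (tw_inr L x)
              = ext BoxB (tw_alg M) (tw_inr M) (i2 x)]].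

(* (DB \boxtimes id) DB = (id \boxtimes DB) DB up to the associator; the models L
   and M of the two triple products are unique up to isomorphism, so the choice
   does not matter. *)
Definition braided_coassociative (DB : op J -> op (twI BB)) : Prop :=
  exists (L : twisted BoxB bBB B bh) (M : twisted B b BoxB bhBB)
         (Dl : op (twI BB) -> op (twI L)) (Dr : op (twI BB) -> op (twI M))
         (F : op (twI L) -> op (twI M)),
  [/\ is_twmap BB L DB id Dl, is_twmap BB M id DB Dr, @is_associator L M F &
      forall x, B x ->
        ext (tw_alg L) (tw_alg M) F (ext BoxB (tw_alg L) Dl (DB x))
        = ext BoxB (tw_alg M) Dr (DB x)].

Definition braided_bialgebra (DB : op J -> op (twI BB)) : Prop :=
  [/\ yetter_drinfeld B b bh /\ yd_product,
      is_mor B BoxB DB,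
      equivariant A B b BoxB bBB DB,
      equivariant Ah B bh BoxB bhBB DB &
      braided_coassociative DB].

Definition braided_bisimplifiable (DB : op J -> op (twI BB)) : Prop :=
  cdot (DB @` B) (i1 @` B) = BoxB /\ cdot (DB @` B) (i2 @` B) = BoxB.

(* With E = A \boxtimes (B \boxtimes B): the two copies of B in E are embedded through
   i1 and i2. *)
Definition is_Psi (AB : twisted A DA B bh) (ABB : twisted A DA BoxB bhBB)
    (Psi : op (twI ABB) -> op (twI AB * twI AB)%type) : Prop :=
  let C := tw_alg AB in let E := tw_alg ABB in
  [/\ is_mor E (atens C C) Psi,
      inj_on E Psi,
      (forall a, A a -> ext E (atens C C) Psi (tw_inl ABB a)
         = text A A C C (tw_inl AB) (tw_inl AB) (DA a)),
      (forall x, B x -> ext E (atens C C) Psi (ext BoxB E (tw_inr ABB) (i1 x))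
         = text B A C C (tw_inr AB) (tw_inl AB) (b x)) &
      (forall x, B x -> ext E (atens C C) Psi (ext BoxB E (tw_inr ABB) (i2 x))
         = op1 ⊗ tw_inr AB x)].

End Braided.
End TwistedTensor.

Arguments tw_alg {R G Un I J C g D d} T.
Arguments tw_inl {R G Un I J C g D d} T c.
Arguments tw_inr {R G Un I J C g D d} T x.
Arguments is_twmap {R G Un I1 J1 I2 J2 C1 g1 D1 d1 C2 g2 D2 d2} T1 T2 f k h.
Arguments is_Psi {R G Un J B b bh BB bhBB} AB ABB Psi.
Arguments braided_bialgebra {R G Un J B b bh BB} bBB bhBB DB.
Arguments braided_bisimplifiable {R G Un J B b bh BB} DB.

(* Main.v *)
Require Import Defs.
From mathcomp Require Import all_boot all_order all_algebra finmap complex.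
From mathcomp Require Import all_classical all_reals all_analysis.
From HB Require Import structures.
From mathcomp Require Import ring lra.
Set Implicit Arguments.
Unset Strict Implicit.
Unset Printing Implicit Defensive.
Import Order.TTheory GRing.Theory Num.Theory.
Local Open Scope classical_set_scope.
Local Open Scope complex_scope.
Local Open Scope ring_scope.

(* A C*-algebra on l^2(I) is handled as a closed *-subalgebra of the ring of bounded
   operators, and a morphism through its extension to multipliers.

   A twisted tensor product C [x] D is isomorphic to the closed linear span of the
   products g(c)_13 d(y)_23 in M(C (x) D (x) K(L)), by conjugation with U_13 V_23; this
   rests on the Heisenberg commutation relation V_23 U_13 = U_13 V_23 Z_12.  It is a
   C*-algebra as soon as d(y)_23 g(c)_13 belongs to this span.  For (A, Delta_A) this
   follows by writing Delta_A(a) through slices of W; for iterated products it is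
   inherited from the factors.

   On generators, Delta_C is Delta_A on A and Theta o Delta_B on B, where
   Theta(i1 x) = (i_B (x) i_A) beta(x) and Theta(i2 x) = 1 (x) i_B(x).
   Bisimplifiability:
     Delta_C(C) (1 (x) C) = Delta_C(A) Theta(Delta_B(B) i2(B)) (1 (x) A)
                          = Delta_C(A) Theta(i1(B)) (1 (x) A) (1 (x) B),
   and then the Podles condition for beta and bisimplifiability of A give C (x) C;
   the other side is similar.  Coassociativity on B is that of Delta_B
   transported along the map B [x] B [x] B -> M(C (x) C (x) C) that is
   (i_B (x) i_A (x) i_A) (id (x) Delta_A) beta, 1 (x) (i_B (x) i_A) beta and 1 (x) 1 (x) i_B
   on the three factors.  Since Psi is injective, Delta_C is injective
   if and only if id [x] Delta_B is, and in the concrete models this map is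
   id (x) Delta_B (x) id. *)

(** * Absolutely convergent sums *)

(** The obstacle is that the closed span of products defining a twisted tensor product is not
    visibly closed under multiplication. Only for B [x] B is this part of the hypotheses. There the
    commutation of the two legs is read back from it in the canonical model, where it no longer
    depends on covariant representations and can be pushed along equivariant morphisms to the triple
    products. The canonical model has a third leg K(L) and slices of multipliers occur throughout,
    so F (x) id is defined block by block on M(A (x) K), not only on A (x) C. The underlying
    C*-theory avoids spectra: positivity enters through identities star T * T + P = M^2, and square
    roots come from a fixed-point iteration that stays inside a nonunital algebra. Contractivity of
    homomorphisms, isometry of injective ones and approximate units follow. Columns [T * Emx j j]
    replace vectors, and matrix-unit slices replace normal functionals. In the statement, extensions
    and tensor products of morphisms are chosen by [xget]; nondegeneracy shows that each choice is
    the only possible one. *)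

Section Modulus.
Variable R : realType.
Implicit Types z w : R[i].

Definition cm z : R := Normc.normc z.

Lemma cm_ge0 z : 0 <= cm z.
Proof. by case: z => a b; exact: sqrtr_ge0. Qed.
Lemma cmE z : cm z ^+ 2 = sqn z.
Proof. by case: z => a b; rewrite /cm /sqn /= sqr_sqrtr // addr_ge0 ?sqr_ge0. Qed.
Lemma sqn_ge0 z : 0 <= sqn z.
Proof. by rewrite -cmE sqr_ge0. Qed.
Lemma cmM z w : cm (z * w) = cm z * cm w.
Proof. exact: Normc.normcM. Qed.
Lemma cmD z w : cm (z + w) <= cm z + cm w.
Proof. exact: le_normcD. Qed.
Lemma cmN z : cm (- z) = cm z.
Proof. exact: normcN. Qed.
Lemma cmB z w : cm (z - w) <= cm z + cm w.
Proof. by rewrite -(cmN w) cmD. Qed.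
Lemma cm0 : cm 0 = 0.
Proof. exact: Normc.normc0. Qed.
Lemma cm1 : cm 1 = 1.
Proof. exact: Normc.normc1. Qed.
Lemma cm_eq0 z : cm z = 0 -> z = 0.
Proof. exact: Normc.eq0_normc. Qed.
Lemma cm_conj z : cm (conjc z) = cm z.
Proof. by case: z => a b; rewrite /cm /= sqrrN. Qed.
Lemma cm_real (a : R) : 0 <= a -> cm a%:C = a.
Proof. by move=> a0; rewrite /cm /= expr0n addr0 sqrtr_sqr ger0_norm. Qed.
Lemma sqn0 : sqn 0 = 0 :> R.
Proof. by rewrite -cmE cm0 expr0n. Qed.
Lemma sqn_conj z : sqn (conjc z) = sqn z.
Proof. by rewrite -!cmE cm_conj. Qed.
Lemma sqn_eq0 z : sqn z = 0 -> z = 0.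
Proof. by rewrite -cmE => /eqP; rewrite sqrf_eq0 => /eqP /cm_eq0. Qed.
Lemma conjc_sqn z : conjc z * z = (sqn z)%:C.
Proof. by case: z => a b; rewrite /sqn; congr Complex => /=; ring. Qed.
Lemma cm_sum (I : Type) (r : seq I) (f : I -> R[i]) :
  cm (\sum_(i <- r) f i) <= \sum_(i <- r) cm (f i).
Proof.
elim/big_rec2: _ => [|i y z _ h]; first by rewrite cm0.
by apply: le_trans (cmD _ _) _; rewrite lerD2l.
Qed.
Lemma cm_eps z w : (forall e : R, 0 < e -> cm (z - w) <= e) -> z = w.
Proof.
move=> h; apply/eqP; rewrite -subr_eq0; apply/eqP/cm_eq0/eqP.
rewrite eq_le cm_ge0 andbT; apply/ler_addgt0Pr => e e0; rewrite add0r; exact: h.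
Qed.
Lemma Re_le_cm z : `|complex.Re z| <= cm z.
Proof.
case: z => a b; rewrite /cm /= -sqrtr_sqr.
by rewrite ler_sqrt ?addr_ge0 ?sqr_ge0 // lerDl sqr_ge0.
Qed.
Lemma Im_le_cm z : `|complex.Im z| <= cm z.
Proof.
case: z => a b; rewrite /cm /= -sqrtr_sqr.
by rewrite ler_sqrt ?addr_ge0 ?sqr_ge0 // lerDr sqr_ge0.
Qed.
Lemma cm_le_ReIm z : cm z <= `|complex.Re z| + `|complex.Im z|.
Proof.
case: z => a b; have E : a +i* b = a%:C + (0 +i* 1) * b%:C.
  by congr Complex => /=; ring.
rewrite {1}E.
apply: le_trans (cmD _ _) _; rewrite cmM.
have -> : cm (0 +i* 1 : R[i]) = 1 by rewrite /cm /= expr0n expr1n add0r sqrtr1.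
by rewrite mul1r /cm /= !(expr0n, addr0) /= !sqrtr_sqr.
Qed.

End Modulus.

Section Sums.
Variable R : realType.
Implicit Types (I N : choiceType).

(** Unconditional convergence along finite sets. [csum] is tied to it once, in [csum_sums];
    afterwards most sums are handled through limits and their uniqueness instead of through
    [esum]. *)
Definition sums I (f : I -> R[i]) (v : R[i]) : Prop :=
  forall e : R, 0 < e -> exists F0 : {fset I},
    forall F : {fset I}, (F0 `<=` F)%fset -> cm (\sum_(i <- F) f i - v) <= e.

Definition asum I (f : I -> R[i]) : Prop :=
  exists M : R, forall F : {fset I}, \sum_(i <- F) cm (f i) <= M.

Lemma sums_uniq I (f : I -> R[i]) v w : sums f v -> sums f w -> v = w.
Proof.
move=> hv hw; apply: cm_eps => e e0.
have e2 : 0 < e / 2 by lra.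
have [F1 h1] := hv _ e2; have [F2 h2] := hw _ e2.
pose F := (F1 `|` F2)%fset.
have := h1 F (fsubsetUl _ _); have := h2 F (fsubsetUr _ _).
set s := \sum_(i <- F) _ => a b.
have -> : v - w = (s - w) - (s - v) by ring.
by apply: le_trans (cmB _ _) _; lra.
Qed.

Lemma sumsD I (f g : I -> R[i]) v w :
  sums f v -> sums g w -> sums (fun i => f i + g i) (v + w).
Proof.
move=> hv hw e e0; have e2 : 0 < e / 2 by lra.
have [F1 h1] := hv _ e2; have [F2 h2] := hw _ e2.
exists (F1 `|` F2)%fset => F; rewrite fsubUset => /andP[/h1 a /h2 b].
rewrite big_split /= opprD addrACA; apply: le_trans (cmD _ _) _; lra.
Qed.

Lemma sumsZ I (f : I -> R[i]) c v : sums f v -> sums (fun i => c * f i) (c * v).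
Proof.
move=> hv e e0; have c0 := cm_ge0 c.
have e2 : 0 < e / (cm c + 1) by rewrite divr_gt0 // ltr_wpDl.
have [F1 h1] := hv _ e2; exists F1 => F /h1 a.
rewrite -mulr_sumr -mulrBr cmM.
apply: le_trans (ler_wpM2l c0 a) _.
rewrite mulrA ler_pdivrMr ?ltr_wpDl // mulrC ler_wpM2l //; lra.
Qed.

Lemma sums_conj I (f : I -> R[i]) v :
  sums f v -> sums (fun i => conjc (f i)) (conjc v).
Proof.
move=> hv e /hv[F1 h1]; exists F1 => F /h1 a.
by rewrite -rmorph_sum -rmorphB cm_conj.
Qed.

Lemma sums0 I : sums (fun _ : I => 0) (0 : R[i]).
Proof. by move=> e e0; exists fset0 => F _; rewrite big1 // subr0 cm0 ltW. Qed.

Lemma sums_sum I (T : Type) (r : seq T) (f : T -> I -> R[i]) (v : T -> R[i]) :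
  (forall t, sums (f t) (v t)) ->
  sums (fun i => \sum_(t <- r) f t i) (\sum_(t <- r) v t).
Proof.
move=> h; elim: r => [|t r IH].
  rewrite big_nil; have -> : (fun i => \sum_(t <- [::]) f t i) = fun=> 0.
    by apply/funext => i; rewrite big_nil.
  exact: sums0.
rewrite big_cons; have -> : (fun i => \sum_(s <- t :: r) f s i) =
   fun i => f t i + \sum_(s <- r) f s i by apply/funext => i; rewrite big_cons.
exact: sumsD.
Qed.

Lemma fsum_diff I (V : zmodType) (F G : {fset I}) (f : I -> V) : (F `<=` G)%fset ->
  \sum_(i <- G) f i = \sum_(i <- F) f i + \sum_(i <- (G `\` F)%fset) f i.
Proof.
move=> FG; rewrite (big_fsetID _ (mem F)) /=; congr (_ + _); apply: eq_fbigl => i.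
  by rewrite !inE /= andb_idl // => /(fsubsetP FG).
by rewrite !inE /= andbC.
Qed.

(** A finite set that is good for the limit may be enlarged by F; what remains after removing F is a
    finite sum disjoint from F, bounded by M. *)
Lemma sums_tail I (f : I -> R[i]) v (F : {fset I}) (M : R) : sums f v ->
  (forall G : {fset I}, [disjoint F & G]%fset -> cm (\sum_(i <- G) f i) <= M) ->
  cm (v - \sum_(i <- F) f i) <= M.
Proof.
move=> hv h; apply/ler_addgt0Pr => e e0; have [F1 h1] := hv _ e0.
pose G := (F `|` F1)%fset.
have := h1 G (fsubsetUr _ _); rewrite (@fsum_diff _ _ F G _ (fsubsetUl _ _)).
set s := \sum_(i <- F) _; set t := \sum_(i <- (G `\` F)%fset) _ => a.
have tM : cm t <= M by apply: h; apply/fdisjointP => i iF; rewrite inE iF.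
have -> : v - s = t - (s + t - v) by ring.
by apply: le_trans (cmB _ _) _; lra.
Qed.

Lemma sums_le I (f : I -> R[i]) v (M : R) : sums f v ->
  (forall G : {fset I}, cm (\sum_(i <- G) f i) <= M) -> cm v <= M.
Proof.
move=> hv h; have := @sums_tail _ f v fset0 M hv; rewrite big_seq_fset0 subr0.
by apply => G _; exact: h.
Qed.

Lemma sums_fin I (f : I -> R[i]) (F : {fset I}) :
  (forall i, i \notin F -> f i = 0) -> sums f (\sum_(i <- F) f i).
Proof.
move=> h e e0; exists F => G FG; rewrite (fsum_diff _ FG) addrAC subrr add0r.
rewrite big_seq big1 ?cm0 ?ltW // => i; rewrite !inE => /andP[iF _]; exact: h.
Qed.

Let rposum I (f : I -> R) : R := fine (\esum_(i in [set: I]) (Num.max (f i) 0)%:E).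

Lemma fsum_fsbig I (F : {fset I}) (f : I -> R) :
  (\sum_(i \in [set` F]) (f i)%:E = (\sum_(i <- F) f i)%:E)%E.
Proof.
rewrite fsbig_finite /=; last exact: finite_fset.
by rewrite set_fsetK sumEFin.
Qed.

(** Monotone convergence of the positive parts: the bound M makes the [esum] finite, so some finite
    sum comes within e of it and no finite sum exceeds it. *)
Lemma rposum_lim I (f : I -> R) (M : R) :
  (forall F : {fset I}, \sum_(i <- F) `|f i| <= M) ->
  forall e : R, 0 < e -> exists F0 : {fset I}, forall F : {fset I}, (F0 `<=` F)%fset ->
    `|\sum_(i <- F) Num.max (f i) 0 - rposum f| <= e.
Proof.
move=> hM e e0; pose g i := Num.max (f i) 0.
have g0 i : 0 <= g i by rewrite /g le_max lexx orbT.
have gM (F : {fset I}) : \sum_(i <- F) g i <= M.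
  apply: le_trans (hM F); apply: ler_sum => i _.
  by rewrite /g ge_max normr_ge0 ler_norm.
set s := (\esum_(i in [set: I]) (g i)%:E)%E.
have ubs (F : {fset I}) : ((\sum_(i <- F) g i)%:E <= s)%E.
  apply: esum_ge; exists [set` F]; last by rewrite fsum_fsbig.
  by split => //; exact: finite_fset.
have sM : (s <= M%:E)%E.
  apply: ge_ereal_sup => _ [X [fX _] <-].
  by rewrite -[X](fset_setK fX) fsum_fsbig lee_fin.
have s_fin : s \is a fin_num.
  rewrite ge0_fin_numE; first by rewrite (le_lt_trans sM) ?ltry.
  by apply: esum_ge0 => i _; rewrite lee_fin.
have [F0 hF0] : exists F0 : {fset I}, fine s - e < \sum_(i <- F0) g i.
  have : (s - e%:E < s)%E by rewrite lteBlDr // lteDl ?lte_fin.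
  move=> /ereal_sup_gt[_ [X [fX _] <-]].
  rewrite -[X](fset_setK fX) fsum_fsbig -(fineK s_fin) -EFinB lte_fin => h.
  by exists (fset_set X).
exists F0 => F FF; have h1 : \sum_(i <- F) g i <= fine s.
  by rewrite -lee_fin fineK.
have h2 : \sum_(i <- F0) g i <= \sum_(i <- F) g i.
  rewrite [X in _ <= X](big_fsetID _ (mem F0)) /=.
  have -> : [fset x in F | mem F0 x]%fset = F0.
    by apply/fsetP => i; rewrite !inE /= andb_idl // => /(fsubsetP FF).
  by rewrite lerDl sumr_ge0.
by rewrite ler_distlC /rposum -/g -/s; apply/andP; split; lra.
Qed.

Lemma rsum_lim I (f : I -> R) (M : R) :
  (forall F : {fset I}, \sum_(i <- F) `|f i| <= M) ->
  forall e : R, 0 < e -> exists F0 : {fset I}, forall F : {fset I}, (F0 `<=` F)%fset ->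
    `|\sum_(i <- F) f i - rsum f| <= e.
Proof.
move=> hM e e0; have e2 : 0 < e / 2 by lra.
have [F1 h1] := rposum_lim hM e2.
have hM' (F : {fset I}) : \sum_(i <- F) `|- f i| <= M.
  by rewrite (eq_bigr (fun i => `|f i|)) // => i _; rewrite normrN.
have [F2 h2] := rposum_lim hM' e2.
exists (F1 `|` F2)%fset => F; rewrite fsubUset => /andP[/h1 a /h2 b].
have -> : \sum_(i <- F) f i =
   \sum_(i <- F) Num.max (f i) 0 - \sum_(i <- F) Num.max (- f i) 0.
  rewrite -sumrB; apply: eq_bigr => i _.
  by case: (leP (f i) 0) => h; case: (leP (- f i) 0) => h'; lra.
rewrite /rsum -/(rposum f) -/(rposum (fun i => - f i)).
move: a b; set u := \sum_(i <- F) _; set v := \sum_(i <- F) _.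
set p := rposum f; set q := rposum _; rewrite !ler_norml; lra.
Qed.

Lemma csum_sums I (f : I -> R[i]) : asum f -> sums f (csum f).
Proof.
move=> [M hM] e e0; have e2 : 0 < e / 2 by lra.
have hR (F : {fset I}) : \sum_(i <- F) `|complex.Re (f i)| <= M.
  by apply: le_trans (hM F); apply: ler_sum => i _; exact: Re_le_cm.
have hI (F : {fset I}) : \sum_(i <- F) `|complex.Im (f i)| <= M.
  by apply: le_trans (hM F); apply: ler_sum => i _; exact: Im_le_cm.
have [F1 h1] := rsum_lim hR e2; have [F2 h2] := rsum_lim hI e2.
exists (F1 `|` F2)%fset => F; rewrite fsubUset => /andP[/h1 a /h2 b].
apply: le_trans (cm_le_ReIm _) _.
have ReB (u v : R[i]) : complex.Re (u - v) = complex.Re u - complex.Re v.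
  by case: u v => ? ? [].
have ImB (u v : R[i]) : complex.Im (u - v) = complex.Im u - complex.Im v.
  by case: u v => ? ? [].
rewrite ReB ImB !raddf_sum /=; move: a b => /=; lra.
Qed.

Lemma csumE I (f : I -> R[i]) v : asum f -> sums f v -> csum f = v.
Proof. by move=> /csum_sums h /(sums_uniq h). Qed.

Lemma asum_fin I (f : I -> R[i]) (F : {fset I}) :
  (forall i, i \notin F -> f i = 0) -> asum f.
Proof.
move=> h; exists (\sum_(i <- F) cm (f i)) => G.
rewrite (big_fsetID _ (mem F)) /= [X in _ + X]big_seq [X in _ + X]big1 ?addr0; last first.
  by move=> i; rewrite !inE /= => /andP[_ iF]; rewrite h // cm0.
rewrite [X in _ <= X](big_fsetID _ (mem G)) /=.
have -> : [fset x in F | mem G x]%fset = [fset x in G | mem F x]%fset.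
  by apply/fsetP => i; rewrite !inE /= andbC.
by rewrite lerDl sumr_ge0 // => i _; exact: cm_ge0.
Qed.

Lemma csum_fin I (f : I -> R[i]) (F : {fset I}) :
  (forall i, i \notin F -> f i = 0) -> csum f = \sum_(i <- F) f i.
Proof. by move=> h; apply: csumE; [exact: asum_fin h | exact: sums_fin]. Qed.

Lemma csum1 I (f : I -> R[i]) i0 : (forall i, i != i0 -> f i = 0) -> csum f = f i0.
Proof.
move=> h; rewrite (@csum_fin _ _ [fset i0]%fset) ?big_seq_fset1 // => i.
by rewrite inE => /h.
Qed.

Lemma csum0 I (f : I -> R[i]) : (forall i, f i = 0) -> csum f = 0.
Proof. by move=> h; rewrite (@csum_fin _ _ fset0) ?big_seq_fset0. Qed.

(** No summability is involved: [csum] is built from [esum]s of positive parts, and those reindex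
    along an injection unconditionally. *)
Lemma csum_inj I N (h : I -> N) (f : N -> R[i]) : injective h ->
  (forall n, (forall i, n <> h i) -> f n = 0) -> csum f = csum (fun i => f (h i)).
Proof.
move=> hi f0; rewrite /csum.
have key (g : N -> R) : (forall n, (forall i, n <> h i) -> g n = 0) ->
    \esum_(n in [set: N]) (Num.max (g n) 0)%:E =
    \esum_(i in [set: I]) (Num.max (g (h i)) 0)%:E.
  move=> g0; rewrite -(@esum_image _ _ _ [set: I] h (fun n => (Num.max (g n) 0)%:E));
    last by move=> x y _ _; exact: hi.
  rewrite [RHS]esum_mkcond; apply: eq_esum => n _; case: ifPn => //.
  rewrite notin_setE => hn; rewrite g0 ?maxxx // => i ni; apply: hn; by exists i.
congr Complex; rewrite /rsum !key //.
- by move=> n /f0 -> /=; rewrite ?oppr0.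
- by move=> n /f0 ->.
- by move=> n /f0 -> /=; rewrite ?oppr0.
- by move=> n /f0 ->.
Qed.

Lemma asumD I (f g : I -> R[i]) : asum f -> asum g -> asum (fun i => f i + g i).
Proof.
move=> [M h] [M' h']; exists (M + M') => F.
apply: le_trans (lerD (h F) (h' F)); rewrite -big_split /=.
by apply: ler_sum => i _; exact: cmD.
Qed.
Lemma asumZ I (f : I -> R[i]) c : asum f -> asum (fun i => c * f i).
Proof.
move=> [M h]; exists (cm c * M) => F.
rewrite (eq_bigr (fun i => cm c * cm (f i))) => [|i _]; last exact: cmM.
by rewrite -mulr_sumr ler_wpM2l ?cm_ge0.
Qed.
Lemma asum_conj I (f : I -> R[i]) : asum f -> asum (fun i => conjc (f i)).
Proof.
move=> [M h]; exists M => F.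
by rewrite (eq_bigr (fun i => cm (f i))) => [|i _]; [exact: h|exact: cm_conj].
Qed.
Lemma csumD I (f g : I -> R[i]) : asum f -> asum g ->
  csum (fun i => f i + g i) = csum f + csum g.
Proof.
by move=> hf hg; apply: csumE; [exact: asumD|apply: sumsD; exact: csum_sums].
Qed.
Lemma csumZ I (f : I -> R[i]) c : asum f -> csum (fun i => c * f i) = c * csum f.
Proof. by move=> hf; apply: csumE; [exact: asumZ|apply: sumsZ; exact: csum_sums]. Qed.
Lemma csum_conj I (f : I -> R[i]) : asum f ->
  csum (fun i => conjc (f i)) = conjc (csum f).
Proof. by move=> hf; apply: csumE; [exact: asum_conj|apply: sums_conj; exact: csum_sums]. Qed.

End Sums.

(** * Bounded operators *)

Section Forms.
Variable R : realType.
Implicit Types (I J : choiceType).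
Local Notation op := (op R).
Local Notation vec := (vec R).

Definition nF I (F : {fset I}) (x : vec I) : R := Num.sqrt (\sum_(i <- F) sqn (x i)).

Definition bform I (T : op I) (F G : {fset I}) (y x : vec I) : R[i] :=
  \sum_(i <- F) \sum_(j <- G) y i * T i j * x j.

(** Differs from [opnorm_le] by two independent finite sets, no conjugation and no squares. This
    form is stable under transposition and suits rectangular partial sums. The condition [0 <= M] is
    included because [opnorm_le] only sees M^2. *)
Definition opb I (T : op I) (M : R) : Prop :=
  0 <= M /\ forall F G y x, cm (bform T F G y x) <= M * nF F y * nF G x.

Lemma nF_ge0 I (F : {fset I}) x : 0 <= nF F x.
Proof. exact: sqrtr_ge0. Qed.
Lemma nFE I (F : {fset I}) x : nF F x ^+ 2 = \sum_(i <- F) sqn (x i).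
Proof. by rewrite sqr_sqrtr // sumr_ge0 // => i _; exact: sqn_ge0. Qed.
Lemma nF_conj I (F : {fset I}) x : nF F (fun i => conjc (x i)) = nF F x.
Proof. by rewrite /nF; congr Num.sqrt; apply: eq_bigr => i _; exact: sqn_conj. Qed.

Lemma realC_sum (T : Type) (r : seq T) (f : T -> R) :
  (\sum_(i <- r) f i)%:C = \sum_(i <- r) (f i)%:C.
Proof. exact: (rmorph_sum (real_complex R)). Qed.

(** Weighted arithmetic-geometric mean in each term, with weights q/p and p/q for p, q the two
    norms; these weights make the total equal to p * q. Zero norms are split off because of the
    division. *)
Lemma cauchy_schwarz I (F : {fset I}) (y x : vec I) :
  \sum_(i <- F) cm (y i) * cm (x i) <= nF F y * nF F x.
Proof.
have p0 := nF_ge0 F y; have q0 := nF_ge0 F x.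
have z0 (v : vec I) : nF F v = 0 -> forall i, i \in F -> cm (v i) = 0.
  move=> v0 i iF; have := nFE F v; rewrite v0 expr0n /= => /esym/eqP.
  rewrite psumr_eq0 => [/allP/(_ i iF)/=/eqP/sqn_eq0 ->|j _]; last exact: sqn_ge0.
  exact: cm0.
have [/z0 y0|yn] := eqVneq (nF F y) 0.
  by rewrite big_seq big1 ?mulr_ge0 // => i /y0 ->; rewrite mul0r.
have [/z0 x0|xn] := eqVneq (nF F x) 0.
  by rewrite big_seq big1 ?mulr_ge0 // => i /x0 ->; rewrite mulr0.
have pp : 0 < nF F y by rewrite lt_def yn.
have qp : 0 < nF F x by rewrite lt_def xn.
set p := nF F y; set q := nF F x.
have key i : cm (y i) * cm (x i) <=
     q / p / 2 * sqn (y i) + p / q / 2 * sqn (x i).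
  rewrite -!cmE; have : 0 <= (q * cm (y i) - p * cm (x i)) ^+ 2 / (p * q).
    by rewrite divr_ge0 ?sqr_ge0 // mulr_ge0 // ltW.
  have -> : (q * cm (y i) - p * cm (x i)) ^+ 2 / (p * q) =
     2 * (q / p / 2 * cm (y i) ^+ 2 + p / q / 2 * cm (x i) ^+ 2 - cm (y i) * cm (x i)).
    by field; rewrite yn xn.
  lra.
apply: le_trans (ler_sum _ (fun i _ => key i)) _.
rewrite big_split /= -!mulr_sumr -!nFE -/p -/q le_eqVlt; apply/orP; left; apply/eqP.
by field; rewrite yn xn.
Qed.

Lemma cauchy_schwarz_cm I (F : {fset I}) (y x : vec I) :
  cm (\sum_(i <- F) y i * x i) <= nF F y * nF F x.
Proof.
apply: le_trans (cauchy_schwarz F y x); apply: le_trans (cm_sum _ _) _.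
by apply: ler_sum => i _; rewrite cmM.
Qed.

Lemma big_restrict I (V : zmodType) (F K : {fset I}) (f : I -> V) : (F `<=` K)%fset ->
  \sum_(i <- F) f i = \sum_(i <- K) (if i \in F then f i else 0).
Proof.
move=> FK; transitivity (\sum_(i <- F) (if i \in F then f i else 0)).
  by apply: eq_big_seq => i ->.
by apply: big_fset_incl => // i _ /negPf ->.
Qed.

(** Since [opnorm_le] only tests square forms, the two finite sets are embedded into their union and
    the vectors are extended by zero. *)
Lemma opnorm_le_opb I (T : op I) (M : R) : 0 <= M -> opnorm_le T M <-> opb T M.
Proof.
move=> M0; split=> [h|[_ h] F x y]; last first.
  have := h F F (fun i => conjc (y i)) x; rewrite nF_conj /bform => h1.
  rewrite -cmE -!nFE -!exprMn; rewrite ler_pXn2r ?nnegrE ?cm_ge0 ?mulr_ge0 ?nF_ge0 //.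
  by rewrite -mulrA [nF F x * _]mulrC mulrA.
split=> // F G y x; pose K := (F `|` G)%fset.
pose y' := fun i => if i \in F then conjc (y i) else 0.
pose x' := fun i => if i \in G then x i else 0.
have FK : (F `<=` K)%fset by exact: fsubsetUl.
have GK : (G `<=` K)%fset by exact: fsubsetUr.
have -> : bform T F G y x = \sum_(i <- K) \sum_(j <- K) conjc (y' i) * T i j * x' j.
  rewrite /bform (big_restrict _ FK); apply: eq_bigr => i _; rewrite /y'.
  case: ifP => _; last by rewrite conjc0 big1 // => j _; rewrite !mul0r.
  rewrite (big_restrict _ GK); apply: eq_bigr => j _; rewrite conjcK /x'.
  by case: ifP => _; rewrite ?mulr0.
have nFr (L : {fset I}) (v : vec I) : (L `<=` K)%fset ->
    \sum_(i <- K) sqn (if i \in L then v i else 0) = nF L v ^+ 2.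
  move=> LK; rewrite nFE (big_restrict _ LK); apply: eq_bigr => i _.
  by case: ifP; rewrite ?sqn0.
have := h K x' y'; rewrite !nFr // nF_conj -cmE -!exprMn.
rewrite ler_pXn2r ?nnegrE ?cm_ge0 ?mulr_ge0 ?nF_ge0 //.
by rewrite -mulrA [nF G x * _]mulrC mulrA.
Qed.

(** Testing the form against the conjugate of the image vector itself gives S^2 <= M S |x| for its
    norm S, and S is cancelled when nonzero. *)
Lemma opb_col I (T : op I) (M : R) (F G : {fset I}) x : opb T M ->
  nF F (fun i => \sum_(j <- G) T i j * x j) <= M * nF G x.
Proof.
move=> [M0 h]; set v := fun i => _; set S := nF F v.
have := h F G (fun i => conjc (v i)) x; rewrite nF_conj.
have -> : bform T F G (fun i => conjc (v i)) x = (S ^+ 2)%:C.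
  rewrite nFE realC_sum; apply: eq_bigr => i _; rewrite -conjc_sqn {2}/v mulr_sumr.
  by apply: eq_bigr => j _; rewrite mulrA.
rewrite cm_real ?sqr_ge0 // -/S mulrAC expr2.
have [->|Sn] := eqVneq S 0; first by rewrite mulr_ge0 ?nF_ge0.
by rewrite ler_pM2r // lt_def Sn nF_ge0.
Qed.

Lemma opb_tr I (T : op I) (M : R) : opb T M -> opb (fun i j => T j i) M.
Proof.
move=> [M0 h]; split=> // F G y x; rewrite mulrAC; apply: le_trans (h _ _ _ _).
rewrite /bform exchange_big /= le_eqVlt; apply/orP; left; apply/eqP.
by congr cm; apply: eq_bigr => i _; apply: eq_bigr => j _; ring.
Qed.

Lemma opb_row I (T : op I) (M : R) (F G : {fset I}) y : opb T M ->
  nF G (fun j => \sum_(i <- F) y i * T i j) <= M * nF F y.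
Proof.
move=> /opb_tr /(opb_col G F y); congr (_ <= _); congr (nF G).
by apply/funext => j; apply: eq_bigr => i _; rewrite mulrC.
Qed.

Lemma nF1 I (i : I) (x : vec I) : nF [fset i]%fset x = cm (x i).
Proof. by rewrite /nF big_seq_fset1 -cmE sqrtr_sqr ger0_norm ?cm_ge0. Qed.

Lemma nF_row I (T : op I) (M : R) i G : opb T M -> nF G (T i) <= M.
Proof.
move=> /(@opb_row _ _ _ [fset i]%fset G (fun=> 1)); rewrite nF1 cm1 mulr1.
by congr (nF G _ <= _); apply/funext => j; rewrite big_seq_fset1 mul1r.
Qed.

Lemma nF_column I (T : op I) (M : R) j F : opb T M -> nF F (fun i => T i j) <= M.
Proof. by move=> /opb_tr /(nF_row j F). Qed.

Lemma asum_l2 I (x y : vec I) a b : (forall F, nF F x <= a) -> (forall F, nF F y <= b) ->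
  asum (fun i => x i * y i).
Proof.
move=> ha hb; exists (a * b) => F.
rewrite (eq_bigr (fun i => cm (x i) * cm (y i))) => [|i _]; last exact: cmM.
by apply: le_trans (cauchy_schwarz _ _ _) _; apply: ler_pM; rewrite ?nF_ge0.
Qed.

Lemma asum_mul I (S T : op I) M N i k : opb S M -> opb T N ->
  asum (fun j => S i j * T j k).
Proof.
move=> hS hT; apply: (@asum_l2 _ _ _ M N) => F; [exact: nF_row|exact: nF_column].
Qed.

Lemma asum_opapp I (T : op I) M (x : vec I) b i : opb T M -> (forall F, nF F x <= b) ->
  asum (fun j => T i j * x j).
Proof. by move=> hT hx; apply: (@asum_l2 _ _ _ M b) => // F; exact: nF_row. Qed.

(** The finite form of S T is a limit over the inner index of pairings of the row y S with the
    column T x. Cauchy-Schwarz bounds each partial sum, and the bound passes to the limit. *)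
Lemma opb_mul I (S T : op I) M N : opb S M -> opb T N -> opb (S ** T) (M * N).
Proof.
move=> hS hT; have [M0 _] := hS; have [N0 _] := hT.
split=> [|F G y x]; first exact: mulr_ge0.
have e : sums (fun j => \sum_(i <- F) \sum_(k <- G) y i * (S i j * T j k) * x k)
    (bform (S ** T) F G y x).
  apply: sums_sum => i; apply: sums_sum => k.
  have -> : (fun j => y i * (S i j * T j k) * x k) =
            (fun j => (y i * x k) * (S i j * T j k)) by apply/funext => j; ring.
  have -> : y i * (S ** T) i k * x k = (y i * x k) * (S ** T) i k by ring.
  by apply: sumsZ; apply: csum_sums; exact: asum_mul hS hT.
apply: sums_le e _ => H.
have -> : \sum_(j <- H) \sum_(i <- F) \sum_(k <- G) y i * (S i j * T j k) * x k =
   \sum_(j <- H) (\sum_(i <- F) y i * S i j) * (\sum_(k <- G) T j k * x k).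
  apply: eq_bigr => j _; rewrite mulr_suml; apply: eq_bigr => i _.
  by rewrite mulr_sumr; apply: eq_bigr => k _; ring.
apply: le_trans (cauchy_schwarz_cm _ _ _) _.
have -> : M * N * nF F y * nF G x = (M * nF F y) * (N * nF G x) by ring.
by apply: ler_pM; rewrite ?nF_ge0 ?opb_col ?opb_row.
Qed.

(** The squares form an absolutely summable family, and the partial sums over H0 and over H0 joined
    with H differ exactly by the sum over H. *)
Lemma nF_tail I (x : vec I) a (e : R) : (forall F, nF F x <= a) -> 0 < e ->
  exists H0, forall H, [disjoint H0 & H]%fset -> nF H x <= e.
Proof.
move=> ha e0; pose f i := (sqn (x i))%:C : R[i].
have fs : asum f.
  exists (a ^+ 2) => F; rewrite (eq_bigr (fun i => sqn (x i))) => [|i _]; last first.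
    by rewrite cm_real ?sqn_ge0.
  by rewrite -nFE ler_pXn2r ?nnegrE ?nF_ge0 // (le_trans _ (ha F)) ?nF_ge0.
have e2 : 0 < e ^+ 2 / 2 by rewrite divr_gt0 // exprn_gt0.
have [H0 h0] := csum_sums fs e2; exists H0 => H HH.
have H1 := h0 _ (fsubset_refl H0); have H2 := h0 _ (fsubsetUl H0 H).
have : cm (\sum_(i <- H) f i) <= e ^+ 2.
  have -> : \sum_(i <- H) f i =
     (\sum_(i <- (H0 `|` H)%fset) f i - csum f) - (\sum_(i <- H0) f i - csum f).
    rewrite (fsum_diff _ (fsubsetUl H0 H)).
    have -> : ((H0 `|` H) `\` H0)%fset = H.
      apply/fsetP => i; rewrite !inE; case iH: (i \in H); rewrite ?andbF ?orbF ?orbT ?andNb //.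
      by rewrite andbT; apply/negP => iH0; move/fdisjointP: HH => /(_ _ iH0); rewrite iH.
    by ring.
  by apply: le_trans (cmB _ _) _; lra.
rewrite -realC_sum -nFE cm_real ?sqr_ge0 //.
by rewrite ler_pXn2r ?nnegrE ?nF_ge0 // ltW.
Qed.

Lemma nF_opapp I (T : op I) M (x : vec I) b : opb T M -> (forall F, nF F x <= b) ->
  forall F, nF F (opapp T x) <= M * b.
Proof.
move=> hT hx F; have [M0 hM] := hT.
have b0 : 0 <= b by rewrite (le_trans _ (hx fset0)) ?nF_ge0.
pose v := opapp T x; set S := nF F v.
have e : sums (fun j => \sum_(i <- F) conjc (v i) * (T i j * x j)) (S ^+ 2)%:C.
  rewrite nFE realC_sum.
  have -> : \sum_(i <- F) (sqn (v i))%:C = \sum_(i <- F) conjc (v i) * v i.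
    by apply: eq_bigr => i _; rewrite conjc_sqn.
  apply: sums_sum => i; apply: sumsZ; apply: csum_sums; exact: asum_opapp hT hx.
have : cm (S ^+ 2)%:C <= M * S * b.
  apply: sums_le e _ => G.
  have -> : \sum_(j <- G) \sum_(i <- F) conjc (v i) * (T i j * x j) =
     bform T F G (fun i => conjc (v i)) x.
    rewrite exchange_big; apply: eq_bigr => i _; apply: eq_bigr => j _; ring.
  apply: le_trans (hM _ _ _ _) _; rewrite nF_conj ler_wpM2l ?hx //.
  by rewrite mulr_ge0 ?nF_ge0.
rewrite cm_real ?sqr_ge0 // mulrAC expr2.
have [->|Sn] := eqVneq S 0; first by rewrite mulr_ge0.
by rewrite ler_pM2r // lt_def Sn nF_ge0.
Qed.

(* Absolute convergence of the double sum may fail; the iterated sums still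
   agree because rectangular partial sums are controlled by the l2 norms. *)
Lemma csum_exchange I (T : op I) M (s u : vec I) a b : opb T M ->
  (forall F, nF F s <= a) -> (forall F, nF F u <= b) ->
  csum (fun k => csum (fun j => s j * T j k) * u k) =
  csum (fun j => s j * csum (fun k => T j k * u k)).
Proof.
move=> hT hs hu; have [M0 hM] := hT.
have a0 : 0 <= a by rewrite (le_trans _ (hs fset0)) ?nF_ge0.
have b0 : 0 <= b by rewrite (le_trans _ (hu fset0)) ?nF_ge0.
have hTt := opb_tr hT.
have sTE k : csum (fun j => s j * T j k) = opapp (fun i j => T j i) s k.
  by congr csum; apply/funext => j; rewrite mulrC.
set v1 := csum _; set v2 := RHS.
have nsT F : nF F (fun k => csum (fun j => s j * T j k)) <= M * a.
  by under [fun k => _]eq_fun do rewrite sTE; exact: nF_opapp.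
have nTu : forall F, nF F (fun j => csum (fun k => T j k * u k)) <= M * b.
  exact: (nF_opapp hT hu).
have s1 : sums (fun k => csum (fun j => s j * T j k) * u k) v1.
  by apply: csum_sums; exact: asum_l2 nsT hu.
have s2 : sums (fun j => s j * csum (fun k => T j k * u k)) v2.
  by apply: csum_sums; exact: asum_l2 hs nTu.
(* The four errors t1 to t4 below add up to (c - 1) * d, which is at most e for d = e / c; the
   summand 1 makes c positive. *)
apply: cm_eps => e e0; pose c := 2 * M * (a + b) + 1.
have c0 : 0 < c by rewrite ltr_wpDl // mulr_ge0 ?addr_ge0 // mulr_ge0.
pose d := e / c; have d0 : 0 < d by rewrite divr_gt0.
have [H hH] := nF_tail hs d0; have [K hK] := nF_tail hu d0.
pose A := bform T H K s u.
have t1 : cm (v1 - \sum_(k <- K) csum (fun j => s j * T j k) * u k) <= M * a * d.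
  apply: sums_tail s1 _ => G /hK uG; apply: le_trans (cauchy_schwarz_cm _ _ _) _.
  by apply: ler_pM; rewrite ?nF_ge0.
have t2 : cm (v2 - \sum_(j <- H) s j * csum (fun k => T j k * u k)) <= M * b * d.
  apply: sums_tail s2 _ => G /hH uG; apply: le_trans (cauchy_schwarz_cm _ _ _) _.
  by rewrite mulrC; apply: ler_pM; rewrite ?nF_ge0.
have t3 : cm (\sum_(k <- K) csum (fun j => s j * T j k) * u k - A) <= M * b * d.
  have q : sums (fun j => \sum_(k <- K) u k * (s j * T j k))
      (\sum_(k <- K) csum (fun j => s j * T j k) * u k).
    under [X in sums _ X]eq_bigr do rewrite mulrC.
    apply: sums_sum => k; apply: sumsZ; apply: csum_sums.
    by apply: (asum_l2 hs (b := M)) => F; exact: nF_column.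
  have := @sums_tail _ _ _ _ H (M * b * d) q.
  have -> : \sum_(i <- H) \sum_(k <- K) u k * (s i * T i k) = A.
    by apply: eq_bigr => i _; apply: eq_bigr => k _; ring.
  apply=> G /hH sG.
  have -> : \sum_(i <- G) \sum_(k <- K) u k * (s i * T i k) = bform T G K s u.
    by apply: eq_bigr => i _; apply: eq_bigr => k _; ring.
  apply: le_trans (hM _ _ _ _) _; rewrite mulrAC.
  by apply: ler_pM; rewrite ?mulr_ge0 ?nF_ge0 ?ler_wpM2l.
have t4 : cm (\sum_(j <- H) s j * csum (fun k => T j k * u k) - A) <= M * a * d.
  have q : sums (fun k => \sum_(j <- H) s j * (T j k * u k))
      (\sum_(j <- H) s j * csum (fun k => T j k * u k)).
    apply: sums_sum => j; apply: sumsZ; apply: csum_sums.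
    by apply: (asum_l2 (a := M) _ hu) => F; exact: nF_row.
  have := @sums_tail _ _ _ _ K (M * a * d) q.
  have -> : \sum_(k <- K) \sum_(j <- H) s j * (T j k * u k) = A.
    by rewrite exchange_big; apply: eq_bigr => i _; apply: eq_bigr => k _; ring.
  apply=> G /hK uG.
  have -> : \sum_(k <- G) \sum_(j <- H) s j * (T j k * u k) = bform T H G s u.
    by rewrite exchange_big; apply: eq_bigr => i _; apply: eq_bigr => k _; ring.
  apply: le_trans (hM _ _ _ _) _.
  by apply: ler_pM; rewrite ?mulr_ge0 ?nF_ge0 ?ler_wpM2l.
move: t1 t2 t3 t4; set p := \sum_(k <- K) _; set q := \sum_(j <- H) _ => t1 t2 t3 t4.
have -> : v1 - v2 = ((v1 - p) + (p - A)) - ((v2 - q) + (q - A)) by ring.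
apply: le_trans (cmB _ _) _.
apply: le_trans (lerD (cmD _ _) (cmD _ _)) _.
apply: le_trans (lerD (lerD t1 t3) (lerD t2 t4)) _.
have -> : M * a * d + M * b * d + (M * b * d + M * a * d) = (c - 1) * d by rewrite /c; ring.
by rewrite /d mulrA ler_pdivrMr // mulrC ler_wpM2l //; [exact: ltW|lra].
Qed.

Lemma opmulA I (S T U : op I) L M N : opb S L -> opb T M -> opb U N ->
  S ** (T ** U) = S ** T ** U.
Proof.
move=> hS hT hU; apply/funext => i; apply/funext => l; apply/esym.
apply: (csum_exchange hT (a := L) (b := N)) => F; [exact: nF_row|exact: nF_column].
Qed.

Lemma opb_adj I (T : op I) M : opb T M -> opb (T^†) M.
Proof.
move=> /opb_tr[M0 h]; split=> // F G y x; rewrite -(nF_conj F) -(nF_conj G).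
apply: le_trans (h F G (fun i => conjc (y i)) (fun i => conjc (x i))).
rewrite -cm_conj /bform rmorph_sum le_eqVlt; apply/orP; left; apply/eqP; congr cm.
apply: eq_bigr => i _; rewrite rmorph_sum; apply: eq_bigr => j _.
by rewrite !rmorphM /opadj /= conjcK.
Qed.

Lemma opbD I (S T : op I) M N : opb S M -> opb T N ->
  opb (fun i j => S i j + T i j) (M + N).
Proof.
move=> [M0 hS] [N0 hT]; split=> [|F G y x]; first exact: addr_ge0.
have -> : bform (fun i j => S i j + T i j) F G y x = bform S F G y x + bform T F G y x.
  rewrite -big_split; apply: eq_bigr => i _; rewrite -big_split; apply: eq_bigr => j _.
  by rewrite /=; ring.
by rewrite !mulrDl; apply: le_trans (cmD _ _) _; rewrite lerD.
Qed.

Lemma opbZ I c (T : op I) M : opb T M -> opb (fun i j => c * T i j) (cm c * M).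
Proof.
move=> [M0 h]; split=> [|F G y x]; first by rewrite mulr_ge0 ?cm_ge0.
have -> : bform (fun i j => c * T i j) F G y x = c * bform T F G y x.
  rewrite mulr_sumr; apply: eq_bigr => i _; rewrite mulr_sumr; apply: eq_bigr => j _.
  by ring.
by rewrite cmM -!mulrA ler_wpM2l ?cm_ge0 // mulrA.
Qed.

Lemma opb0 I : opb (fun _ _ : I => 0) 0.
Proof.
split=> // F G y x; rewrite /bform big1 ?cm0 ?mul0r // => i _.
by rewrite big1 // => j _; rewrite mulr0 mul0r.
Qed.

Lemma opb1 I : opb (op1 : op I) 1.
Proof.
split=> // F G y x; rewrite mul1r; pose x' := fun i => if i \in G then x i else 0.
have -> : bform op1 F G y x = \sum_(i <- F) y i * x' i.
  apply: eq_bigr => i _; rewrite /x'; case: ifP => iG.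
    rewrite (big_fsetD1 i) //= /op1 eqxx mulr1 big_seq big1 ?addr0 // => j.
    by rewrite !inE eq_sym => /andP[/negPf -> _]; rewrite mulr0 mul0r.
  rewrite mulr0 big_seq big1 // => j jG; rewrite /op1.
  by have [ij|_] := eqVneq i j; [rewrite ij jG in iG|rewrite mulr0 mul0r].
apply: le_trans (cauchy_schwarz_cm _ _ _) _; rewrite ler_wpM2l ?nF_ge0 //.
rewrite ler_sqrt ?sumr_ge0 // => [|i _]; last exact: sqn_ge0.
have GU := fsubsetUr F G.
have -> : \sum_(i <- G) sqn (x i) = \sum_(i <- (F `|` G)%fset) sqn (x' i).
  rewrite (big_restrict _ GU); apply: eq_bigr => i _.
  by rewrite /x'; case: ifP; rewrite ?sqn0.
by rewrite (fsum_diff _ (fsubsetUl F G)) lerDl sumr_ge0 // => i _; exact: sqn_ge0.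
Qed.

Lemma opb_le I (T : op I) M N : opb T M -> M <= N -> opb T N.
Proof.
move=> [M0 h] MN; split=> [|F G y x]; first exact: le_trans MN.
by apply: le_trans (h _ _ _ _) _; rewrite -!mulrA ler_wpM2r ?mulr_ge0 ?nF_ge0.
Qed.

Lemma bounded_opP I (T : op I) : bounded_op T <-> exists M, opb T M.
Proof.
split=> [[M hM]|[M hM]]; last by exists M; apply/opnorm_le_opb => //; case: hM.
exists `|M|; apply/opnorm_le_opb => // F x y.
by rewrite -normrX ger0_norm ?sqr_ge0.
Qed.

End Forms.

(** * Completeness of the scalars *)

Section Cauchy.
Variable R : realType.

(** The limit is taken to be the supremum of the eventual lower bounds, that is, the limit inferior
    of the sequence. *)
Lemma real_cauchy (u : nat -> R) :
  (forall e : R, 0 < e -> exists N, forall m n, (N <= m)%N -> (N <= n)%N -> `|u m - u n| <= e) ->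
  exists l, forall e : R, 0 < e -> exists N, forall n, (N <= n)%N -> `|u n - l| <= e.
Proof.
move=> hu; pose E := [set x : R | exists N, forall n, (N <= n)%N -> x <= u n].
have E_ub N (e : R) : (forall m n, (N <= m)%N -> (N <= n)%N -> `|u m - u n| <= e) ->
    ubound E (u N + e).
  move=> h x [K hK]; have := hK _ (leq_maxl K N).
  by have := h _ _ (leq_maxr K N) (leqnn N); rewrite ler_norml; lra.
have E_in N (e : R) : (forall m n, (N <= m)%N -> (N <= n)%N -> `|u m - u n| <= e) ->
    E (u N - e).
  by move=> h; exists N => n /(h _ _ (leqnn N)); rewrite ler_norml; lra.
have [N1 h1] := hu 1 ltr01.
have Eb : has_ubound E by exists (u N1 + 1); exact: E_ub.
have E0 : E !=set0 by exists (u N1 - 1); exact: E_in.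
exists (sup E) => e e0; have e2 : 0 < e / 2 by lra.
have [N h] := hu _ e2; exists N => n Nn.
have := ub_le_sup Eb (E_in _ _ h); have := ge_sup E0 (E_ub _ _ h).
by have := h _ _ Nn (leqnn N); rewrite !ler_norml; lra.
Qed.

Lemma complex_cauchy (u : nat -> R[i]) :
  (forall e : R, 0 < e -> exists N, forall m n, (N <= m)%N -> (N <= n)%N -> cm (u m - u n) <= e) ->
  exists l, forall e : R, 0 < e -> exists N, forall n, (N <= n)%N -> cm (u n - l) <= e.
Proof.
move=> hu.
have ReB (z w : R[i]) : complex.Re (z - w) = complex.Re z - complex.Re w.
  by case: z w => ? ? [].
have ImB (z w : R[i]) : complex.Im (z - w) = complex.Im z - complex.Im w.
  by case: z w => ? ? [].
have [a ha] : exists l, forall e : R, 0 < e -> exists N, forall n, (N <= n)%N ->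
    `|complex.Re (u n) - l| <= e.
  apply: real_cauchy => e /hu[N h]; exists N => m n hm hn; rewrite -ReB.
  exact: le_trans (Re_le_cm _) (h _ _ hm hn).
have [b hb] : exists l, forall e : R, 0 < e -> exists N, forall n, (N <= n)%N ->
    `|complex.Im (u n) - l| <= e.
  apply: real_cauchy => e /hu[N h]; exists N => m n hm hn; rewrite -ImB.
  exact: le_trans (Im_le_cm _) (h _ _ hm hn).
exists (a +i* b) => e e0; have e2 : 0 < e / 2 by lra.
have [N h] := ha _ e2; have [N' h'] := hb _ e2; exists (maxn N N') => n.
rewrite geq_max => /andP[/h p /h' q]; apply: le_trans (cm_le_ReIm _) _.
by rewrite ReB ImB /=; lra.
Qed.

End Cauchy.

(** * The ring of bounded operators, its involution and its norm *)

Section BoundedOperators.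
Variables (R : realType) (I : choiceType).

(** On arbitrary matrices [opmul] need not be associative, because [csum] has junk values on
    divergent families; bundling boundedness with the matrix makes the operators a ring. *)
Record bop := Bop { bval :> I -> I -> R[i]; bvalP : bounded_op (bval : op R I) }.

HB.instance Definition _ := gen_eqMixin bop.
HB.instance Definition _ := gen_choiceMixin bop.

Lemma bval_inj (S T : bop) : bval S = bval T -> S = T.
Proof.
by case: S T => [S hS] [T hT] /= ST; case: _ / ST hT => hT; congr Bop; exact: Prop_irrelevance.
Qed.

Lemma bopP (S T : bop) : (forall i j, S i j = T i j) -> S = T.
Proof. by move=> h; apply: bval_inj; apply/funext => i; apply/funext => j. Qed.

Lemma bop_opb (T : bop) : exists M, opb T M.
Proof. by apply/bounded_opP; exact: bvalP. Qed.

(* The operations are opaque: unfolding them during unification is ruinous. *)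
Lemma bop_ops_ex : {ops : bop * bop * (bop -> bop -> bop) * (R[i] -> bop -> bop) *
    (bop -> bop -> bop) * (bop -> bop) |
  let: (z, o, a, s, m, t) := ops in
  [/\ bval z = (fun _ _ => 0), bval o = op1,
     (forall S T, bval (a S T) = fun i j => S i j + T i j),
     (forall c S, bval (s c S) = fun i j => c * S i j) &
     (forall S T, bval (m S T) = bval S ** bval T) /\ (forall S, bval (t S) = (bval S)^†)]}.
Proof.
have z : bounded_op ((fun _ _ => 0) : op R I) by apply/bounded_opP; exists 0; exact: opb0.
have o : bounded_op (op1 : op R I) by apply/bounded_opP; exists 1; exact: opb1.
have a (S T : bop) : bounded_op ((fun i j => S i j + T i j) : op R I).
  apply/bounded_opP.
  by have [[M hM] [N hN]] := (bop_opb S, bop_opb T); exists (M + N); exact: opbD.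
have s (c : R[i]) (S : bop) : bounded_op ((fun i j => c * S i j) : op R I).
  by apply/bounded_opP; have [M hM] := bop_opb S; exists (cm c * M); exact: opbZ.
have m (S T : bop) : bounded_op ((bval S : op R I) ** bval T).
  apply/bounded_opP.
  by have [[M hM] [N hN]] := (bop_opb S, bop_opb T); exists (M * N); exact: opb_mul.
have t (S : bop) : bounded_op ((bval S : op R I)^†).
  by apply/bounded_opP; have [M hM] := bop_opb S; exists M; exact: opb_adj.
by exists (Bop z, Bop o, fun S T => Bop (a S T), fun c S => Bop (s c S),
  fun S T => Bop (m S T), fun S => Bop (t S)).
Qed.
Definition bop0 := (sval bop_ops_ex).1.1.1.1.1.
Definition bop_one := (sval bop_ops_ex).1.1.1.1.2.
Definition bopD := (sval bop_ops_ex).1.1.1.2.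
Definition bopZ := (sval bop_ops_ex).1.1.2.
Definition bopM := (sval bop_ops_ex).1.2.
Definition star := (sval bop_ops_ex).2.
Lemma bop_opsP : [/\ bval bop0 = (fun _ _ => 0), bval bop_one = op1,
     (forall S T, bval (bopD S T) = fun i j => S i j + T i j),
     (forall c S, bval (bopZ c S) = fun i j => c * S i j) &
     (forall S T, bval (bopM S T) = bval S ** bval T) /\
     (forall S, bval (star S) = (bval S)^†)].
Proof.
rewrite /bop0 /bop_one /bopD /bopZ /bopM /star; have := svalP bop_ops_ex.
by case: (sval bop_ops_ex) => -[[[[z o] a] s] m] t.
Qed.

Lemma bop0E i j : bop0 i j = 0. Proof. by have [-> _ _ _ _] := bop_opsP. Qed.
Lemma bopDE S T i j : bopD S T i j = S i j + T i j.
Proof. by have [_ _ -> _ _] := bop_opsP. Qed.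
Lemma bopZE c S i j : bopZ c S i j = c * S i j.
Proof. by have [_ _ _ -> _] := bop_opsP. Qed.

Lemma asum_bop (S T : bop) i k : asum (fun j => S i j * T j k).
Proof. by have [[M hM] [N hN]] := (bop_opb S, bop_opb T); exact: asum_mul hM hN. Qed.

Lemma bopDA : associative bopD.
Proof. by move=> S T U; apply: bopP => i j; rewrite !bopDE addrA. Qed.
Lemma bopDC : commutative bopD.
Proof. by move=> S T; apply: bopP => i j; rewrite !bopDE addrC. Qed.
Lemma bop0D : left_id bop0 bopD.
Proof. by move=> S; apply: bopP => i j; rewrite bopDE bop0E add0r. Qed.
Lemma bopND : left_inverse bop0 (bopZ (-1)) bopD.
Proof. by move=> S; apply: bopP => i j; rewrite bopDE bopZE bop0E mulN1r addNr. Qed.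
HB.instance Definition _ := GRing.isZmodule.Build bop bopDA bopDC bop0D bopND.

Lemma bopMv S T : bval (bopM S T) = bval S ** bval T.
Proof. by have [_ _ _ _ [-> _]] := bop_opsP. Qed.
Lemma bopME S T i k : bopM S T i k = csum (fun j => S i j * T j k).
Proof. by rewrite bopMv. Qed.
Lemma bop1v : bval bop_one = op1. Proof. by have [_ -> _ _ _] := bop_opsP. Qed.

Lemma bopMA : associative bopM.
Proof.
move=> S T U; apply: bval_inj; rewrite !bopMv.
have [[L hL] [M hM]] := (bop_opb S, bop_opb T); have [N hN] := bop_opb U.
exact: opmulA hL hM hN.
Qed.
Lemma bop1M : left_id bop_one bopM.
Proof.
move=> S; apply: bopP => i j; rewrite bopME bop1v (@csum1 _ _ _ i) /op1.
  by rewrite eqxx mul1r.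
by move=> k; rewrite eq_sym => /negPf ->; rewrite mul0r.
Qed.
Lemma bopM1 : right_id bop_one bopM.
Proof.
move=> S; apply: bopP => i j; rewrite bopME bop1v (@csum1 _ _ _ j) /op1.
  by rewrite eqxx mulr1.
by move=> k /negPf ->; rewrite mulr0.
Qed.
Lemma bopMDl : left_distributive bopM bopD.
Proof.
move=> S T U; apply: bopP => i j; rewrite bopDE !bopME -csumD; try exact: asum_bop.
by congr csum; apply/funext => k; rewrite bopDE mulrDl.
Qed.
Lemma bopMDr : right_distributive bopM bopD.
Proof.
move=> S T U; apply: bopP => i j; rewrite bopDE !bopME -csumD; try exact: asum_bop.
by congr csum; apply/funext => k; rewrite bopDE mulrDr.
Qed.
HB.instance Definition _ :=
  GRing.Zmodule_isPzRing.Build bop bopMA bop1M bopM1 bopMDl bopMDr.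

Lemma bopZA a b (S : bop) : bopZ a (bopZ b S) = bopZ (a * b) S.
Proof. by apply: bopP => i j; rewrite !bopZE mulrA. Qed.
Lemma bopZ1 : left_id 1 bopZ.
Proof. by move=> S; apply: bopP => i j; rewrite bopZE mul1r. Qed.
Lemma bopZDr : right_distributive bopZ +%R.
Proof. by move=> c S T; apply: bopP => i j; rewrite !(bopZE, bopDE) mulrDr. Qed.
Lemma bopZDl S : {morph bopZ^~ S : a b / a + b}.
Proof. by move=> a b; apply: bopP => i j; rewrite !(bopZE, bopDE) mulrDl. Qed.
HB.instance Definition _ :=
  GRing.Zmodule_isLmodule.Build R[i] bop bopZA bopZ1 bopZDr bopZDl.

Implicit Types (S T U : bop) (c : R[i]).

Lemma bvalM S T : bval (S * T) = bval S ** bval T. Proof. exact: bopMv. Qed.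
Lemma bval1 : bval 1 = op1. Proof. exact: bop1v. Qed.
Lemma bval_star S : bval (star S) = (bval S)^†. Proof. by have [_ _ _ _ [_ ->]] := bop_opsP. Qed.
Lemma bvalZ c S i j : (c *: S) i j = c * S i j. Proof. exact: bopZE. Qed.
Lemma bvalD S T i j : (S + T) i j = S i j + T i j. Proof. exact: bopDE. Qed.
Lemma bvalN S i j : (- S) i j = - S i j. Proof. by rewrite -[RHS]mulN1r; exact: bopZE. Qed.
Lemma bvalB S T i j : (S - T) i j = S i j - T i j.
Proof. by rewrite bvalD bvalN. Qed.
Lemma bval0 i j : (0 : bop) i j = 0. Proof. exact: bop0E. Qed.
Lemma bval_sum (A : Type) (r : seq A) (f : A -> bop) i j :
  (\sum_(a <- r) f a) i j = \sum_(a <- r) f a i j.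
Proof. by elim/big_rec2: _ => [|a x y _ <-]; rewrite ?bval0 ?bvalD. Qed.
Lemma bvalME S T i k : (S * T) i k = csum (fun j => S i j * T j k).
Proof. exact: bopME. Qed.
Lemma starE S i j : star S i j = conjc (S j i). Proof. by rewrite bval_star. Qed.

Lemma bscalerAl c S T : c *: (S * T) = c *: S * T.
Proof.
apply: bopP => i j; rewrite bvalZ !bvalME -csumZ; last exact: asum_bop.
by congr csum; apply/funext => k; rewrite bvalZ mulrA.
Qed.
Lemma bscalerAr c S T : c *: (S * T) = S * (c *: T).
Proof.
apply: bopP => i j; rewrite bvalZ !bvalME -csumZ; last exact: asum_bop.
by congr csum; apply/funext => k; rewrite bvalZ; ring.
Qed.
Lemma starK S : star (star S) = S.
Proof. by apply: bopP => i j; rewrite !starE conjcK. Qed.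
Lemma starD S T : star (S + T) = star S + star T.
Proof. by apply: bopP => i j; rewrite !starE !bvalD !starE rmorphD. Qed.
Lemma starZ c S : star (c *: S) = conjc c *: star S.
Proof. by apply: bopP => i j; rewrite !starE !bvalZ !starE rmorphM. Qed.
Lemma starM S T : star (S * T) = star T * star S.
Proof.
apply: bopP => i j; rewrite !starE !bvalME -csum_conj; last exact: asum_bop.
by congr csum; apply/funext => k; rewrite !starE rmorphM mulrC.
Qed.
Lemma star1 : star 1 = 1.
Proof.
by apply: bopP => i j; rewrite !starE !bval1 /op1 eq_sym; case: eqP => _; rewrite ?rmorph1 ?rmorph0.
Qed.
Lemma star0 : star 0 = 0.
Proof. by apply: bopP => i j; rewrite !starE !bval0 rmorph0. Qed.
Lemma starN S : star (- S) = - star S.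
Proof. by apply: bopP => i j; rewrite !starE !bvalN !starE rmorphN. Qed.
Lemma starB S T : star (S - T) = star S - star T.
Proof. by rewrite starD starN. Qed.
Lemma starX S n : star (S ^+ n) = star S ^+ n.
Proof. by elim: n => [|n IH]; rewrite ?expr0 ?star1 // exprS exprSr starM IH. Qed.
Lemma star_sum (A : Type) (r : seq A) (f : A -> bop) :
  star (\sum_(a <- r) f a) = \sum_(a <- r) star (f a).
Proof. by elim/big_rec2: _ => [|a x y _ <-]; rewrite ?star0 ?starD. Qed.

Lemma nrm_ex : {n : bop -> R | forall T, n T = inf [set M : R | opb T M]}.
Proof. by eexists. Qed.
Definition nrm : bop -> R := sval nrm_ex.
Lemma nrmE T : nrm T = inf [set M : R | opb T M].
Proof. exact: (svalP nrm_ex). Qed.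
Lemma nrm_set0 T : [set M : R | opb T M] !=set0.
Proof. by have [M hM] := bop_opb T; exists M. Qed.
Lemma nrm_lb T : lbound [set M : R | opb T M] 0.
Proof. by move=> M []. Qed.
Lemma nrm_ge0 T : 0 <= nrm T.
Proof. by rewrite nrmE; apply: lb_le_inf (nrm_set0 T) (@nrm_lb T). Qed.
Lemma nrm_le T M : opb T M -> nrm T <= M.
Proof. by move=> hM; rewrite nrmE; apply: ge_inf => //; exists 0; exact: nrm_lb. Qed.
Lemma nrmP T : opb T (nrm T).
Proof.
split=> [|F G y x]; first exact: nrm_ge0.
have p0 := nF_ge0 F y; have q0 := nF_ge0 G x.
have [M hM] := nrm_set0 T.
have [pq|pq] := eqVneq (nF F y * nF G x) 0.
  by have [_ /(_ F G y x)] := hM; rewrite -!mulrA pq !mulr0.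
have pq0 : 0 < nF F y * nF G x by rewrite lt_def pq mulr_ge0.
rewrite -mulrA -ler_pdivrMr // nrmE; apply: lb_le_inf; first by exists M.
by move=> N [_ h]; rewrite ler_pdivrMr // mulrA.
Qed.
Lemma opnorm_nrm T M : 0 <= M -> opnorm_le T M <-> nrm T <= M.
Proof.
move=> M0; split; first by move/(opnorm_le_opb _ M0)/nrm_le.
by move=> h; apply/opnorm_le_opb => //; exact: opb_le (nrmP T) h.
Qed.
Lemma nrmD S T : nrm (S + T) <= nrm S + nrm T.
Proof. by apply: nrm_le; rewrite (_ : bval _ = fun i j => S i j + T i j); [exact: opbD (nrmP S) (nrmP T)|by apply/funext => i; apply/funext => j; rewrite bvalD]. Qed.
Lemma nrmM S T : nrm (S * T) <= nrm S * nrm T.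
Proof. by apply: nrm_le; rewrite bvalM; exact: opb_mul (nrmP S) (nrmP T). Qed.
Lemma nrm0 : nrm 0 = 0.
Proof. by apply/eqP; rewrite eq_le nrm_ge0 andbT; apply: nrm_le; rewrite (_ : bval _ = fun _ _ => 0); [exact: opb0|by apply/funext => i; apply/funext => j; rewrite bval0]. Qed.
Lemma nrm1_le : nrm 1 <= 1.
Proof. by apply: nrm_le; rewrite bval1; exact: opb1. Qed.
Lemma nrmZ_le c S : nrm (c *: S) <= cm c * nrm S.
Proof. by apply: nrm_le; rewrite (_ : bval _ = fun i j => c * S i j); [exact: opbZ (nrmP S)|by apply/funext => i; apply/funext => j; rewrite bvalZ]. Qed.
Lemma nrmZ c S : nrm (c *: S) = cm c * nrm S.
Proof.
have [->|c0] := eqVneq c 0; first by rewrite scale0r nrm0 cm0 mul0r.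
have cc : cm c != 0 by apply/eqP => /cm_eq0/eqP; rewrite (negPf c0).
apply/eqP; rewrite eq_le nrmZ_le /=.
have := nrmZ_le c^-1 (c *: S); rewrite scalerA mulVf // scale1r.
have -> : cm c^-1 = (cm c)^-1 by apply: (mulfI cc); rewrite -cmM !mulfV ?cm1.
by rewrite mulrC ler_pdivlMr ?lt_def ?cc ?cm_ge0 // mulrC.
Qed.
Lemma nrmN S : nrm (- S) = nrm S.
Proof. by rewrite -scaleN1r nrmZ cmN cm1 mul1r. Qed.
Lemma nrmB S T : nrm (S - T) <= nrm S + nrm T.
Proof. by rewrite -(nrmN T) nrmD. Qed.
Lemma nrm_distC S T : nrm (S - T) = nrm (T - S).
Proof. by rewrite -nrmN opprB. Qed.
Lemma nrm_star_le S : nrm (star S) <= nrm S.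
Proof. by apply: nrm_le; rewrite bval_star; exact: opb_adj (nrmP S). Qed.
Lemma nrm_star S : nrm (star S) = nrm S.
Proof. by apply/eqP; rewrite eq_le nrm_star_le -{1}(starK S) nrm_star_le. Qed.
Lemma nrm_entry S i j : cm (S i j) <= nrm S.
Proof. by rewrite -(nF1 i (fun k => S k j)); apply: nF_column; exact: nrmP. Qed.
Lemma nrm_eq0 S : nrm S <= 0 -> S = 0.
Proof.
move=> h; apply: bopP => i j; rewrite bval0; apply: cm_eq0; apply/eqP.
by rewrite eq_le cm_ge0 andbT (le_trans (nrm_entry _ _ _)).
Qed.
Lemma nrm_eps S T : (forall e : R, 0 < e -> nrm (S - T) <= e) -> S = T.
Proof.
move=> h; apply/eqP; rewrite -subr_eq0; apply/eqP/nrm_eq0.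
by apply/ler_addgt0Pr => e e0; rewrite add0r h.
Qed.
Lemma nrm_sum (A : Type) (r : seq A) (f : A -> bop) :
  nrm (\sum_(a <- r) f a) <= \sum_(a <- r) nrm (f a).
Proof.
elim/big_rec2: _ => [|a x y _ h]; first by rewrite nrm0.
by apply: le_trans (nrmD _ _) _; rewrite lerD2l.
Qed.
Lemma nrm_le_trans S T (a b : R) U : nrm (S - T) <= a -> nrm (T - U) <= b ->
  nrm (S - U) <= a + b.
Proof.
by move=> h h'; rewrite -(subrKA T); apply: le_trans (nrmD _ _) (lerD h h').
Qed.

Lemma nrm_tri S T U (e : R) : nrm (S - T) <= e / 2 -> nrm (T - U) <= e / 2 ->
  nrm (S - U) <= e.
Proof. by move=> h h'; rewrite [e]splitr; exact: nrm_le_trans h h'. Qed.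

Lemma nrm_complete (u : nat -> bop) :
  (forall e : R, 0 < e -> exists N, forall m n, (N <= m)%N -> (N <= n)%N -> nrm (u m - u n) <= e) ->
  exists T, forall e : R, 0 < e -> exists N, forall n, (N <= n)%N -> nrm (u n - T) <= e.
Proof.
move=> hu.
have /choice[l hl] : forall ij : I * I, exists l, forall e : R, 0 < e -> exists N, forall n,
    (N <= n)%N -> cm (u n ij.1 ij.2 - l) <= e.
  move=> [i j] /=; apply: (complex_cauchy (u := fun n => u n i j)) => e /hu[N h].
  exists N => m n hm hn; rewrite -bvalB.
  exact: le_trans (nrm_entry _ _ _) (h _ _ hm hn).
pose L : op R I := fun i j => l (i, j).
(* The bound on [u n - L] comes from the one on [u n - u m] as m grows: a finite form sees finitely
   many entries, and these converge simultaneously. *)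
have key (e : R) N : 0 < e ->
    (forall m n, (N <= m)%N -> (N <= n)%N -> nrm (u m - u n) <= e) ->
    forall n, (N <= n)%N -> opb (fun i j => u n i j - L i j) e.
  move=> e0 h n Nn; split=> [|F G y x]; first exact: ltW.
  apply/ler_addgt0Pr => d d0.
  have [K hK] : exists K, forall m, (K <= m)%N ->
      cm (bform (fun i j => u m i j - L i j) F G y x) <= d.
    have [d' d'0 hd'] : exists2 d' : R, 0 < d' &
        \sum_(i <- F) \sum_(j <- G) cm (y i) * d' * cm (x j) <= d.
      pose A := \sum_(i <- F) \sum_(j <- G) cm (y i) * cm (x j).
      have A0 : 0 <= A by do 2!(apply: sumr_ge0 => ? _); rewrite mulr_ge0 ?cm_ge0.
      exists (d / (A + 1)); first by rewrite divr_gt0 // ltr_wpDl.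
      have -> : \sum_(i <- F) \sum_(j <- G) cm (y i) * (d / (A + 1)) * cm (x j) =
         A * (d / (A + 1)).
        rewrite mulr_suml; apply: eq_bigr => i _; rewrite mulr_suml.
        by apply: eq_bigr => j _; ring.
      rewrite mulrCA ler_piMr //; first exact: ltW.
      by rewrite ler_pdivrMr ?ltr_wpDl // mul1r lerDl.
    have /choice[g hg] : forall ij : I * I, exists K, forall m, (K <= m)%N ->
        cm (u m ij.1 ij.2 - l ij) <= d' by move=> ij; exact: hl.
    (* The sum of the finitely many thresholds serves as a common upper bound of them. *)
    exists (\sum_(i <- F) \sum_(j <- G) g (i, j))%N => m hm.
    apply: le_trans hd'; apply: le_trans (cm_sum _ _) _.
    rewrite big_seq [X in _ <= X]big_seq; apply: ler_sum => i iF.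
    apply: le_trans (cm_sum _ _) _.
    rewrite big_seq [X in _ <= X]big_seq; apply: ler_sum => j jG.
    rewrite !cmM ler_wpM2r ?cm_ge0 // ler_wpM2l ?cm_ge0 //.
    apply: (hg (i, j)); apply: leq_trans hm.
    rewrite (big_fsetD1 i) //= (big_fsetD1 j) //=.
    by rewrite -addnA leq_addr.
  pose m := maxn N K.
  have -> : bform (fun i j => u n i j - L i j) F G y x =
    bform (u n - u m) F G y x + bform (fun i j => u m i j - L i j) F G y x.
    rewrite -big_split; apply: eq_bigr => i _; rewrite -big_split.
    by apply: eq_bigr => j _; rewrite bvalB /=; ring.
  apply: le_trans (cmD _ _) _; apply: lerD; last exact/hK/leq_maxr.
  have [_ /(_ F G y x) h1] := nrmP (u n - u m).
  apply: le_trans h1 _; rewrite -!mulrA ler_wpM2r ?mulr_ge0 ?nF_ge0 //.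
  by apply: h => //; exact: leq_maxl.
have [N h] := hu 1 ltr01.
have Lb : bounded_op L.
  apply/bounded_opP; exists (cm (-1) * 1 + nrm (u N)).
  have -> : L = fun i j => -1 * (u N i j - L i j) + u N i j.
    by apply/funext => i; apply/funext => j; ring.
  apply: opbD (nrmP _); apply: opbZ; exact: key ltr01 h _ (leqnn N).
exists (Bop Lb) => e e0; have [K hK] := hu _ e0; exists K => n Kn.
apply: nrm_le; have := key _ _ e0 hK _ Kn; congr opb.
by apply/funext => i; apply/funext => j; rewrite bvalB.
Qed.

(** Positivity of a quadratic form, tested by its real part on finitely supported vectors. In this
    form it can be fed directly into the certificates of [sos]. *)
Definition pos T := forall (G : {fset I}) x,
  0 <= complex.Re (bform T G G (fun i => conjc (x i)) x).

Lemma star_mul_sums T (G : {fset I}) x :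
  sums (fun i => (sqn (\sum_(j <- G) T i j * x j))%:C)
       (bform (star T * T) G G (fun i => conjc (x i)) x).
Proof.
have -> : (fun i => (sqn (\sum_(j <- G) T i j * x j))%:C) =
  fun i => \sum_(j <- G) \sum_(k <- G) conjc (x j) * (star T j i * T i k) * x k.
  apply/funext => i; rewrite -conjc_sqn rmorph_sum mulr_suml; apply: eq_bigr => j _.
  by rewrite mulr_sumr; apply: eq_bigr => k _; rewrite rmorphM starE; ring.
apply: sums_sum => j; apply: sums_sum => k.
have -> : (fun i => conjc (x j) * (star T j i * T i k) * x k) =
          (fun i => (conjc (x j) * x k) * (star T j i * T i k)) by apply/funext => i; ring.
rewrite mulrAC bvalME; apply: sumsZ; apply: csum_sums; exact: asum_bop.
Qed.

Lemma star_mul_Re_ge T (F G : {fset I}) x :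
  nF F (fun i => \sum_(j <- G) T i j * x j) ^+ 2 <=
  complex.Re (bform (star T * T) G G (fun i => conjc (x i)) x).
Proof.
set v := fun i => _; apply/ler_addgt0Pr => e e0.
have [F0 h] := star_mul_sums T G x e0; have := h _ (fsubsetUl F0 F).
rewrite -realC_sum -/v => /(le_trans (Re_le_cm _)).
set z := bform _ _ _ _ _.
have ReB (u w : R[i]) : complex.Re (u - w) = complex.Re u - complex.Re w.
  by case: u w => ? ? [].
rewrite ReB /= -nFE ler_norml => /andP[_].
have : nF F v ^+ 2 <= nF (F0 `|` F)%fset v ^+ 2.
  rewrite !nFE (fsum_diff _ (fsubsetUr F0 F)) lerDl sumr_ge0 // => i _; exact: sqn_ge0.
lra.
Qed.

Lemma pos_star T : pos (star T * T).
Proof. by move=> G x; apply: le_trans (star_mul_Re_ge T fset0 G x); exact: sqr_ge0. Qed.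

Lemma posD S T : pos S -> pos T -> pos (S + T).
Proof.
move=> hS hT G x.
have -> : bform (S + T) G G (fun i => conjc (x i)) x =
   bform S G G (fun i => conjc (x i)) x + bform T G G (fun i => conjc (x i)) x.
  rewrite -big_split; apply: eq_bigr => i _; rewrite -big_split; apply: eq_bigr => j _.
  by rewrite bvalD /=; ring.
have := hS G x; have := hT G x.
by case: (bform _ _ _ _ _) => ? ?; case: (bform _ _ _ _ _) => ? ? /=; lra.
Qed.

Lemma pos0 : pos 0.
Proof. by rewrite -(mulr0 (star 0)); exact: pos_star. Qed.

Lemma pos_sum (A : Type) (r : seq A) (f : A -> bop) :
  (forall a, pos (f a)) -> pos (\sum_(a <- r) f a).
Proof. by move=> h; elim/big_ind: _ => //; [exact: pos0|exact: posD]. Qed.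

Lemma opb_of_col (T : op R I) M : 0 <= M ->
  (forall (F G : {fset I}) x, nF F (fun i => \sum_(j <- G) T i j * x j) <= M * nF G x) ->
  opb T M.
Proof.
move=> M0 h; split=> // F G y x.
have -> : bform T F G y x = \sum_(i <- F) y i * (\sum_(j <- G) T i j * x j).
  by apply: eq_bigr => i _; rewrite mulr_sumr; apply: eq_bigr => j _; rewrite mulrA.
apply: le_trans (cauchy_schwarz_cm _ _ _) _.
by rewrite mulrAC [X in _ <= X]mulrC ler_wpM2l ?nF_ge0.
Qed.

Lemma bform1 (G : {fset I}) x :
  complex.Re (bform (op1 : op R I) G G (fun i => conjc (x i)) x) = nF G x ^+ 2.
Proof.
have -> : bform (op1 : op R I) G G (fun i => conjc (x i)) x = (nF G x ^+ 2)%:C; last by [].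
rewrite nFE realC_sum; apply: eq_big_seq => i iG.
rewrite (big_fsetD1 i) //= /op1 eqxx mulr1 conjc_sqn big_seq big1 ?addr0 // => j.
by rewrite !inE eq_sym => /andP[/negPf -> _]; rewrite mulr0 mul0r.
Qed.

(** For finitely supported x the identity gives |T x|^2 = M^2 |x|^2 - <x, P x> <= M^2 |x|^2. Norm
    bounds that would otherwise come from functional calculus are obtained below from such
    certificates. *)
Lemma sos T P (M : R) : 0 <= M -> pos P -> star T * T + P = (M ^+ 2)%:C *: (1 : bop) ->
  nrm T <= M.
Proof.
move=> M0 hP E; apply: nrm_le; apply: opb_of_col => // F G x.
rewrite -(@ler_pXn2r _ 2) ?nnegrE ?mulr_ge0 ?nF_ge0 //.
apply: le_trans (star_mul_Re_ge T F G x) _; rewrite exprMn.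
have {}E : bform (star T * T) G G (fun i => conjc (x i)) x =
    (M ^+ 2)%:C * bform (op1 : op R I) G G (fun i => conjc (x i)) x -
    bform P G G (fun i => conjc (x i)) x.
  rewrite mulr_sumr -sumrB; apply: eq_bigr => i _; rewrite mulr_sumr -sumrB.
  apply: eq_bigr => j _; have := congr1 (fun S : bop => S i j) E.
  by rewrite bvalD bvalZ bval1 => /(canRL (addrK _)) ->; ring.
have {E} -> : complex.Re (bform (star T * T) G G (fun i => conjc (x i)) x) =
   M ^+ 2 * nF G x ^+ 2 - complex.Re (bform P G G (fun i => conjc (x i)) x).
  rewrite E -bform1; case: (bform (op1 : op R I) _ _ _ _) => ? ?; case: (bform P _ _ _ _) => ? ? /=.
  by rewrite mul0r subr0.
by rewrite gerDl oppr_le0.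
Qed.

Lemma sos0 T P : pos P -> star T * T + P = 0 -> T = 0.
Proof.
move=> hP E; apply: nrm_eq0; apply: (sos (lexx _) hP).
by rewrite E expr0n scale0r.
Qed.

(** Pairing star T * T with x on both sides: |T x|^2 = <x, star T T x> <= |star T T| |x|^2. *)
Lemma cstar_le T : nrm T ^+ 2 <= nrm (star T * T).
Proof.
set M := nrm (star T * T); have M0 : 0 <= M by exact: nrm_ge0.
rewrite -(sqr_sqrtr M0) ler_pXn2r ?nnegrE ?nrm_ge0 ?sqrtr_ge0 //.
apply: nrm_le; apply: opb_of_col => [|F G x]; first exact: sqrtr_ge0.
rewrite -(@ler_pXn2r _ 2) ?nnegrE ?mulr_ge0 ?nF_ge0 ?sqrtr_ge0 //.
apply: le_trans (star_mul_Re_ge T F G x) _; rewrite exprMn sqr_sqrtr //.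
apply: le_trans (ler_norm _) _; apply: le_trans (Re_le_cm _) _.
have [_ /(_ G G (fun i => conjc (x i)) x)] := nrmP (star T * T).
by rewrite nF_conj -mulrA -expr2.
Qed.

Lemma cstar T : nrm (star T * T) = nrm T ^+ 2.
Proof.
apply/eqP; rewrite eq_le cstar_le andbT.
by apply: le_trans (nrmM _ _) _; rewrite nrm_star expr2.
Qed.

End BoundedOperators.
Arguments star {R I}.

Ltac blin := apply: bopP => ? ?; rewrite ?(bvalD, bvalN, bvalZ, bval0); ring.
Ltac bexp := rewrite ?(mulrDl, mulrDr, mulNr, mulrN, mul1r, mulr1, mul0r, mulr0, opprK).

(** * C*-algebras of bounded operators *)

Section Subspaces.
Variables (R : realType) (I : choiceType).
Local Notation bop := (bop R I).
Implicit Types (P Q S : set bop) (x y : bop).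

Definition csub P : Prop :=
  [/\ P 0, (forall c x y, P x -> P y -> P (c *: x + y)) &
      forall x, (forall e : R, 0 < e -> exists2 y, P y & nrm (x - y) <= e) -> P x].

Definition calg P : Prop :=
  [/\ csub P, (forall x y, P x -> P y -> P (x * y)) & forall x, P x -> P (star x)].

Lemma csub_add P x y : csub P -> P x -> P y -> P (x + y).
Proof. by move=> [_ h _] px py; have := h 1 x y px py; rewrite scale1r. Qed.
Lemma csub_scale P c x : csub P -> P x -> P (c *: x).
Proof. by move=> [p0 h _] px; have := h c x 0 px p0; rewrite addr0. Qed.
Lemma csub_opp P x : csub P -> P x -> P (- x).
Proof. by rewrite -scaleN1r; exact: csub_scale. Qed.
Lemma csub_sub P x y : csub P -> P x -> P y -> P (x - y).
Proof. by move=> hP px py; apply: csub_add => //; exact: csub_opp. Qed.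
Lemma csub_sum P (A : Type) (r : seq A) (f : A -> bop) : csub P ->
  (forall a, P (f a)) -> P (\sum_(a <- r) f a).
Proof.
move=> hP h; elim/big_ind: _ => //; first by case: hP.
by move=> x y px py; exact: csub_add.
Qed.
Lemma csub_lim P x : csub P ->
  (forall e : R, 0 < e -> exists2 y, P y & nrm (x - y) <= e) -> P x.
Proof. by move=> [_ _ h]; exact: h. Qed.

Lemma csub_seq P (u : nat -> bop) x : csub P -> (forall n, P (u n)) ->
  (forall e : R, 0 < e -> exists N, forall n, (N <= n)%N -> nrm (u n - x) <= e) -> P x.
Proof.
move=> hP pu hu; apply: (csub_lim hP) => e /hu[N h]; exists (u N) => //.
by rewrite nrm_distC; exact: h.
Qed.

(** Defined as an intersection, so that a property of the whole span is proved by checking it on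
    generators and verifying that it cuts out a closed subspace. *)
Definition bcspan S : set bop := [set x | forall P, csub P -> S `<=` P -> P x].

Lemma bcspan_csub S : csub (bcspan S).
Proof.
split=> [P [p0 _ _] _ //|c x y hx hy P hP SP|x hx P hP SP].
  by have [_ h _] := hP; apply: h; [exact: hx|exact: hy].
by apply: (csub_lim hP) => e /hx[y hy ?]; exists y => //; exact: hy.
Qed.
Lemma bcspan_in S x : S x -> bcspan S x.
Proof. by move=> sx P _; exact. Qed.
Lemma bcspan_sub S P : csub P -> S `<=` P -> bcspan S `<=` P.
Proof. by move=> hP SP x; exact. Qed.
Lemma bcspanS S S' : S `<=` bcspan S' -> bcspan S `<=` bcspan S'.
Proof. by apply: bcspan_sub; exact: bcspan_csub. Qed.

Lemma csub_commute y : csub [set x | x * y = y * x].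
Proof.
split=> [|c a b /= ha hb|x hx] /=; first by rewrite mul0r mulr0.
  by rewrite mulrDl mulrDr -bscalerAl ha hb bscalerAr.
apply: nrm_eps => e e0; have n0 := nrm_ge0 y.
have d0 : 0 < e / (2 * nrm y + 1) by rewrite divr_gt0 // ltr_wpDl // mulr_ge0.
have [z /= hz d] := hx _ d0.
have -> : x * y - y * x = (x - z) * y - y * (x - z) by bexp; rewrite hz; blin.
apply: le_trans (nrmB _ _) _; apply: le_trans (lerD (nrmM _ _) (nrmM _ _)) _.
rewrite [X in X + _]mulrC -mulrDr -mulr2n -mulr_natl mulrCA mulrA mulrC.
apply: le_trans (ler_wpM2r _ d) _; first by rewrite mulr_ge0.
rewrite mulrAC ler_pdivrMr ?ltr_wpDl ?mulr_ge0 // ler_wpM2l ?ltW //; lra.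
Qed.

End Subspaces.

(** * Square roots by iteration *)

Section SquareRoot.
Variables (R : realType) (I : choiceType).
Local Notation bop := (bop R I).
Implicit Types (P Q : set bop) (t k x y : bop).

Definition chalf : R[i] := (2^-1 : R)%:C.
Lemma cm_chalf : cm chalf = 2^-1.
Proof. by rewrite cm_real // invr_ge0. Qed.
Lemma chalfD (x : bop) : chalf *: x + chalf *: x = x.
Proof.
rewrite -scalerDl; have -> : chalf + chalf = 1; last by rewrite scale1r.
by rewrite /chalf; congr Complex => /=; field.
Qed.
Lemma chalf_conj : conjc chalf = chalf. Proof. by congr Complex; rewrite oppr0. Qed.

(** The limit k satisfies 2 k = t + k^2, that is (1 - k)^2 = 1 - t, so 1 - k is a square root of 1 -
    t. Each [kseq t n] is a polynomial in t without constant term; hence k stays in every closed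
    subalgebra containing t, unital or not. *)
Fixpoint kseq t n : bop := if n is m.+1 then chalf *: (t + kseq t m * kseq t m) else 0.
Fixpoint sseq n : R := if n is m.+1 then 2^-1 * (1 + sseq m * sseq m) else 0.

Lemma sseq_bd n : 0 <= sseq n <= 1.
Proof. by elim: n => [|n /andP[a b]] /=; [lra|nra]. Qed.

Lemma kseq_nrm t n : nrm t <= 1 -> nrm (kseq t n) <= sseq n.
Proof.
move=> t1; elim: n => [|n h] /=; first by rewrite nrm0.
have /andP[a b] := sseq_bd n; have hn := nrm_ge0 (kseq t n).
rewrite nrmZ cm_chalf ler_wpM2l ?invr_ge0 //.
apply: le_trans (nrmD _ _) _; apply: lerD => //.
by apply: le_trans (nrmM _ _) _; exact: ler_pM.
Qed.

Lemma sq_diff x y : x * x - y * y = x * (x - y) + (x - y) * y.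
Proof. by bexp; blin. Qed.

(** Majorant method: replacing t by the scalar 1 in the iteration gives [sseq], whose increments
    dominate those of [kseq t] when |t| <= 1. As [sseq] is bounded by 1 and increasing, [kseq t] is
    a Cauchy sequence. *)
Lemma kseq_bd t n m : nrm t <= 1 -> (n <= m)%N ->
  nrm (kseq t m - kseq t n) <= sseq m - sseq n.
Proof.
move=> t1; elim: m n => [|m IH] [|n] // nm.
- by rewrite subrr nrm0 subrr.
- by rewrite !subr0; exact: kseq_nrm.
have {IH}h := IH n nm; have hm := kseq_nrm m t1; have hn := kseq_nrm n t1.
have -> : kseq t m.+1 - kseq t n.+1 = chalf *: (kseq t m * kseq t m - kseq t n * kseq t n).
  by rewrite /=; blin.
rewrite nrmZ cm_chalf sq_diff /=.
have := nrmD (kseq t m * (kseq t m - kseq t n)) ((kseq t m - kseq t n) * kseq t n).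
have := nrmM (kseq t m) (kseq t m - kseq t n); have := nrmM (kseq t m - kseq t n) (kseq t n).
have := nrm_ge0 (kseq t m - kseq t n); have := nrm_ge0 (kseq t m); have := nrm_ge0 (kseq t n).
set D := nrm (_ - _); set M := nrm (kseq t m); set N := nrm (kseq t n).
move=> *; have : M * D <= sseq m * (sseq m - sseq n) by apply: ler_pM.
have : D * N <= (sseq m - sseq n) * sseq n by apply: ler_pM.
lra.
Qed.

Lemma sseq_cauchy (e : R) : 0 < e -> exists N, forall n, (N <= n)%N -> sseq n - sseq N <= e.
Proof.
move=> e0; pose E := [set x | exists n, x = sseq n].
have Eb : has_ubound E by exists 1 => _ [n ->]; case/andP: (sseq_bd n).
have E0 : E !=set0 by exists 0; exists 0%N.
have [_ [N ->] hN] := sup_adherent e0 (conj E0 Eb); exists N => n _.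
have : sseq n <= sup E by apply: ub_le_sup => //; exists n.
by move: hN; lra.
Qed.

Lemma sqrt_lim t : nrm t <= 1 -> exists k,
  [/\ (forall e : R, 0 < e -> exists N, forall n, (N <= n)%N -> nrm (kseq t n - k) <= e),
      nrm k <= 1, k = chalf *: (t + k * k), (star t = t -> star k = k) &
      forall P, csub P -> (forall x y, P x -> P y -> P (x * y)) -> P t -> P k].
Proof.
move=> t1; have [|k hk] := @nrm_complete _ _ (kseq t).
  move=> e e0; have e2 : 0 < e / 2 by rewrite divr_gt0.
  have [N h] := sseq_cauchy e2; exists N => m n hm hn.
  apply: (@nrm_tri _ _ _ (kseq t N)); last rewrite nrm_distC.
    exact: le_trans (kseq_bd t1 hm) (h _ hm).
  exact: le_trans (kseq_bd t1 hn) (h _ hn).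
have k1 : nrm k <= 1.
  apply/ler_addgt0Pr => e /hk[N /(_ _ (leqnn N))]; rewrite nrm_distC => h.
  have -> : k = (k - kseq t N) + kseq t N by rewrite subrK.
  apply: le_trans (nrmD _ _) _; have /andP[_ s1] := sseq_bd N.
  have := kseq_nrm N t1; lra.
exists k; split=> //.
- apply: nrm_eps => e e0; have e2 : 0 < e / 2 by rewrite divr_gt0.
have [N h] := hk _ e2; apply: (@nrm_tri _ _ _ (kseq t N.+1)); first by rewrite nrm_distC; apply: h.
have -> : kseq t N.+1 - chalf *: (t + k * k) = chalf *: (kseq t N * kseq t N - k * k).
  by rewrite /=; blin.
rewrite nrmZ cm_chalf sq_diff.
have := nrmD (kseq t N * (kseq t N - k)) ((kseq t N - k) * k).
have := nrmM (kseq t N) (kseq t N - k); have := nrmM (kseq t N - k) k.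
have := h _ (leqnn N); have := nrm_ge0 (kseq t N - k).
have /andP[_ s1] := sseq_bd N; have := kseq_nrm N t1.
have := nrm_ge0 (kseq t N); have := nrm_ge0 k.
set D := nrm (_ - _); set M := nrm (kseq t N); move=> *.
have : M * D <= 1 * D by apply: ler_wpM2r => //; lra.
have : D * nrm k <= D * 1 by apply: ler_wpM2l => //; lra.
lra.
- move=> ts; have hs n : star (kseq t n) = kseq t n.
    by elim: n => [|n IH] /=; rewrite ?star0 // starZ chalf_conj starD starM IH ts.
  apply: nrm_eps => e e0; have e2 : 0 < e / 2 by rewrite divr_gt0.
  have [N /(_ _ (leqnn N)) h] := hk _ e2; apply: (@nrm_tri _ _ _ (kseq t N)); last exact: h.
  by rewrite -nrm_star starB starK hs nrm_distC.
- move=> P hP PM Pt; apply: (csub_seq hP) hk; elim=> [|n IH] /=; first by case: hP.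
  by apply: csub_scale => //; apply: csub_add => //; exact: PM.
Qed.

Lemma sqrt_fix t k : k = chalf *: (t + k * k) -> (1 - k) * (1 - k) = 1 - t.
Proof.
move=> kE; have -> : t = k + k - k * k by rewrite {1 2}kE chalfD; blin.
by bexp; blin.
Qed.

Lemma sqrt_ex t : nrm t <= 1 -> star t = t -> exists k,
  [/\ (1 - k) * (1 - k) = 1 - t, star k = k, nrm k <= 1 &
      forall P, csub P -> (forall x y, P x -> P y -> P (x * y)) -> P t -> P k].
Proof.
move=> t1 ts; have [k [_ k1 kE ks kP]] := sqrt_lim t1; exists k; split=> //.
  exact: sqrt_fix.
exact: ks.
Qed.

(** With k such that (1 - k)^2 = 1 - x^2, the certificate is (1 - x^2)^2 + x^2 + x (1 - k)^2 x =
    1. *)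
Lemma nrm_1Bsq x : star x = x -> nrm x <= 1 -> nrm (1 - x * x) <= 1.
Proof.
move=> xs x1; have xx1 : nrm (x * x) <= 1.
  by apply: le_trans (nrmM _ _) _; have := nrm_ge0 x; nra.
have [|k [kE ks _ _]] := sqrt_ex xx1; first by rewrite starM xs.
have s1 : star (1 - k) = 1 - k by rewrite starB star1 ks.
apply: (@sos _ _ _ (star x * x + star ((1 - k) * x) * ((1 - k) * x))) => //.
  by apply: posD; exact: pos_star.
have E : x * (1 - k) * ((1 - k) * x) = x * x - x * x * (x * x).
  by rewrite -mulrA [(1 - k) * (_ * x)]mulrA kE; bexp; rewrite !mulrA.
by rewrite starM s1 starB star1 starM xs E expr1n scale1r; bexp; rewrite !mulrA; blin.
Qed.

End SquareRoot.

(** * Contractivity and isometry of homomorphisms *)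

Section Homs.
Variables (R : realType) (I J : choiceType).
Local Notation bop := (bop R).
Implicit Types (P : set (bop I)) (f : bop I -> bop J).

Definition shom P f : Prop :=
  [/\ (forall c x y, P x -> P y -> f (c *: x + y) = c *: f x + f y),
      (forall x y, P x -> P y -> f (x * y) = f x * f y) &
      forall x, P x -> f (star x) = star (f x)].

Lemma hom0 P f : P 0 -> shom P f -> f 0 = 0.
Proof.
move=> p0 [h _ _]; have := h 1 0 0 p0 p0; rewrite !scale1r addr0 => E.
by apply: (addrI (f 0)); rewrite addr0 -E.
Qed.
Lemma homZ P f c x : P 0 -> shom P f -> P x -> f (c *: x) = c *: f x.
Proof.
by move=> p0 hf px; have [h _ _] := hf; rewrite -[c *: x]addr0 h // (hom0 p0 hf) addr0.
Qed.
Lemma homD P f x y : shom P f -> P x -> P y -> f (x + y) = f x + f y.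
Proof. by move=> [h _ _] px py; rewrite -[x]scale1r h // !scale1r. Qed.
Lemma homB P f x y : shom P f -> P x -> P y -> f (x - y) = f x - f y.
Proof.
move=> [h _ _] px py; rewrite -scaleN1r addrC h // scaleN1r addrC //.
Qed.

(** For k in P with (1 - k)^2 = 1 - star a * a, the relation star a * a = 2 k - k^2 lives inside P,
    so f carries it over. In the target it reads star (f a) * f a + (1 - f k)^2 = 1, which is a
    certificate for [sos]. *)
Lemma hom_contr_unit P f a : calg P -> shom P f -> P a -> nrm a <= 1 -> nrm (f a) <= 1.
Proof.
move=> [hP PM PS] hf pa a1; have p0 : P 0 by case: hP.
have t1 : nrm (star a * a) <= 1 by rewrite cstar expr_le1 ?nrm_ge0.
have ts : star (star a * a) = star a * a by rewrite starM starK.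
have [k [kE ks _ /(_ P hP PM) pk]] := sqrt_ex t1 ts.
have {}pk : P k by apply: pk; apply: PM => //; exact: PS.
have E : star a * a = k + k - k * k.
  have -> : star a * a = 1 - (1 - star a * a) by blin.
  by rewrite -kE; bexp; blin.
have [_ fM fS] := hf.
have fE : star (f a) * f a = f k + f k - f k * f k.
  rewrite -fS // -fM //; last exact: PS.
  by rewrite E (homB hf) ?(homD hf) ?fM //; [exact: csub_add|exact: PM].
apply: (@sos _ _ _ (star (1 - f k) * (1 - f k))) => //; first exact: pos_star.
by rewrite starB star1 -(fS _ pk) ks fE expr1n scale1r; bexp; blin.
Qed.

Lemma hom_contr P f a : calg P -> shom P f -> P a -> nrm (f a) <= nrm a.
Proof.
move=> cP hf pa; have [hP _ _] := cP; have p0 : P 0 by case: hP.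
have [/eqP|an] := eqVneq (nrm a) 0.
  rewrite eq_le => /andP[/nrm_eq0 -> _].
  by rewrite (hom0 p0 hf) nrm0 nrm_ge0.
have a0 : 0 < nrm a by rewrite lt_def an nrm_ge0.
have i0 : 0 <= (nrm a)^-1 by rewrite invr_ge0 ltW.
have := @hom_contr_unit P f (((nrm a)^-1)%:C *: a) cP hf (csub_scale _ hP pa).
rewrite (homZ _ p0 hf pa) !nrmZ cm_real // mulVf // => /(_ (lexx _)).
by rewrite mulrC ler_pdivrMr // mul1r.
Qed.

(** Contractivity makes the equalizer closed; homomorphisms are therefore compared on generators
    only. *)
Lemma hom_closed_eq P (f g : bop I -> bop J) : calg P -> shom P f -> shom P g ->
  csub [set x | P x /\ f x = g x].
Proof.
move=> cP hf hg; have [hP _ _] := cP; have p0 : P 0 by case: hP.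
have [fL _ _] := hf; have [gL _ _] := hg.
split=> [|c x y [px ex] [py ey]|x hx] /=; first by rewrite (hom0 p0 hf) (hom0 p0 hg).
  split; first by have [_ h _] := hP; exact: h.
  by rewrite fL // gL // ex ey.
have px : P x by apply: (csub_lim hP) => e /hx[y [py _] d]; exists y.
split=> //; apply: nrm_eps => e e0; have e2 : 0 < e / 2 by rewrite divr_gt0.
have [y [py ey] d] := hx _ e2; apply: (@nrm_tri _ _ _ (f y)).
  rewrite -(homB hf) //; apply: le_trans d; apply: (hom_contr cP hf); exact: csub_sub.
rewrite ey nrm_distC -(homB hg) //; apply: le_trans d.
by apply: (hom_contr cP hg); exact: csub_sub.
Qed.

Lemma hom_preim P f (Q : set (bop J)) : calg P -> shom P f -> csub Q ->
  csub [set x | P x /\ Q (f x)].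
Proof.
move=> cP hf hQ; have [hP _ _] := cP; have p0 : P 0 by case: hP.
have [fL _ _] := hf.
split=> [|c x y [px ex] [py ey]|x hx] /=.
- by rewrite (hom0 p0 hf); split=> //; case: hQ.
- split; first by have [_ h _] := hP; exact: h.
  by rewrite fL //; have [_ h _] := hQ; exact: h.
have px : P x by apply: (csub_lim hP) => e /hx[y [py _] d]; exists y.
split=> //; apply: (csub_lim hQ) => e /hx[y [py ey] d]; exists (f y) => //.
rewrite -(homB hf) //; apply: le_trans d; apply: (hom_contr cP hf); exact: csub_sub.
Qed.

Lemma kseqM (K : choiceType) (t y : bop K) n :
  y * kseq t n.+1 = chalf R *: (y * t + y * kseq t n * kseq t n).
Proof. by rewrite /= -bscalerAr mulrDr mulrA. Qed.

(* If |f a| < |a|, the positive part g of a^*a - r, for |f a|^2 < r < |a|^2,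
   is a limit of polynomials with f (a^*a g) = 0 although a^*a g <> 0. *)
Lemma hom_inj_half P f a : calg P -> shom P f -> (forall x, P x -> f x = 0 -> x = 0) ->
  P a -> nrm a ^+ 2 = 2^-1 -> 2^-1 <= nrm (f a) ^+ 2.
Proof.
move=> cP hf inj pa na; rewrite leNgt; apply/negP => lt.
have [hP PM PS] := cP; have p0 : P 0 by case: hP.
have [fL fM fS] := hf.
set q := nrm (f a) ^+ 2 in lt; have q0 : 0 <= q by exact: sqr_ge0.
pose r := (q + 2^-1) / 2; have [qr r2] : q < r /\ r < 2^-1 by rewrite /r; split; lra.
have r0 : 0 < r by lra.
pose rc : R[i] := r%:C; have rcc : conjc rc = rc by congr Complex; rewrite oppr0.
pose b := star a * a; pose b' := star (f a) * f a.
have pb : P b by apply: PM => //; exact: PS.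
have fb : f b = b' by rewrite fM ?fS //; exact: PS.
have bs : star b = b by rewrite starM starK.
have bs' : star b' = b' by rewrite starM starK.
have nb : nrm b = 2^-1 by rewrite cstar.
have nb' : nrm b' = q by rewrite cstar.
pose x := b - rc *: (1 : bop I); pose x' := b' - rc *: (1 : bop J).
have xs : star x = x by rewrite starB starZ star1 bs rcc.
have xs' : star x' = x' by rewrite starB starZ star1 bs' rcc.
have r1 (K : choiceType) : nrm (rc *: (1 : bop K)) <= r.
  rewrite nrmZ (cm_real (ltW r0)) -[X in _ <= X]mulr1 ler_wpM2l ?(ltW r0) //.
  exact: nrm1_le.
have nx : nrm x <= 1.
  by apply: le_trans (nrmB _ _) _; have := r1 I; rewrite nb; lra.
have nx' : nrm x' <= 1.
  by apply: le_trans (nrmB _ _) _; have := r1 J; rewrite nb'; lra.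
have nt := nrm_1Bsq xs nx; have nt' := nrm_1Bsq xs' nx'.
set t := 1 - x * x in nt; set t' := 1 - x' * x' in nt'.
have tE : t = 1 - x * x by []. have tE' : t' = 1 - x' * x' by [].
have xE : x = b - rc *: (1 : bop I) by []. have xE' : x' = b' - rc *: (1 : bop J) by [].
have bE : star a * a = b by []. have rcE : r%:C = rc by [].
clearbody t t' x x' b b' rc.
have [k [hk k1 kE ks kP]] := sqrt_lim nt; have [k' [hk' k1' kE' _ _]] := sqrt_lim nt'.
(* As |b'| = q < r, the element x' is negative and 1 - k' is its absolute value r - b'. Both sides
   are fixed points of the same iteration, which contracts their difference by the factor (2 - r +
   q) / 2 < 1. *)
have k'E : k' = 1 - rc *: (1 : bop J) + b'.
  pose l := 1 - rc *: (1 : bop J) + b'; have lE : l = chalf R *: (t' + l * l).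
    rewrite -[LHS]chalfD -scalerDr; congr (_ *: _); rewrite tE' /l xE'; bexp.
    by rewrite -?(bscalerAl, bscalerAr) ?mul1r ?mulr1; blin.
  have nl : nrm l <= 1 - r + q.
    have -> : l = (1 - rc) *: (1 : bop J) + b' by rewrite scalerBl scale1r.
    apply: le_trans (nrmD _ _) _; rewrite nb' lerD2r nrmZ.
    have -> : 1 - rc = (1 - r)%:C by rewrite -rcE rmorphB.
    rewrite cm_real; last lra.
    by rewrite -[X in _ <= X]mulr1 ler_wpM2l ?nrm1_le //; lra.
  have : nrm (k' - l) <= 2^-1 * (2 - r + q) * nrm (k' - l).
    rewrite {1}kE' {1}lE.
    have -> : chalf R *: (t' + k' * k') - chalf R *: (t' + l * l) =
              chalf R *: (k' * k' - l * l) by blin.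
    rewrite nrmZ cm_chalf sq_diff -mulrA ler_wpM2l ?invr_ge0 //.
    apply: le_trans (nrmD _ _) _.
    apply: le_trans (lerD (nrmM _ _) (nrmM _ _)) _.
    by have := nrm_ge0 (k' - l); nra.
  move=> h; apply/eqP; rewrite -subr_eq0; apply/eqP/nrm_eq0.
  by have := nrm_ge0 (k' - l); nra.
(* t involves the unit, so [kseq t n] need not lie in P; only its multiples by elements of P do, and
   f is followed along these. *)
have lem n : forall y, P y -> P (y * kseq t n) /\ f (y * kseq t n) = f y * kseq t' n.
  elim: n => [|n IH] y py; first by rewrite !mulr0 (hom0 p0 hf).
  have [p1 e1] := IH _ py; have [p2 e2] := IH _ p1.
  have yxP z : P z -> P (z * x) /\ f (z * x) = f z * x'.
    move=> pz; rewrite xE xE' !mulrBr -!bscalerAr !mulr1.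
    have pzb : P (z * b) by exact: PM.
    have prz : P (rc *: z) by exact: (csub_scale _ hP pz).
    split; first exact: csub_sub hP pzb prz.
    by rewrite (homB hf pzb prz) (homZ _ p0 hf pz) (fM _ _ pz pb) fb.
  have [p3 e3] := yxP _ py; have [p4 e4] := yxP _ p3.
  have E : y * t = y - y * x * x by rewrite tE mulrBr mulr1 mulrA.
  have pyt : P (y * t) by rewrite E; exact: csub_sub.
  have eyt : f (y * t) = f y * t' by rewrite E (homB hf py p4) e4 e3 tE' [RHS]mulrBr mulr1 mulrA.
  rewrite !kseqM; split.
    exact: (csub_scale _ hP (csub_add hP pyt p2)).
  rewrite (homZ _ p0 hf (csub_add hP pyt p2)).
  by rewrite (homD hf pyt p2) eyt e2 e1.
have mulL (K : choiceType) (u : nat -> bop K) (l z : bop K) :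
  (forall e : R, 0 < e -> exists N, forall n, (N <= n)%N -> nrm (u n - l) <= e) ->
  (forall e : R, 0 < e -> exists N, forall n, (N <= n)%N -> nrm (z * u n - z * l) <= e).
  move=> hu e e0; have z0 := nrm_ge0 z.
  have d0 : 0 < e / (nrm z + 1) by rewrite divr_gt0 // ltr_wpDl.
  have [N h] := hu _ d0; exists N => n /h; rewrite -mulrBr => d.
  apply: le_trans (nrmM _ _) _; apply: le_trans (ler_wpM2l z0 d) _.
  by rewrite mulrA ler_pdivrMr ?ltr_wpDl // mulrC ler_wpM2l ?ltW //; lra.
have hbk := mulL _ _ _ b hk.
have [pbk fbk] : P (b * k) /\ f (b * k) = b' * k'.
  have pbk : P (b * k).
    by apply: (csub_seq hP) hbk => n; have [] := lem n _ pb.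
  split=> //; apply: nrm_eps => e e0; have e2 : 0 < e / 2 by rewrite divr_gt0.
  have [N1 h1] := hbk _ e2; have [N2 h2] := mulL _ _ _ b' hk' _ e2.
  have /h1 d1 := leq_maxl N1 N2; have /h2 d2 := leq_maxr N1 N2.
  set n := maxn N1 N2 in d1 d2; have [pn en] := lem n _ pb.
  apply: (@nrm_tri _ _ _ (b' * kseq t' n)); last exact: d2.
  rewrite (_ : b' * kseq t' n = f (b * kseq t n)); last by rewrite en fb.
  rewrite nrm_distC -(homB hf) //; apply: le_trans d1.
  by apply: (hom_contr cP hf); exact: csub_sub.
pose w := 1 - k; pose g := w + x.
(* Here w is the absolute value of x, and g = w + x is twice its positive part. The element b g lies
   in P, and f sends it to b' (1 - k' + b' - r), which vanishes by the formula for k'. *)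
have bg : b * g = 0.
  have E : b * g = b - b * k + (b * b - rc *: b).
    by rewrite /g /w xE; bexp; rewrite -bscalerAr mulr1; blin.
  have pbb : P (b * b) by exact: PM.
  have prb : P (rc *: b) by exact: csub_scale.
  have p1 := csub_sub hP pb pbk; have p2 := csub_sub hP pbb prb.
  apply: inj; rewrite E; first exact: csub_add hP p1 p2.
  rewrite (homD hf p1 p2) (homB hf pb pbk) (homB hf pbb prb) (fM _ _ pb pb) fbk.
  rewrite (homZ _ p0 hf pb) fb.
  by rewrite k'E; bexp; rewrite -?(bscalerAl, bscalerAr) ?mul1r ?mulr1; blin.

have ts : star t = t by rewrite tE starB star1 starM xs.
have {}ks := ks ts.
have wx : w * x = x * w.
  have kx : k * x = x * k.
    apply: (kP _ (csub_commute x)) => [y z /= hy hz|]; first by rewrite -mulrA hz mulrA hy mulrA.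
    by rewrite /= tE (mulrBl x 1) (mulrBr x 1) mul1r mulr1 mulrA.
  by rewrite /w [LHS]mulrBl [RHS]mulrBr mul1r mulr1 kx.
have ww : w * w = x * x by rewrite /w (sqrt_fix kE) tE; blin.
have ws : star w = w by rewrite starB star1 ks.
have wE : w = 1 - k by [].
have gs : star g = g by rewrite starD ws xs.
clearbody w.
have gb : g * b = 0 by apply: (can_inj (@starK R I)); rewrite starM bs gs bg star0.
have xg : x * g = - (rc *: g).
  by rewrite xE mulrBl bg sub0r -(bscalerAl rc 1 g) mul1r.
have wg : w * g = x * g by rewrite /g !mulrDr ww wx addrC.
(* (1 - k2)^2 = 1 - k = w exhibits w as a square of a self-adjoint element. *)
have [k2 [k2E k2s _ _]] := sqrt_ex k1 ks.
(* From b g = 0 one gets g w g = g x g = - r g^2, while g w g is the square of (1 - k2) g. So r g^2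
   plus a square is zero. *)
have g0 : g = 0.
  have sr : (Num.sqrt r)%:C != 0 :> R[i].
    by apply/eqP => /(congr1 (@cm R)); rewrite cm_real ?sqrtr_ge0 // cm0 => /eqP; rewrite sqrtr_eq0 leNgt r0.
  suff E : (Num.sqrt r)%:C *: g = 0 by rewrite -[g]scale1r -(mulVf sr) -scalerA E scaler0.
  apply: (@sos0 _ _ _ (star ((1 - k2) * g) * ((1 - k2) * g))); first exact: pos_star.
  rewrite starM starZ gs (_ : star (1 - k2) = 1 - k2); last by rewrite starB star1 k2s.
  have -> : g * (1 - k2) * ((1 - k2) * g) = g * (w * g).
    by rewrite -mulrA [(1 - k2) * (_ * g)]mulrA k2E wE.
  have -> : g * (w * g) = - (rc *: (g * g)) by rewrite wg xg mulrN bscalerAr.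
  rewrite -bscalerAl -bscalerAr scalerA.
  have -> : conjc (Num.sqrt r)%:C * (Num.sqrt r)%:C = rc.
    by rewrite -rcE conjc_sqn /sqn /= expr0n addr0 sqr_sqrtr // ltW.
  by rewrite subrr.
(* With g = 0 one has w = - x, hence b + (1 - k2)^2 = r: a certificate for |a|^2 <= r, against r <
   |a|^2. *)
have : nrm a <= Num.sqrt r.
  apply: (@sos _ _ _ (star (1 - k2) * (1 - k2))); [exact: sqrtr_ge0|exact: pos_star|].
  rewrite starB star1 k2s k2E -wE (sqr_sqrtr (ltW r0)) rcE bE.
  have -> : w = - x by apply/eqP; rewrite -addr_eq0 -/g g0.
  by rewrite xE; blin.
rewrite -(@ler_pXn2r _ 2) ?nnegrE ?nrm_ge0 ?sqrtr_ge0 // (sqr_sqrtr (ltW r0)) na.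
by move: r2; lra.
Qed.

(** Rescaling to |a|^2 = 1/2 reduces the claim to [hom_inj_half]; this normalization keeps the
    auxiliary elements there in the unit ball, where the square root iteration converges. *)
Lemma hom_isom P f a : calg P -> shom P f -> (forall x, P x -> f x = 0 -> x = 0) ->
  P a -> nrm (f a) = nrm a.
Proof.
move=> cP hf inj pa; apply/eqP; rewrite eq_le (hom_contr cP hf pa) /=.
have [hP _ _] := cP; have p0 : P 0 by case: hP.
have [->|an] := eqVneq (nrm a) 0; first exact: nrm_ge0.
have a0 : 0 < nrm a by rewrite lt_def an nrm_ge0.
pose s := Num.sqrt 2^-1 / nrm a; have s0 : 0 < s by rewrite divr_gt0 // sqrtr_gt0 invr_gt0.
have hs : (s * nrm a) ^+ 2 = 2^-1.
  by rewrite /s divfK // sqr_sqrtr // invr_ge0.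
have := @hom_inj_half P f (s%:C *: a) cP hf inj (csub_scale _ hP pa).
rewrite (homZ _ p0 hf pa) !nrmZ (cm_real (ltW s0)) hs => /(_ erefl).
have sn K (y : bop K) : 0 <= s * nrm y by apply: mulr_ge0 (ltW s0) (nrm_ge0 y).
rewrite -hs ler_pXn2r ?nnegrE ?sn //.
by rewrite ler_pM2l.
Qed.

End Homs.

(** * Approximate units *)

Section ApproximateUnit.
Variables (R : realType) (I : choiceType).
Local Notation bop := (bop R I).
Implicit Types (P : set bop).

(** Kept as an explicit list of squares because conjugation by d then acts on the list; for [pos],
    which only sees finitely supported vectors, the same stability would require a limit
    argument. *)
Definition ssq (Q : bop) : Prop := exists s : seq bop, Q = \sum_(y <- s) star y * y.

Lemma ssqD Q Q' : ssq Q -> ssq Q' -> ssq (Q + Q').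
Proof. by move=> [s ->] [s' ->]; exists (s ++ s'); rewrite big_cat. Qed.
Lemma ssq1 y : ssq (star y * y).
Proof. by exists [:: y]; rewrite big_seq1. Qed.
Lemma ssq_conj Q d : ssq Q -> ssq (star d * Q * d).
Proof.
move=> [s ->]; exists [seq y * d | y <- s]; rewrite big_map mulr_sumr mulr_suml.
by apply: eq_bigr => y _; rewrite starM !mulrA.
Qed.
Lemma ssq_pos Q : ssq Q -> pos Q.
Proof. by move=> [s ->]; apply: pos_sum => y; exact: pos_star. Qed.

(* With c = d^2, [1 - (n+1) c^n (1 - c)] is a sum of squares. *)
Lemma ssq_power (d : bop) n : star d = d ->
  ssq (1 - (d ^+ n * (1 - d * d) * d ^+ n) *+ n.+1).
Proof.
move=> ds; have dn m : star (d ^+ m) = d ^+ m by rewrite starX ds.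
have c1 : GRing.comm (1 - d * d) d.
  by rewrite /GRing.comm mulrBl mulrBr mul1r mulr1 mulrA.
have cm m : d ^+ m * (1 - d * d) = (1 - d * d) * d ^+ m := esym (commrX m c1).
elim: n => [|n IH].
  rewrite expr0 mul1r mulr1 mulr1n; have -> : 1 - (1 - d * d) = star d * d by rewrite ds; blin.
  exact: ssq1.
set X := d ^+ n * _ * _ in IH.
have -> : d ^+ n.+1 * (1 - d * d) * d ^+ n.+1 = d * X * d.
  by rewrite {1}exprS exprSr /X !mulrA.
have geo : ssq ((1 - d * d) * (1 - d ^+ n.+1 * d ^+ n.+1)).
  elim: {IH X} n => [|n IH].
    rewrite expr1; have -> : (1 - d * d) * (1 - d * d) = star (1 - d * d) * (1 - d * d).
      by rewrite starB star1 starM ds.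
    exact: ssq1.
  have -> : (1 - d * d) * (1 - d ^+ n.+2 * d ^+ n.+2) =
    (1 - d * d) * (1 - d ^+ n.+1 * d ^+ n.+1) +
    star ((1 - d * d) * d ^+ n.+1) * ((1 - d * d) * d ^+ n.+1).
    have as_ : star (1 - d * d) = 1 - d * d by rewrite starB star1 starM ds.
    have YaY : d ^+ n.+1 * (1 - d * d) * d ^+ n.+1 =
       d ^+ n.+1 * d ^+ n.+1 - d ^+ n.+2 * d ^+ n.+2.
      rewrite mulrBr mulr1 mulrBl; congr (_ - _).
      by rewrite {1}(exprSr d n.+1) (exprS d n.+1) !mulrA.
    have Ya := cm n.+1; rewrite starM dn as_.
    move: (d ^+ n.+1) (d ^+ n.+2) (1 - d * d) Ya YaY => Y Y' a Ya YaY.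
    by rewrite mulrA Ya -(mulrA a Y a) -(mulrA a) YaY -mulrDr; congr (a * _); blin.
  by apply: ssqD => //; exact: ssq1.
have XE : X = (1 - d * d) * (d ^+ n * d ^+ n) by rewrite /X cm mulrA.
have -> : 1 - d * X * d *+ n.+2 =
   star d * (1 - X *+ n.+1) * d + (1 - d * d) * (1 - d ^+ n.+1 * d ^+ n.+1).
  have dXd : d * X * d = (1 - d * d) * (d ^+ n.+1 * d ^+ n.+1).
    rewrite XE (mulrA d) -c1 -!mulrA; congr (_ * _).
    by rewrite mulrA -exprS -exprSr.
  have e1 : d * (1 - X *+ n.+1) * d = d * d - d * X * d *+ n.+1.
    by rewrite (mulrBr d) mulr1 mulrBl mulrnAr mulrnAl.
  have e2 : (1 - d * d) * (1 - d ^+ n.+1 * d ^+ n.+1) = (1 - d * d) - d * X * d.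
    by rewrite dXd mulrBr mulr1.
  rewrite ds e1 e2 mulrS; move: (d * X * d) (d * X * d *+ n.+1) (d * d) => Y Z W; blin.
by apply: ssqD => //; exact: ssq_conj.
Qed.

(** With b a small multiple of the sum of the a * star a and d^2 = 1 - b, the unit is u = 1 - d^n,
    so that a - u a = d^n a. By [ssq_power], (n+1) c times d^n a (star a) d^n is at most (n+1) d^n
    (1 - d^2) d^n <= 1, whence |d^n a|^2 <= 1 / ((n+1) c). Although d is outside P, all 1 - d^n are
    in P. *)
Lemma approx_unit P (s : seq bop) (e : R) : calg P -> (forall a, a \in s -> P a) -> 0 < e ->
  exists u, [/\ P u, nrm u <= 2 & forall a, a \in s -> nrm (a - u * a) <= e].
Proof.
move=> cP ps e0; have [hP PM PS] := cP.
pose N := \sum_(a <- s) nrm a ^+ 2.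
have N0 : 0 <= N by apply: sumr_ge0 => a _; exact: sqr_ge0.
(* This factor makes |b| <= 1, so that 1 - b has the square root d. *)
pose c := (1 + N)^-1; have c0 : 0 < c by rewrite invr_gt0 ltr_pwDl.
pose b := c%:C *: \sum_(a <- s) a * star a.
have pb : P b.
  apply: csub_scale => //; rewrite big_seq; elim/big_ind: _ => [|x y px py|a /ps pa].
  - by case: hP.
  - exact: csub_add.
  - by apply: PM => //; exact: PS.
have bs : star b = b.
  rewrite starZ star_sum; congr (_ *: _); first by congr Complex; rewrite oppr0.
  by apply: eq_bigr => a _; rewrite starM starK.
have nb : nrm b <= 1.
  rewrite nrmZ (cm_real (ltW c0)) mulrC ler_pdivrMr ?ltr_pwDl // mul1r.
  apply: le_trans (nrm_sum _ _) _; apply: (@le_trans _ _ N); last by rewrite lerDr.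
  by apply: ler_sum => a _; rewrite -{1}(starK a) cstar nrm_star.
have [k [kE ks k1 kP]] := sqrt_ex nb bs.
have {kP}pk : P k by exact: kP.
pose d := 1 - k; have ds : star d = d by rewrite starB star1 ks.
have nd : nrm d <= 1.
  apply: (@sos _ _ _ b) => //.
    rewrite /b scaler_sumr; apply: pos_sum => a.
    have -> : c%:C *: (a * star a) =
       star ((Num.sqrt c)%:C *: star a) * ((Num.sqrt c)%:C *: star a).
      rewrite starZ starK -bscalerAl -bscalerAr scalerA conjc_sqn /sqn /= expr0n addr0.
      by rewrite sqr_sqrtr // ltW.
    exact: pos_star.
  by rewrite ds kE expr1n scale1r subrK.
have ec0 : 0 < e ^+ 2 * c by rewrite mulr_gt0 // exprn_gt0.
pose n := Num.bound (e ^+ 2 * c)^-1.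
have hn : 1 <= e ^+ 2 * (n.+1%:R * c).
  have /archi_boundP : 0 <= (e ^+ 2 * c)^-1 by rewrite invr_ge0 ltW.
  rewrite -/n => h; rewrite mulrCA -ler_pdivrMr // mul1r (le_trans (ltW h)) //.
  by rewrite ler_nat.
have nX m : nrm (d ^+ m) <= 1.
  elim: m => [|m IH]; first by rewrite expr0; exact: nrm1_le.
  rewrite exprS; apply: le_trans (nrmM _ _) _.
  by have := nrm_ge0 d; have := nrm_ge0 (d ^+ m); nra.
have pX m : P (1 - d ^+ m).
  elim: m => [|m IH]; first by rewrite expr0 subrr; case: hP.
  have -> : 1 - d ^+ m.+1 = (1 - d ^+ m) + (k - (1 - d ^+ m) * k).
    by rewrite exprSr {3}/d; bexp; blin.
  by apply: csub_add => //; apply: (csub_sub hP pk); exact: PM.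
exists (1 - d ^+ n); split => [//||a as_].
  apply: le_trans (nrmB _ _) _; have := nX n; have := nrm1_le R I; lra.
have -> : a - (1 - d ^+ n) * a = d ^+ n * a by bexp; blin.
pose r := n.+1%:R * c; have r0 : 0 < r by rewrite mulr_gt0 ?ltr0n.
pose F x := star ((Num.sqrt r)%:C *: (star x * d ^+ n)) * ((Num.sqrt r)%:C *: (star x * d ^+ n)).
have dn : star (d ^+ n) = d ^+ n by rewrite starX ds.
have FE x : F x = r%:C *: (d ^+ n * (x * star x) * d ^+ n).
  rewrite /F starZ starM starK dn -bscalerAl -bscalerAr scalerA conjc_sqn /sqn /= expr0n addr0.
  by rewrite (sqr_sqrtr (ltW r0)) !mulrA.
have sumF : \sum_(x <- s) F x = (d ^+ n * (1 - d * d) * d ^+ n) *+ n.+1.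
  have -> : 1 - d * d = b by rewrite kE; blin.
  rewrite (eq_bigr _ (fun x _ => FE x)) -scaler_sumr -mulr_suml -mulr_sumr.
  rewrite /b -bscalerAr -bscalerAl -scaler_nat scalerA; congr (_ *: _).
  by rewrite /r rmorphM /= rmorph_nat.
have : nrm ((Num.sqrt r)%:C *: (star a * d ^+ n)) <= 1.
  have hq := ssq_power n ds.
  apply: (@sos _ _ _ (\sum_(x <- rem a s) F x + (1 - (d ^+ n * (1 - d * d) * d ^+ n) *+ n.+1))) => //.
    by apply: posD; [apply: pos_sum => x; exact: pos_star|exact: ssq_pos].
  have E : \sum_(x <- s) F x = F a + \sum_(x <- rem a s) F x by exact: (big_rem a as_).
  by rewrite -/(F a) addrA -E sumF expr1n scale1r addrC subrK.
rewrite nrmZ cm_real ?sqrtr_ge0 // -nrm_star starM starK dn => h.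
have sr : 0 < Num.sqrt r by rewrite sqrtr_gt0.
have : 1 <= e * Num.sqrt r.
  rewrite -(@ler_pXn2r _ 2) ?nnegrE ?mulr_ge0 ?sqrtr_ge0 ?(ltW e0) //.
  by rewrite expr1n exprMn (sqr_sqrtr (ltW r0)).
move=> h2; rewrite -(ler_pM2l sr); apply: le_trans h _; by rewrite mulrC.
Qed.

End ApproximateUnit.

(** * Compact operators and nondegeneracy *)

Section MatrixUnits.
Variables (R : realType) (I : choiceType).
Local Notation bop := (bop R I).

(** Total, with value 0 on unbounded matrices, so that constructions can be written before
    boundedness is proved. *)
Definition mkb (T : op R I) : bop :=
  if pselect (bounded_op T) is left h then Bop h else 0.

Lemma mkbE T : bounded_op T -> bval (mkb T) = T.
Proof. by move=> h; rewrite /mkb; case: pselect. Qed.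
Lemma mkb_val (T : bop) : mkb T = T.
Proof. by apply: bval_inj; rewrite mkbE //; exact: bvalP. Qed.

Lemma rank1_bounded (x y : vec R I) a b : (forall F, nF F x <= a) -> (forall F, nF F y <= b) ->
  bounded_op ((fun i j => x i * conjc (y j)) : op R I).
Proof.
move=> hx hy; apply/bounded_opP; exists (a * b).
have a0 : 0 <= a := le_trans (nF_ge0 _ _) (hx fset0).
have b0 : 0 <= b := le_trans (nF_ge0 _ _) (hy fset0).
split=> [|F G u v]; first exact: mulr_ge0.
have -> : bform (fun i j => x i * conjc (y j)) F G u v =
   (\sum_(i <- F) u i * x i) * (\sum_(j <- G) conjc (y j) * v j).
  rewrite mulr_suml; apply: eq_bigr => i _; rewrite mulr_sumr; apply: eq_bigr => j _; ring.
rewrite cmM.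
have -> : a * b * nF F u * nF G v = (nF F u * a) * (b * nF G v) by ring.
apply: ler_pM; rewrite ?cm_ge0 //; apply: le_trans (cauchy_schwarz_cm _ _ _) _.
  by rewrite ler_wpM2l ?nF_ge0.
by rewrite nF_conj ler_wpM2r ?nF_ge0.
Qed.

Definition dlt (i : I) : vec R I := fun k => (k == i)%:R.
Lemma nF_dlt i F : nF F (dlt i) <= 1.
Proof. exact: (nF_column i F (opb1 R I)). Qed.

Lemma Emx_ex : {U : I -> I -> bop |
  forall i j, U i j = mkb (fun k l => dlt i k * conjc (dlt j l))}.
Proof. by eexists. Qed.
Definition Emx : I -> I -> bop := sval Emx_ex.
Lemma EmxE i j k l : Emx i j k l = (k == i)%:R * (l == j)%:R.
Proof.
rewrite /Emx (svalP Emx_ex) mkbE; last by apply: (@rank1_bounded _ _ 1 1); exact: nF_dlt.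
by rewrite /dlt; case: (l == j); rewrite ?conjc1 ?conjc0.
Qed.
Lemma Emx_star i j : star (Emx i j) = Emx j i.
Proof.
apply: bopP => k l; rewrite starE !EmxE rmorphM mulrC.
by case: (k == j); case: (l == i); rewrite ?rmorph1 ?rmorph0.
Qed.
Lemma mulEmx (T : bop) i j k l : (T * Emx i j) k l = T k i * (l == j)%:R.
Proof.
rewrite bvalME (@csum1 _ _ _ i) => [|m mi]; first by rewrite EmxE eqxx mul1r.
by rewrite EmxE (negPf mi) mul0r mulr0.
Qed.
Lemma Emxmul (T : bop) i j k l : (Emx i j * T) k l = (k == i)%:R * T j l.
Proof.
rewrite bvalME (@csum1 _ _ _ j) => [|m mi]; first by rewrite EmxE eqxx mulr1.
by rewrite EmxE (negPf mi) mulr0 mul0r.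
Qed.
Lemma Emx_mul i j k l : Emx i j * Emx k l = (j == k)%:R *: Emx i l.
Proof.
by apply: bopP => p q; rewrite mulEmx bvalZ !EmxE (eq_sym j k); ring.
Qed.
Lemma Emx_sandwich (T : bop) i j k l : Emx i j * T * Emx k l = T j k *: Emx i l.
Proof. by apply: bopP => p q; rewrite mulEmx Emxmul bvalZ EmxE; ring. Qed.
Lemma nrmEmx i j : nrm (Emx i j) = 1.
Proof.
have idem k : nrm (Emx k k) = 1.
  have := cstar (Emx k k); rewrite Emx_star Emx_mul eqxx scale1r => /eqP.
  rewrite expr2 -{1}[nrm _]mulr1 -subr_eq0 -mulrBr mulf_eq0 subr_eq0 => /orP[/eqP h|/eqP //].
  have := nrm_entry (Emx k k) k k; rewrite h EmxE !eqxx mulr1 cm1 => h'.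
  by have := @ltr01 R; rewrite ltNge h'.
have := cstar (Emx i j); rewrite Emx_star Emx_mul eqxx scale1r idem => /esym/eqP.
by rewrite sqrp_eq1 ?nrm_ge0 // => /eqP.
Qed.

Lemma eq_col (S T : bop) : (forall j, S * Emx j j = T * Emx j j) -> S = T.
Proof.
move=> h; apply: bopP => i j; have := congr1 (fun X : bop => X i j) (h j).
by rewrite !mulEmx eqxx !mulr1.
Qed.

(** Compressing star X * X by [Emx j j] leaves its diagonal entry times [Emx j j], and the
    C*-identity gives the norm. Thus [X * Emx j j] stands in for the vector X e_j, with its norm as
    length. *)
Lemma nrm_col_sq (X : bop) j :
  (star X * X) j j = (nrm (X * Emx j j) ^+ 2)%:C.
Proof.
have E : Emx j j * (star X * X) * Emx j j = (star X * X) j j *: Emx j j.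
  exact: Emx_sandwich.
have r : exists r : R, (star X * X) j j = r%:C /\ 0 <= r.
  have := csum_sums (asum_bop (star X) X j j); rewrite -bvalME.
  have := pos_star X [fset j]%fset (fun=> 1); rewrite /bform !big_seq_fset1 conjc1 mul1r mulr1.
  have : conjc ((star X * X) j j) = (star X * X) j j by rewrite -starE starM starK.
  case: ((star X * X) j j) => a b [/eqP]; rewrite eq_sym -subr_eq0 opprK -mulr2n mulrn_eq0 /= => /eqP -> h _.
  by exists a.
have [r0 [rE r_ge0]] := r.
have -> : nrm (X * Emx j j) ^+ 2 = r0; last by [].
rewrite -cstar starM Emx_star mulrA -[_ * star X * _]mulrA E rE nrmZ cm_real //.
by rewrite nrmEmx mulr1.
Qed.

Lemma col_parallelogram (X Y : bop) j :
  nrm ((X + Y) * Emx j j) ^+ 2 + nrm ((X - Y) * Emx j j) ^+ 2 =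
  2 * nrm (X * Emx j j) ^+ 2 + 2 * nrm (Y * Emx j j) ^+ 2.
Proof.
have nE Z : nrm (Z * Emx j j) ^+ 2 = complex.Re ((star Z * Z) j j) by rewrite nrm_col_sq.
have E1 : star (X + Y) * (X + Y) = star X * X + star X * Y + (star Y * X + star Y * Y).
  by rewrite starD; bexp.
have E2 : star (X - Y) * (X - Y) = star X * X - star X * Y - (star Y * X - star Y * Y).
  by rewrite starB; bexp; rewrite opprB addrC; blin.
rewrite !nE E1 E2 !(bvalD, bvalN).
have ReD (z w : R[i]) : complex.Re (z + w) = complex.Re z + complex.Re w.
  by case: z w => ? ? [].
have ReN (z : R[i]) : complex.Re (- z) = - complex.Re z by case: z.
by rewrite !(ReD, ReN); ring.
Qed.
End MatrixUnits.

Section Density.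
Variables (R : realType) (I : choiceType).
Local Notation bop := (bop R I).
Implicit Types (P : set bop).

(** Stated with operators X instead of vectors; read column by column it says that P has no nonzero
    common null vector. *)
Definition nondeg P : Prop := forall X : bop, (forall a, P a -> a * X = 0) -> X = 0.

Lemma sq_near (x d m t : R) : 0 <= x -> x < d + m -> 0 <= d -> 0 < m -> m <= 1 ->
  m * (2 * d + 1) <= t -> x ^+ 2 <= d ^+ 2 + t.
Proof.
move=> x0 xd d0 m0 m1 mt.
have : x ^+ 2 <= (d + m) ^+ 2 by rewrite ler_pXn2r ?nnegrE ?addr_ge0 ?(ltW m0) // ltW.
have : m * m <= m by rewrite ler_piMl // ltW.
rewrite !expr2; nra.
Qed.

Lemma par_near (d w p q r m n : R) : 0 <= d -> d <= w -> p ^+ 2 <= d ^+ 2 + m ->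
  q ^+ 2 <= d ^+ 2 + n -> (2 * w) ^+ 2 + r ^+ 2 = 2 * p ^+ 2 + 2 * q ^+ 2 ->
  r ^+ 2 <= 2 * m + 2 * n.
Proof.
move=> d0 dw hp hq E.
have : d ^+ 2 <= w ^+ 2 by rewrite ler_pXn2r ?nnegrE // (le_trans d0).
move: E; rewrite exprMn; lra.
Qed.

Lemma orth_aux (n s c : R) (p : R[i]) :
  n%:C - (s%:C * conjc p) * p - (conjc (s%:C * conjc p) * conjc p -
    conjc (s%:C * conjc p) * (s%:C * conjc p) * c%:C) =
  (n - (2 * s - s ^+ 2 * c) * sqn p)%:C.
Proof. by case: p => a b; rewrite /sqn; congr Complex => /=; ring. Qed.

(** The projection theorem in column form. Elements of P minimizing the distance from e_j to P e_j
    converge on the column j by the parallelogram law; the residual x is orthogonal to P e_j, hence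
    killed by P, hence zero by nondegeneracy. *)
Lemma nondeg_dense P j (e : R) : calg P -> nondeg P -> 0 < e ->
  exists2 a, P a & nrm ((a - 1) * Emx R j j) <= e.
Proof.
move=> cP nd e0; have [hP PM PS] := cP; set E := Emx R j j.
have EE : E * E = E by rewrite Emx_mul eqxx scale1r.
pose N (b : bop) := nrm ((1 - b) * E).
pose S := [set N b | b in P].
have S0 : S !=set0 by exists (N 0); exists 0 => //; case: hP.
have Slb : has_lbound S by exists 0 => _ [b _ <-]; exact: nrm_ge0.
set D := inf S; have DN b : P b -> D <= N b by move=> pb; apply: ge_inf => //; exists b.
have D0 : 0 <= D by apply: lb_le_inf => // _ [b _ <-]; exact: nrm_ge0.
have /choice[b hb] : forall n : nat, exists b, P b /\ N b ^+ 2 <= D ^+ 2 + n.+1%:R^-1.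
  move=> n; have n0 : (0 : R) < n.+1%:R^-1 by rewrite invr_gt0 ltr0n.
  have d0 : 0 < n.+1%:R^-1 / (2 * D + 1) :> R.
    by rewrite divr_gt0 // ltr_wpDl // mulr_ge0.
  have m0 : 0 < Num.min 1 (n.+1%:R^-1 / (2 * D + 1)) :> R by rewrite lt_min ltr01 d0.
  have [_ [c pc <-] h] := inf_adherent m0 (conj S0 Slb).
  exists c; split=> //; rewrite -/D in h.
  set m := Num.min _ _ in m0 h; have m1 : m <= 1 by rewrite ge_min lexx.
  have m2 : m * (2 * D + 1) <= n.+1%:R^-1.
    by rewrite -ler_pdivlMr ?ltr_wpDl ?mulr_ge0 // ge_min lexx orbT.
  exact: (sq_near (nrm_ge0 _) h D0 m0 m1 m2).
have dist m n : nrm ((b m - b n) * E) ^+ 2 <= 2 * m.+1%:R^-1 + 2 * n.+1%:R^-1.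
  have [[pm hm] [pn hn]] := (hb m, hb n).
  (* The midpoint of [b m] and [b n] is again in P, so its distance to the column is at least D;
     this bounds the difference of the two. *)
  have := col_parallelogram (1 - b m) (1 - b n) j; rewrite -/E.
  have -> : 1 - b m - (1 - b n) = - (b m - b n) by blin.
  rewrite mulNr nrmN -/(N (b m)) -/(N (b n)).
  have -> : 1 - b m + (1 - b n) = 2%:R *: (1 - chalf R *: (b m + b n)).
    rewrite scalerBr scalerA (_ : 2%:R * chalf R = 1) ?scale1r.
      by rewrite scaler_nat mulr2n; blin.
    by rewrite /chalf -(rmorph_nat (real_complex R)) -rmorphM /= divff.
  rewrite -bscalerAl nrmZ -/(N _).
  have -> : cm (2%:R : R[i]) = 2.
    by rewrite -(rmorph_nat (real_complex R)) cm_real.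
  have Dw : D <= N (chalf R *: (b m + b n)).
    by apply: DN; apply: csub_scale => //; exact: csub_add.
  exact: (par_near D0 Dw hm hn).
have small (d : R) : 0 < d -> exists K, forall n, (K <= n)%N -> n.+1%:R^-1 <= d.
  move=> d0; exists (Num.bound d^-1) => n Kn.
  have /archi_boundP h : 0 <= d^-1 by rewrite invr_ge0 ltW.
  rewrite -[d]invrK lef_pV2 ?posrE ?invr_gt0 ?ltr0n //.
  by apply: le_trans (ltW h) _; rewrite ler_nat (leq_trans Kn).
have [|v hv] := @nrm_complete _ _ (fun n => b n * E).
  move=> d d0; have d1 : 0 < d ^+ 2 / 4 by rewrite divr_gt0 ?exprn_gt0.
  have [K hK] := small _ d1; exists K => m n /hK hm /hK hn; rewrite -mulrBl.
  rewrite -(@ler_pXn2r _ 2) ?nnegrE ?nrm_ge0 ?(ltW d0) //.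
  apply: le_trans (dist m n) _.
  have -> : d ^+ 2 = 2 * (d ^+ 2 / 4) + 2 * (d ^+ 2 / 4) by field.
  by rewrite lerD // ler_wpM2l.
pose x := E - v.
have vE : v * E = v.
  apply: nrm_eps => d d0; have d1 : 0 < d / 2 by lra.
  have [K /(_ _ (leqnn K)) h] := hv _ d1.
  apply: (@nrm_tri _ _ _ (b K * E)) => //.
  rewrite -{2}EE mulrA -mulrBl; apply: le_trans (nrmM _ _) _.
  by rewrite nrmEmx mulr1 nrm_distC.
have xE : x * E = x by rewrite /x mulrBl EE vE.
have xlim (d : R) : 0 < d -> exists K, forall n, (K <= n)%N -> nrm ((1 - b n) * E - x) <= d.
  move=> /hv[K hK]; exists K => n /hK.
  rewrite /x (_ : (1 - b n) * E - (E - v) = - (b n * E - v)) ?nrmN //.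
  by rewrite mulrBl mul1r; blin.
have xD : nrm x <= D.
  have h n : nrm x <= Num.sqrt (D ^+ 2 + n.+1%:R^-1) + nrm ((1 - b n) * E - x).
    have {1}-> : x = (1 - b n) * E - ((1 - b n) * E - x) by blin.
    apply: le_trans (nrmB _ _) _.
    rewrite lerD2r -(@ler_pXn2r _ 2) ?nnegrE ?nrm_ge0 ?sqrtr_ge0 // sqr_sqrtr.
      by have [] := hb n.
    by rewrite addr_ge0 ?sqr_ge0 // invr_ge0.
  apply/ler_addgt0Pr => d d0; pose d' := d / 2; have d'0 : 0 < d' by rewrite /d'; lra.
  have [K1 h1] := small (d' ^+ 2) (exprn_gt0 _ d'0); have [K2 h2] := xlim _ d'0.
  have /h1 l1 := leq_maxl K1 K2; have /h2 l2 := leq_maxr K1 K2.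
  apply: le_trans (h (maxn K1 K2)) _.
  have : Num.sqrt (D ^+ 2 + (maxn K1 K2).+1%:R^-1) <= D + d'.
    rewrite -(@ler_pXn2r _ 2) ?nnegrE ?sqrtr_ge0 ?addr_ge0 ?(ltW d'0) // sqr_sqrtr.
      apply: le_trans (lerD (lexx _) l1) _.
      by rewrite sqrrD -addrA lerD2l lerDr mulrn_wge0 // mulr_ge0 // ltW.
    by rewrite addr_ge0 ?sqr_ge0 // invr_ge0.
  by move: l2; rewrite /d'; lra.
(* If p = <x, c e_j> were nonzero, moving the approximants by z c with z = s * conjc p would lower
   the squared distance by (2 s - s^2 |c e_j|^2) |p|^2, and s = 1 / (|c e_j|^2 + 1) makes this
   positive. *)
have orth c : P c -> (star x * c) j j = 0.
  move=> pc; set p := _ j j; apply: sqn_eq0; apply/eqP; apply/negPn/negP => pn.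
  have p0 : 0 < sqn p by rewrite lt_def pn sqn_ge0.
  pose cc := nrm (c * E) ^+ 2; have cc0 : 0 <= cc by exact: sqr_ge0.
  pose s := (cc + 1)^-1; have s0 : 0 < s by rewrite invr_gt0 ltr_wpDl.
  pose z := s%:C * conjc p.
  have hD : D <= nrm ((x - z *: c) * E).
    apply/ler_addgt0Pr => d d0; have [K /(_ _ (leqnn K)) h] := xlim _ d0.
    apply: le_trans (DN (b K + z *: c) _) _.
      by apply: csub_add => //; [have [] := hb K|exact: csub_scale].
    have -> : N (b K + z *: c) = nrm ((x - z *: c) * E + ((1 - b K) * E - x)).
      rewrite /N (mulrBl E x) xE (mulrBl E 1) (mulrBl E 1) mulrDl.
      by congr nrm; clear; blin.
    by apply: le_trans (nrmD _ _) _; rewrite lerD2l.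
  have : D ^+ 2 <= nrm x ^+ 2 - (2 * s - s ^+ 2 * cc) * sqn p.
    have -> : nrm x ^+ 2 - (2 * s - s ^+ 2 * cc) * sqn p = nrm ((x - z *: c) * E) ^+ 2.
      have inj (a a' : R) : a%:C = a'%:C -> a = a' by move=> [].
      have X1 := nrm_col_sq x j; rewrite -/E xE in X1.
      have C1 := nrm_col_sq c j; rewrite -/E -/cc in C1.
      have P1 : (star c * x) j j = conjc p by rewrite /p -starE starM starK.
      have E2 : star (x - z *: c) * (x - z *: c) = star x * x - z *: (star x * c) -
          (conjc z *: (star c * x) - (conjc z * z) *: (star c * c)).
        rewrite starB starZ mulrBl !(mulrBr _ x) -!bscalerAl -!bscalerAr scalerA //.
      apply: inj; rewrite -nrm_col_sq E2 !(bvalB, bvalZ) X1 C1 P1 -/p /z.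
      by rewrite -orth_aux.
    by rewrite ler_pXn2r ?nnegrE ?nrm_ge0.
  have : nrm x ^+ 2 <= D ^+ 2 by rewrite ler_pXn2r ?nnegrE ?nrm_ge0.
  have sc : s * cc < 1 by rewrite /s mulrC ltr_pdivrMr ?ltr_wpDl // mul1r ltrDl.
  have : 0 < (2 * s - s ^+ 2 * cc) * sqn p.
    rewrite mulr_gt0 // (_ : 2 * s - s ^+ 2 * cc = s * (2 - s * cc)); last by ring.
    by rewrite mulr_gt0 //; lra.
  lra.
(* |c x|^2 = <x, star c c x> with x = e_j - v. The e_j part vanishes by orthogonality; the v part
   vanishes because v is the limit of the columns [b n * E] and star c * c * b n is in P. *)
have x0 : x = 0.
  apply: nd => c pc; rewrite -xE mulrA.
  have pcc : P (star c * c) by apply: PM => //; exact: PS.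
  apply: nrm_eq0; have inj (a : R) : a%:C = 0 :> R[i] -> a = 0 by move=> [].
  suff /inj/eqP : (nrm (c * x * E) ^+ 2)%:C = 0 :> R[i] by rewrite sqrf_eq0 => /eqP ->.
  rewrite -nrm_col_sq starM -mulrA [star c * _]mulrA [star x * _]mulrA.
  have -> : star x * (star c * c) * x = star x * (star c * c) * E - star x * (star c * c) * v.
    by rewrite {2}/x mulrBr.
  rewrite bvalB mulEmx eqxx mulr1 orth // sub0r.
  set a := star x * _; apply/eqP; rewrite oppr_eq0; apply/eqP.
  apply: cm_eps => d d0; rewrite subr0.
  have a0 := nrm_ge0 a.
  have d1 : 0 < d / (nrm a + 1) by rewrite divr_gt0 // ltr_wpDl.
  have [K /(_ _ (leqnn K)) h] := hv _ d1.
  have -> : (a * v) j j = - ((a * (b K * E - v)) j j).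
    have e1 : (a * (b K * E)) j j = 0.
      rewrite (mulrA a) (mulEmx (a * b K)) eqxx mulr1 /a -(mulrA (star x)).
      by apply: orth; apply: PM => //; have [] := hb K.
    by rewrite (mulrBr a) bvalB e1 sub0r opprK.
  rewrite cmN; apply: le_trans (nrm_entry _ _ _) _; apply: le_trans (nrmM _ _) _.
  apply: le_trans (ler_wpM2l a0 h) _.
  by rewrite mulrA ler_pdivrMr ?ltr_wpDl // mulrC ler_wpM2l ?(ltW d0) // lerDl.
have [K hK] := hv _ e0; exists (b K); first by have [] := hb K.
have Ev : E = v by apply/eqP; rewrite -subr_eq0 -/x x0.
by rewrite (mulrBl E) mul1r [X in _ - X]Ev; exact: (hK _ (leqnn K)).
Qed.

End Density.

(** * Tensor products of operators *)

(* An opaque identity; it keeps unification from unfolding tensor products of operators. *)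
Lemma opq_ex (T : Type) : {f : T -> T | forall x, f x = x}.
Proof. by exists id. Qed.
Definition opq (T : Type) : T -> T := sval (opq_ex T).
Lemma opqE (T : Type) (x : T) : opq x = x.
Proof. exact: (svalP (opq_ex T)). Qed.

Section Submatrices.
Variable R : realType.
Implicit Types (I J K N P Q : choiceType).
Local Notation bop := (bop R).

(** Vectors are pushed forward along the injections, which preserves both the form and the norms. *)
Lemma opb_sub N N' P (T : op R P) (h : N -> P) M (h' : N -> P) :
  injective h -> injective h' -> opb T M -> opb (fun n n' => T (h n) (h' n')) M.
Proof.
move=> hi hi' [M0 hT]; split=> // F G y x.
pose ex (g : N -> P) (L : {fset N}) (v : vec R N) : vec R P := fun p =>
  \sum_(i <- L | g i == p) v i.
have exE (g : N -> P) (L : {fset N}) v i : injective g -> i \in L -> ex g L v (g i) = v i.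
  move=> gi iL; rewrite /ex (eq_bigl (pred1 i)) => [|j]; last by rewrite /= (inj_eq gi).
  by rewrite -big_filter filter_pred1_uniq ?fset_uniq // big_seq1.
have := hT (h @` F)%fset (h' @` G)%fset (ex h F y) (ex h' G x).
have imE (g : N -> P) (L : {fset N}) (V : zmodType) (f : P -> V) : injective g ->
    \sum_(p <- (g @` L)%fset) f p = \sum_(i <- L) f (g i).
  by move=> gi; rewrite big_imfset //= => a b _ _; exact: gi.
have -> : nF (h @` F)%fset (ex h F y) = nF F y.
  rewrite /nF imE //; congr Num.sqrt; apply: eq_big_seq => i iF; by rewrite exE.
have -> : nF (h' @` G)%fset (ex h' G x) = nF G x.
  rewrite /nF imE //; congr Num.sqrt; apply: eq_big_seq => i iF; by rewrite exE.
suff -> : bform T (h @` F)%fset (h' @` G)%fset (ex h F y) (ex h' G x) =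
  bform (fun n n' => T (h n) (h' n')) F G y x by [].
rewrite /bform imE //; apply: eq_big_seq => i iF; rewrite imE //.
by apply: eq_big_seq => j jG; rewrite !exE.
Qed.

Definition sub N P (h h' : N -> P) (T : bop P) : bop N := opq (mkb (fun n n' => T (h n) (h' n'))).

Lemma sub_bounded N P (h h' : N -> P) (T : bop P) : injective h -> injective h' ->
  bounded_op (fun n n' => T (h n) (h' n')).
Proof.
move=> hi hi'; apply/bounded_opP; exists (nrm T); apply: opb_sub => //; exact: nrmP.
Qed.
Lemma subE N P (h h' : N -> P) (T : bop P) n n' : injective h -> injective h' ->
  sub h h' T n n' = T (h n) (h' n').
Proof. by move=> hi hi'; rewrite /sub opqE mkbE //; exact: sub_bounded. Qed.
Lemma nrm_sub N P (h h' : N -> P) (T : bop P) : injective h -> injective h' ->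
  nrm (sub h h' T) <= nrm T.
Proof.
move=> hi hi'; apply: nrm_le; rewrite /sub opqE mkbE; last exact: sub_bounded.
by apply: opb_sub => //; exact: nrmP.
Qed.

Lemma fsum_rect P Q (V : zmodType) (F : {fset P * Q}) (K1 : {fset P}) (K2 : {fset Q})
    (f : P * Q -> V) : (forall n, n \in F -> n.1 \in K1 /\ n.2 \in K2) ->
  \sum_(n <- F) f n =
  \sum_(q <- K2) \sum_(p <- K1) (if (p, q) \in F then f (p, q) else 0).
Proof.
move=> h; pose s := [seq (p, q) | q <- K2, p <- K1].
transitivity (\sum_(n <- s | n \in F) f n); last first.
  rewrite big_mkcond /= /s big_allpairs_dep /=.
  by [].
rewrite -[RHS]big_filter; apply: perm_big; apply: uniq_perm; first exact: fset_uniq.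
  rewrite filter_uniq // allpairs_uniq ?fset_uniq // => -[a b] [c d] _ _ /=.
  by case=> -> ->.
move=> [p q]; rewrite mem_filter; case pF: ((p, q) \in F) => //=.
have [/= pK qK] := h _ pF; apply/esym/allpairsP; exists (q, p); split=> //.
Qed.

(** T (x) 1 is block diagonal: the squared norm splits over the second coordinate, and [opb_col]
    applies on each slice. *)
Lemma opb_ten1 P Q (T : op R P) M : opb T M ->
  opb (fun p q : P * Q => T p.1 q.1 * (p.2 == q.2)%:R) M.
Proof.
move=> hT; have [M0 _] := hT; apply: opb_of_col => // F G x.
pose K := (F `|` G)%fset; pose K1 := [fset n.1 | n in K]%fset; pose K2 := [fset n.2 | n in K]%fset.
have KF n : n \in F -> n.1 \in K1 /\ n.2 \in K2.
  by move=> nF; split; apply/imfsetP; exists n => //=; rewrite inE nF.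
have KG n : n \in G -> n.1 \in K1 /\ n.2 \in K2.
  by move=> nG; split; apply/imfsetP; exists n => //=; rewrite inE nG orbT.
rewrite -(@ler_pXn2r _ 2) ?nnegrE ?mulr_ge0 ?nF_ge0 // exprMn !nFE.
pose x' q p := if (p, q) \in G then x (p, q) else 0.
rewrite (fsum_rect _ KF) (fsum_rect _ KG) mulr_sumr; apply: ler_sum => q _.
have -> : \sum_(p <- K1) (if (p, q) \in G then sqn (x (p, q)) else 0) =
    nF K1 (x' q) ^+ 2.
  by rewrite nFE; apply: eq_bigr => p _; rewrite /x'; case: ifP; rewrite ?sqn0.
rewrite -exprMn; apply: (@le_trans _ _ (nF K1 (fun p => \sum_(p' <- K1) T p p' * x' q p') ^+ 2)).
  rewrite nFE big_seq [X in _ <= X]big_seq; apply: ler_sum => p pK; case: ifP => [pF|_].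
    rewrite (fsum_rect _ KG) /= (big_fsetD1 q) /=; last by have [] := KF _ pF.
    rewrite [X in _ + X]big_seq [X in _ + X]big1 ?addr0 => [|q']; last first.
      rewrite !inE => /andP[nq _]; rewrite big1 // => p' _; case: ifP => // _.
      by rewrite eq_sym (negPf nq) mulr0 mul0r.
    rewrite le_eqVlt; apply/orP; left; apply/eqP; congr sqn; apply: eq_bigr => p' _.
    by rewrite /x' eqxx; case: ifP => _; rewrite ?mulr1 ?mulr0.
  exact: sqn_ge0.
by rewrite ler_pXn2r ?nnegrE ?mulr_ge0 ?nF_ge0 // opb_col.
Qed.

Definition ten1 P Q (T : bop P) : bop (P * Q)%type :=
  opq (mkb (fun p q => T p.1 q.1 * (p.2 == q.2)%:R)).
Lemma ten1v P Q (T : bop P) : bval (@ten1 P Q T) = fun p q => T p.1 q.1 * (p.2 == q.2)%:R.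
Proof.
rewrite /ten1 opqE mkbE //; apply/bounded_opP; exists (nrm T); apply: opb_ten1; exact: nrmP.
Qed.
Lemma ten1E P Q (T : bop P) p q : @ten1 P Q T p q = T p.1 q.1 * (p.2 == q.2)%:R.
Proof. by rewrite ten1v. Qed.

(* [T] acts on the factor P of [N ~ P * Q]; [c] is the projection to the other factor. *)
Definition leg N P Q (h : N -> P) (c : N -> Q) (T : bop P) : bop N :=
  opq (sub (fun n => (h n, c n)) (fun n => (h n, c n)) (@ten1 P Q T)).

Lemma legE N P Q (h : N -> P) (c : N -> Q) (T : bop P) n n' :
  injective (fun n => (h n, c n)) ->
  leg h c T n n' = T (h n) (h n') * (c n == c n')%:R.
Proof. by move=> hi; rewrite /leg opqE subE // ten1E. Qed.

Lemma nrm_leg N P Q (h : N -> P) (c : N -> Q) (T : bop P) :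
  injective (fun n => (h n, c n)) -> nrm (leg h c T) <= nrm T.
Proof.
move=> hi; rewrite /leg opqE; apply: le_trans (nrm_sub _ hi hi) _; apply: nrm_le.
rewrite ten1v; apply: opb_ten1; exact: nrmP.
Qed.

End Submatrices.

Section Legs.
Variable R : realType.
Variables (N P Q : choiceType) (h : N -> P) (c : N -> Q).
Hypothesis hc : bijective (fun n => (h n, c n)).
Local Notation bop := (bop R).
Let hi : injective (fun n => (h n, c n)) := bij_inj hc.

Lemma legD (S T : bop P) : leg h c (S + T) = leg h c S + leg h c T.
Proof. by apply: bopP => i j; rewrite bvalD !legE // bvalD mulrDl. Qed.
Lemma legZ a (S : bop P) : leg h c (a *: S) = a *: leg h c S.
Proof. by apply: bopP => i j; rewrite bvalZ !legE // bvalZ mulrA. Qed.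
Lemma leg_star (S : bop P) : leg h c (star S) = star (leg h c S).
Proof.
by apply: bopP => i j; rewrite starE !legE // starE rmorphM eq_sym; case: eqP => _; rewrite ?rmorph1 ?rmorph0.
Qed.
Lemma leg1 : leg h c (1 : bop P) = 1.
Proof.
apply: bopP => i j; rewrite legE // !bval1 /op1 -(inj_eq hi) /= -pair_eqE /=.
by case: (_ == _); rewrite ?mul1r ?mul0r.
Qed.
(** In the sum over N only the fibre on which [c] has the value [c i] contributes, and the bijection
    identifies that fibre with P. *)
Lemma legM (S T : bop P) : leg h c (S * T) = leg h c S * leg h c T.
Proof.
apply: bopP => i j; rewrite legE // !bvalME.
have [g gK Kg] := hc.
have gE p q : h (g (p, q)) = p /\ c (g (p, q)) = q.
  by have [] := Kg (p, q).
rewrite (@csum_inj _ _ _ (fun p => g (p, c i))).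
- rewrite mulrC -csumZ; last exact: asum_bop.
  congr csum; apply/funext => p; have [e1 e2] := gE p (c i).
  by rewrite !legE // e1 e2 eqxx mulr1; ring.
- by move=> p p' /(congr1 h); have [-> _] := gE p (c i); have [-> _] := gE p' (c i).
- move=> n hn; rewrite !legE //; case: eqP => [e|]; last by rewrite mulr0 mul0r.
  by exfalso; apply: (hn (h n)); rewrite e -(gK n).
Qed.
Lemma leg_hom : shom setT (leg h c : bop P -> bop N).
Proof.
by split=> [a x y _ _|x y _ _|x _]; rewrite ?legD ?legZ ?legM ?leg_star.
Qed.
End Legs.

Section LegsCommute.
Variable R : realType.
Variables (N P P' S : choiceType) (h : N -> P) (h' : N -> P') (r : N -> S).
Hypothesis hr : bijective (fun n => (h n, (h' n, r n))).
Local Notation bop := (bop R).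

(** The two Kronecker factors leave the single term m in the inner sum. In the other order a
    different single term survives with the same value, and this gives commutation. *)
Lemma legs_mul (x : bop P) (y : bop P') n n' :
  (leg h (fun n => (h' n, r n)) x * leg h' (fun n => (h n, r n)) y) n n' =
  x (h n) (h n') * y (h' n) (h' n') * (r n == r n')%:R.
Proof.
have hi := bij_inj hr; have [g gK Kg] := hr.
have hi' : injective (fun n => (h' n, (h n, r n))).
  by move=> a b [e1 e2 e3]; apply: hi; rewrite e1 e2 e3.
pose m := g (h n', (h' n, r n)); have [e1 e2 e3] := Kg (h n', (h' n, r n)).
rewrite bvalME (@csum1 _ _ _ m) => [|k km].
  by rewrite !legE // e1 e2 e3 !xpair_eqE !eqxx /= ?andbT; case: (r n == r n'); rewrite ?mulr1 ?mulr0 //; ring.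
rewrite !legE //.
have [/eqP|] := boolP ((h' n, r n) == (h' k, r k)); last by rewrite mulr0 mul0r.
case=> f1 f2; have [/eqP|] := boolP ((h k, r k) == (h n', r n')); last by rewrite !mulr0.
case=> f3 f4; case/eqP: km; apply: hi; by rewrite e1 e2 e3 f1 f2 f3.
Qed.

Lemma legs_mul' (x : bop P) (y : bop P') n n' :
  (leg h' (fun n => (h n, r n)) y * leg h (fun n => (h' n, r n)) x) n n' =
  x (h n) (h n') * y (h' n) (h' n') * (r n == r n')%:R.
Proof.
have hi := bij_inj hr; have [g gK Kg] := hr.
have hi' : injective (fun n => (h' n, (h n, r n))).
  by move=> a b [e1 e2 e3]; apply: hi; rewrite e1 e2 e3.
pose m := g (h n, (h' n', r n)); have [e1 e2 e3] := Kg (h n, (h' n', r n)).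
rewrite bvalME (@csum1 _ _ _ m) => [|k km].
  by rewrite !legE // e1 e2 e3 !xpair_eqE !eqxx /= ?andbT; case: (r n == r n'); rewrite ?mulr1 ?mulr0 //; ring.
rewrite !legE //.
have [/eqP|] := boolP ((h n, r n) == (h k, r k)); last by rewrite mulr0 mul0r.
case=> f1 f2; have [/eqP|] := boolP ((h' k, r k) == (h' n', r n')); last by rewrite !mulr0.
case=> f3 f4; case/eqP: km; apply: hi; by rewrite e1 e2 e3 f1 f2 f3.
Qed.

Lemma legs_commute (x : bop P) (y : bop P') :
  leg h (fun n => (h' n, r n)) x * leg h' (fun n => (h n, r n)) y =
  leg h' (fun n => (h n, r n)) y * leg h (fun n => (h' n, r n)) x.
Proof. by apply: bopP => n n'; rewrite legs_mul legs_mul'. Qed.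
End LegsCommute.

Section LegChange.
Variable R : realType.
Local Notation bop := (bop R).

Lemma leg_ext (N P Q Q' : choiceType) (h : N -> P) (c : N -> Q) (c' : N -> Q') (x : bop P) :
  injective (fun n => (h n, c n)) -> injective (fun n => (h n, c' n)) ->
  (forall n n', (c n == c n') = (c' n == c' n')) -> leg h c x = leg h c' x.
Proof. by move=> i1 i2 e; apply: bopP => n n'; rewrite !legE // e. Qed.

End LegChange.

Section Blocks.
Variable R : realType.
Implicit Types (I J K : choiceType).
Local Notation bop := (bop R).

(* Slices by matrix units; they suffice to test membership in tensor products
   because the compact operators are spanned by matrix units. *)
Definition rblock I K (k k' : K) (T : bop (I * K)%type) : bop I :=
  sub (fun i => (i, k)) (fun i => (i, k')) T.
Definition lblock I K (i i' : I) (T : bop (I * K)%type) : bop K :=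
  sub (fun k => (i, k)) (fun k => (i', k)) T.
Lemma rblockE I K (k k' : K) (T : bop (I * K)%type) i i' :
  rblock k k' T i i' = T (i, k) (i', k').
Proof. by rewrite /rblock subE // => a b []. Qed.
Lemma lblockE I K (i i' : I) (T : bop (I * K)%type) k k' :
  lblock i i' T k k' = T (i, k) (i', k').
Proof. by rewrite /lblock subE // => a b []. Qed.
Lemma nrm_rblock I K (k k' : K) (T : bop (I * K)%type) : nrm (rblock k k' T) <= nrm T.
Proof. by apply: nrm_sub => a b []. Qed.
Lemma nrm_lblock I K (k k' : I) (T : bop (I * K)%type) : nrm (lblock k k' T) <= nrm T.
Proof. by apply: nrm_sub => a b []. Qed.
Lemma rblockL I K (k k' : K) a (S T : bop (I * K)%type) :
  rblock k k' (a *: S + T) = a *: rblock k k' S + rblock k k' T.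
Proof. by apply: bopP => i j; rewrite !(bvalD, bvalZ, rblockE). Qed.
Lemma lblockL I K (k k' : I) a (S T : bop (I * K)%type) :
  lblock k k' (a *: S + T) = a *: lblock k k' S + lblock k k' T.
Proof. by apply: bopP => i j; rewrite !(bvalD, bvalZ, lblockE). Qed.
Lemma rblock_star I K (k k' : K) (T : bop (I * K)%type) :
  rblock k k' (star T) = star (rblock k' k T).
Proof. by apply: bopP => i j; rewrite !(starE, rblockE). Qed.
Lemma rblock_inj I K (S T : bop (I * K)%type) :
  (forall k k', rblock k k' S = rblock k k' T) -> S = T.
Proof.
by move=> e; apply: bopP => -[i k] [i' k']; rewrite -!rblockE e.
Qed.
Lemma lblock_inj I K (S T : bop (I * K)%type) :
  (forall k k', lblock k k' S = lblock k k' T) -> S = T.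
Proof.
by move=> e; apply: bopP => -[i k] [i' k']; rewrite -!lblockE e.
Qed.

Definition t1 I K (x : bop I) : bop (I * K)%type := opq (leg fst snd x).
Definition t2 I K (y : bop K) : bop (I * K)%type := opq (leg snd fst y).
Definition bten I K (x : bop I) (y : bop K) : bop (I * K)%type := opq (t1 K x * t2 I y).

Lemma btenK I K (x : bop I) (y : bop K) : bten x y = t1 K x * t2 I y.
Proof. exact: opqE. Qed.

Lemma bij_id2 I K : bijective (fun n : I * K => (n.1, n.2)).
Proof. by exists id => -[]. Qed.
Lemma bij_sw2 I K : bijective (fun n : I * K => (n.2, n.1)).
Proof. by exists (fun n => (n.2, n.1)) => -[]. Qed.

Lemma t1E I K (x : bop I) p q : t1 K x p q = x p.1 q.1 * (p.2 == q.2)%:R.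
Proof. by rewrite /t1 opqE legE //; exact: bij_inj (bij_id2 I K). Qed.
Lemma t2E I K (y : bop K) p q : t2 I y p q = (p.1 == q.1)%:R * y p.2 q.2.
Proof. by rewrite /t2 opqE legE; [exact: mulrC|exact: bij_inj (bij_sw2 I K)]. Qed.

Lemma bten_commute I K (x : bop I) (y : bop K) : t1 K x * t2 I y = t2 I y * t1 K x.
Proof.
have b : bijective (fun n : I * K => (n.1, (n.2, tt))).
  by exists (fun n => (n.1, n.2.1)) => [[]|[a [b []]]].
have := legs_commute b x y.
have -> : leg fst (fun n : I * K => (n.2, tt)) x = t1 K x.
  by rewrite /t1 opqE; apply: leg_ext => [[a b1] [c d] [-> ->]|[a b1] [c d] [-> ->]|n n'] //; rewrite xpair_eqE eqxx andbT.
have -> // : leg snd (fun n : I * K => (n.1, tt)) y = t2 I y.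
by rewrite /t2 opqE; apply: leg_ext => [[a b1] [c d] [-> ->]|[a b1] [c d] [-> ->]|n n'] //; rewrite xpair_eqE eqxx andbT.
Qed.

Lemma btenE I K (x : bop I) (y : bop K) p q : bten x y p q = x p.1 q.1 * y p.2 q.2.
Proof.
rewrite btenK bvalME (@csum1 _ _ _ (q.1, p.2)) => [|[a b] ab].
  by rewrite t1E t2E /= !eqxx mulr1 mul1r.
rewrite t1E t2E /=; have [e|] := eqVneq p.2 b; last by rewrite mulr0 mul0r.
have [e'|] := eqVneq a q.1; last by rewrite mul0r mulr0.
by rewrite e e' eqxx in ab.
Qed.

Lemma t1M I K (x y : bop I) : t1 K (x * y) = t1 K x * t1 K y.
Proof. by rewrite /t1 !opqE (legM (bij_id2 I K)). Qed.
Lemma t2M I K (x y : bop K) : t2 I (x * y) = t2 I x * t2 I y.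
Proof. by rewrite /t2 !opqE (legM (bij_sw2 I K)). Qed.
Lemma t1_star I K (x : bop I) : t1 K (star x) = star (t1 K x).
Proof. by rewrite /t1 !opqE (leg_star (bij_id2 I K)). Qed.
Lemma t2_star I K (x : bop K) : t2 I (star x) = star (t2 I x).
Proof. by rewrite /t2 !opqE (leg_star (bij_sw2 I K)). Qed.
Lemma t1_1 I K : t1 K (1 : bop I) = 1.
Proof. by rewrite /t1 opqE (leg1 _ (bij_id2 I K)). Qed.
Lemma t2_1 I K : t2 I (1 : bop K) = 1.
Proof. by rewrite /t2 opqE (leg1 _ (bij_sw2 I K)). Qed.
Lemma nrm_t1 I K (x : bop I) : nrm (t1 K x) <= nrm x.
Proof. by rewrite /t1 opqE; exact: nrm_leg (bij_inj (bij_id2 I K)). Qed.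
Lemma nrm_t2 I K (x : bop K) : nrm (t2 I x) <= nrm x.
Proof. by rewrite /t2 opqE; exact: nrm_leg (bij_inj (bij_sw2 I K)). Qed.
Lemma bten1r I K (x : bop I) : bten x (1 : bop K) = t1 K x.
Proof. by rewrite ?btenK t2_1 mulr1. Qed.
Lemma bten1l I K (y : bop K) : bten (1 : bop I) y = t2 I y.
Proof. by rewrite ?btenK t1_1 mul1r. Qed.
Lemma btenM I K (x x' : bop I) (y y' : bop K) : bten x y * bten x' y' = bten (x * x') (y * y').
Proof.
rewrite !btenK t1M t2M -!mulrA; congr (_ * _); rewrite !mulrA; congr (_ * _).
exact: esym (bten_commute x' y).
Qed.
Lemma bten_star I K (x : bop I) (y : bop K) : star (bten x y) = bten (star x) (star y).
Proof. by rewrite ?btenK starM -t1_star -t2_star bten_commute. Qed.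
Lemma nrm_bten I K (x : bop I) (y : bop K) : nrm (bten x y) <= nrm x * nrm y.
Proof.
by rewrite btenK; apply: le_trans (nrmM _ _) _; exact: ler_pM (nrm_ge0 _) (nrm_ge0 _) (nrm_t1 _ _) (nrm_t2 _ _).
Qed.
Lemma btenZl I K a (x : bop I) (y : bop K) : bten (a *: x) y = a *: bten x y.
Proof. by apply: bopP => p q; rewrite bvalZ !btenE bvalZ mulrA. Qed.
Lemma btenZr I K a (x : bop I) (y : bop K) : bten x (a *: y) = a *: bten x y.
Proof. by apply: bopP => p q; rewrite bvalZ !btenE bvalZ; ring. Qed.
Lemma btenDl I K (x x' : bop I) (y : bop K) : bten (x + x') y = bten x y + bten x' y.
Proof. by apply: bopP => p q; rewrite bvalD !btenE bvalD mulrDl. Qed.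
Lemma btenDr I K (x : bop I) (y y' : bop K) : bten x (y + y') = bten x y + bten x y'.
Proof. by apply: bopP => p q; rewrite bvalD !btenE bvalD mulrDr. Qed.

Lemma rblock_bten I K (k k' : K) (x : bop I) (y : bop K) :
  rblock k k' (bten x y) = y k k' *: x.
Proof. by apply: bopP => i j; rewrite rblockE btenE bvalZ mulrC. Qed.
Lemma rblock_mulE I K (T : bop (I * K)%type) (x : bop I) (m n k l : K) :
  rblock m n (T * bten x (Emx R k l)) = (n == l)%:R *: (rblock m k T * x).
Proof.
apply: bopP => i j; rewrite rblockE bvalZ !bvalME.
rewrite (@csum_inj _ _ _ (fun i => (i, k))) => [|a b []|[a b] ab] //.
  rewrite -csumZ; last exact: asum_bop.
  by congr csum; apply/funext => p; rewrite rblockE btenE EmxE /= eqxx mul1r; ring.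
rewrite btenE EmxE /=; have [e|] := eqVneq b k; last by rewrite mul0r !mulr0.
by exfalso; apply: (ab a); rewrite e.
Qed.
Lemma rblock_t1r I K (T : bop (I * K)%type) (x : bop I) (m n : K) :
  rblock m n (T * t1 K x) = rblock m n T * x.
Proof.
apply: bopP => i j; rewrite rblockE !bvalME.
rewrite (@csum_inj _ _ _ (fun i => (i, n))) => [|a b []|[a b] ab] //.
  by congr csum; apply/funext => p; rewrite rblockE t1E /= eqxx mulr1.
rewrite t1E /=; have [e|] := eqVneq b n; last by rewrite !mulr0.
by exfalso; apply: (ab a); rewrite e.
Qed.
Lemma rblock_t1l I K (T : bop (I * K)%type) (x : bop I) (m n : K) :
  rblock m n (t1 K x * T) = x * rblock m n T.
Proof.
by rewrite -[LHS]starK -rblock_star starM -t1_star rblock_t1r rblock_star starM !starK.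
Qed.
End Blocks.

(** * Multipliers and morphisms *)

Section BoundedLinear.
Variable R : realType.
Implicit Types (I J K N P Q : choiceType).
Local Notation bop := (bop R).

Definition blinear I J (f : bop I -> bop J) : Prop :=
  (forall a x y, f (a *: x + y) = a *: f x + f y) /\
  exists2 c : R, 0 < c & forall x, nrm (f x) <= c * nrm x.

Lemma blinear0 I J (f : bop I -> bop J) : blinear f -> f 0 = 0.
Proof.
move=> [h _]; have := h 1 0 0; rewrite !scale1r addr0 => E.
by apply: (addrI (f 0)); rewrite addr0 -E.
Qed.
Lemma blinearB I J (f : bop I -> bop J) x y : blinear f -> f (x - y) = f x - f y.
Proof. by move=> [h _]; rewrite addrC -scaleN1r h scaleN1r addrC. Qed.
Lemma blinear_sum I J (f : bop I -> bop J) (A : Type) (r : seq A) (g : A -> bop I) :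
  blinear f -> f (\sum_(a <- r) g a) = \sum_(a <- r) f (g a).
Proof.
move=> hf; elim: r => [|a r IH]; first by rewrite !big_nil blinear0.
by rewrite !big_cons -IH; have [h _] := hf; rewrite -[g a]scale1r h !scale1r.
Qed.

Lemma csub_pre I J (f : bop I -> bop J) (Q : set (bop J)) :
  blinear f -> csub Q -> csub [set x | Q (f x)].
Proof.
move=> hf hQ; have [fL [c c0 fc]] := hf; have [q0 qL _] := hQ.
split=> [|a x y hx hy|x hx] /=; first by rewrite blinear0.
  by rewrite fL; exact: qL.
apply: (csub_lim hQ) => e e0; have ec : 0 < e / c by rewrite divr_gt0.
have [y hy d] := hx _ ec; exists (f y) => //; rewrite -blinearB //.
apply: le_trans (fc _) _; by rewrite mulrC -ler_pdivlMr.
Qed.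

Lemma csub_zero I : csub [set 0 : bop I].
Proof.
split=> [|a x y -> -> |x hx] /=; rewrite ?scaler0 ?addr0 //.
by apply: nrm_eps => e /hx[y -> ?].
Qed.

Lemma blinear_comp I J K (f : bop I -> bop J) (g : bop J -> bop K) :
  blinear f -> blinear g -> blinear (fun x => g (f x)).
Proof.
move=> [fL [c c0 fc]] [gL [d d0 gd]]; split=> [a x y|]; first by rewrite fL gL.
exists (d * c) => [|x]; first exact: mulr_gt0.
by apply: le_trans (gd _) _; rewrite -mulrA ler_wpM2l ?(ltW d0).
Qed.
Lemma blinear_mull I (b : bop I) : blinear (fun x => b * x).
Proof.
split=> [a x y|]; first by rewrite mulrDr -bscalerAr.
exists (nrm b + 1) => [|x]; first by rewrite ltr_wpDl ?nrm_ge0.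
by apply: le_trans (nrmM _ _) _; rewrite ler_wpM2r ?nrm_ge0 // lerDl.
Qed.
Lemma blinear_mulr I (b : bop I) : blinear (fun x => x * b).
Proof.
split=> [a x y|]; first by rewrite mulrDl -bscalerAl.
exists (nrm b + 1) => [|x]; first by rewrite ltr_wpDl ?nrm_ge0.
by apply: le_trans (nrmM _ _) _; rewrite mulrC ler_wpM2r ?nrm_ge0 // lerDl.
Qed.
Lemma blinear_rblock I K (k k' : K) : blinear (@rblock R I K k k').
Proof.
split=> [a x y|]; first exact: rblockL.
by exists 1 => // x; rewrite mul1r nrm_rblock.
Qed.
Lemma blinear_lblock I K (i i' : I) : blinear (@lblock R I K i i').
Proof.
split=> [a x y|]; first exact: lblockL.
by exists 1 => // x; rewrite mul1r nrm_lblock.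
Qed.
Lemma blinear_leg N P Q (h : N -> P) (c : N -> Q) :
  bijective (fun n => (h n, c n)) -> blinear (leg h c : bop P -> bop N).
Proof.
move=> hc; split=> [a x y|]; first by rewrite legD ?legZ.
by exists 1 => // x; rewrite mul1r; apply: nrm_leg; exact: bij_inj.
Qed.
Lemma blinear_btenl I K (y : bop K) : blinear (fun x : bop I => bten x y).
Proof.
split=> [a x x'|]; first by rewrite btenDl btenZl.
exists (nrm y + 1) => [|x]; first by rewrite ltr_wpDl ?nrm_ge0.
by apply: le_trans (nrm_bten _ _) _; rewrite mulrC ler_wpM2r ?nrm_ge0 // lerDl.
Qed.
Lemma blinear_btenr I K (x : bop I) : blinear (fun y : bop K => bten x y).
Proof.
split=> [a y y'|]; first by rewrite btenDr btenZr.
exists (nrm x + 1) => [|y]; first by rewrite ltr_wpDl ?nrm_ge0.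
by apply: le_trans (nrm_bten _ _) _; rewrite ler_wpM2r ?nrm_ge0 // lerDl.
Qed.

Lemma csub_star I (Q : set (bop I)) : csub Q -> csub [set x | Q (star x)].
Proof.
move=> hQ; have [q0 qL _] := hQ; split=> [|a x y hx hy|x hx] /=.
- by rewrite star0.
- by rewrite starD starZ; exact: qL.
- apply: (csub_lim hQ) => e /hx[y hy d]; exists (star y) => //.
  by rewrite -starB nrm_star.
Qed.

Definition bprod I (X Y : set (bop I)) : set (bop I) :=
  [set x | exists2 a, X a & exists2 b, Y b & x = a * b].
Definition bcdot I (X Y : set (bop I)) := bcspan (bprod X Y).

Lemma bcdot_in I (X Y : set (bop I)) a b : X a -> Y b -> bcdot X Y (a * b).
Proof. by move=> xa yb; apply: bcspan_in; exists a => //; exists b. Qed.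
Lemma bcdot_sub I (X Y P : set (bop I)) : csub P ->
  (forall a b, X a -> Y b -> P (a * b)) -> bcdot X Y `<=` P.
Proof. by move=> hP h; apply: bcspan_sub => // _ [a xa [b yb ->]]; exact: h. Qed.
Lemma bcdot_csub I (X Y : set (bop I)) : csub (bcdot X Y).
Proof. exact: bcspan_csub. Qed.

Lemma bcspan_star I (S S' : set (bop I)) : (forall x, S x -> bcspan S' (star x)) ->
  forall x, bcspan S x -> bcspan S' (star x).
Proof. by move=> h; apply: bcspan_sub => //; exact: csub_star (bcspan_csub S'). Qed.
End BoundedLinear.

(** * Operators from densely defined module maps *)

Section LeftMultiplier.
Variables (R : realType) (J : choiceType).
Local Notation bop := (bop R J).
Local Notation E := (Emx R).

Definition Pf (F : {fset J}) : bop := \sum_(j <- F) E j j.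

Lemma PfE F i j : Pf F i j = (i \in F)%:R * (i == j)%:R.
Proof.
rewrite /Pf bval_sum; case: (boolP (i \in F)) => iF; last first.
  rewrite mul0r big_seq big1 // => k kF; rewrite EmxE.
  by have [e|] := eqVneq i k; rewrite ?mul0r //; rewrite e kF in iF.
rewrite (big_fsetD1 i) //= big_seq big1 ?addr0 => [|k]; last first.
  by rewrite !inE EmxE eq_sym => /andP[/negPf -> _]; rewrite mul0r.
by rewrite EmxE eqxx mul1r eq_sym mul1r.
Qed.
Lemma PfM F (W : bop) i k : (Pf F * W) i k = (i \in F)%:R * W i k.
Proof.
rewrite bvalME (@csum1 _ _ _ i) => [|j ji]; first by rewrite PfE eqxx mulr1.
by rewrite PfE eq_sym (negPf ji) mulr0 mul0r.
Qed.
Lemma nrm_Pf F : nrm (Pf F) <= 1.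
Proof.
have ps : star (Pf F) = Pf F.
  by rewrite /Pf star_sum; apply: eq_bigr => i _; rewrite Emx_star.
have pp : star (Pf F) * Pf F = Pf F.
  by rewrite ps; apply: bopP => i k; rewrite PfM PfE; case: (i \in F); rewrite ?mul0r ?mul1r.
have := cstar (Pf F); rewrite pp => e.
have n0 := nrm_ge0 (Pf F); rewrite leNgt; apply/negP => h.
by move: (e) => /eqP; rewrite expr2 -{1}[nrm _]mulr1 eq_sym; apply/negP; rewrite gt_eqF // ltr_pM2l // (lt_trans ltr01).
Qed.

Lemma col_tail (W : bop) l (e : R) : 0 < e ->
  exists F, nrm (W * E l l - Pf F * (W * E l l)) <= e.
Proof.
move=> e0.
have [F hF] := @nF_tail R J (fun i => W i l) (nrm W) e (fun F => nF_column l F (nrmP W)) e0.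
exists F; set Y := _ - _.
have YE i : Y i l = (i \notin F)%:R * W i l.
  rewrite /Y bvalB PfM mulEmx eqxx mulr1.
  by case: (i \in F); rewrite ?mul1r ?mul0r ?subrr ?subr0.
have YY : Y * E l l = Y.
  by rewrite /Y mulrBl -!mulrA Emx_mul eqxx scale1r.
have := nrm_col_sq Y l; rewrite YY => h.
rewrite -(@ler_pXn2r _ 2) ?nnegrE ?nrm_ge0 ?(ltW e0) //.
rewrite -(cm_real (sqr_ge0 (nrm Y))) -h bvalME.
apply: (sums_le (csum_sums (asum_bop (star Y) Y l l))) => G.
have -> : \sum_(i <- G) star Y l i * Y i l = (nF G (fun i => Y i l) ^+ 2)%:C.
  by rewrite nFE realC_sum; apply: eq_bigr => i _; rewrite starE conjc_sqn.
rewrite cm_real ?sqr_ge0 // ler_pXn2r ?nnegrE ?nF_ge0 ?(ltW e0) //.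
have : nF (G `\` F)%fset (fun i => W i l) <= e.
  by apply: hF; apply/fdisjointP => i iF; rewrite inE iF.
apply: le_trans; rewrite /nF ler_sqrt ?sumr_ge0 // => [|i _]; last exact: sqn_ge0.
rewrite (big_fsetID _ (mem F)) /= [X in X + _]big_seq [X in X + _]big1 ?add0r => [|i]; last first.
  by rewrite !inE /= => /andP[_ iF]; rewrite YE iF mul0r sqn0.
have -> : [fset x in G | x \notin F]%fset = (G `\` F)%fset.
  by apply/fsetP => i; rewrite !inE /= andbC.
rewrite big_seq [X in _ <= X]big_seq ler_sum // => i.
by rewrite !inE => /andP[iF _]; rewrite YE iF mul1r.
Qed.

(** Pr is the graph of a bounded map commuting with right multiplications. Its domain approximates
    the unit only column by column, not in norm, so T is assembled from columns found in the norm
    closure Q of the graph. *)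
Lemma left_mult_ex (Pr : bop -> bop -> Prop) (c : R) : 0 < c -> Pr 0 0 ->
  (forall a X Z X' Z', Pr X Z -> Pr X' Z' -> Pr (a *: X + X') (a *: Z + Z')) ->
  (forall X Z Y, Pr X Z -> Pr (X * Y) (Z * Y)) ->
  (forall X Z, Pr X Z -> nrm Z <= c * nrm X) ->
  (forall j (e : R), 0 < e -> exists X Z, Pr X Z /\ nrm ((X - 1) * E j j) <= e) ->
  exists T, forall X Z, Pr X Z -> T * X = Z.
Proof.
move=> c0 P0 PL PM Pc Pd.
pose Q X Z := forall e : R, 0 < e -> exists X' Z',
  [/\ Pr X' Z', nrm (X - X') <= e & nrm (Z - Z') <= e].
have PQ X Z : Pr X Z -> Q X Z.
  by move=> h e e0; exists X, Z; rewrite !subrr nrm0 (ltW e0).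
have QL a X Z X' Z' : Q X Z -> Q X' Z' -> Q (a *: X + X') (a *: Z + Z').
  move=> h h' e e0; have a0 : 0 < cm a + 1 by rewrite ltr_wpDl ?cm_ge0.
  have d0 : 0 < e / 2 / (cm a + 1) by rewrite !divr_gt0.
  have e2 : 0 < e / 2 by rewrite divr_gt0.
  have [Y [U [p1 p2 p3]]] := h _ d0; have [Y' [U' [q1 q2 q3]]] := h' _ e2.
  exists (a *: Y + Y'), (a *: U + U'); split; first exact: PL.
    rewrite (_ : _ - _ = a *: (X - Y) + (X' - Y')); last by blin.
    apply: le_trans (nrmD _ _) _; rewrite nrmZ [e]splitr lerD //.
    apply: le_trans (ler_wpM2l (cm_ge0 a) p2) _.
    by rewrite mulrA ler_pdivrMr // mulrC ler_wpM2l ?(ltW e2) // lerDl.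
  rewrite (_ : _ - _ = a *: (Z - U) + (Z' - U')); last by blin.
  apply: le_trans (nrmD _ _) _; rewrite nrmZ [e]splitr lerD //.
  apply: le_trans (ler_wpM2l (cm_ge0 a) p3) _.
  by rewrite mulrA ler_pdivrMr // mulrC ler_wpM2l ?(ltW e2) // lerDl.
have QB X Z X' Z' : Q X Z -> Q X' Z' -> Q (X - X') (Z - Z').
  by move=> h h'; have := QL (-1) _ _ _ _ h' h; rewrite !scaleN1r ![- _ + _]addrC.
have QM X Z Y : Q X Z -> Q (X * Y) (Z * Y).
  move=> h e e0; have y0 : 0 < nrm Y + 1 by rewrite ltr_wpDl ?nrm_ge0.
  have d0 : 0 < e / (nrm Y + 1) by rewrite divr_gt0.
  have [X' [Z' [p1 p2 p3]]] := h _ d0; exists (X' * Y), (Z' * Y); split; first exact: PM.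
    rewrite -mulrBl; apply: le_trans (nrmM _ _) _.
    apply: le_trans (ler_wpM2r (nrm_ge0 Y) p2) _.
    by rewrite mulrAC ler_pdivrMr // ler_wpM2l ?(ltW e0) // lerDl.
  rewrite -mulrBl; apply: le_trans (nrmM _ _) _.
  apply: le_trans (ler_wpM2r (nrm_ge0 Y) p3) _.
  by rewrite mulrAC ler_pdivrMr // ler_wpM2l ?(ltW e0) // lerDl.
have Qc X Z : Q X Z -> nrm Z <= c * nrm X.
  move=> h; apply/ler_addgt0Pr => e e0; have d0 : 0 < e / (c + 1) by rewrite divr_gt0 ?addr_gt0.
  have [X' [Z' [p1 p2 p3]]] := h _ d0.
  have -> : Z = (Z - Z') + Z' by blin.
  apply: le_trans (nrmD _ _) _; apply: le_trans (lerD p3 (Pc _ _ p1)) _.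
  have : nrm X' <= nrm X + e / (c + 1).
    have -> : X' = X - (X - X') by blin.
    by apply: le_trans (nrmB _ _) _; rewrite lerD2l.
  move=> h1; apply: le_trans (lerD (lexx _) (ler_wpM2l (ltW c0) h1)) _.
  rewrite mulrDr addrCA lerD2l -[X in X + _]mul1r -mulrDl (addrC 1) mulrC divfK //.
  by rewrite gt_eqF ?addr_gt0.
(* The j-th column of T: the first components times E_jj tend to E_jj, and the bound makes the
   second components times E_jj a Cauchy sequence. *)
have /choice[Z hZ] : forall j, exists Z, Q (E j j) Z.
  move=> j.
  have /choice[XZ hXZ] : forall n : nat, exists XZ : bop * bop,
      Pr XZ.1 XZ.2 /\ nrm ((XZ.1 - 1) * E j j) <= n.+1%:R^-1.
    by move=> n; have [|X [Z h]] := Pd j n.+1%:R^-1; [rewrite invr_gt0 ltr0n|exists (X, Z)].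
  have small (d : R) : 0 < d -> exists K, forall n, (K <= n)%N -> n.+1%:R^-1 <= d.
    move=> d0; exists (Num.bound d^-1) => n Kn.
    have /archi_boundP h : 0 <= d^-1 by rewrite invr_ge0 ltW.
    rewrite -[d]invrK lef_pV2 ?posrE ?invr_gt0 ?ltr0n //.
    by apply: le_trans (ltW h) _; rewrite ler_nat (leq_trans Kn).
  have XE n : nrm ((XZ n).1 * E j j - E j j) <= n.+1%:R^-1.
    by have [_] := hXZ n; rewrite mulrBl mul1r.
  have [|Z hZ] := @nrm_complete R J (fun n => (XZ n).2 * E j j).
    move=> e e0; have d0 : 0 < e / c / 2 by rewrite !divr_gt0.
    have [K hK] := small _ d0; exists K => m n /hK hm /hK hn.
    have q : Q ((XZ m).1 * E j j - (XZ n).1 * E j j) ((XZ m).2 * E j j - (XZ n).2 * E j j).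
      by apply: QB; apply: QM; apply: PQ; [have [] := hXZ m|have [] := hXZ n].
    apply: le_trans (Qc _ _ q) _; rewrite mulrC -ler_pdivlMr //.
    apply: (nrm_tri (T := E j j)); first exact: le_trans (XE m) hm.
    rewrite nrm_distC; exact: le_trans (XE n) hn.
  exists Z => e e0; have [K1 h1] := small _ e0; have [K2 h2] := hZ _ e0.
  have /h1 l1 := leq_maxl K1 K2; have /h2 l2 := leq_maxr K1 K2.
  exists ((XZ (maxn K1 K2)).1 * E j j), ((XZ (maxn K1 K2)).2 * E j j); split.
  - by apply: PM; have [] := hXZ (maxn K1 K2).
  - by rewrite nrm_distC; exact: le_trans (XE _) l1.
  - by rewrite nrm_distC.
have Q_uniq X Z1 Z2 : Q X Z1 -> Q X Z2 -> Z1 = Z2.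
  move=> h1 h2; have := QL (-1) _ _ _ _ h1 h2; rewrite scaleN1r addNr => /Qc.
  rewrite nrm0 mulr0 => /nrm_eq0; rewrite scaleN1r addrC => /eqP.
  by rewrite subr_eq0 => /eqP ->.
have ZE j : Z j * E j j = Z j.
  by apply: Q_uniq (hZ j); have := QM _ _ (E j j) (hZ j); rewrite Emx_mul eqxx scale1r.
have Q0 : Q 0 0 by exact: PQ.
have QF (F : {fset J}) : Q (Pf F) (\sum_(j <- F) Z j).
  rewrite /Pf; elim: (enum_fset F) => [|j s IH]; first by rewrite !big_nil.
  by rewrite !big_cons -[E j j]scale1r -[Z j]scale1r; exact: QL.
have ZjE j i l : Z j i l = Z j i j * (l == j)%:R by rewrite -{1}ZE mulEmx.
(* On the columns in G the matrix agrees with the sum of the [Z j], which is the image under Q of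
   the projection [Pf G], of norm at most 1. *)
have Tb : bounded_op ((fun i j => Z j i j) : op R J).
  apply/bounded_opP; exists c; split=> [|F G y x]; first exact: ltW.
  have -> : bform (fun i j => Z j i j) F G y x = bform (\sum_(j <- G) Z j) F G y x.
    apply: eq_bigr => i _; apply: eq_big_seq => j jG; rewrite bval_sum.
    rewrite (big_fsetD1 j) //= big_seq big1 ?addr0 // => k.
    by rewrite !inE ZjE eq_sym => /andP[/negPf -> _]; rewrite mulr0.
  have [_ /(_ F G y x) h] := nrmP (\sum_(j <- G) Z j).
  apply: le_trans h _; rewrite -!mulrA ler_wpM2r ?mulr_ge0 ?nF_ge0 //.
  apply: le_trans (Qc _ _ (QF G)) _; rewrite -[X in _ <= X]mulr1 ler_wpM2l ?(ltW c0) //.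
  exact: nrm_Pf.
pose T : bop := Bop Tb.
have TE j : T * E j j = Z j.
  by apply: bopP => i l; rewrite mulEmx ZjE.
(* T is controlled on finite projections only. The column X E_ll is therefore truncated by [Pf F] at
   small cost in norm, and the graph Q compares the two values. *)
exists T => X V XV; apply: eq_col => l; rewrite -mulrA.
apply: nrm_eps => e e0; have e2 : 0 < e / 2 by rewrite divr_gt0.
have t0 : 0 < nrm T + c by rewrite ltr_wpDl ?nrm_ge0.
have [F hF] := col_tail X l (divr_gt0 e2 t0).
set W := X * E l l in hF *.
have TP : T * (Pf F * W) = (\sum_(j <- F) Z j) * W.
  rewrite mulrA; congr (_ * _); rewrite /Pf mulr_sumr; apply: eq_bigr => j _; exact: TE.
have q : Q (Pf F * W - W) (T * (Pf F * W) - V * E l l).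
  by rewrite TP; apply: QB; [exact: QM|apply: PQ; exact: PM].
have -> : e = nrm T * (e / 2 / (nrm T + c)) + c * (e / 2 / (nrm T + c)) + e / 2.
  rewrite -mulrDl [_ * (e / 2 / _)]mulrC divfK ?gt_eqF // -splitr //.
rewrite (_ : T * W - V * E l l = T * (W - Pf F * W) + (T * (Pf F * W) - V * E l l)); last first.
  by rewrite mulrBr; blin.
apply: le_trans (nrmD _ _) _; rewrite -[X in X <= _]addr0 lerD ?(ltW e2) //.
apply: lerD; first by apply: le_trans (nrmM _ _) _; rewrite ler_wpM2l ?nrm_ge0.
apply: le_trans (Qc _ _ q) _; by rewrite nrm_distC ler_wpM2l ?(ltW c0).
Qed.
End LeftMultiplier.

Section Multipliers.
Variables (R : realType) (I : choiceType).
Local Notation bop := (bop R I).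
Implicit Types (A P : set bop).

Definition calgn A : Prop := calg A /\ nondeg A.
Definition multb A : set bop := [set T | forall a, A a -> A (T * a) /\ A (a * T)].

Lemma csub_multb A : csub A -> csub (multb A).
Proof.
move=> hA; have [a0 aL _] := hA; split=> [a ha|c x y hx hy a ha|x hx a ha].
- by rewrite mul0r mulr0.
- have [[x1 x2] [y1 y2]] := (hx _ ha, hy _ ha).
  by rewrite mulrDl mulrDr -bscalerAl -bscalerAr; split; exact: aL.
- split.
    apply: (csub_lim (csub_pre (blinear_mulr a) hA)) => e /hx[y hy d].
    by exists y => //=; have [] := hy _ ha.
  apply: (csub_lim (csub_pre (blinear_mull a) hA)) => e /hx[y hy d].
  by exists y => //=; have [] := hy _ ha.
Qed.
Lemma calg_multb A : calg A -> calg (multb A).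
Proof.
move=> [hA AM AS]; split=> [|x y hx hy a ha|x hx a ha]; first exact: csub_multb.
  have [[x1 x2] [y1 y2]] := (hx _ ha, hy _ ha).
  by split; [rewrite -mulrA; have [] := hx _ y1|rewrite mulrA; have [] := hy _ x2].
have [h1 h2] := hx _ (AS _ ha).
by split; [rewrite -[X in A X]starK starM starK; exact: AS|rewrite -[X in A X]starK starM starK; exact: AS].
Qed.
Lemma multb1 A : multb A 1.
Proof. by move=> a; rewrite mul1r mulr1. Qed.
Lemma multb_in A : calg A -> A `<=` multb A.
Proof. by move=> [_ AM _] a ha b hb; split; exact: AM. Qed.

Lemma nondegR A X : calg A -> nondeg A -> (forall a, A a -> X * a = 0) -> X = 0.
Proof.
move=> [_ _ AS] nd h; rewrite -[X]starK (_ : star X = 0) ?star0 //; apply: nd => a ha.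
by rewrite -[a]starK -starM h ?star0 //; exact: AS.
Qed.
End Multipliers.

(** * Extension of morphisms to multipliers *)

Section Morphisms.
Variables (R : realType) (I J : choiceType).
Local Notation bop := (bop R).
Implicit Types (A : set (bop I)) (B : set (bop J)) (F G f : bop I -> bop J).

Definition mor A B f : Prop :=
  [/\ shom A f, (forall a, A a -> multb B (f a)) & B `<=` bcdot (f @` A) B].

(* [F] is the extension to multipliers of a morphism from [A] to [B]. *)
Definition mhom A B F : Prop :=
  [/\ shom (multb A) F, (forall m, multb A m -> multb B (F m)), F 1 = 1 &
      B `<=` bcdot (F @` A) B].

(** Nondegeneracy of f(A), in the form that lets an identity between operators be tested after
    multiplication by f(A). *)
Definition faithful_on A (f : bop I -> bop J) : Prop :=
  forall X : bop J, (forall a, A a -> f a * X = 0) -> X = 0.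

Lemma shomS A P f : A `<=` P -> shom P f -> shom A f.
Proof.
by move=> AP [h1 h2 h3]; split=> [c x y /AP px /AP py|x y /AP px /AP py|x /AP px]; auto.
Qed.

Lemma mor_nondeg A B f : calgn A -> calgn B -> shom A f -> B `<=` bcdot (f @` A) B ->
  faithful_on A f.
Proof.
move=> [[_ _ AS] _] [[_ _ BS] ndB] [_ _ fS] nd X h; apply: ndB => b hb.
have hQ : csub [set b : bop J | star b * X = 0].
  apply: (@csub_star _ _ [set b : bop J | b * X = 0]).
  exact: csub_pre (blinear_mulr X) (csub_zero R J).
suff /= H : [set b : bop J | star b * X = 0] (star b) by rewrite starK in H.
apply: (bcdot_sub hQ) (nd _ (BS _ hb)) => _ b' [a ha <-] hb' /=.
by rewrite starM -mulrA -fS // h ?mulr0 //; exact: AS.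
Qed.

Lemma faithfulR A f X : calg A -> shom A f -> faithful_on A f ->
  (forall a, A a -> X * f a = 0) -> X = 0.
Proof.
move=> [_ _ AS] [_ _ fS] ff h; rewrite -[X]starK (_ : star X = 0) ?star0 //; apply: ff => a ha.
by rewrite -[f a]starK -starM -fS // h ?star0 //; exact: AS.
Qed.

(** (F m - G m) F(a) = 0 for every a in A, because m a is in A, where F and G agree. *)
Lemma shom_uniq A F G : calg A -> faithful_on A F -> shom (multb A) F -> shom (multb A) G ->
  (forall a, A a -> F a = G a) -> forall m, multb A m -> F m = G m.
Proof.
move=> cA ff hF hG e m hm; apply/eqP; rewrite -subr_eq0; apply/eqP.
have AM := multb_in cA; have [_ FM _] := hF; have [_ GM _] := hG.
apply: (faithfulR cA (shomS AM hF) ff) => a ha; have [ma _] := hm _ ha.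
rewrite mulrBl -(FM _ _ hm (AM _ ha)) (e _ ma) (e _ ha) -(GM _ _ hm (AM _ ha)) subrr //.
Qed.

Lemma mhom_faithful A B F : calgn A -> calgn B -> mhom A B F -> faithful_on A F.
Proof.
move=> cA cB [hF _ _ nd]; apply: (mor_nondeg cA cB _ nd).
by apply: shomS hF; apply: multb_in; case: cA.
Qed.

Lemma mhom_uniq A B B' F G : calgn A -> calgn B -> mhom A B F -> mhom A B' G ->
  (forall a, A a -> F a = G a) -> forall m, multb A m -> F m = G m.
Proof.
move=> cA cB hF hG; have [hF' _ _ _] := hF; have [hG' _ _ _] := hG.
by have [cA' _] := cA; exact: (shom_uniq cA' (mhom_faithful cA cB hF) hF' hG').
Qed.

Lemma mhom_inj A B F : calgn A -> calgn B -> mhom A B F -> (forall a, A a -> F a = 0 -> a = 0) ->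
  forall m, multb A m -> F m = 0 -> m = 0.
Proof.
move=> [cA nA] cB [hF _ _ _] inj m hm Fm; apply: (nondegR cA nA) => a ha.
have [ma _] := hm _ ha; apply: inj => //; have [_ FM _] := hF.
by rewrite FM ?Fm ?mul0r //; exact: multb_in.
Qed.

(** F m is forced by F m (f a * y) = f (m a) * y. Finite sums of such equations form the graph Pr
    handed to [left_mult_ex]; faithfulness of f(A) then gives the algebraic identities for F. *)
Lemma ext_ex A B f : calgn A -> calgn B -> mor A B f ->
  exists F, mhom A B F /\ forall a, A a -> F a = f a.
Proof.
move=> [cA nA] [cB nB] [hf fB nd]; have [hA AM AS] := cA; have [hB BM BS] := cB.
have a0 : A 0 by case: hA. have [fL fM fS] := hf.
have ff : faithful_on A f by exact: mor_nondeg hf nd.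
have /choice[F hF] : forall m, exists T, multb A m -> forall a, A a -> T * f a = f (m * a).
  move=> m; have [hm|] := pselect (multb A m); last by exists 0.
  pose Pr X Z := exists s : seq (bop I * bop J), [/\ (forall p, p \in s -> A p.1),
    X = \sum_(p <- s) f p.1 * p.2 & Z = \sum_(p <- s) f (m * p.1) * p.2].
  (* The part 2 |m| comes from approximate units, whose norm is bounded by 2; adding 1 makes the
     constant positive. *)
  have [||||||T hT] := @left_mult_ex R J Pr (2 * nrm m + 1).
  - by rewrite ltr_wpDl // mulr_ge0 ?nrm_ge0.
  - by exists [::]; rewrite !big_nil; split.
  - move=> c _ _ _ _ [s [hs -> ->]] [s' [hs' -> ->]].
    exists ([seq (p.1, c *: p.2) | p <- s] ++ s'); split.
    + move=> p; rewrite mem_cat => /orP[/mapP[q /hs hq ->]|/hs'] //.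
    + rewrite big_cat big_map scaler_sumr; congr (_ + _).
      by apply: eq_bigr => p _; rewrite bscalerAr.
    + rewrite big_cat big_map scaler_sumr; congr (_ + _).
      by apply: eq_bigr => p _; rewrite bscalerAr.
  - move=> _ _ Y [s [hs -> ->]]; exists [seq (p.1, p.2 * Y) | p <- s]; split.
    + by move=> p /mapP[q /hs hq ->].
    + by rewrite big_map mulr_suml; apply: eq_bigr => p _; rewrite mulrA.
    + by rewrite big_map mulr_suml; apply: eq_bigr => p _; rewrite mulrA.
  - move=> X Z [s [hs XE ZE]]; apply/ler_addgt0Pr => e e0.
    pose K := \sum_(p <- s) nrm m * nrm p.2.
    have K0 : 0 <= K by apply: sumr_ge0 => p _; rewrite mulr_ge0 ?nrm_ge0.
    have d0 : 0 < e / (K + 1) by rewrite divr_gt0 // ltr_wpDl.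
    (* One element u acting almost as a unit on all first factors gives Z close to f (m u) X, so the
       bound does not grow with the number of terms. *)
    have [u [uA u2 hu]] : exists u, [/\ A u, nrm u <= 2 &
       forall a, a \in [seq p.1 | p <- s] -> nrm (a - u * a) <= e / (K + 1)].
      by apply: approx_unit => // a /mapP[p /hs hp ->].
    have [mu _] := hm _ uA.
    have dZ : nrm (Z - f (m * u) * X) <= e.
      rewrite ZE XE mulr_sumr -sumrB; apply: le_trans (nrm_sum _ _) _.
      apply: (@le_trans _ _ (\sum_(p <- s) (nrm m * nrm p.2) * (e / (K + 1)))).
        rewrite big_seq [X in _ <= X]big_seq; apply: ler_sum => p ps.
        have pA := hs _ ps; have [mp _] := hm _ pA.
        have uA' : A (u * p.1) by exact: AM.
        have [mup _] := hm _ uA'.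
        have -> : f (m * p.1) * p.2 - f (m * u) * (f p.1 * p.2) =
           f (m * (p.1 - u * p.1)) * p.2.
          rewrite mulrA -fM // -mulrA -mulrBl; congr (_ * _).
          by rewrite -(homB hf) // mulrBr.
        apply: le_trans (nrmM _ _) _; rewrite mulrAC ler_wpM2r ?nrm_ge0 //.
        have mA : A (m * (p.1 - u * p.1)) by rewrite mulrBr; exact: csub_sub.
        apply: le_trans (hom_contr cA hf mA) _; apply: le_trans (nrmM _ _) _.
        by rewrite ler_wpM2l ?nrm_ge0 //; apply: hu; apply: map_f.
      rewrite -mulr_suml -/K mulrC -mulrA ler_piMr ?(ltW e0) //.
      by rewrite mulrC ler_pdivrMr ?ltr_wpDl // mul1r lerDl.
    have -> : Z = f (m * u) * X + (Z - f (m * u) * X) by blin.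
    apply: le_trans (nrmD _ _) _; apply: lerD => //.
    apply: le_trans (nrmM _ _) _; rewrite ler_wpM2r ?nrm_ge0 //.
    apply: le_trans (hom_contr cA hf mu) _; apply: le_trans (nrmM _ _) _.
    apply: le_trans (ler_wpM2l (nrm_ge0 m) u2) _.
    by rewrite mulrC lerDl.
  - move=> j e e0; have e2 : 0 < e / 2 by rewrite divr_gt0.
    have [b hb db] := nondeg_dense j cB nB e2.
    have [X [Z [XZ dX]]] : exists X Z, Pr X Z /\ nrm (b - X) <= e / 2.
      (* The norm limits of admissible X form a closed subspace. It contains f(A) B, hence B, and B
         approximates the unit on every column. *)
      have hQ : csub [set b : bop J | forall d : R, 0 < d -> exists X Z, Pr X Z /\ nrm (b - X) <= d].
        split=> [d d0|c x y hx hy d d0|x hx d d0].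
        + exists 0, 0; split; last by rewrite subrr nrm0 (ltW d0).
          by exists [::]; rewrite !big_nil; split.
        + have c0 : 0 < cm c + 1 by rewrite ltr_wpDl ?cm_ge0.
          have d2 : 0 < d / 2 by rewrite divr_gt0.
          have [X [Z [[s [hs XE ZE]] dx]]] := hx _ (divr_gt0 d2 c0).
          have [X' [Z' [[s' [hs' XE' ZE']] dx']]] := hy _ d2.
          exists (c *: X + X'), (c *: Z + Z'); split.
            exists ([seq (p.1, c *: p.2) | p <- s] ++ s'); split.
            * move=> p; rewrite mem_cat => /orP[/mapP[q /hs hq ->]|/hs'] //.
            * rewrite big_cat big_map XE XE' scaler_sumr; congr (_ + _).
              by apply: eq_bigr => p _; rewrite bscalerAr.
            * rewrite big_cat big_map ZE ZE' scaler_sumr; congr (_ + _).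
              by apply: eq_bigr => p _; rewrite bscalerAr.
          rewrite (_ : _ - _ = c *: (x - X) + (y - X')); last by blin.
          apply: le_trans (nrmD _ _) _; rewrite nrmZ [d]splitr lerD //.
          apply: le_trans (ler_wpM2l (cm_ge0 c) dx) _.
          by rewrite mulrA ler_pdivrMr // mulrC ler_wpM2l ?(ltW d2) // lerDl.
        + have d2 : 0 < d / 2 by rewrite divr_gt0.
          have [y hy dy] := hx _ d2; have [X [Z [XZ dX]]] := hy _ d2.
          by exists X, Z; split=> //; exact: nrm_tri dy dX.
      apply: (bcdot_sub hQ) (nd _ hb) _ e2 => _ b' [a ha <-] hb' d d0.
      exists (f a * b'), (f (m * a) * b'); split; last by rewrite subrr nrm0 (ltW d0).
      by exists [:: (a, b')]; rewrite !big_seq1; split=> // p; rewrite inE => /eqP ->.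
    exists X, Z; split=> //.
    have -> : (X - 1) * Emx R j j = (b - 1) * Emx R j j - (b - X) * Emx R j j.
      by rewrite -mulrBl; congr (_ * _); blin.
    apply: le_trans (nrmB _ _) _; rewrite [e]splitr lerD //.
    by apply: le_trans (nrmM _ _) _; rewrite nrmEmx mulr1.
  exists T => _ a ha; rewrite -[T * _]mulr1 -mulrA.
  have := hT (f a * 1) (f (m * a) * 1); rewrite !mulr1; apply.
  by exists [:: (a, 1)]; rewrite !big_seq1 !mulr1; split=> // p; rewrite inE => /eqP ->.
have Fu m X : multb A m -> (forall a, A a -> X * f a = f (m * a)) -> F m = X.
  move=> hm h; apply/eqP; rewrite -subr_eq0; apply/eqP.
  by apply: (faithfulR cA hf ff) => a ha; rewrite mulrBl hF // h // subrr.
have cM := calg_multb cA; have [hM MM MS] := cM.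
have Ff a : A a -> F a = f a.
  by move=> ha; apply: Fu => [|a' ha']; [exact: multb_in|rewrite fM].
have FS m : multb A m -> F (star m) = star (F m).
  move=> hm; have hms := MS _ hm; apply: Fu => // a ha.
  apply/eqP; rewrite -subr_eq0; apply/eqP; apply: ff => a' ha'.
  have [_ am] := hms _ ha'; have [ma _] := hms _ ha; have [ma' _] := hm _ (AS _ ha').
  have e1 : f a' * star (F m) = f (a' * star m).
    rewrite -[f a' * _]starK starM starK -(fS _ ha') (hF _ hm _ (AS _ ha')).
    by rewrite -(fS _ ma') starM starK.
  by rewrite mulrBr mulrA e1 -(fM _ _ ha' ma) -(fM _ _ am ha) mulrA subrr.
exists F; split=> //; split.
- split=> [c x y hx hy|x y hx hy|x hx]; last exact: FS.
    apply: Fu => [|a ha]; first by have [_ h _] := hM; exact: h.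
    have [xa _] := hx _ ha; have [ya _] := hy _ ha.
    by rewrite mulrDl -bscalerAl !hF // mulrDl -bscalerAl fL.
  apply: Fu => [|a ha]; first exact: MM.
  by have [ya _] := hy _ ha; rewrite -mulrA !hF // mulrA.
- have FB m b : multb A m -> B b -> B (F m * b).
    move=> hm hb; have hQ := csub_pre (blinear_mull (F m)) hB.
    apply: (bcdot_sub hQ) (nd _ hb) => _ b' [a ha <-] hb' /=.
    have [ma _] := hm _ ha.
    by rewrite mulrA hF //; have [] := fB _ ma _ hb'.
  move=> m hm b hb; split; first exact: FB.
  rewrite -[X in B X]starK starM -FS //; apply: (BS); apply: FB; first exact: MS.
  exact: BS.
- by apply: Fu => [|a ha]; [exact: multb1|rewrite !mul1r].
- move=> b /nd; apply: bcspanS => _ [_ [a ha <-] [b' hb' ->]].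
  by rewrite -Ff //; apply: bcdot_in => //; exists a.
Qed.
End Morphisms.

Section MorphismCalculus.
Variable R : realType.
Implicit Types (I J K : choiceType).
Local Notation bop := (bop R).

Lemma calgn_idem I (A : set (bop I)) : calgn A -> A `<=` bcdot A A.
Proof.
move=> [cA nA] a ha; apply: (csub_lim (bcdot_csub A A)) => e e0.
have [|u [uA _ hu]] := @approx_unit R I A [:: a] e cA _ e0.
  by move=> x; rewrite inE => /eqP ->.
by exists (u * a); [exact: bcdot_in|apply: hu; rewrite inE].
Qed.

Lemma bcdotS I (X X' Y Y' : set (bop I)) : X `<=` X' -> Y `<=` Y' -> bcdot X Y `<=` bcdot X' Y'.
Proof.
by move=> hX hY; apply: bcdot_sub; [exact: bcdot_csub|move=> a b /hX xa /hY yb; exact: bcdot_in].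
Qed.

Lemma mhom_id I (A : set (bop I)) : calgn A -> mhom A A id.
Proof.
move=> cA; split=> // b hb; apply: (bcdotS _ _ (calgn_idem cA hb)) => // a ha.
by exists a.
Qed.

Lemma shom_comp I J K (P : set (bop I)) (Q : set (bop J)) (F : bop I -> bop J) (G : bop J -> bop K) :
  shom P F -> (forall x, P x -> Q (F x)) -> shom Q G -> shom P (fun x => G (F x)).
Proof.
move=> [fL fM fS] FQ [gL gM gS].
by split=> [c x y hx hy|x y hx hy|x hx]; rewrite ?fL ?gL ?fM ?gM ?fS ?gS; auto.
Qed.

Lemma mhom_comp I J K (A : set (bop I)) (B : set (bop J)) (C : set (bop K))
    (F : bop I -> bop J) (G : bop J -> bop K) : calgn A -> calgn B -> calgn C ->
  mhom A B F -> mhom B C G -> mhom A C (fun x => G (F x)).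
Proof.
move=> [cA nA] [cB nB] [cC nC] [hF FB F1 Fn] [hG GC G1 Gn]; split.
- exact: shom_comp hF FB hG.
- by move=> m /FB/GC.
- by rewrite F1 G1.
move=> c /Gn; apply: bcdot_sub; first exact: bcdot_csub.
move=> _ c' [b hb <-] hc'.
have hQ := csub_pre (blinear_mulr c') (bcdot_csub ((fun x => G (F x)) @` A) C).
have cM := calg_multb cB.
have := hom_preim cM hG hQ => hP.
suff [] : [set x | multb B x /\ [set x0 | bcdot ((fun x => G (F x)) @` A) C (x0 * c')] (G x)] b by [].
apply: (bcdot_sub hP) (Fn _ hb) => _ b' [a ha <-] hb'.
have hFa : multb B (F a) by apply: FB; exact: multb_in.
have hb'' : multb B b' by exact: multb_in.
split; first by have [_ h _] := cM; exact: h.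
have [_ gM _] := hG; rewrite /= gM // -mulrA; apply: bcdot_in; first by exists a.
by have [] := GC _ hb'' _ hc'.
Qed.

(** Agreement on X and Y passes to products, then to A by closedness, then to multipliers by
    nondegeneracy. It serves with X and Y the two embedded factors of a twisted tensor product. *)
Lemma mhom_gen I J (A X Y : set (bop I)) (B B' : set (bop J)) F G : calgn A -> calgn B ->
  mhom A B F -> mhom A B' G -> X `<=` multb A -> Y `<=` multb A -> A `<=` bcdot X Y ->
  (forall x, X x -> F x = G x) -> (forall y, Y y -> F y = G y) ->
  forall m, multb A m -> F m = G m.
Proof.
move=> cA cB hF hG XM YM AXY eX eY; apply: (mhom_uniq cA cB hF hG) => a /AXY.
have [cA' _] := cA; have cM := calg_multb cA'.
have [hF' _ _ _] := hF; have [hG' _ _ _] := hG.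
suff h : bcdot X Y `<=` [set x | multb A x /\ F x = G x] by move=> /h[].
apply: bcdot_sub; first exact: hom_closed_eq cM hF' hG'.
move=> x y hx hy; have [_ MM _] := cM; have xM := XM _ hx; have yM := YM _ hy.
split; first exact: MM.
by have [_ -> // _] := hF'; have [_ -> // _] := hG'; rewrite eX // eY.
Qed.

End MorphismCalculus.

(** * Amplification of a homomorphism by an identity leg *)

Section Amplification.
Variables (R : realType) (I I' K : choiceType).
Local Notation bop := (bop R).
Variables (P : set (bop I)) (F : bop I -> bop I').
Hypotheses (cP : calg P) (hF : shom P F).
Implicit Types (T S : bop (I * K)%type).
Local Notation E := (Emx R).

Definition blk (T : bop (I * K)%type) : Prop := forall k k', P (rblock k k' T).

Let hP : csub P. Proof. by case: cP. Qed.
Let PM x y : P x -> P y -> P (x * y). Proof. by case: cP => _ h _; exact: h. Qed.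
Let PS x : P x -> P (star x). Proof. by case: cP => _ _ h; exact: h. Qed.
Let p0 : P 0. Proof. by case: hP. Qed.
Let F0 : F 0 = 0. Proof. exact: hom0 p0 hF. Qed.

Let F_sum (A : Type) (r : seq A) (g : A -> bop I) : (forall a, P (g a)) ->
  F (\sum_(a <- r) g a) = \sum_(a <- r) F (g a).
Proof.
move=> h; elim: r => [|a r IH]; rewrite ?big_nil ?F0 // !big_cons (homD hF) ?IH //.
exact: csub_sum.
Qed.

Lemma csub_blk : csub blk.
Proof.
split=> [k k'|c x y hx hy k k'|x hx k k'].
- by rewrite (blinear0 (blinear_rblock _ _ k k')).
- by rewrite rblockL; have [_ h _] := hP; exact: h.
- by apply: (csub_lim (csub_pre (blinear_rblock _ _ k k') hP)) => e /hx[y hy d]; exists y.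
Qed.

(** The finite matrices over P indexed by G, realized as an algebra of operators. Applying F to each
    block is a homomorphism there, hence contractive, with a bound independent of G. *)
Definition corner (G : {fset K}) : set (bop (I * K)%type) :=
  [set T | blk T /\ forall k k', ~~ ((k \in G) && (k' \in G)) -> rblock k k' T = 0].

Definition cut (J : choiceType) (G : {fset K}) (f : K -> K -> bop J) : bop (J * K)%type :=
  opq (\sum_(k <- G) \sum_(l <- G) bten (f k l) (E k l)).

Lemma rblock_cut (J : choiceType) (G : {fset K}) (f : K -> K -> bop J) k l :
  rblock k l (cut G f) = if (k \in G) && (l \in G) then f k l else 0.
Proof.
rewrite /cut opqE (blinear_sum _ _ (blinear_rblock _ _ k l)).
have rE m n : rblock k l (bten (f m n) (E m n)) = ((k == m) && (l == n))%:R *: f m n.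
  by rewrite rblock_bten EmxE -natrM mulnb.
under eq_bigr => m _ do rewrite (blinear_sum _ _ (blinear_rblock _ _ k l)).
case: (boolP (k \in G)) => kG /=; last first.
  rewrite big_seq big1 // => m mG; rewrite big1 // => n _; rewrite rE.
  by have [e|_] := eqVneq k m; rewrite ?scale0r //; rewrite e mG in kG.
rewrite (big_fsetD1 k) //= [X in _ + X]big_seq [X in _ + X]big1 ?addr0 => [|m]; last first.
  rewrite !inE eq_sym => /andP[/negPf km _]; rewrite big1 // => n _.
  by rewrite rE km scale0r.
case: (boolP (l \in G)) => lG; last first.
  rewrite big_seq big1 // => n nG; rewrite rE eqxx /=.
  by have [e|_] := eqVneq l n; rewrite ?scale0r //; rewrite e nG in lG.
rewrite (big_fsetD1 l) //= [X in _ + X]big_seq [X in _ + X]big1 ?addr0 => [|n]; last first.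
  rewrite !inE eq_sym => /andP[/negPf ln _].
  by rewrite rE ln andbF scale0r.
by rewrite rE !eqxx scale1r.
Qed.

Lemma rblock_mul_cut (J : choiceType) (G : {fset K}) (U : bop (J * K)%type)
    (f : K -> K -> bop J) k l :
  rblock k l (U * cut G f) = if l \in G then \sum_(m <- G) rblock k m U * f m l else 0.
Proof.
rewrite /cut opqE mulr_sumr (blinear_sum _ _ (blinear_rblock _ _ k l)).
under eq_bigr => m _.
  rewrite mulr_sumr (blinear_sum _ _ (blinear_rblock _ _ k l)).
  under eq_bigr => n _ do rewrite rblock_mulE.
  over.
case: ifP => lG.
  apply: eq_bigr => m _; rewrite (big_fsetD1 l) //= eqxx scale1r.
  rewrite big_seq big1 ?addr0 // => n; rewrite !inE eq_sym => /andP[/negPf -> _].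
  by rewrite scale0r.
rewrite big1 // => m _; rewrite big_seq big1 // => n nG.
by have [e|_] := eqVneq l n; rewrite ?scale0r //; rewrite e nG in lG.
Qed.

Lemma cornerE G T : corner G T -> T = cut G (fun k l => rblock k l T).
Proof.
move=> [_ h]; apply: rblock_inj => k l; rewrite rblock_cut.
by case: ifP => // /negbT /h.
Qed.

Lemma calg_corner G : calg (corner G).
Proof.
split.
- split=> [|c x y [bx hx] [by_ hy]|x hx].
  + split=> [k k'|k k' _]; first by rewrite (blinear0 (blinear_rblock _ _ k k')).
    exact: (blinear0 (blinear_rblock _ _ k k')).
  + split=> [|k k' kk]; first by have [_ h _] := csub_blk; exact: h.
    by rewrite rblockL hx // hy // scaler0 addr0.
  + split=> [|k k' kk].
      by apply: (csub_lim csub_blk) => e /hx[y [hy _] d]; exists y.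
    apply: (csub_lim (csub_pre (blinear_rblock _ _ k k') (csub_zero R I))) => e /hx[y [_ hy] d].
    by exists y => //=; exact: hy.
- move=> x y hx hy; have := cornerE hy => yE; have [bx zx] := hx; have [by_ zy] := hy.
  have rE k l : rblock k l (x * y) =
      if l \in G then \sum_(m <- G) rblock k m x * rblock m l y else 0.
    by rewrite {1}yE rblock_mul_cut.
  split=> [k l|k l kl]; rewrite rE.
    by case: ifP => // _; apply: csub_sum => // m; exact: PM.
  case: ifP => // lG; rewrite lG andbT in kl; rewrite big1 // => m _.
  by rewrite zx ?mul0r // (negPf kl).
- move=> x [bx zx]; split=> [k l|k l kl]; rewrite rblock_star; first exact: PS.
  by rewrite zx ?star0 // andbC.
Qed.

Definition Fcut G T : bop (I' * K)%type := opq (cut G (fun k l => F (rblock k l T))).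

Lemma rblock_Fcut G T k l :
  rblock k l (Fcut G T) = if (k \in G) && (l \in G) then F (rblock k l T) else 0.
Proof. by rewrite /Fcut opqE rblock_cut. Qed.

Lemma shom_Fcut G : shom (corner G) (Fcut G).
Proof.
have [fL fM fS] := hF; split.
- move=> c x y [bx _] [by_ _].
  apply: rblock_inj => k l.
  rewrite [RHS]rblockL.
  rewrite [LHS]rblock_Fcut rblockL (rblock_Fcut G x) (rblock_Fcut G y).
  by case: ifP => _; rewrite ?scaler0 ?addr0 // fL.
- move=> x y hx hy; apply: rblock_inj => k l.
  have [bx zx] := hx; have [by_ zy] := hy.
  rewrite [Fcut G y]/Fcut opqE rblock_mul_cut rblock_Fcut; case: (boolP (l \in G)) => lG; rewrite ?andbF // andbT.
  have -> : rblock k l (x * y) = \sum_(m <- G) rblock k m x * rblock m l y.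
    by rewrite {1}(cornerE hy) rblock_mul_cut lG.
  case: (boolP (k \in G)) => kG; last first.
    by rewrite big1 // => m _; rewrite rblock_Fcut (negPf kG) mul0r.
  rewrite F_sum => [|m]; last exact: PM.
  by apply: eq_big_seq => m mG; rewrite rblock_Fcut kG mG fM.
- move=> x [bx _]; apply: rblock_inj => k l; rewrite rblock_star 2!rblock_Fcut andbC.
  by case: ifP => _; rewrite ?star0 // rblock_star fS.
Qed.

(** Cutting down to G x G is compression by the projection 1 (x) [Pf G]. *)
Lemma nrm_cut G T : nrm (cut G (fun k l => rblock k l T)) <= nrm T.
Proof.
have -> : cut G (fun k l => rblock k l T) = t2 I (Pf R G) * T * t2 I (Pf R G).
  have pE : t2 I (Pf R G : bop K) = cut G (fun k l => (k == l)%:R *: (1 : bop I)).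
    apply: rblock_inj => k l; rewrite rblock_cut -bten1l rblock_bten PfE.
    by case: (boolP (k \in G)) => kG /=; rewrite ?mul0r ?scale0r // mul1r; case: eqVneq => [<-|_]; rewrite ?kG //= ?scale0r ?if_same.
  have rr (U : bop (I * K)%type) k l : rblock k l (U * t2 I (Pf R G)) = if l \in G then rblock k l U else 0.
    rewrite pE rblock_mul_cut; case: ifP => // lG; rewrite (big_fsetD1 l) //= eqxx scale1r mulr1.
    rewrite big_seq big1 ?addr0 // => m; rewrite !inE => /andP[/negPf -> _].
    by rewrite scale0r mulr0.
  apply: rblock_inj => k l; rewrite rr rblock_cut; case: (boolP (l \in G)) => lG; rewrite ?andbF // andbT.
  rewrite -[RHS]starK -rblock_star starM -t2_star.
  have -> : star (Pf R G) = Pf R G :> bop K.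
    by rewrite /Pf star_sum; apply: eq_bigr => i _; rewrite Emx_star.
  by rewrite rr; case: ifP => _; rewrite ?star0 // rblock_star starK.
have p1 : nrm (t2 I (Pf R G : bop K)) <= 1.
  by apply: le_trans (nrm_t2 _ _) _; exact: nrm_Pf.
apply: le_trans (nrmM _ _) _; rewrite -[X in _ <= X]mulr1.
apply: ler_pM; rewrite ?nrm_ge0 //; apply: le_trans (nrmM _ _) _.
by rewrite -[X in _ <= X]mul1r; apply: ler_wpM2r => //; exact: nrm_ge0.
Qed.

(* F (x) id, obtained by applying F to every block; this makes sense on all of
   M(A (x) K(l^2 K)) and not only on M(A (x) C). *)
Definition amp1 T : bop (I' * K)%type :=
  opq (mkb (fun p q => F (rblock p.2 q.2 T) p.1 q.1)).

(** A finite form involves finitely many blocks, so it only sees [Fcut G] of a corner; contractivity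
    of [Fcut G] and [nrm_cut] bound it uniformly in G. *)
Lemma opb_amp1 T : blk T ->
  opb (fun p q : I' * K => F (rblock p.2 q.2 T) p.1 q.1) (nrm T).
Proof.
move=> hT; split=> [|L M y x]; first exact: nrm_ge0.
pose G := ([fset p.2 | p in L] `|` [fset p.2 | p in M])%fset.
have LG p : p \in L -> p.2 \in G.
  by move=> pL; rewrite inE; apply/orP; left; apply/imfsetP; exists p.
have MG p : p \in M -> p.2 \in G.
  by move=> pL; rewrite inE; apply/orP; right; apply/imfsetP; exists p.
pose C := cut G (fun k l => rblock k l T).
have hC : corner G C.
  split=> [k l|k l /negPf kl]; rewrite rblock_cut ?kl //.
  by case: ifP.
have -> : bform (fun p q : I' * K => F (rblock p.2 q.2 T) p.1 q.1) L M y x =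
    bform (Fcut G C) L M y x.
  apply: eq_big_seq => p pL; apply: eq_big_seq => q qM; congr (_ * _ * _).
  have -> : Fcut G C p q = rblock p.2 q.2 (Fcut G C) p.1 q.1.
    by rewrite rblockE -!surjective_pairing.
  by rewrite rblock_Fcut /C rblock_cut LG // MG.
have [_ /(_ L M y x) h] := nrmP (Fcut G C); apply: le_trans h _.
rewrite -!mulrA ler_wpM2r ?mulr_ge0 ?nF_ge0 //.
exact: le_trans (hom_contr (calg_corner G) (shom_Fcut G) hC) (nrm_cut G T).
Qed.

Lemma amp1v T : blk T -> bval (amp1 T) = fun p q => F (rblock p.2 q.2 T) p.1 q.1.
Proof.
by move=> hT; rewrite /amp1 opqE mkbE //; apply/bounded_opP; exists (nrm T); exact: opb_amp1.
Qed.
Lemma rblock_amp1 T k l : blk T -> rblock k l (amp1 T) = F (rblock k l T).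
Proof. by move=> hT; apply: bopP => i j; rewrite rblockE amp1v. Qed.
Lemma nrm_amp1 T : blk T -> nrm (amp1 T) <= nrm T.
Proof. by move=> hT; apply: nrm_le; rewrite amp1v //; exact: opb_amp1. Qed.
Lemma amp1_star T : blk T -> blk (star T) /\ amp1 (star T) = star (amp1 T).
Proof.
move=> hT; have hS : blk (star T) by move=> k l; rewrite rblock_star; exact: PS.
split=> //; apply: rblock_inj => k l.
by rewrite rblock_amp1 // rblock_star rblock_star rblock_amp1 //; have [_ _ ->] := hF.
Qed.
Lemma amp1L c S T : blk S -> blk T -> amp1 (c *: S + T) = c *: amp1 S + amp1 T.
Proof.
move=> hS hT; have hc : blk (c *: S + T) by have [_ h _] := csub_blk; exact: h.
apply: rblock_inj => k l; rewrite rblockL !rblock_amp1 // rblockL.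
by have [-> //] := hF.
Qed.
Lemma amp1_bten x y : P x -> amp1 (bten x y) = bten (F x) y.
Proof.
move=> hx; have hb : blk (bten x y) by move=> k l; rewrite rblock_bten; exact: csub_scale.
apply: rblock_inj => k l; rewrite rblock_amp1 // !rblock_bten.
exact: homZ p0 hF hx.
Qed.
End Amplification.

Section PartialLinear.
Variable R : realType.
Implicit Types (I J K : choiceType).
Local Notation bop := (bop R).

Definition pblin I J (D : set (bop I)) (f : bop I -> bop J) : Prop :=
  (forall a x y, D x -> D y -> f (a *: x + y) = a *: f x + f y) /\
  exists2 c : R, 0 < c & forall x, D x -> nrm (f x) <= c * nrm x.

Lemma pblin0 I J (D : set (bop I)) (f : bop I -> bop J) : D 0 -> pblin D f -> f 0 = 0.
Proof.
move=> d0 [h _]; have := h 1 0 0 d0 d0; rewrite !scale1r addr0 => E.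
by apply: (addrI (f 0)); rewrite addr0 -E.
Qed.
Lemma pblinB I J (D : set (bop I)) (f : bop I -> bop J) x y : pblin D f -> D x -> D y ->
  f (x - y) = f x - f y.
Proof. by move=> [h _] dx dy; rewrite addrC -scaleN1r h // scaleN1r addrC. Qed.

Lemma pblin_near I J (D : set (bop I)) (f : bop I -> bop J) (e : R) : csub D -> pblin D f -> 0 < e ->
  exists2 d : R, 0 < d & forall x y, D x -> D y -> nrm (x - y) <= d -> nrm (f x - f y) <= e.
Proof.
move=> hD hf e0; have [_ [c c0 fc]] := hf; exists (e / c); first exact: divr_gt0.
move=> x y dx dy d; rewrite -(pblinB hf) //; apply: le_trans (fc _ (csub_sub hD dx dy)) _.
by rewrite mulrC -ler_pdivlMr.
Qed.

Lemma pcsub_pre I J (D : set (bop I)) (f : bop I -> bop J) (Q : set (bop J)) :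
  csub D -> pblin D f -> csub Q -> csub [set x | D x /\ Q (f x)].
Proof.
move=> hD hf hQ; have [fL _] := hf; have [q0 qL _] := hQ; have [d0 dL _] := hD.
split=> [|a x y [dx hx] [dy hy]|x hx] /=; first by rewrite (pblin0 d0 hf).
  by split; [exact: dL|rewrite fL //; exact: qL].
have dx : D x by apply: (csub_lim hD) => e /hx[y [dy _] d]; exists y.
split=> //; apply: (csub_lim hQ) => e /(pblin_near hD hf)[d /hx[y [dy hy] hd] h].
by exists (f y) => //; exact: h.
Qed.

Lemma pcsub_eq I J (D : set (bop I)) (f g : bop I -> bop J) : csub D -> pblin D f -> pblin D g ->
  csub [set x | D x /\ f x = g x].
Proof.
move=> hD hf hg; have [fL _] := hf; have [gL _] := hg; have [d0 dL _] := hD.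
split=> [|a x y [dx hx] [dy hy]|x hx] /=.
- by rewrite (pblin0 d0 hf) (pblin0 d0 hg).
- by split; [exact: dL|rewrite fL // gL // hx hy].
have dx : D x by apply: (csub_lim hD) => e /hx[y [dy _] d]; exists y.
split=> //; apply: nrm_eps => e e0; have e2 : 0 < e / 2 by rewrite divr_gt0.
have [d1 d10 h1] := pblin_near hD hf e2; have [d2 d20 h2] := pblin_near hD hg e2.
have d0' : 0 < Num.min d1 d2 by rewrite lt_min d10.
have [y [dy hy]] := hx _ d0'; rewrite le_min => /andP[l1 l2].
by apply: (@nrm_tri _ _ _ (f y)); [exact: h1|rewrite hy nrm_distC; exact: h2].
Qed.

Lemma pblin_shom I J (P : set (bop I)) (f : bop I -> bop J) : calg P -> shom P f -> pblin P f.
Proof.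
by move=> cP hf; split; [case: hf|exists 1 => // x px; rewrite mul1r; exact: (hom_contr cP hf px)].
Qed.
Lemma blinear_pblin I J (f : bop I -> bop J) : blinear f -> pblin setT f.
Proof. by move=> [fL [c c0 fc]]; split=> [a x y _ _|]; [exact: fL|exists c]. Qed.
Lemma pblin_sub I J (D D' : set (bop I)) (f : bop I -> bop J) : D `<=` D' -> pblin D' f -> pblin D f.
Proof. by move=> DD [fL [c c0 fc]]; split; [auto|exists c; auto]. Qed.
Lemma pblin_comp I J K (D : set (bop I)) (D' : set (bop J)) (f : bop I -> bop J) (g : bop J -> bop K) :
  (forall x, D x -> D' (f x)) -> pblin D f -> pblin D' g -> pblin D (fun x => g (f x)).
Proof.
move=> DD [fL [c c0 fc]] [gL [c' c0' gc]]; split=> [a x y dx dy|]; first by rewrite fL // gL //; exact: DD.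
exists (c' * c) => [|x dx]; first exact: mulr_gt0.
apply: le_trans (gc _ (DD _ dx)) _; rewrite -mulrA ler_wpM2l ?(ltW c0') //; exact: fc.
Qed.
Lemma pblin_compl I J K (D : set (bop I)) (f : bop I -> bop J) (g : bop J -> bop K) :
  pblin D f -> blinear g -> pblin D (fun x => g (f x)).
Proof. by move=> hf /blinear_pblin hg; exact: (@pblin_comp _ _ _ D setT f g _ hf hg). Qed.
Lemma pblin_compr I J K (D : set (bop I)) (D' : set (bop J)) (f : bop I -> bop J) (g : bop J -> bop K) :
  (forall x, D x -> D' (f x)) -> blinear f -> pblin D' g -> pblin D (fun x => g (f x)).
Proof.
by move=> DD /blinear_pblin hf; apply: pblin_comp DD _; apply: pblin_sub hf => x.
Qed.
End PartialLinear.

(** * Spatial tensor products and slice maps *)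

Section TensorAlgebras.
Variable R : realType.
Implicit Types (I J K : choiceType).
Local Notation bop := (bop R).
Local Notation E := (Emx R).

Definition sw I K : bop (I * K)%type -> bop (K * I)%type :=
  leg (fun n : K * I => (n.2, n.1)) (fun=> tt).
Lemma bij_sw I K : bijective (fun n : K * I => ((n.2, n.1), tt)).
Proof. by exists (fun m : (I * K) * unit => (m.1.2, m.1.1)) => [[]|[[a b] []]]. Qed.
Lemma swE I K (T : bop (I * K)%type) p q : sw T p q = T (p.2, p.1) (q.2, q.1).
Proof. by rewrite /sw legE ?eqxx ?mulr1 //; exact: bij_inj (bij_sw I K). Qed.
Lemma swK I K (T : bop (I * K)%type) : sw (sw T) = T.
Proof. by apply: bopP => -[a b] [c d]; rewrite !swE. Qed.
Lemma sw_bten I K (x : bop I) (y : bop K) : sw (bten x y) = bten y x.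
Proof. by apply: bopP => p q; rewrite swE !btenE mulrC. Qed.
Lemma swM I K (S T : bop (I * K)%type) : sw (S * T) = sw S * sw T.
Proof. exact: legM (bij_sw I K) _ _. Qed.
Lemma sw_star I K (S : bop (I * K)%type) : sw (star S) = star (sw S).
Proof. exact: leg_star (bij_sw I K) _. Qed.
Lemma blinear_sw I K : blinear (@sw I K).
Proof. exact: blinear_leg (bij_sw I K). Qed.
Lemma sw1 I K : sw (1 : bop (I * K)%type) = 1.
Proof. exact: leg1 (bij_sw I K). Qed.
Lemma lblock_sw I K i i' (T : bop (I * K)%type) : lblock i i' T = rblock i i' (sw T).
Proof. by apply: bopP => k l; rewrite lblockE rblockE swE. Qed.
Lemma rblock_sw I K i i' (T : bop (I * K)%type) : lblock i i' (sw T) = rblock i i' T.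
Proof. by apply: bopP => k l; rewrite lblockE rblockE swE. Qed.

Definition bat I K (A : set (bop I)) (C : set (bop K)) : set (bop (I * K)%type) :=
  bcspan [set x | exists2 a, A a & exists2 c, C c & x = bten a c].

Lemma bat_in I K (A : set (bop I)) (C : set (bop K)) a c : A a -> C c -> bat A C (bten a c).
Proof. by move=> ha hc; apply: bcspan_in; exists a => //; exists c. Qed.
Lemma bat_sub I K (A : set (bop I)) (C : set (bop K)) (P : set (bop (I * K)%type)) : csub P ->
  (forall a c, A a -> C c -> P (bten a c)) -> bat A C `<=` P.
Proof. by move=> hP h; apply: bcspan_sub => // _ [a ha [c hc ->]]; exact: h. Qed.
Lemma csub_bat I K (A : set (bop I)) (C : set (bop K)) : csub (bat A C).
Proof. exact: bcspan_csub. Qed.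

Lemma sw_bat I K (A : set (bop I)) (C : set (bop K)) x : bat A C x -> bat C A (sw x).
Proof.
move: x; apply: bat_sub; first exact: csub_pre (blinear_sw I K) (csub_bat C A).
by move=> a c ha hc /=; rewrite sw_bten; exact: bat_in.
Qed.
Lemma sw_multb_bat I K (A : set (bop I)) (C : set (bop K)) T :
  multb (bat A C) T -> multb (bat C A) (sw T).
Proof.
move=> hT x hx; have [h1 h2] := hT _ (sw_bat hx).
by split; rewrite -[x]swK -swM; exact: sw_bat.
Qed.

Lemma nondeg_t1 I K (A : set (bop I)) (X : bop (I * K)%type) : nondeg A ->
  (forall a, A a -> t1 K a * X = 0) -> X = 0.
Proof.
move=> nA h; apply: rblock_inj => k l; rewrite (blinear0 (blinear_rblock _ _ k l)).
by apply: nA => a ha; rewrite -rblock_t1l h // (blinear0 (blinear_rblock _ _ k l)).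
Qed.
Lemma sw_t1 I K (a : bop I) : sw (t1 K a) = t2 K a.
Proof. by rewrite -bten1r sw_bten bten1l. Qed.
Lemma sw_t2 I K (a : bop K) : sw (t2 I a) = t1 I a.
Proof. by rewrite -bten1l sw_bten bten1r. Qed.
Lemma sw_inj I K : injective (@sw I K).
Proof. exact: can_inj (@swK I K). Qed.
Lemma sw0 I K : sw (0 : bop (I * K)%type) = 0.
Proof. exact: blinear0 (blinear_sw I K). Qed.
Lemma nondeg_t2 I K (A : set (bop K)) (X : bop (I * K)%type) : nondeg A ->
  (forall a, A a -> t2 I a * X = 0) -> X = 0.
Proof.
move=> nA h; apply: sw_inj; rewrite sw0; apply: (nondeg_t1 nA) => a ha.
by rewrite -sw_t2 -swM h // sw0.
Qed.

Lemma calg_bat I K (A : set (bop I)) (C : set (bop K)) : calg A -> calg C -> calg (bat A C).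
Proof.
move=> [hA AM AS] [hC CM CS]; split.
- exact: csub_bat.
- move=> x y hx hy.
  have h1 a c : A a -> C c -> forall y, bat A C y -> bat A C (bten a c * y).
    move=> ha hc; apply: bat_sub; first exact: csub_pre (blinear_mull _) (csub_bat A C).
    by move=> a' c' ha' hc' /=; rewrite btenM; apply: bat_in; [exact: AM|exact: CM].
  move: x hx; apply: bat_sub; first exact: csub_pre (blinear_mulr y) (csub_bat A C).
  by move=> a c ha hc /=; exact: h1.
- apply: bcspan_star => _ [a ha [c hc ->]]; rewrite bten_star.
  by apply: bat_in; [exact: AS|exact: CS].
Qed.

Lemma calgn_bat I K (A : set (bop I)) (C : set (bop K)) : calgn A -> calgn C -> calgn (bat A C).
Proof.
move=> [cA nA] [cC nC]; split=> [|X hX]; first exact: calg_bat.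
apply: (nondeg_t2 nC) => c hc; apply: (nondeg_t1 nA) => a ha.
by rewrite mulrA -btenK; apply: hX; exact: bat_in.
Qed.

Definition Kc K : set (bop K) := bcspan [set x | exists k l, x = E k l].

Lemma csub_Kc K : csub (@Kc K).
Proof. exact: bcspan_csub. Qed.

Lemma Kc_in K (k l : K) : Kc (E k l).
Proof. by apply: bcspan_in; exists k, l. Qed.

(** T E_kl is a single column, hence a norm limit of columns with finitely many entries, which are
    combinations of matrix units. *)
Lemma Kc_mull K (T : bop K) x : Kc x -> Kc (T * x).
Proof.
move: x; apply: bcspan_sub; first exact: csub_pre (blinear_mull T) (bcspan_csub _).
move=> _ [k [l ->]]; apply: (csub_lim (bcspan_csub _)) => e e0.
have -> : E k l = E k k * E k l by rewrite Emx_mul eqxx scale1r.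
have [F hF] := col_tail T k e0; exists (Pf R F * (T * E k k) * E k l); last first.
  rewrite mulrA -mulrBl; apply: le_trans (nrmM _ _) _; by rewrite nrmEmx mulr1.
rewrite /Pf !mulr_suml; apply: (csub_sum _ (csub_Kc K)).
move=> i; rewrite mulrA Emx_sandwich -bscalerAl; apply: (csub_scale _ (csub_Kc K)).
by rewrite Emx_mul eqxx scale1r; exact: Kc_in.
Qed.
Lemma Kc_star K (x : bop K) : Kc x -> Kc (star x).
Proof. by apply: bcspan_star => _ [k [l ->]]; rewrite Emx_star; exact: Kc_in. Qed.
Lemma Kc_mulr K (T : bop K) x : Kc x -> Kc (x * T).
Proof. by move=> hx; rewrite -[_ * T]starK starM; apply: Kc_star; apply: Kc_mull; exact: Kc_star. Qed.
Lemma calgn_Kc K : calgn (@Kc K).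
Proof.
split; first split; [exact: bcspan_csub|by move=> x y _; exact: Kc_mull|exact: Kc_star|].
move=> X h; apply: bopP => k l; have := congr1 (fun T : bop K => T k l) (h _ (Kc_in k k)).
by rewrite Emxmul eqxx mul1r.
Qed.
Lemma multb_Kc K (T : bop K) : multb (@Kc K) T.
Proof. by move=> x hx; split; [exact: Kc_mull|exact: Kc_mulr]. Qed.

Lemma multb_bten I K (A : set (bop I)) (C : set (bop K)) m n :
  multb A m -> multb C n -> multb (bat A C) (bten m n).
Proof.
move=> hm hn x hx; split; move: x hx; apply: bat_sub.
- exact: csub_pre (blinear_mull _) (csub_bat A C).
- by move=> a c /hm[h1 h2] /hn[h3 h4] /=; rewrite btenM; exact: bat_in.
- exact: csub_pre (blinear_mulr _) (csub_bat A C).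
- by move=> a c /hm[h1 h2] /hn[h3 h4] /=; rewrite btenM; exact: bat_in.
Qed.

Lemma bat_E_sub I K (A : set (bop I)) (P : set (bop (I * K)%type)) : csub P ->
  (forall a k l, A a -> P (bten a (E k l))) -> bat A (@Kc K) `<=` P.
Proof.
move=> hP h; apply: bat_sub => // a c ha; move: c.
apply: bcspan_sub; first exact: csub_pre (blinear_btenr _ a) hP.
by move=> _ [k [l ->]]; exact: h.
Qed.

Lemma blk_bat I K (A : set (bop I)) (x : bop (I * K)%type) : calg A ->
  bat A (@Kc K) x -> blk A x.
Proof.
move=> cA; have [hA _ _] := cA; move: x; apply: bat_E_sub; first exact: (csub_blk K cA).
by move=> a k l ha m n; rewrite rblock_bten; exact: (csub_scale _ hA ha).
Qed.
Lemma blk_multb I K (A : set (bop I)) (T : bop (I * K)%type) : calg A ->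
  multb (bat A (@Kc K)) T -> blk (multb A) T.
Proof.
move=> cA hT k l a ha; have [hA AM AS] := cA.
have sub1 (S : bop (I * K)%type) (a' : bop I) : multb (bat A (@Kc K)) S -> A a' -> forall k l, A (rblock k l S * a').
  move=> hS ha' k' l'; have [h _] := hS _ (bat_in ha' (Kc_in l' l')).
  have := blk_bat cA h k' l'; by rewrite rblock_mulE eqxx scale1r.
split; first exact: sub1.
have [_ _ MS] := calg_multb (calg_bat cA (proj1 (calgn_Kc K))).
have := AS _ (sub1 _ _ (MS _ hT) (AS _ ha) l k); by rewrite rblock_star starM !starK.
Qed.

(** C contains c with c E_kk close to E_kk, so a (x) E_kl is close to (a (x) c) (1 (x) E_kl), which
    S sends into A (x) K. Consequently blocks of multipliers of A (x) C are multipliers of A, and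
    [amp1] applies to them. *)
Lemma multb_batK I K (A : set (bop I)) (C : set (bop K)) : calg A -> calgn C ->
  multb (bat A C) `<=` multb (bat A (@Kc K)).
Proof.
move=> cA [cC nC] T hT.
have [cK _] := calgn_Kc K; have cAK := calg_bat cA cK; have cAC := calg_bat cA cC.
have main S : multb (bat A C) S -> forall x, bat A (@Kc K) x -> bat A (@Kc K) (S * x).
  move=> hS; apply: bat_E_sub; first exact: csub_pre (blinear_mull _) (csub_bat A _).
  move=> a k l ha /=; apply: (csub_lim (csub_bat A _)) => e e0.
  pose M := nrm S * nrm a; have M0 : 0 <= M by rewrite mulr_ge0 ?nrm_ge0.
  have d0 : 0 < e / (M + 1) by rewrite divr_gt0 // ltr_wpDl.
  have [c hc dc] := nondeg_dense k cC nC d0.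
  exists (S * bten a (c * E k l)).
    have -> : bten a (c * E k l) = bten a c * t2 I (E k l).
      by rewrite -bten1l btenM mulr1.
    rewrite mulrA; have [h _] := hS _ (bat_in ha hc).
    move: (S * bten a c) h; apply: bat_sub; first exact: csub_pre (blinear_mulr _) (csub_bat A _).
    move=> a' c' ha' hc' /=; rewrite -bten1l btenM mulr1; apply: bat_in => //.
    by apply: Kc_mull; exact: Kc_in.
  rewrite -mulrBr -[bten a (E k l)]mulr1.
  have -> : bten a (E k l) * 1 - bten a (c * E k l) = - bten a ((c - 1) * E k k * E k l).
    by rewrite mulr1 -mulrA Emx_mul eqxx scale1r mulrBl mul1r; apply: bopP => p q;
       rewrite !(bvalD, bvalN, btenE); ring.
  rewrite mulrN nrmN; apply: le_trans (nrmM _ _) _.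
  apply: (@le_trans _ _ (nrm S * (nrm a * (e / (M + 1))))).
    rewrite ler_wpM2l ?nrm_ge0 //; apply: le_trans (nrm_bten _ _) _.
    rewrite ler_wpM2l ?nrm_ge0 //; apply: le_trans (nrmM _ _) _.
    by rewrite nrmEmx mulr1.
  by rewrite mulrA -/M mulrA ler_pdivrMr ?ltr_wpDl // mulrC ler_wpM2l ?(ltW e0) // lerDl.
move=> x hx; split; first exact: main.
have [_ _ MS] := calg_multb cAC; have [_ _ KS] := cAK.
by have := KS _ (main _ (MS _ hT) _ (KS _ hx)); rewrite starM !starK.
Qed.

End TensorAlgebras.
Arguments Kc {R} K.

Section AmplifiedMorphisms.
Variable R : realType.
Implicit Types (I J K N : choiceType).
Local Notation bop := (bop R).
Local Notation E := (Emx R).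

Section Amp1.
Variables (I I' K : choiceType) (A : set (bop I)) (B : set (bop I')) (F : bop I -> bop I').
Hypotheses (cA : calgn A) (cB : calgn B) (hF : mhom A B F).
Let cA' : calg A := proj1 cA.
Let cM : calg (multb A) := calg_multb cA'.
Let hM : csub (multb A). Proof. by case: cM. Qed.
Let m0 : multb A 0. Proof. by case: hM. Qed.
Let hF' : shom (multb A) F. Proof. by case: hF. Qed.
Let cK : calg (@Kc R K) := proj1 (calgn_Kc R K).
Let cAK : calg (bat A (@Kc R K)) := calg_bat cA' cK.
Local Notation M := (multb (bat A (@Kc R K))).
Local Notation ampF := (@amp1 R I I' K F).
Let Mblk (T : bop (I * K)%type) : M T -> blk (multb A) T := blk_multb cA'.

Lemma amp1_mulE T a k l : blk (multb A) T -> multb A a ->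
  ampF (T * bten a (E k l)) = ampF T * bten (F a) (E k l).
Proof.
move=> hT ha; have [_ MM _] := cM; have [_ FM _] := hF'.
have hb : blk (multb A) (T * bten a (E k l)).
  by move=> m n; rewrite rblock_mulE; apply: (csub_scale _ hM); apply: MM.
apply: rblock_inj => m n; rewrite (rblock_amp1 cM hF') // !rblock_mulE (rblock_amp1 cM hF') //.
by rewrite (homZ _ m0 hF') ?FM //; apply: MM.
Qed.

Lemma pblin_amp1 : pblin (blk (multb A)) ampF.
Proof.
split=> [a x y hx hy|]; first exact: (amp1L cM hF').
by exists 1 => // x hx; rewrite mul1r; exact: (nrm_amp1 cM hF').
Qed.

Lemma pblin_amp1M : pblin M ampF.
Proof. exact: (pblin_sub (fun T => @Mblk T) pblin_amp1). Qed.

Lemma amp1_faithful (X : bop (I' * K)%type) : (forall a k l, A a -> X * bten (F a) (E k l) = 0) -> X = 0.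
Proof.
move=> h; apply: rblock_inj => m k; rewrite (blinear0 (blinear_rblock R _ m k)).
apply: (faithfulR cA' (shomS (multb_in cA') hF') (mhom_faithful cA cB hF)) => a ha.
have := congr1 (rblock m k) (h a k k ha).
by rewrite rblock_mulE eqxx scale1r (blinear0 (blinear_rblock R _ m k)).
Qed.

(** Multiplicativity is checked first when the right factor is in A (x) K, by closedness from
    elementary tensors; the general case follows by testing against such elements and
    [amp1_faithful]. *)
Lemma shom_amp1 : shom M ampF.
Proof.
have AM := multb_in cA'; have [_ FM _] := hF'.
have cMM := calg_multb cAK; have [hMM MM MS] := cMM.
have [hAK AKM _] := cAK; have AKm := multb_in cAK.
have m1 S X : M S -> bat A (@Kc R K) X -> ampF (S * X) = ampF S * ampF X.
  move=> hS; move: X.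
  have hQ : csub [set X | M X /\ ampF (S * X) = ampF S * ampF X].
    apply: (pcsub_eq hMM); last exact: (pblin_compl pblin_amp1M (blinear_mull (ampF S))).
    by apply: (pblin_compr _ (blinear_mull S) pblin_amp1M) => x; exact: MM.
  suff /= H : bat A (@Kc R K) `<=` [set X | M X /\ ampF (S * X) = ampF S * ampF X] by move=> X /H[].
  apply: bat_E_sub => // a k l ha; split; first by apply: AKm; apply: bat_in => //; exact: Kc_in.
  by rewrite amp1_mulE ?(amp1_bten cM hF') //; auto.
split=> [c x y hx hy|S T hS hT|x /Mblk/(amp1_star cM hF')[] //].
  by apply: (amp1L cM hF'); exact: Mblk.
apply/eqP; rewrite -subr_eq0; apply/eqP; apply: amp1_faithful => a k l ha.
have hX : bat A (@Kc R K) (bten a (E k l)) by apply: bat_in => //; exact: Kc_in.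
rewrite -(amp1_bten cM hF' (E k l) (AM _ ha)). rewrite mulrBl -(m1 (S * T)) //; last exact: MM.
have [hTX _] := hT _ hX.
by rewrite -[S * T * _]mulrA m1 // m1 // mulrA subrr.
Qed.

Lemma amp1_1 : ampF 1 = 1.
Proof.
have [_ _ F1 _] := hF; rewrite -(t1_1 R I K) -bten1r (amp1_bten cM hF'); last exact: multb1.
by rewrite F1 bten1r t1_1.
Qed.

(** Nondegeneracy of F on b and the factorization of C through C C on c rewrite b (x) c as a limit
    of sums of (F a (x) c') y. *)
Lemma bat_mhom_gen (C : set (bop K)) : calgn C -> bat B C `<=`
  bcspan [set x | exists2 z, (exists2 a, A a & exists2 c, C c & z = bten (F a) c) & exists2 y, bat B C y & x = z * y].
Proof.
move=> cC; apply: bat_sub; first exact: bcspan_csub.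
have [_ _ _ nF] := hF; move=> b c /nF hb hc; move: b hb.
apply: bcdot_sub; first exact: csub_pre (blinear_btenl I' c) (bcspan_csub _).
move=> _ b [a ha <-] hb /=; have := calgn_idem cC hc; move: c {hc}.
apply: bcdot_sub; first exact: csub_pre (blinear_btenr K _) (bcspan_csub _).
move=> c c' hc hc' /=; apply: bcspan_in; exists (bten (F a) c); first by exists a => //; exists c.
by exists (bten b c'); [exact: bat_in|rewrite btenM].
Qed.

Lemma mhom_amp1 (C : set (bop K)) : calgn C -> mhom (bat A C) (bat B C) ampF.
Proof.
move=> cC; have [cC' nC] := cC; have [cB' nB] := cB.
have cAC := calg_bat cA' cC'; have cBC := calg_bat cB' cC'.
have sM : multb (bat A C) `<=` M by exact: multb_batK.
have hs : shom (multb (bat A C)) ampF by exact: shomS sM shom_amp1.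
have [_ ampM ampS] := hs; have AM := multb_in cA'.
have [_ _ MS] := calg_multb cAC; have [hBC BCM BCS] := cBC.
have [_ FB _ _] := hF.
have m1 T y : multb (bat A C) T -> bat B C y -> bat B C (ampF T * y).
  move=> hT /(bat_mhom_gen cC); move: y.
  apply: bcspan_sub; first exact: csub_pre (blinear_mull _) hBC.
  move=> _ [_ [a ha [c hc ->]] [y hy ->]] /=; rewrite mulrA.
  have hac := bat_in ha hc; have hac' := multb_in cAC hac.
  rewrite -(amp1_bten cM hF' c (AM _ ha)) -ampM //; have [+ _] := hT _ hac.
  move: (T * bten a c).
  suff H : bat A C `<=` [set x | M x /\ bat B C (ampF x * y)] by move=> x /H[].
  apply: bat_sub; first exact: (pcsub_pre (csub_multb (csub_bat A _)) pblin_amp1M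
     (csub_pre (blinear_mulr y) hBC)).
  move=> a' c' ha' hc'; split; first by apply: sM; apply: (multb_in cAC); exact: bat_in.
  rewrite /= (amp1_bten cM hF' c' (AM _ ha')).
  by have [] := multb_bten (FB _ (AM _ ha')) (multb_in cC' hc') hy.
split=> //; first last.
- move=> x /(bat_mhom_gen cC); apply: bcspanS => _ [_ [a ha [c hc ->]] [y hy ->]].
  apply: bcdot_in => //; exists (bten a c); first exact: bat_in.
  by rewrite (amp1_bten cM hF') //; exact: AM.
- exact: amp1_1.
move=> T hT y hy; split; first exact: m1.
rewrite -[X in bat B C X]starK starM -ampS //; apply: (BCS); apply: m1; first exact: MS.
exact: BCS.
Qed.

Lemma amp1_inj : (forall a, A a -> F a = 0 -> a = 0) -> forall T, blk (multb A) T -> ampF T = 0 -> T = 0.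
Proof.
move=> inj T hT T0; apply: rblock_inj => k l; rewrite (blinear0 (blinear_rblock R _ k l)).
apply: (mhom_inj cA cB hF inj (hT k l)).
by rewrite -(rblock_amp1 cM hF') // T0 (blinear0 (blinear_rblock R _ k l)).
Qed.
Lemma amp1_t1 m : multb A m -> ampF (t1 K m) = t1 K (F m).
Proof. by move=> hm; rewrite -!bten1r (amp1_bten cM hF'). Qed.
Lemma amp1_t2 y : ampF (t2 I y) = t2 I' y.
Proof. by have [_ _ F1 _] := hF; rewrite -!bten1l (amp1_bten cM hF') ?F1 //; exact: multb1. Qed.
End Amp1.
End AmplifiedMorphisms.

(** * Tensor products of morphisms and leg numbering *)

Section TensorMorphisms.
Variable R : realType.
Implicit Types (I J K L N : choiceType).
Local Notation bop := (bop R).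
Local Notation E := (Emx R).

Lemma multb_blk I K (A : set (bop I)) (C : set (bop K)) T k l : calg A -> calgn C ->
  multb (bat A C) T -> multb A (rblock k l T).
Proof. by move=> cA cC hT; apply: (blk_multb cA (multb_batK cA cC hT)). Qed.
Lemma multb_lblk I K (A : set (bop I)) (C : set (bop K)) T k l : calgn A -> calg C ->
  multb (bat A C) T -> multb C (lblock k l T).
Proof. by move=> cA cC hT; rewrite lblock_sw; apply: (multb_blk k l cC cA); exact: sw_multb_bat. Qed.

Lemma mhom_sw I K (A : set (bop I)) (C : set (bop K)) : calgn A -> calgn C ->
  mhom (bat A C) (bat C A) (@sw R I K).
Proof.
move=> cA cC; have cCA := calgn_bat cC cA; split.
- split=> [c x y _ _|x y _ _|x _]; [|exact: swM|exact: sw_star].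
  by have [-> _] := blinear_sw R I K.
- by move=> m; exact: sw_multb_bat.
- exact: sw1.
- move=> x /(calgn_idem cCA); apply: bcdotS => // y hy; exists (sw y); last exact: swK.
  exact: sw_bat.
Qed.

Definition amp2 I J K (G : bop J -> bop K) (T : bop (I * J)%type) : bop (I * K)%type :=
  sw (amp1 G (sw T)).

Section Amp2.
Variables (I J K : choiceType) (A : set (bop I)) (B : set (bop J)) (C : set (bop K)) (G : bop J -> bop K).
Hypotheses (cA : calgn A) (cB : calgn B) (cC : calgn C) (hG : mhom B C G).
Let cM : calg (multb B) := calg_multb (proj1 cB).
Let hG' : shom (multb B) G. Proof. by case: hG. Qed.

Lemma mhom_amp2 : mhom (bat A B) (bat A C) (@amp2 I J K G).
Proof.
have hBA := mhom_sw cA cB; have hCA := mhom_sw cC cA.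
have h1 := mhom_amp1 cB cC hG cA.
have h2 := mhom_comp (calgn_bat cA cB) (calgn_bat cB cA) (calgn_bat cC cA) hBA h1.
exact: mhom_comp (calgn_bat cA cB) (calgn_bat cC cA) (calgn_bat cA cC) h2 hCA.
Qed.
Lemma amp2_bten x y : multb B y -> @amp2 I J K G (bten x y) = bten x (G y).
Proof. by move=> hy; rewrite /amp2 sw_bten (amp1_bten cM hG' _ hy) sw_bten. Qed.
Lemma lblock_amp2 (T : bop (I * J)%type) i i' : (forall i i', multb B (lblock i i' T)) ->
  lblock i i' (amp2 G T) = G (lblock i i' T).
Proof.
move=> hT; rewrite /amp2 rblock_sw (rblock_amp1 cM hG') ?lblock_sw // => k l.
by rewrite -lblock_sw.
Qed.
Lemma amp2_t1 x : @amp2 I J K G (t1 J x) = t1 K x.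
Proof. by rewrite /amp2 sw_t1 (amp1_t2 cB hG) sw_t2. Qed.
Lemma amp2_t2 x : multb B x -> @amp2 I J K G (t2 I x) = t2 I (G x).
Proof. by move=> hx; rewrite /amp2 sw_t2 (amp1_t1 _ cB hG) // sw_t1. Qed.
Lemma amp2_inj : (forall a, B a -> G a = 0 -> a = 0) ->
  forall T : bop (I * J)%type, (forall i i', multb B (lblock i i' T)) -> amp2 G T = 0 -> T = 0.
Proof.
move=> inj T hT h; apply: lblock_inj => i i'; rewrite (blinear0 (blinear_lblock R J i i')).
apply: (mhom_inj cB cC hG inj (hT i i')); rewrite -lblock_amp2 // h.
by rewrite (blinear0 (blinear_lblock R _ i i')).
Qed.
End Amp2.

Lemma mhom_bat_uniq I J K (A : set (bop I)) (B : set (bop J)) (C C' : set (bop K)) F G :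
  calgn A -> calgn B -> calgn C -> mhom (bat A B) C F -> mhom (bat A B) C' G ->
  (forall a b, A a -> B b -> F (bten a b) = G (bten a b)) ->
  forall T, multb (bat A B) T -> F T = G T.
Proof.
move=> cA cB cC hF hG h; have cAB := calgn_bat cA cB; have [cAB' _] := cAB.
apply: (mhom_uniq cAB cC hF hG) => a.
have [hF' _ _ _] := hF; have [hG' _ _ _] := hG; have cM := calg_multb cAB'.
suff H : bat A B `<=` [set x | multb (bat A B) x /\ F x = G x] by move=> /H[].
apply: bat_sub; first exact: (hom_closed_eq cM hF' hG').
by move=> x y hx hy; split; [apply: (multb_in cAB'); exact: bat_in|exact: h].
Qed.

Lemma amp12 I I' J J' (A : set (bop I)) (A' : set (bop I')) (B : set (bop J)) (B' : set (bop J')) F G T :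
  calgn A -> calgn A' -> calgn B -> calgn B' -> mhom A A' F -> mhom B B' G ->
  multb (bat A B) T -> amp1 F (amp2 G T) = amp2 G (amp1 F T).
Proof.
move=> cA cA' cB cB' hF hG; move: T.
have AA := multb_in (proj1 cA); have BB := multb_in (proj1 cB).
have [hF' _ _ _] := hF; have cM := calg_multb (proj1 cA).
apply: (mhom_bat_uniq cA cB (calgn_bat cA' cB')).
- exact: (mhom_comp (calgn_bat cA cB) (calgn_bat cA cB') (calgn_bat cA' cB')
     (mhom_amp2 cA cB cB' hG) (mhom_amp1 cA cA' hF cB')).
- exact: (mhom_comp (calgn_bat cA cB) (calgn_bat cA' cB) (calgn_bat cA' cB')
     (mhom_amp1 cA cA' hF cB) (mhom_amp2 cA' cB cB' hG)).
move=> a b /AA ha /BB hb; rewrite (amp2_bten cB hG) // !(amp1_bten cM hF') //.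
by rewrite (amp2_bten cB hG).
Qed.

Lemma amp1_comp I I' I'' K (A : set (bop I)) (A' : set (bop I')) (A'' : set (bop I'')) F G T :
  calgn A -> calgn A' -> mhom A A' F -> mhom A' A'' G -> blk (multb A) T ->
  amp1 (K:=K) G (amp1 F T) = amp1 (fun x => G (F x)) T.
Proof.
move=> [cA _] [cA' _] [hF FA _ _] [hG _ _ _] hT; apply: rblock_inj => k l.
have cM := calg_multb cA; have cM' := calg_multb cA'.
have hb : blk (multb A') (amp1 F T) by move=> k' l'; rewrite (rblock_amp1 cM hF) //; exact: FA.
rewrite (rblock_amp1 cM' hG) // (rblock_amp1 cM hF) // (rblock_amp1 cM) //.
exact: shom_comp hF FA hG.
Qed.
Lemma amp1_eq I I' K (A : set (bop I)) (F G : bop I -> bop I') (T : bop (I * K)%type) :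
  calg A -> shom (multb A) F -> (forall x, multb A x -> F x = G x) -> blk (multb A) T ->
  amp1 F T = amp1 G T.
Proof.
move=> cA hF h hT; apply: rblock_inj => k l; have cM := calg_multb cA; have [[_ ML _] MM MS] := cM.
have hG : shom (multb A) G.
  have [h1 h2 h3] := hF; split=> [c x y hx hy|x y hx hy|x hx]; rewrite -!h; auto.
by rewrite (rblock_amp1 cM hF) // (rblock_amp1 cM hG) // h.
Qed.
Lemma amp1_id I K (A : set (bop I)) (F : bop I -> bop I) (T : bop (I * K)%type) :
  calg A -> (forall x, multb A x -> F x = x) -> blk (multb A) T -> amp1 F T = T.
Proof.
move=> cA h hT; have cM := calg_multb cA; have [[_ ML _] MM MS] := cM.
have hF : shom (multb A) F by split=> [c x y hx hy|x y hx hy|x hx]; rewrite !h //; auto.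
by apply: rblock_inj => k l; rewrite (rblock_amp1 cM hF) // h.
Qed.
Lemma blk_sw I J (B : set (bop J)) (T : bop (I * J)%type) :
  (forall i i', multb B (lblock i i' T)) -> blk (multb B) (sw T).
Proof. by move=> h k l; rewrite -lblock_sw. Qed.
Lemma amp2_comp I J J' J'' (B : set (bop J)) (B' : set (bop J')) (B'' : set (bop J'')) F G
    (T : bop (I * J)%type) :
  calgn B -> calgn B' -> mhom B B' F -> mhom B' B'' G -> (forall i i', multb B (lblock i i' T)) ->
  amp2 G (amp2 F T) = amp2 (fun x => G (F x)) T.
Proof. by move=> cB cB' hF hG hT; have hS := @blk_sw _ _ B T hT; rewrite /amp2 swK (amp1_comp cB cB' hF hG). Qed.
Lemma amp2_eq I J J' (B : set (bop J)) (F G : bop J -> bop J') (T : bop (I * J)%type) :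
  calg B -> shom (multb B) F -> (forall x, multb B x -> F x = G x) ->
  (forall i i', multb B (lblock i i' T)) -> amp2 F T = amp2 G T.
Proof. by move=> cB hF h hT; have hS := @blk_sw _ _ B T hT; rewrite /amp2 (amp1_eq cB hF h hS). Qed.
Lemma amp2_id I J (B : set (bop J)) (F : bop J -> bop J) (T : bop (I * J)%type) :
  calg B -> (forall x, multb B x -> F x = x) -> (forall i i', multb B (lblock i i' T)) -> amp2 F T = T.
Proof. by move=> cB h hT; have hS := @blk_sw _ _ B T hT; rewrite /amp2 (amp1_id cB) ?swK. Qed.

(* Leg numbering: l12, l13 and t2 act on I * (J * K), t1, r13 and r23 on (I * J) * K. *)
Definition l12 I J K (T : bop (I * J)%type) : bop (I * (J * K))%type :=
  opq (leg (fun n => (n.1, n.2.1)) (fun n => n.2.2) T).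
Definition l13 I J K (T : bop (I * K)%type) : bop (I * (J * K))%type :=
  opq (leg (fun n => (n.1, n.2.2)) (fun n => n.2.1) T).
Definition r13 I J K (T : bop (I * K)%type) : bop ((I * J) * K)%type :=
  opq (leg (fun n => (n.1.1, n.2)) (fun n => n.1.2) T).
Definition r23 I J K (T : bop (J * K)%type) : bop ((I * J) * K)%type :=
  opq (leg (fun n => (n.1.2, n.2)) (fun n => n.1.1) T).
Definition asc I J K (T : bop ((I * J) * K)%type) : bop (I * (J * K))%type :=
  opq (leg (fun n => ((n.1, n.2.1), n.2.2)) (fun=> tt) T).
Definition asr I J K (T : bop (I * (J * K))%type) : bop ((I * J) * K)%type :=
  opq (leg (fun n => (n.1.1, (n.1.2, n.2))) (fun=> tt) T).

Lemma bij_l12 I J K : bijective (fun n : I * (J * K) => ((n.1, n.2.1), n.2.2)).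
Proof. by exists (fun m => (m.1.1, (m.1.2, m.2))) => [[a [b c]]|[[a b] c]]. Qed.
Lemma bij_l13 I J K : bijective (fun n : I * (J * K) => ((n.1, n.2.2), n.2.1)).
Proof. by exists (fun m => (m.1.1, (m.2, m.1.2))) => [[a [b c]]|[[a b] c]]. Qed.
Lemma bij_r13 I J K : bijective (fun n : (I * J) * K => ((n.1.1, n.2), n.1.2)).
Proof. by exists (fun m => ((m.1.1, m.2), m.1.2)) => [[[a b] c]|[[a b] c]]. Qed.
Lemma bij_r23 I J K : bijective (fun n : (I * J) * K => ((n.1.2, n.2), n.1.1)).
Proof. by exists (fun m => ((m.2, m.1.1), m.1.2)) => [[[a b] c]|[[a b] c]]. Qed.
Lemma bij_asc I J K : bijective (fun n : I * (J * K) => (((n.1, n.2.1), n.2.2), tt)).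
Proof. by exists (fun m => (m.1.1.1, (m.1.1.2, m.1.2))) => [[a [b c]]|[[[a b] c] []]]. Qed.
Lemma bij_asr I J K : bijective (fun n : (I * J) * K => ((n.1.1, (n.1.2, n.2)), tt)).
Proof. by exists (fun m => ((m.1.1, m.1.2.1), m.1.2.2)) => [[[a b] c]|[[a [b c]] []]]. Qed.

Lemma l12E I J K (T : bop (I * J)%type) p q :
  l12 K T p q = T (p.1, p.2.1) (q.1, q.2.1) * (p.2.2 == q.2.2)%:R.
Proof. by rewrite /l12 opqE legE //; exact: bij_inj (bij_l12 I J K). Qed.
Lemma l13E I J K (T : bop (I * K)%type) p q :
  l13 J T p q = T (p.1, p.2.2) (q.1, q.2.2) * (p.2.1 == q.2.1)%:R.
Proof. by rewrite /l13 opqE legE //; exact: bij_inj (bij_l13 I J K). Qed.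
Lemma r13E I J K (T : bop (I * K)%type) p q :
  r13 J T p q = T (p.1.1, p.2) (q.1.1, q.2) * (p.1.2 == q.1.2)%:R.
Proof. by rewrite /r13 opqE legE //; exact: bij_inj (bij_r13 I J K). Qed.
Lemma r23E I J K (T : bop (J * K)%type) p q :
  r23 I T p q = T (p.1.2, p.2) (q.1.2, q.2) * (p.1.1 == q.1.1)%:R.
Proof. by rewrite /r23 opqE legE //; exact: bij_inj (bij_r23 I J K). Qed.
Lemma ascE I J K (T : bop ((I * J) * K)%type) p q :
  asc T p q = T ((p.1, p.2.1), p.2.2) ((q.1, q.2.1), q.2.2).
Proof. by rewrite /asc opqE legE ?eqxx ?mulr1 //; exact: bij_inj (bij_asc I J K). Qed.
Lemma asrE I J K (T : bop (I * (J * K))%type) p q :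
  asr T p q = T (p.1.1, (p.1.2, p.2)) (q.1.1, (q.1.2, q.2)).
Proof. by rewrite /asr opqE legE ?eqxx ?mulr1 //; exact: bij_inj (bij_asr I J K). Qed.

Definition uhom I J (f : bop I -> bop J) : Prop := shom setT f /\ f 1 = 1.
Lemma uhom_leg N (P Q : choiceType) (h : N -> P) (c : N -> Q) : bijective (fun n => (h n, c n)) ->
  uhom (fun x : bop P => opq (leg h c x)).
Proof.
move=> b; split; last by rewrite opqE (leg1 R b).
by have [h1 h2 h3] := leg_hom R b; split=> *; rewrite !opqE; auto.
Qed.
Lemma uhom_l12 I J K : uhom (@l12 I J K). Proof. exact: uhom_leg (bij_l12 I J K). Qed.
Lemma uhom_l13 I J K : uhom (@l13 I J K). Proof. exact: uhom_leg (bij_l13 I J K). Qed.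
Lemma uhom_r23 I J K : uhom (@r23 I J K). Proof. exact: uhom_leg (bij_r23 I J K). Qed.
Lemma uhom_asc I J K : uhom (@asc I J K). Proof. exact: uhom_leg (bij_asc I J K). Qed.
Lemma uhom_asr I J K : uhom (@asr I J K). Proof. exact: uhom_leg (bij_asr I J K). Qed.
Lemma uhom_t1 I J : uhom (@t1 R I J). Proof. exact: uhom_leg (bij_id2 I J). Qed.
Lemma uhom_t2 I J : uhom (@t2 R I J). Proof. exact: uhom_leg (bij_sw2 I J). Qed.
Lemma uhomM I J (f : bop I -> bop J) x y : uhom f -> f (x * y) = f x * f y.
Proof. by move=> [[_ h _] _]; exact: h. Qed.
Lemma uhom_star I J (f : bop I -> bop J) x : uhom f -> f (star x) = star (f x).
Proof. by move=> [[_ _ h] _]; exact: h. Qed.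
Lemma calg_setT I : calg (setT : set (bop I)).
Proof. by []. Qed.
Lemma blinear_uhom I J (f : bop I -> bop J) : uhom f -> blinear f.
Proof.
move=> [h _]; split; first by move=> a x y; have [h1 _ _] := h; exact: h1.
by exists 1 => // x; rewrite mul1r; exact: (hom_contr (calg_setT I) h Logic.I).
Qed.
Lemma ascK I J K (T : bop ((I * J) * K)%type) : asr (asc T) = T.
Proof. by apply: bopP => -[[a b] c] [[a' b'] c']; rewrite asrE ascE. Qed.
Lemma asrK I J K (T : bop (I * (J * K))%type) : asc (asr T) = T.
Proof. by apply: bopP => -[a [b c]] [a' [b' c']]; rewrite ascE asrE. Qed.
Lemma asc_t1 I J K (T : bop (I * J)%type) : asc (t1 K T) = l12 K T.
Proof. by apply: bopP => p q; rewrite ascE l12E t1E. Qed.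
Lemma asc_r13 I J K (T : bop (I * K)%type) : asc (r13 J T) = l13 J T.
Proof. by apply: bopP => p q; rewrite ascE l13E r13E. Qed.
Lemma asc_r23 I J K (T : bop (J * K)%type) : asc (r23 I T) = t2 I T.
Proof. by apply: bopP => p q; rewrite ascE r23E t2E mulrC -!surjective_pairing. Qed.
Lemma asc_bten I J K (x : bop I) (y : bop J) (z : bop K) :
  asc (bten (bten x y) z) = bten x (bten y z).
Proof. by apply: bopP => p q; rewrite ascE !btenE mulrA. Qed.

Lemma lblock_l12 I J K (T : bop (I * J)%type) i i' : lblock i i' (l12 K T) = t1 K (lblock i i' T).
Proof. by apply: bopP => p q; rewrite t1E !lblockE l12E. Qed.
Lemma lblock_l13 I J K (T : bop (I * K)%type) i i' : lblock i i' (l13 J T) = t2 J (lblock i i' T).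
Proof. by apply: bopP => p q; rewrite t2E !lblockE l13E mulrC. Qed.
Lemma rblock_r13 I J K (T : bop (I * K)%type) i i' : rblock i i' (r13 J T) = t1 J (rblock i i' T).
Proof. by apply: bopP => p q; rewrite t1E !rblockE r13E. Qed.
Lemma rblock_r23 I J K (T : bop (J * K)%type) i i' : rblock i i' (r23 I T) = t2 I (rblock i i' T).
Proof. by apply: bopP => p q; rewrite t2E !rblockE r23E mulrC. Qed.
Lemma lblock_t2l I J (x : bop J) (T : bop (I * J)%type) i i' :
  lblock i i' (t2 I x * T) = x * lblock i i' T.
Proof. by rewrite !lblock_sw swM sw_t2 rblock_t1l. Qed.
Lemma lblock_t2r I J (x : bop J) (T : bop (I * J)%type) i i' :
  lblock i i' (T * t2 I x) = lblock i i' T * x.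
Proof. by rewrite !lblock_sw swM sw_t2 rblock_t1r. Qed.

(** A conjugation applied in each block is again a conjugation. This turns identities for
    comultiplications into identities between legs of W. *)
Lemma amp1_Ad I L K (A : set (bop I)) (F : bop I -> bop (I * L)%type) u T :
  calg A -> shom (multb A) F -> (forall x, multb A x -> F x = u * t1 L x * star u) ->
  blk (multb A) T -> amp1 (K:=K) F T = t1 K u * r13 L T * t1 K (star u).
Proof.
move=> cA hF h hT; apply: rblock_inj => k l; rewrite (rblock_amp1 (calg_multb cA) hF) //.
by rewrite rblock_t1r rblock_t1l rblock_r13 h.
Qed.
Lemma amp2_Ad I L K (A : set (bop I)) (B : set (bop (I * L)%type)) (F : bop I -> bop (I * L)%type) u T :
  calgn A -> mhom A B F -> (forall x, multb A x -> F x = u * t1 L x * star u) ->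
  (forall k l, multb A (lblock k l T)) -> amp2 (I:=K) F T = t2 K u * l12 L T * t2 K (star u).
Proof.
move=> cA hF h hT; apply: lblock_inj => k l; rewrite (lblock_amp2 cA hF) //.
by rewrite lblock_t2r lblock_t2l lblock_l12 h.
Qed.
End TensorMorphisms.

Section Naturality.
Variable R : realType.
Implicit Types (I J K L N : choiceType).
Local Notation bop := (bop R).

Lemma mhomM I J (A : set (bop I)) (B : set (bop J)) F x : mhom A B F -> multb A x -> multb B (F x).
Proof. by move=> [_ h _ _]; exact: h. Qed.
Lemma mhomX I J (A : set (bop I)) (B : set (bop J)) F x y : mhom A B F -> multb A x -> multb A y ->
  F (x * y) = F x * F y.
Proof. by move=> [[_ h _] _ _ _]; exact: h. Qed.
Lemma mhom_star I J (A : set (bop I)) (B : set (bop J)) F x : mhom A B F -> multb A x ->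
  F (star x) = star (F x).
Proof. by move=> [[_ _ h] _ _ _]; exact: h. Qed.
Lemma mhomS I J (A : set (bop I)) (B : set (bop J)) F : mhom A B F -> shom (multb A) F.
Proof. by case. Qed.
Lemma mhomE I J (A : set (bop I)) (B : set (bop J)) F G : calg A -> (forall x, multb A x -> G x = F x) ->
  mhom A B F -> mhom A B G.
Proof.
move=> cA h [[h1 h2 h3] h4 h5 h6]; have [[_ ML _] MM MS] := calg_multb cA; split.
- by split=> [c x y hx hy|x y hx hy|x hx]; rewrite !h; auto.
- by move=> m hm; rewrite h //; exact: h4.
- by rewrite h //; exact: multb1.
- by move=> b /h6; apply: bcdotS => // _ [a ha <-]; exists a; rewrite ?h //; exact: multb_in.
Qed.
Lemma multbM I (A : set (bop I)) x y : calg A -> multb A x -> multb A y -> multb A (x * y).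
Proof. by move=> /calg_multb[_ h _]; exact: h. Qed.
Lemma multb_star I (A : set (bop I)) x : calg A -> multb A x -> multb A (star x).
Proof. by move=> /calg_multb[_ _ h]; exact: h. Qed.

Lemma uhom_pre I J (A : set (bop I)) (f : bop I -> bop J) : uhom f -> shom A f.
Proof.
move=> [[h1 h2 h3] _]; split=> [c x y _ _|x y _ _|x _].
- exact: (h1 c x y Logic.I Logic.I).
- exact: (h2 x y Logic.I Logic.I).
- exact: (h3 x Logic.I).
Qed.
Lemma mhom_t1 I J (A : set (bop I)) (B : set (bop J)) : calgn A -> calgn B -> mhom A (bat A B) (@t1 R I J).
Proof.
move=> cA cB; split; [exact: uhom_pre _ (uhom_t1 R I J)| |exact: t1_1|].
  by move=> m hm; rewrite -bten1r; apply: multb_bten => //; exact: multb1.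
apply: bat_sub; first exact: bcdot_csub.
move=> a b /(calgn_idem cA) + hb; move: a.
apply: bcdot_sub; first exact: csub_pre (blinear_btenl I b) (bcdot_csub _ _).
move=> a a' ha ha' /=; rewrite -[b]mul1r -btenM bten1r.
by apply: bcdot_in; [exists a|exact: bat_in].
Qed.
Lemma mhom_t2 I J (A : set (bop I)) (B : set (bop J)) : calgn A -> calgn B -> mhom B (bat A B) (@t2 R I J).
Proof.
move=> cA cB; have h := mhom_comp cB (calgn_bat cB cA) (calgn_bat cA cB) (mhom_t1 cB cA) (mhom_sw cB cA).
by apply: (mhomE (proj1 cB) _ h) => x _; rewrite sw_t1.
Qed.

Lemma shom_ad I (P : set (bop I)) (u : bop I) : u * star u = 1 -> shom P (fun y => star u * y * u).
Proof.
move=> uu; split=> [c x y _ _|x y _ _|x _]; last by rewrite !starM starK mulrA.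
  by rewrite mulrDr mulrDl -bscalerAr -bscalerAl.
by rewrite -!mulrA (mulrA u (star u)) uu mul1r.
Qed.
Lemma amp1_t1E I J K (T : bop (I * K)%type) : amp1 (@t1 R I J) T = r13 J T.
Proof.
apply: rblock_inj => k l; rewrite (rblock_amp1 (calg_setT R I) (uhom_pre _ (uhom_t1 R I J))) //.
by rewrite rblock_r13.
Qed.
Lemma amp1_t2E I J K (T : bop (J * K)%type) : amp1 (@t2 R I J) T = r23 I T.
Proof.
apply: rblock_inj => k l; rewrite (rblock_amp1 (calg_setT R J) (uhom_pre _ (uhom_t2 R I J))) //.
by rewrite rblock_r23.
Qed.
Lemma amp2_t1E I J K (T : bop (I * J)%type) : amp2 (@t1 R J K) T = l12 K T.
Proof.
apply: lblock_inj => k l; rewrite /amp2 rblock_sw (rblock_amp1 (calg_setT R J) (uhom_pre _ (uhom_t1 R J K))) //.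
by rewrite lblock_l12 lblock_sw.
Qed.
Lemma amp2_t2E I J K (T : bop (I * K)%type) : amp2 (@t2 R J K) T = l13 J T.
Proof.
apply: lblock_inj => k l; rewrite /amp2 rblock_sw (rblock_amp1 (calg_setT R K) (uhom_pre _ (uhom_t2 R J K))) //.
by rewrite lblock_l13 lblock_sw.
Qed.

Section Three.
Variables (I J K : choiceType) (A : set (bop I)) (B : set (bop J)) (C : set (bop K)).
Hypotheses (cA : calgn A) (cB : calgn B) (cC : calgn C).

Lemma mhom_r13 : mhom (bat A C) (bat (bat A B) C) (@r13 R I J K).
Proof.
have h := mhom_amp1 cA (calgn_bat cA cB) (mhom_t1 cA cB) cC.
by apply: (mhomE (proj1 (calgn_bat cA cC)) _ h) => x _; rewrite amp1_t1E.
Qed.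
Lemma mhom_r23 : mhom (bat B C) (bat (bat A B) C) (@r23 R I J K).
Proof.
have h := mhom_amp1 cB (calgn_bat cA cB) (mhom_t2 cA cB) cC.
by apply: (mhomE (proj1 (calgn_bat cB cC)) _ h) => x _; rewrite amp1_t2E.
Qed.
Lemma mhom_l12 : mhom (bat A B) (bat A (bat B C)) (@l12 R I J K).
Proof.
have h := mhom_amp2 cA cB (calgn_bat cB cC) (mhom_t1 cB cC).
by apply: (mhomE (proj1 (calgn_bat cA cB)) _ h) => x _; rewrite amp2_t1E.
Qed.
Lemma mhom_l13 : mhom (bat A C) (bat A (bat B C)) (@l13 R I J K).
Proof.
have h := mhom_amp2 cA cC (calgn_bat cB cC) (mhom_t2 cB cC).
by apply: (mhomE (proj1 (calgn_bat cA cC)) _ h) => x _; rewrite amp2_t2E.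
Qed.

Lemma bat3l_sub (P : set (bop ((I * J) * K)%type)) : csub P ->
  (forall a b c, A a -> B b -> C c -> P (bten (bten a b) c)) -> bat (bat A B) C `<=` P.
Proof.
move=> hP h; apply: bat_sub => // x c + hc; move: x.
apply: bat_sub; first exact: csub_pre (blinear_btenl _ c) hP.
by move=> a b ha hb; exact: h.
Qed.
Lemma bat3r_sub (P : set (bop (I * (J * K))%type)) : csub P ->
  (forall a b c, A a -> B b -> C c -> P (bten a (bten b c))) -> bat A (bat B C) `<=` P.
Proof.
move=> hP h; apply: bat_sub => // a x ha; move: x.
apply: bat_sub; first exact: csub_pre (blinear_btenr _ a) hP.
by move=> b c hb hc; exact: h.
Qed.
Lemma asc_bat x : bat (bat A B) C x -> bat A (bat B C) (asc x).
Proof.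
move: x; apply: bat3l_sub; first exact: csub_pre (blinear_uhom (uhom_asc R I J K)) (csub_bat _ _).
by move=> a b c ha hb hc /=; rewrite asc_bten; apply: bat_in => //; exact: bat_in.
Qed.
Lemma asr_bten (x : bop I) (y : bop J) (z : bop K) : asr (bten x (bten y z)) = bten (bten x y) z.
Proof. by rewrite -asc_bten ascK. Qed.
Lemma asr_bat x : bat A (bat B C) x -> bat (bat A B) C (asr x).
Proof.
move: x; apply: bat3r_sub; first exact: csub_pre (blinear_uhom (uhom_asr R I J K)) (csub_bat _ _).
by move=> a b c ha hb hc /=; rewrite asr_bten; apply: bat_in => //; exact: bat_in.
Qed.
Lemma ascM (x y : bop ((I * J) * K)%type) : asc (x * y) = asc x * asc y.
Proof. exact: (uhomM _ _ (uhom_asc R I J K)). Qed.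
Lemma asrM (x y : bop (I * (J * K))%type) : asr (x * y) = asr x * asr y.
Proof. exact: (uhomM _ _ (uhom_asr R I J K)). Qed.
Lemma mhom_asc : mhom (bat (bat A B) C) (bat A (bat B C)) (@asc R I J K).
Proof.
split; [exact: uhom_pre _ (uhom_asc R I J K)| |by case: (uhom_asc R I J K)|].
  move=> m hm x hx; have [h1 h2] := hm _ (asr_bat hx).
  by split; rewrite -[x]asrK -ascM; exact: asc_bat.
move=> x /(calgn_idem (calgn_bat cA (calgn_bat cB cC))); apply: bcdotS => // y hy.
by exists (asr y); [exact: asr_bat|exact: asrK].
Qed.
End Three.
Lemma asr_l12 I J K (T : bop (I * J)%type) : asr (l12 K T) = t1 K T.
Proof. by rewrite -asc_t1 ascK. Qed.
Lemma asr_l13 I J K (T : bop (I * K)%type) : asr (l13 J T) = r13 J T.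
Proof. by rewrite -asc_r13 ascK. Qed.
Lemma asr_t2 I J K (T : bop (J * K)%type) : asr (t2 I T) = r23 I T.
Proof. by rewrite -asc_r23 ascK. Qed.

Definition sw12 I J K (T : bop ((I * J) * K)%type) : bop ((J * I) * K)%type :=
  opq (leg (fun n => ((n.1.2, n.1.1), n.2)) (fun=> tt) T).
Lemma bij_sw12 I J K : bijective (fun n : (J * I) * K => (((n.1.2, n.1.1), n.2), tt)).
Proof. by exists (fun m => ((m.1.1.2, m.1.1.1), m.1.2)) => [[[a b] c]|[[[a b] c] []]]. Qed.
Lemma uhom_sw12 I J K : uhom (@sw12 I J K). Proof. exact: uhom_leg (bij_sw12 I J K). Qed.
Lemma sw12E I J K (T : bop ((I * J) * K)%type) p q :
  sw12 T p q = T ((p.1.2, p.1.1), p.2) ((q.1.2, q.1.1), q.2).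
Proof. by rewrite /sw12 opqE legE ?eqxx ?mulr1 //; exact: bij_inj (bij_sw12 I J K). Qed.
Lemma rblock_sw12 I J K (T : bop ((I * J) * K)%type) k l : rblock k l (sw12 T) = sw (rblock k l T).
Proof. by apply: bopP => p q; rewrite swE !rblockE sw12E. Qed.
Lemma sw12_r13 I J K (T : bop (I * K)%type) : sw12 (r13 J T) = r23 J T.
Proof. by apply: bopP => p q; rewrite sw12E r13E r23E. Qed.
Lemma sw12_r23 I J K (T : bop (J * K)%type) : sw12 (r23 I T) = r13 I T.
Proof. by apply: bopP => p q; rewrite sw12E r13E r23E. Qed.

Section AmpLegs.
Variables (I I' : choiceType) (A : set (bop I)) (A' : set (bop I')) (F : bop I -> bop I').
Hypotheses (cA : calgn A) (cA' : calgn A') (hF : mhom A A' F).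
Let cM := calg_multb (proj1 cA).
Let hF' := mhomS hF.

Lemma amp1_amp1_r13 J K (T : bop (I * K)%type) : blk (multb A) T ->
  amp1 (amp1 (K:=J) F) (r13 J T) = r13 J (amp1 F T).
Proof.
move=> hT; have h := mhom_amp1 cA cA' hF (calgn_Kc R J).
apply: rblock_inj => k l; rewrite (rblock_amp1 (calg_multb (proj1 (calgn_bat cA (calgn_Kc R J)))) (mhomS h)).
  by rewrite !rblock_r13 (rblock_amp1 cM hF') // (amp1_t1 _ cA hF).
by move=> k' l'; rewrite rblock_r13; apply: (mhomM (mhom_t1 cA (calgn_Kc R J))).
Qed.
Lemma amp1_amp1_r23 J K (T : bop (J * K)%type) :
  amp1 (amp1 F) (r23 I T) = r23 I' T.
Proof.
have h := mhom_amp1 cA cA' hF (calgn_Kc R J).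
apply: rblock_inj => k l; rewrite (rblock_amp1 (calg_multb (proj1 (calgn_bat cA (calgn_Kc R J)))) (mhomS h)).
  by rewrite !rblock_r23 (amp1_t2 cA hF).
move=> k' l'; rewrite rblock_r23; apply: (mhomM (mhom_t2 cA (calgn_Kc R J))).
exact: multb_Kc.
Qed.
End AmpLegs.
End Naturality.

(** * The comultiplication of the universal dual *)

Section DualComultiplication.
Variables (R : realType) (L K : choiceType).
Local Notation bop := (bop R).
Variables (W : bop (L * L)%type) (A Ah : set (bop L)) (D : bop L -> bop (L * L)%type).
Hypotheses (cA : calgn A) (hD : mhom A (bat A A) D).
Hypotheses (WW : star W * W = 1) (DW : forall x, multb A x -> D x = W * t1 L x * star W).
Variables (Au : set (bop K)) (V : bop (K * L)%type) (Du : bop K -> bop (K * K)%type) (Lam : bop K -> bop L).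
Hypotheses (cAu : calgn Au) (cAh : calgn Ah) (VM : multb (bat Au A) V) (VV : star V * V = 1) (VV' : V * star V = 1).
Hypotheses (Ab : Au `<=` bcspan [set x | exists k l, x = rblock k l V]).
Hypotheses (DV : amp2 D V = l12 L V * l13 L V).
Hypotheses (hDu : mhom Au (bat Au Au) Du) (DuV : asc (amp1 Du V) = t2 K V * l13 K V).
Hypotheses (hL : mhom Au Ah Lam) (LV : amp1 Lam V = W).

(** The character relation T_23 T_13 for [amp1 Du T] is sliced in its last leg; Lam is applied to
    the first leg and the first two legs are exchanged. *)
Lemma Du_bichar_block (Q : choiceType) (cQ : set (bop Q)) (T : bop (K * Q)%type) k l : calgn cQ ->
  multb (bat Au cQ) T -> amp1 Du T = r23 K T * r13 K T ->
  sw (amp1 Lam (Du (rblock k l T))) = rblock k l (r13 L T * r23 K (amp1 Lam T)).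
Proof.
move=> hQ hT E; have [cAu' _] := cAu; have hb : blk (multb Au) T by move=> i j; exact: (multb_blk _ _ cAu' hQ hT).
have cM := calg_multb cAu'; have cAA := calgn_bat cAu cAu.
have h := mhom_amp1 cAu cAh hL cAu.
rewrite -(rblock_amp1 cM (mhomS hDu)) // E.
have m13 := mhomM (mhom_r13 cAu cAu hQ) hT; have m23 := mhomM (mhom_r23 cAu cAu hQ) hT.
have m := multbM (proj1 (calgn_bat cAA hQ)) m23 m13.
rewrite -(rblock_amp1 (calg_multb (proj1 cAA)) (mhomS h)); last first.
  by move=> i j; exact: (multb_blk _ _ (proj1 cAA) hQ m).
have h2 := mhom_amp1 cAA (calgn_bat cAh cAu) h hQ.
rewrite (mhomX h2 m23 m13) (amp1_amp1_r23 cAu cAh hL) (amp1_amp1_r13 cAu cAh hL) //.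
by rewrite -rblock_sw12 (uhomM _ _ (uhom_sw12 R _ _ _)) sw12_r23 sw12_r13.
Qed.

(** As D is conjugation by W, the character relation for V reads V_12 V_13 W_23 = W_23 V_12;
    multiplying by the adjoint of V_12 gives the claim. *)
Lemma V_pentagon : star (t1 L V) * r23 K W * t1 L V = r13 L V * r23 K W.
Proof.
have e : l12 L V * l13 L V = t2 K W * l12 L V * t2 K (star W).
  by rewrite -DV; apply: (amp2_Ad cA hD DW) => k l; exact: (multb_lblk _ _ cAu (proj1 cA) VM).
have e1 : l12 L V * l13 L V * t2 K W = t2 K W * l12 L V.
  by rewrite e -(mulrA (t2 K W * l12 L V)) -(t2M _ (star W) W) WW t2_1 mulr1.
have := congr1 (fun X => asr X) e1; rewrite (asrM (l12 L V * l13 L V) (t2 K W)) (asrM (l12 L V) (l13 L V)).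
rewrite (asrM (t2 K W) (l12 L V)) asr_l12 asr_l13 asr_t2 => e2.
rewrite -(mulrA (star (t1 L V))) -e2 -(mulrA (t1 L V)) mulrA -t1_star.
by rewrite -(t1M _ (star V) V) VV t1_1 mul1r.
Qed.

(** Both sides are homomorphisms in x, so x may be taken to be a slice of V; there the identity is
    [V_pentagon] combined with the character relation for Du. *)
Lemma Du_conj x : multb Au x -> star V * t2 K (Lam x) * V = sw (amp1 Lam (Du x)).
Proof.
have [cAu' _] := cAu; have AuM := multb_in cAu'.
have cUU := calgn_bat cAu cAu; have cHU := calgn_bat cAh cAu; have cUH := calgn_bat cAu cAh.
have h2 : mhom Au (bat Au Ah) (fun x => sw (amp1 Lam (Du x))).
  exact: (mhom_comp cAu cHU cUH (mhom_comp cAu cUU cHU hDu (mhom_amp1 cAu cAh hL cAu)) (mhom_sw cAh cAu)).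
have h1 : shom (multb Au) (fun x => star V * t2 K (Lam x) * V).
  apply: (shom_comp (Q := setT) (G := fun z => star V * t2 K z * V) (mhomS hL)) => //.
  apply: (shom_comp (Q := setT) (G := fun y => star V * y * V) (uhom_pre _ (uhom_t2 R K L))) => //.
  exact: (shom_ad _ VV').
move: x => y hy; apply/esym; move: y hy.
apply: (shom_uniq cAu' (mhom_faithful cAu cUH h2) (mhomS h2) h1) => x /Ab.
have cM := calg_multb cAu'.
suff H : bcspan [set x | exists k l, x = rblock k l V] `<=`
   [set x | multb Au x /\ sw (amp1 Lam (Du x)) = star V * t2 K (Lam x) * V] by move=> /H[].
apply: bcspan_sub; first exact: (hom_closed_eq cM (mhomS h2) h1).
move=> _ [k [l ->]]; have hb k' l' := multb_blk k' l' cAu' cA VM; split; first exact: hb.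
rewrite (Du_bichar_block _ _ cA VM); last by rewrite -[LHS]ascK DuV asrM asr_t2 asr_l13.
rewrite LV -V_pentagon -t1_star rblock_t1r rblock_t1l rblock_r23 -LV.
by rewrite (rblock_amp1 cM (mhomS hL)).
Qed.

(** Slice by slice this is [Du_conj]. It extends the pentagon relation of V to every T that is a
    character for Du. *)
Lemma Du_bichar (Q : choiceType) (cQ : set (bop Q)) (T : bop (K * Q)%type) : calgn cQ ->
  multb (bat Au cQ) T -> amp1 Du T = r23 K T * r13 K T ->
  star (t1 Q V) * r23 K (amp1 Lam T) * t1 Q V = r13 L T * r23 K (amp1 Lam T).
Proof.
move=> hQ hT E; have [cAu' _] := cAu; apply: rblock_inj => k l.
have hb k' l' := multb_blk k' l' cAu' hQ hT.
rewrite -(Du_bichar_block _ _ hQ hT E) -Du_conj; last exact: hb.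
by rewrite -t1_star rblock_t1r rblock_t1l rblock_r23 (rblock_amp1 (calg_multb cAu') (mhomS hL)).
Qed.
End DualComultiplication.

(** * C*-quantum groups *)

Section QuantumGroup.
Variables (R : realType) (L : choiceType).
Local Notation bop := (bop R).
Local Notation E := (Emx R).
Implicit Types (I J K N : choiceType).

(** The quantum group in terms of bounded operators. The slices by normal functionals that define A
    and its dual are replaced by matrix-unit blocks, which have the same closed span by [lslicesE]
    and [rslicesE]. *)
Record qg (W : bop (L * L)%type) (A Ah : set (bop L)) (D Dh : bop L -> bop (L * L)%type) : Prop := Qg {
  qg_A : calgn A; qg_Ah : calgn Ah;
  qg_M : multb (bat Ah A) W; qg_l : star W * W = 1; qg_r : W * star W = 1;
  qg_pent : t2 L W * l12 L W = l12 L W * l13 L W * t2 L W;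
  qg_Ab : A = bcspan [set x | exists i i', x = lblock i i' W];
  qg_Ahb : Ah = bcspan [set x | exists i i', x = rblock i i' W];
  qg_D : mhom A (bat A A) D; qg_Dh : mhom Ah (bat Ah Ah) Dh;
  qg_DW : amp2 D W = l12 L W * l13 L W;
  qg_DhW : asc (amp1 Dh W) = t2 L W * l13 L W }.

Variables (W : bop (L * L)%type) (A Ah : set (bop L)) (D Dh : bop L -> bop (L * L)%type).
Hypothesis G : qg W A Ah D Dh.
Let cA := qg_A G. Let cAh := qg_Ah G. Let WW := qg_l G. Let WW' := qg_r G. Let WM := qg_M G.
Let cA' := proj1 cA. Let cAh' := proj1 cAh.

(** On slices of W this formula is the pentagon equation, and homomorphisms that agree on the slices
    agree on multipliers. *)
Lemma D_conj x : multb A x -> D x = W * t1 L x * star W.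
Proof.
have hD := qg_D G; have hAd : shom (multb A) (fun y => W * t1 L y * star W).
  apply: (shom_comp (Q := setT) (G := fun y => W * y * star W) (uhom_pre _ (uhom_t1 R L L))) => //.
  by have := @shom_ad R _ setT (star W); rewrite starK; apply.
move: x; apply: (shom_uniq cA' (mhom_faithful cA (calgn_bat cA cA) hD) (mhomS hD) hAd) => x.
rewrite {1}(qg_Ab G) => hx.
suff [] : [set x | multb A x /\ D x = W * t1 L x * star W] x by [].
move: x hx; apply: bcspan_sub; first exact: (hom_closed_eq (calg_multb cA') (mhomS hD) hAd).
move=> _ [k [l ->]]; split; first exact: (multb_lblk k l cAh cA' WM).
rewrite -(lblock_amp2 cA hD) ?(qg_DW G); last by move=> i j; exact: (multb_lblk i j cAh cA' WM).
have -> : l12 L W * l13 L W = t2 L W * l12 L W * t2 L (star W).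
  by rewrite (qg_pent G) -(mulrA (l12 L W * l13 L W)) -(t2M L W (star W)) WW' t2_1 mulr1.
by rewrite lblock_t2r lblock_t2l lblock_l12.
Qed.

Lemma sw12_t1 I J K (T : bop (I * J)%type) : sw12 (t1 K T) = t1 K (sw T).
Proof. by apply: bopP => p q; rewrite sw12E !t1E swE. Qed.

(** The pentagon equation, solved for W_13 W_23 and with its first two legs exchanged, says that the
    flipped adjoint of W implements the dual comultiplication. *)
Lemma Dh_conj x : multb Ah x -> Dh x = sw (star W) * t1 L x * star (sw (star W)).
Proof.
have hD := qg_Dh G; have UU : star (sw (star W)) * sw (star W) = 1.
  by rewrite -sw_star starK -swM WW' sw1.
have hAd : shom (multb Ah) (fun y => sw (star W) * t1 L y * star (sw (star W))).
  apply: (shom_comp (Q := setT) (G := fun y => sw (star W) * y * star (sw (star W))) (uhom_pre _ (uhom_t1 R L L))) => //.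
  by have := @shom_ad R _ setT (star (sw (star W))); rewrite starK; apply.
move: x; apply: (shom_uniq cAh' (mhom_faithful cAh (calgn_bat cAh cAh) hD) (mhomS hD) hAd) => x.
rewrite {1}(qg_Ahb G) => hx.
suff [] : [set x | multb Ah x /\ Dh x = sw (star W) * t1 L x * star (sw (star W))] x by [].
move: x hx; apply: bcspan_sub; first exact: (hom_closed_eq (calg_multb cAh') (mhomS hD) hAd).
move=> _ [k [l ->]]; have hb i j := multb_blk i j cAh' cA WM; split; first exact: hb.
rewrite -(rblock_amp1 (calg_multb cAh') (mhomS hD)) // -[amp1 Dh W]ascK (qg_DhW G).
rewrite (asrM (t2 L W) (l13 L W)) asr_t2 asr_l13.
have e1 : t1 L (star W) * r23 L W * t1 L W = r13 L W * r23 L W.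
  have := congr1 (fun X => asr X) (qg_pent G); rewrite (asrM (t2 L W) (l12 L W)).
  rewrite (asrM (l12 L W * l13 L W)) (asrM (l12 L W)) asr_t2 asr_l12 asr_l13 => e.
  by rewrite -(mulrA (t1 L (star W))) e -(mulrA (t1 L W)) mulrA -(t1M _ (star W) W) WW t1_1 mul1r.
have uM X Y := uhomM X Y (uhom_sw12 R L L L).
have := congr1 (fun X => sw12 X) e1; rewrite (uM (r13 L W)) (uM (t1 L (star W) * r23 L W)) (uM (t1 L (star W))).
rewrite (sw12_t1 L (star W)) (sw12_t1 L W) (sw12_r23 L W) (sw12_r13 L W) => <-.
by rewrite rblock_t1r rblock_t1l rblock_r13 -[in RHS]sw_star starK.
Qed.

Lemma l12_t1 I J K (x : bop I) : l12 K (t1 J x) = t1 (J * K)%type x.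
Proof. by apply: bopP => -[a [b c]] [a' [b' c']]; rewrite l12E !t1E /= xpair_eqE -mulrA -natrM mulnb. Qed.
Lemma l13_t1 I J K (x : bop I) : l13 J (t1 K x) = t1 (J * K)%type x.
Proof. by apply: bopP => -[a [b c]] [a' [b' c']]; rewrite l13E !t1E /= xpair_eqE -mulrA -natrM mulnb andbC. Qed.
Lemma l13_t2 I J K (x : bop K) : l13 J (t2 I x) = t2 I (t2 J x).
Proof. by apply: bopP => p q; rewrite l13E !t2E; ring. Qed.
Lemma l12_t2 I J K (x : bop J) : l12 K (t2 I x) = t2 I (t1 K x).
Proof. by apply: bopP => p q; rewrite l12E !t2E t1E mulrA. Qed.

(** Both sides are conjugates of x in the first leg by products of legs of W. The pentagon equation
    compares the products, and the extra factor W_23 commutes with x. *)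
Lemma D_coassoc x : multb A x -> asc (amp1 D (D x)) = amp2 D (D x).
Proof.
move=> hx; have hD := qg_D G; have hDx := mhomM hD hx.
rewrite (amp2_Ad cA hD D_conj); last by move=> k l; exact: (multb_lblk k l cA cA' hDx).
rewrite (amp1_Ad cA' (mhomS hD) D_conj); last by move=> k l; exact: (multb_blk k l cA' cA hDx).
rewrite !ascM !asc_t1 asc_r13 (D_conj hx) !(uhomM _ _ (uhom_l12 R L L L)) !(uhomM _ _ (uhom_l13 R L L L)).
rewrite l12_t1 l13_t1 !(uhom_star _ (uhom_l12 R L L L)) !(uhom_star _ (uhom_l13 R L L L)) t2_star.
set w12 := l12 L W; set w13 := l13 L W; set w23 := t2 L W; set X := t1 (L * L)%type x.
have e : w23 * w12 = w12 * w13 * w23 by exact: (qg_pent G).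
have -> : w23 * (w12 * X * star w12) * star w23 = w23 * w12 * X * star (w23 * w12).
  by rewrite starM !mulrA.
rewrite e starM starM -(mulrA (w12 * w13) w23 X) (_ : w23 * X = X * w23); last first.
  by rewrite /w23 /X -bten_commute.
rewrite (mulrA (w12 * w13)) -(mulrA (w12 * w13 * X)) (mulrA w23) -t2_star -(t2M L W (star W)) WW' t2_1 mul1r.
by rewrite !mulrA.
Qed.

Lemma lblock_mulE I J (T : bop (I * J)%type) i i' k l :
  lblock i i' (T * t1 J (E k l)) = (i' == l)%:R *: lblock i k T.
Proof. by rewrite !lblock_sw swM sw_t1 -bten1l rblock_mulE mulr1. Qed.

(** A block of T (y (x) 1) combines blocks of T with the entries of one column of y, and that column
    is a norm limit of finitely supported ones. *)
Lemma lblock_mul_in I J (P : set (bop J)) (T : bop (I * J)%type) : csub P ->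
  (forall i i', P (lblock i i' T)) -> forall y i i', P (lblock i i' (T * t1 J y)).
Proof.
move=> hP hT y i i'; apply: (csub_lim hP) => e e0; pose M := nrm T + 1.
have M0 : 0 < M by rewrite ltr_wpDl ?nrm_ge0.
have [F hF] := col_tail y i' (divr_gt0 e0 M0).
exists (lblock i i' (T * t1 J (Pf R F * (y * E i' i')))).
  rewrite mulr_suml (blinear_sum _ _ (blinear_uhom (uhom_t1 R I J))) mulr_sumr.
  rewrite (blinear_sum _ _ (blinear_lblock R J i i')); apply: (csub_sum _ hP) => k.
  rewrite mulrA Emx_sandwich -bten1r btenZl -bscalerAr bten1r -[_ *: (T * _)]addr0 lblockL.
  rewrite lblock_mulE eqxx scale1r (blinear0 (blinear_lblock R J i i')) addr0.
  exact: (csub_scale _ hP).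
have -> : lblock i i' (T * t1 J y) = lblock i i' (T * t1 J (y * E i' i')).
  by rewrite t1M mulrA lblock_mulE eqxx scale1r.
rewrite -(blinearB _ _ (blinear_lblock R J i i')) -mulrBr -(blinearB _ _ (blinear_uhom (uhom_t1 R I J))).
apply: le_trans (nrm_lblock _ _ _) _; apply: le_trans (nrmM _ _) _.
apply: (@le_trans _ _ (M * (e / M))); last by rewrite mulrC divfK // gt_eqF.
apply: ler_pM; rewrite ?nrm_ge0 //; first by rewrite lerDl.
exact: le_trans (nrm_t1 _ _) hF.
Qed.

Lemma W_lblock k l : A (lblock k l W).
Proof. by rewrite (qg_Ab G); apply: bcspan_in; exists k, l. Qed.
Let hA : csub A. Proof. by case: cA'. Qed.
Let AS x : A x -> A (star x). Proof. by case: cA' => _ _; apply. Qed.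

Lemma lblock_star I K (k k' : I) (T : bop (I * K)%type) : lblock k k' (star T) = star (lblock k' k T).
Proof. by rewrite !lblock_sw sw_star rblock_star. Qed.

(** Nondegeneracy of Ah lets x E_jj approximate E_jj. Thus an element of Ah may be inserted in the
    first leg before slicing, where it can be absorbed since W is a multiplier of Ah (x) A. *)
Lemma slice_lim N (P : set (bop N)) (X : bop (L * N)%type) i j : csub P ->
  (forall x, Ah x -> P (lblock i j (X * t1 N x))) -> P (lblock i j X).
Proof.
move=> hP h; apply: (csub_lim hP) => e e0; pose M := nrm X + 1.
have M0 : 0 < M by rewrite ltr_wpDl ?nrm_ge0.
have [cAh2 nAh] := cAh; have [x hx dx] := nondeg_dense j cAh2 nAh (divr_gt0 e0 M0).
exists (lblock i j (X * t1 N x)); first exact: h.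
have -> : lblock i j X = lblock i j (X * t1 N (E j j)) by rewrite lblock_mulE eqxx scale1r.
have -> : lblock i j (X * t1 N x) = lblock i j (X * t1 N (x * E j j)).
  by rewrite t1M mulrA lblock_mulE eqxx scale1r.
rewrite -(blinearB _ _ (blinear_lblock R N i j)) -mulrBr -(blinearB _ _ (blinear_uhom (uhom_t1 R L N))).
apply: le_trans (nrm_lblock _ _ _) _; apply: le_trans (nrmM _ _) _.
apply: (@le_trans _ _ (M * (e / M))); last by rewrite mulrC divfK // gt_eqF.
apply: ler_pM; rewrite ?nrm_ge0 //; first by rewrite lerDl.
apply: le_trans (nrm_t1 _ _) _; rewrite nrm_distC; apply: le_trans dx.
by rewrite mulrBl mul1r.
Qed.

Lemma slice_liml N (P : set (bop N)) (X : bop (L * N)%type) i j : csub P ->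
  (forall x, Ah x -> P (lblock i j (t1 N x * X))) -> P (lblock i j X).
Proof.
move=> hP h; rewrite -[X]starK lblock_star; apply: (slice_lim (csub_star hP)) => x hx /=.
rewrite -lblock_star starM starK -t1_star; apply: h.
by case: cAh' => _ _; apply.
Qed.

Lemma W_slice x i j : A (lblock i j (W * t1 L x)).
Proof. exact: (lblock_mul_in hA W_lblock). Qed.
Lemma W_slicel x i j : A (lblock i j (t1 L x * W)).
Proof.
rewrite -[X in lblock _ _ X]starK lblock_star; apply: AS; rewrite starM -t1_star.
by apply: (lblock_mul_in hA) => k l; rewrite lblock_star; apply: AS; exact: W_lblock.
Qed.

Let hDW := mhom_amp2 cAh cA (calgn_bat cA cA) (qg_D G).
Let mDW k l : multb A (lblock k l W). Proof. exact: multb_in (W_lblock k l). Qed.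
Let l12M (x y : bop (L * L)%type) : l12 L (x * y) = l12 L x * l12 L y.
Proof. exact: (uhomM _ _ (uhom_l12 R L L L)). Qed.
Let l13M (x y : bop (L * L)%type) : l13 L (x * y) = l13 L x * l13 L y.
Proof. exact: (uhomM _ _ (uhom_l13 R L L L)). Qed.

Lemma D_slice x i j : Ah x -> lblock i j (l12 L W * l13 L W * t1 (L * L)%type x) = D (lblock i j (W * t1 L x)).
Proof.
move=> hx; have mx : multb (bat Ah A) (t1 L x) by apply: (mhomM (mhom_t1 cAh cA)); exact: multb_in.
rewrite -(lblock_amp2 cA (qg_D G)); last by move=> k l; apply: (multb_in cA'); exact: W_slice.
by rewrite (mhomX hDW WM mx) (qg_DW G) (amp2_t1 cA (qg_D G)).
Qed.
Lemma D_slicel x i j : Ah x -> lblock i j (t1 (L * L)%type x * (l12 L W * l13 L W)) = D (lblock i j (t1 L x * W)).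
Proof.
move=> hx; have mx : multb (bat Ah A) (t1 L x) by apply: (mhomM (mhom_t1 cAh cA)); exact: multb_in.
rewrite -(lblock_amp2 cA (qg_D G)); last by move=> k l; apply: (multb_in cA'); exact: W_slicel.
by rewrite (mhomX hDW mx WM) (qg_DW G) (amp2_t1 cA (qg_D G)).
Qed.

Lemma l13_bten I J K (x : bop I) (y : bop K) : l13 J (bten x y) = t1 (J * K)%type x * t2 I (t2 J y).
Proof. by rewrite btenK (uhomM _ _ (uhom_l13 R I J K)) l13_t1 l13_t2. Qed.
Lemma l12_bten I J K (x : bop I) (y : bop J) : l12 K (bten x y) = t1 (J * K)%type x * t2 I (t1 K y).
Proof. by rewrite btenK (uhomM _ _ (uhom_l12 R I J K)) l12_t1 l12_t2. Qed.

(* (1 (x) W)(Ah (x) A) = Ah (x) A turns W12 W13 (x (x) 1 (x) b) into W12 (x' (x) 1 (x) b'). *)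
Lemma D_bisimp2 : bcdot (D @` A) (@t2 R L L @` A) = bat A A.
Proof.
have hP := bcdot_csub (D @` A) (@t2 R L L @` A); have hQ := csub_bat A A.
have WY x b : Ah x -> A b -> exists2 Y, bat Ah A Y & bten x b = W * Y.
  move=> hx hb; exists (star W * bten x b); last by rewrite mulrA WW' mul1r.
  by have [] := multb_star (calg_bat cAh' cA') WM (bat_in hx hb).
apply/seteqP; split.
- apply: bcdot_sub => // _ _ [a + <-] [b hb <-]; rewrite {1}(qg_Ab G); move: a.
  suff H : bcspan [set x | exists i i', x = lblock i i' W] `<=` [set a | A a /\ bat A A (D a * t2 L b)] by move=> a /H[].
  apply: bcspan_sub.
    have cM := calg_multb cA'; have AM := multb_in cA'.
    have := pcsub_pre hA (pblin_sub AM (pblin_compl (pblin_shom cM (mhomS (qg_D G))) (blinear_mulr (t2 L b)))) hQ.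
    by [].
  move=> _ [i [j ->]]; split; first exact: W_lblock.
  rewrite -(lblock_amp2 cA (qg_D G)) // (qg_DW G) -lblock_t2r; apply: (slice_lim hQ) => x hx.
  have -> : l12 L W * l13 L W * t2 L (t2 L b) * t1 (L * L)%type x = l12 L W * l13 L (W * bten x b).
    by rewrite l13M l13_bten bten_commute !mulrA.
  have [+ _] := WM (bat_in hx hb); move: (W * bten x b).
  apply: bat_sub; first exact: csub_pre (blinear_comp (blinear_comp (blinear_uhom (uhom_l13 R L L L))
     (blinear_mull _)) (blinear_lblock R _ i j)) hQ.
  move=> x' b' hx' hb' /=; rewrite l13_bten mulrA lblock_t2r -(l12_t1 L L x') -l12M lblock_l12 -btenK.
  by apply: bat_in => //; exact: W_slice.
- apply: bat_sub => // a b + hb; rewrite {1}(qg_Ab G); move: a.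
  apply: bcspan_sub; first exact: csub_pre (blinear_btenl L b) hP.
  move=> _ [i [j ->]] /=; rewrite btenK -lblock_l12 -lblock_t2r; apply: (slice_lim hP) => x hx.
  have -> : l12 L W * t2 L (t2 L b) * t1 (L * L)%type x = l12 L W * l13 L (bten x b).
    by rewrite l13_bten bten_commute !mulrA.
  have [Y + ->] := WY _ _ hx hb; move: Y.
  apply: bat_sub; first exact: csub_pre (blinear_comp (blinear_comp (blinear_comp (blinear_mull W)
     (blinear_uhom (uhom_l13 R L L L))) (blinear_mull _)) (blinear_lblock R _ i j)) hP.
  move=> x' b' hx' hb' /=; rewrite l13M l13_bten !mulrA lblock_t2r D_slice //.
  by apply: bcdot_in; [exists (lblock i j (W * t1 L x')) => //; exact: W_slice|exists b'].
Qed.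

(** The mirror argument: (Ah (x) A) W = Ah (x) A absorbs b through W_12, and W_13 remains. Adjoints
    give the opposite order in [D_bisimp1]. *)
Lemma D_bisimp1l : bcdot (@t1 R L L @` A) (D @` A) = bat A A.
Proof.
have hP := bcdot_csub (@t1 R L L @` A) (D @` A); have hQ := csub_bat A A.
have WY x b : Ah x -> A b -> exists2 Y, bat Ah A Y & bten x b = Y * W.
  move=> hx hb; exists (bten x b * star W); last by rewrite -mulrA WW mulr1.
  by have [] := multb_star (calg_bat cAh' cA') WM (bat_in hx hb).
apply/seteqP; split.
- apply: bcdot_sub => // _ _ [b hb <-] [a + <-]; rewrite {1}(qg_Ab G); move: a.
  suff H : bcspan [set x | exists i i', x = lblock i i' W] `<=` [set a | A a /\ bat A A (t1 L b * D a)] by move=> a /H[].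
  apply: bcspan_sub.
    have cM := calg_multb cA'; have AM := multb_in cA'.
    have := pcsub_pre hA (pblin_sub AM (pblin_compl (pblin_shom cM (mhomS (qg_D G))) (blinear_mull (t1 L b)))) hQ.
    by [].
  move=> _ [i [j ->]]; split; first exact: W_lblock.
  rewrite -(lblock_amp2 cA (qg_D G)) // (qg_DW G) -lblock_t2l; apply: (slice_liml hQ) => x hx.
  have -> : t1 (L * L)%type x * (t2 L (t1 L b) * (l12 L W * l13 L W)) = l12 L (bten x b * W) * l13 L W.
    by rewrite l12M l12_bten !mulrA.
  have [_ +] := WM (bat_in hx hb); move: (bten x b * W).
  apply: bat_sub; first exact: csub_pre (blinear_comp (blinear_comp (blinear_uhom (uhom_l12 R L L L))
     (blinear_mulr _)) (blinear_lblock R _ i j)) hQ.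
  move=> x' b' hx' hb' /=; rewrite l12_bten bten_commute -mulrA lblock_t2l -(l13_t1 L L x') -l13M lblock_l13 -btenK.
  by apply: bat_in => //; exact: W_slicel.
- apply: bat_sub => // b a hb; rewrite {1}(qg_Ab G); move: a.
  apply: bcspan_sub; first exact: csub_pre (blinear_btenr L b) hP.
  move=> _ [i [j ->]] /=; rewrite btenK -lblock_l13 -lblock_t2l; apply: (slice_liml hP) => x hx.
  have -> : t1 (L * L)%type x * (t2 L (t1 L b) * l13 L W) = l12 L (bten x b) * l13 L W.
    by rewrite l12_bten !mulrA.
  have [Y + ->] := WY _ _ hx hb; move: Y.
  apply: bat_sub; first exact: csub_pre (blinear_comp (blinear_comp (blinear_comp (blinear_mulr W)
     (blinear_uhom (uhom_l12 R L L L))) (blinear_mulr _)) (blinear_lblock R _ i j)) hP.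
  move=> x' b' hx' hb' /=; rewrite l12M l12_bten bten_commute -!mulrA lblock_t2l D_slicel //.
  by apply: bcdot_in; [exists b'|exists (lblock i j (t1 L x' * W)) => //; exact: W_slicel].
Qed.
End QuantumGroup.

(** * Algebras that are closed spans of products of two factors *)

Section Factorizations.
Variable R : realType.
Implicit Types (I J K M N : choiceType).
Local Notation bop := (bop R).

Lemma half_pow (e : R) : 0 < e -> exists m : nat, forall n, (m <= n)%N -> 2^-1 ^+ n <= e.
Proof.
move=> e0; have i0 : 0 < e^-1 by rewrite invr_gt0.
have hN := archi_boundP (ltW i0); exists (Num.bound e^-1) => n hn.
have h2 : ((Num.bound e^-1)%:R : R) <= 2 ^+ n.
  by rewrite -natrX ler_nat; apply: leq_trans hn _; exact: ltnW (ltn_expl n _).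
rewrite exprVn -[e]invrK lef_pV2 ?posrE ?exprn_gt0 //.
exact: le_trans (ltW hN) h2.
Qed.

(** Injective homomorphisms are isometric, so a convergent sequence of images comes from a Cauchy
    sequence of preimages. *)
Lemma hom_image_csub I J (P Q : set (bop I)) (f : bop I -> bop J) : calg P -> shom P f ->
  (forall x, P x -> f x = 0 -> x = 0) -> csub Q -> Q `<=` P -> csub (f @` Q).
Proof.
move=> cP hf inj hQ QP; have [hP _ _] := cP; have [fL _ _] := hf.
have iso x : P x -> nrm (f x) = nrm x by exact: hom_isom cP hf inj.
have [q0 QL _] := hQ; split=> [|c _ _ [x qx <-] [y qy <-]|y hy].
- by exists 0 => //; rewrite (hom0 _ hf) //; exact: QP.
- by exists (c *: x + y); [exact: QL|rewrite fL //; exact: QP].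
pose d n : R := 2^-1 ^+ n.
have d0 n : 0 < d n by rewrite exprn_gt0 // invr_gt0.
have /choice[u hu] : forall n, exists x, Q x /\ nrm (y - f x) <= d n.
  by move=> n; have [_ [x qx <-] h] := hy _ (d0 n); exists x.
have uP n : P (u n) by apply: QP; have [] := hu n.
have small (e : R) : 0 < e -> exists m : nat, forall n, (m <= n)%N -> nrm (y - f (u n)) <= e.
  move=> e0; have [N hN] := half_pow e0; exists N => n /hN h.
  by have [_ h'] := hu n; exact: le_trans h' h.
have [x hx] : exists x, forall e : R, 0 < e -> exists m : nat, forall n, (m <= n)%N -> nrm (u n - x) <= e.
  apply: nrm_complete => e e0; have e2 : 0 < e / 2 by rewrite divr_gt0.
  have [N hN] := small _ e2; exists N => m n hm hn.
  rewrite -iso; last exact: csub_sub.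
  by rewrite (homB hf) //; apply: (@nrm_tri _ _ _ y); [rewrite nrm_distC|]; exact: hN.
have qx : Q x by apply: (csub_seq hQ _ hx) => n; have [] := hu n.
exists x => //; apply: nrm_eps => e e0; have e2 : 0 < e / 2 by rewrite divr_gt0.
have [N1 h1] := hx _ e2; have [N2 h2] := small _ e2.
apply: (@nrm_tri _ _ _ (f (u (maxn N1 N2)))); last first.
  by rewrite nrm_distC; apply: h2; exact: leq_maxr.
rewrite nrm_distC -(homB hf) //; last exact: QP.
by rewrite iso; [apply: h1; exact: leq_maxl|apply: csub_sub => //; exact: QP].
Qed.

(** f is S followed by the inverse of F on its image; injectivity of F transfers the algebraic
    identities. *)
Lemma lift_hom I J M (P : set (bop I)) (Q : set (bop J)) (S : bop I -> bop M) (F : bop J -> bop M) :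
  calg P -> calg Q -> shom P S -> shom Q F -> (forall x, Q x -> F x = 0 -> x = 0) ->
  (forall x, P x -> exists2 y, Q y & F y = S x) ->
  exists f, [/\ shom P f, (forall x, P x -> Q (f x)) & forall x, P x -> F (f x) = S x].
Proof.
move=> [[_ PL _] PM PS] [hQ QM QS] [SL SM SS] hF inj h; have [FL FM FS] := hF.
have [_ QL _] := hQ.
have /choice[f hf] : forall x, exists y, P x -> Q y /\ F y = S x.
  move=> x; have [/h[y qy e]|nx] := pselect (P x); first by exists y.
  by exists 0 => /nx.
have Fi x y : Q x -> Q y -> F x = F y -> x = y.
  move=> qx qy e; apply/eqP; rewrite -subr_eq0; apply/eqP; apply: inj; first exact: csub_sub.
  by rewrite (homB hF) // e subrr.
have fQ x : P x -> Q (f x) by move=> /hf[].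
have fE x : P x -> F (f x) = S x by move=> /hf[].
exists f; split=> //; split=> [c x y px py|x y px py|x px].
- by apply: Fi; [auto|auto|rewrite FL ?fE ?SL; auto].
- by apply: Fi; [auto|auto|rewrite FM ?fE ?SM; auto].
- by apply: Fi; [auto|auto|rewrite FS ?fE ?SS; auto].
Qed.

Section SwapAlgebra.
Variables (I J N : choiceType) (C : set (bop I)) (D : set (bop J)) (L1 : bop I -> bop N) (L2 : bop J -> bop N).
Hypotheses (cC : calgn C) (cD : calgn D) (h1 : shom (multb C) L1) (h2 : shom (multb D) L2).
Hypotheses (u1 : L1 1 = 1) (u2 : L2 1 = 1) (f1 : faithful_on C L1) (f2 : faithful_on D L2).
Local Notation P := (bcdot (L1 @` C) (L2 @` D)).
Hypothesis sw : forall c d, C c -> D d -> P (L2 d * L1 c).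
Let hP : csub P := bcdot_csub _ _.
Let Pin c d : C c -> D d -> P (L1 c * L2 d).
Proof. by move=> hc hd; apply: bcdot_in; [exists c|exists d]. Qed.
Let CC := multb_in (proj1 cC). Let DD := multb_in (proj1 cD).
Let Psub (Q : set (bop N)) : csub Q -> (forall c d, C c -> D d -> Q (L1 c * L2 d)) -> P `<=` Q.
Proof. by move=> hQ h; apply: bcdot_sub => // _ _ [c hc <-] [d hd <-]; exact: h. Qed.
Let CS c : C c -> C (star c). Proof. by case: cC => -[_ _ h] _; exact: h. Qed.
Let DS c : D c -> D (star c). Proof. by case: cD => -[_ _ h] _; exact: h. Qed.
Let s1 m : multb C m -> L1 (star m) = star (L1 m). Proof. by case: h1 => _ _; apply. Qed.
Let s2 m : multb D m -> L2 (star m) = star (L2 m). Proof. by case: h2 => _ _; apply. Qed.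
Let m1 m n : multb C m -> multb C n -> L1 (m * n) = L1 m * L1 n. Proof. by case: h1 => _ h _; exact: h. Qed.
Let m2 m n : multb D m -> multb D n -> L2 (m * n) = L2 m * L2 n. Proof. by case: h2 => _ h _; exact: h. Qed.

Let PS x : P x -> P (star x).
Proof.
move: x; apply: Psub; first exact: csub_star.
by move=> c d hc hd /=; rewrite starM -(s1 (CC hc)) -(s2 (DD hd)); apply: sw; auto.
Qed.
Let P1 m x : multb C m -> P x -> P (L1 m * x).
Proof.
move=> hm; move: x; apply: Psub; first exact: csub_pre (blinear_mull _) hP.
move=> c d hc hd /=; rewrite mulrA -(m1 hm (CC hc)); apply: Pin => //.
by have [] := hm _ hc.
Qed.
Let P2r m x : multb D m -> P x -> P (x * L2 m).
Proof.
move=> hm; move: x; apply: Psub; first exact: csub_pre (blinear_mulr _) hP.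
move=> c d hc hd /=; rewrite -mulrA -(m2 (DD hd) hm); apply: Pin => //.
by have [] := hm _ hd.
Qed.
Let P1r m x : multb C m -> P x -> P (x * L1 m).
Proof.
move=> hm px; rewrite -[X in P X]starK starM -(s1 hm); apply: (PS); apply: P1; last exact: PS.
exact: multb_star (proj1 cC) hm.
Qed.
Let P2 m x : multb D m -> P x -> P (L2 m * x).
Proof.
move=> hm px; rewrite -[X in P X]starK starM -(s2 hm); apply: (PS); apply: P2r; last exact: PS.
exact: multb_star (proj1 cD) hm.
Qed.

(** Hypothesis [sw] gives closure under adjoints. This turns the stability under L1 on the left and
    L2 on the right into two-sided stability under both, hence into closure under products. *)
Lemma swap_calgn : calgn P.
Proof.
split; first split=> //.
- move=> x y hx hy; move: x hx; apply: Psub; first exact: csub_pre (blinear_mulr _) hP.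
  move=> c d /CC hc /DD hd /=.
  by rewrite -mulrA; apply: P1 => //; exact: P2.
- move=> X h; apply: f2 => d hd; apply: f1 => c hc; rewrite mulrA; apply: h.
  exact: Pin.
Qed.
Lemma swap_comm : P = bcdot (L2 @` D) (L1 @` C).
Proof.
apply/seteqP; split; last by apply: bcdot_sub => // _ _ [d hd <-] [c hc <-]; exact: sw.
move=> x /PS; rewrite -{2}[x]starK; move: (star x).
apply: bcspan_star => _ [_ [c hc <-] [_ [d hd <-] ->]]; rewrite starM -(s1 (CC hc)) -(s2 (DD hd)).
by apply: bcdot_in; [exists (star d); auto|exists (star c); auto].
Qed.
Lemma swap_mhom1 : mhom C P L1.
Proof.
split=> // [m hm x px|]; first by split; [exact: P1|exact: P1r].
apply: Psub; first exact: bcdot_csub.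
move=> c d /(calgn_idem cC) + hd; move: c.
suff H : bcdot C C `<=` [set c | multb C c /\ bcdot (L1 @` C) P (L1 c * L2 d)] by move=> c /H[].
have cM := calg_multb (proj1 cC); have [hM _ _] := cM.
apply: bcdot_sub.
  exact: pcsub_pre hM (pblin_compl (pblin_shom cM h1) (blinear_mulr _)) (bcdot_csub _ _).
move=> c c' hc hc'; split; first exact: multbM (proj1 cC) (CC hc) (CC hc').
by rewrite /= (m1 (CC hc) (CC hc')) -mulrA; apply: bcdot_in; [exists c|exact: Pin].
Qed.
Lemma swap_mhom2 : mhom D P L2.
Proof.
split=> // [m hm x px|]; first by split; [exact: P2|exact: P2r].
rewrite {1}swap_comm; apply: bcdot_sub; first exact: bcdot_csub.
move=> _ _ [d + <-] [c hc <-]; move=> /(calgn_idem cD); move: d.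
suff H : bcdot D D `<=` [set d | multb D d /\ bcdot (L2 @` D) P (L2 d * L1 c)] by move=> d /H[].
have cM := calg_multb (proj1 cD); have [hM _ _] := cM.
apply: bcdot_sub.
  exact: pcsub_pre hM (pblin_compl (pblin_shom cM h2) (blinear_mulr _)) (bcdot_csub _ _).
move=> d d' hd hd'; split; first exact: multbM (proj1 cD) (DD hd) (DD hd').
by rewrite /= (m2 (DD hd) (DD hd')) -mulrA; apply: bcdot_in; [exists d|exact: sw].
Qed.

(** A homomorphism known on the products L1 c * L2 d is nondegenerate because F1 and F2 are; its
    extension to multipliers is identified with F1 and F2 by testing against the image of the
    span. *)
Lemma swap_lift M (Q : set (bop M)) f F1 F2 : calgn Q -> shom P f -> mhom C Q F1 -> mhom D Q F2 ->
  (forall c d, C c -> D d -> f (L1 c * L2 d) = F1 c * F2 d) ->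
  exists F, [/\ mhom P Q F, (forall x, P x -> F x = f x),
    (forall c, multb C c -> F (L1 c) = F1 c) & (forall d, multb D d -> F (L2 d) = F2 d)].
Proof.
move=> cQ hf hF1 hF2 fE; have cP := swap_calgn; have [cP' nP] := cP; have [cQ' nQ] := cQ.
have [hQ QM QS] := cQ'; have [_ F1M _ F1n] := hF1; have [_ F2M _ F2n] := hF2.
have FM c d : C c -> D d -> multb Q (F1 c * F2 d).
  by move=> /CC hc /DD hd; apply: multbM => //; [exact: F1M|exact: F2M].
have nd : Q `<=` bcdot (f @` P) Q.
  move=> q /F1n; move: q; apply: bcdot_sub; first exact: bcdot_csub.
  move=> _ q [c hc <-] /F2n; move: q.
  apply: bcdot_sub; first exact: csub_pre (blinear_mull _) (bcdot_csub _ _).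
  move=> _ q [d hd <-] hq /=; rewrite mulrA -fE //; apply: bcdot_in => //.
  by exists (L1 c * L2 d) => //; exact: Pin.
have mf : mor P Q f.
  split=> // x px; suff [] : [set x | P x /\ multb Q (f x)] x by [].
  move: x px; apply: Psub; first exact: pcsub_pre hP (pblin_shom cP' hf) (csub_multb hQ).
  by move=> c d hc hd; split; [exact: Pin|rewrite /= fE //; exact: FM].
have [F [hF Ff]] := ext_ex cP cQ mf; exists F; split=> //.
- have hL := swap_mhom1; have hc := mhom_comp cC cP cQ hL hF.
  apply: (mhom_uniq cC cQ hc hF1) => c hc'; apply/eqP; rewrite -subr_eq0; apply/eqP.
  apply: (faithfulR cP' hf) => [|x px].
    exact: mor_nondeg cP cQ hf nd.
  suff [] : [set x | P x /\ (F (L1 c) - F1 c) * f x = 0] x by [].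
  move: x px; apply: Psub.
    exact: pcsub_pre hP (pblin_compl (pblin_shom cP' hf) (blinear_mull (F (L1 c) - F1 c))) (csub_zero R M).
  move=> c' d hc2 hd; have px := Pin hc2 hd; split=> //=.
  rewrite mulrBl -{1}Ff // -(mhomX hF (mhomM hL (CC hc'))); last exact: multb_in.
  have [hcc _] := CC hc' hc2.
  rewrite mulrA -(m1 (CC hc') (CC hc2)) Ff; last exact: Pin.
  by rewrite fE // fE // (mhomX hF1 (CC hc') (CC hc2)) mulrA subrr.
- have hL := swap_mhom2; have hc := mhom_comp cD cP cQ hL hF.
  apply: (mhom_uniq cD cQ hc hF2) => d hd'; apply/eqP; rewrite -subr_eq0; apply/eqP.
  apply: (mor_nondeg cP cQ hf nd) => x px; rewrite mulrBr.
  suff [_] : [set x | P x /\ f x * (F (L2 d) - F2 d) = 0] x by rewrite /= mulrBr.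
  move: x px; apply: Psub.
    exact: pcsub_pre hP (pblin_compl (pblin_shom cP' hf) (blinear_mulr (F (L2 d) - F2 d))) (csub_zero R M).
  move=> c d2 hc2 hd; have px := Pin hc2 hd; split=> //=.
  rewrite mulrBr -{1}Ff // -(mhomX hF _ (mhomM hL (DD hd'))); last exact: multb_in.
  have [_ hdd] := DD hd' hd.
  rewrite -mulrA -(m2 (DD hd) (DD hd')) Ff; last exact: Pin.
  by rewrite fE // fE // (mhomX hF2 (DD hd) (DD hd')) mulrA subrr.
Qed.
End SwapAlgebra.

End Factorizations.

(** * Heisenberg pairs and twisted tensor products *)

Section Heisenberg.
Variables (R : realType) (L : choiceType).
Local Notation bop := (bop R).
Implicit Types (I J K H N : choiceType).

Record udual K (A Ah : set (bop L)) (D : bop L -> bop (L * L)%type) (W : bop (L * L)%type)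
  (Au : set (bop K)) (V : bop (K * L)%type) (Du : bop K -> bop (K * K)%type) (Lam : bop K -> bop L) : Prop :=
 Udual { ud_A : calgn Au; ud_M : multb (bat Au A) V;
  ud_l : star V * V = 1; ud_r : V * star V = 1;
  ud_b : Au = bcspan [set x | exists k l, x = rblock k l V];
  ud_D : amp2 D V = l12 L V * l13 L V;
  ud_hD : mhom Au (bat Au Au) Du; ud_DV : asc (amp1 Du V) = t2 K V * l13 K V;
  ud_hL : mhom Au Ah Lam; ud_L : amp1 Lam V = W }.

Lemma sw_l13 I J K (T : bop (I * K)%type) : sw (l13 J T) = r23 J (sw T).
Proof. by apply: bopP => p q; rewrite swE l13E r23E swE. Qed.
Lemma sw_l12 I J K (T : bop (I * J)%type) : sw (l12 K T) = r13 K (sw T).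
Proof. by apply: bopP => p q; rewrite swE l12E r13E swE. Qed.
Lemma lblock_r13 I J K (T : bop (I * K)%type) (p q : I * J) :
  lblock p q (r13 J T) = (p.2 == q.2)%:R *: lblock p.1 q.1 T.
Proof. by apply: bopP => k l; rewrite bvalZ !lblockE r13E mulrC. Qed.
Lemma lblock_r23 I J K (T : bop (J * K)%type) (p q : I * J) :
  lblock p q (r23 I T) = (p.1 == q.1)%:R *: lblock p.2 q.2 T.
Proof. by apply: bopP => k l; rewrite bvalZ !lblockE r23E mulrC. Qed.
Lemma rblock_l12 I J K (T : bop (I * J)%type) (p q : J * K) :
  rblock p q (l12 K T) = (p.2 == q.2)%:R *: rblock p.1 q.1 T.
Proof. by apply: bopP => k l; rewrite bvalZ !rblockE l12E mulrC. Qed.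
Lemma rblock_l13 I J K (T : bop (I * K)%type) (p q : J * K) :
  rblock p q (l13 J T) = (p.1 == q.1)%:R *: rblock p.2 q.2 T.
Proof. by apply: bopP => k l; rewrite bvalZ !rblockE l13E mulrC. Qed.

Section OuterLegs.
Variables (I I' : choiceType) (A : set (bop I)) (A' : set (bop I')) (F : bop I -> bop I').
Hypotheses (cA : calgn A) (cA' : calgn A') (hF : mhom A A' F).
Let cM := calg_multb (proj1 cA).
Let hF' := mhomS hF.
Let hM : csub (multb A). Proof. by case: cM. Qed.
Let m0 : multb A 0. Proof. by case: hM. Qed.

Lemma amp1_l12 J K (T : bop (I * J)%type) : blk (multb A) T -> amp1 F (l12 K T) = l12 K (amp1 F T).
Proof.
move=> hT; apply: rblock_inj => p q; rewrite (rblock_amp1 cM hF').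
  by rewrite !rblock_l12 (rblock_amp1 cM hF') // (homZ _ m0 hF').
by move=> k l; rewrite rblock_l12; exact: (csub_scale _ hM).
Qed.
Lemma amp1_l13 J K (T : bop (I * K)%type) : blk (multb A) T -> amp1 F (l13 J T) = l13 J (amp1 F T).
Proof.
move=> hT; apply: rblock_inj => p q; rewrite (rblock_amp1 cM hF').
  by rewrite !rblock_l13 (rblock_amp1 cM hF') // (homZ _ m0 hF').
by move=> k l; rewrite rblock_l13; exact: (csub_scale _ hM).
Qed.
Lemma amp2_r13 J K (T : bop (K * I)%type) : (forall k l, multb A (lblock k l T)) ->
  amp2 F (r13 J T) = r13 J (amp2 F T).
Proof.
move=> hT; apply: lblock_inj => p q; rewrite (lblock_amp2 cA hF).
  by rewrite !lblock_r13 (lblock_amp2 cA hF) // (homZ _ m0 hF').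
by move=> k l; rewrite lblock_r13; exact: (csub_scale _ hM).
Qed.
Lemma amp2_r23 J K (T : bop (K * I)%type) : (forall k l, multb A (lblock k l T)) ->
  amp2 F (r23 J T) = r23 J (amp2 F T).
Proof.
move=> hT; apply: lblock_inj => p q; rewrite (lblock_amp2 cA hF).
  by rewrite !lblock_r23 (lblock_amp2 cA hF) // (homZ _ m0 hF').
by move=> k l; rewrite lblock_r23; exact: (csub_scale _ hM).
Qed.
End OuterLegs.

Lemma mhom_conj I J (A : set (bop I)) (B : set (bop J)) F x y : calg A -> mhom A B F ->
  multb A x -> multb A y -> F (star x * y * x) = star (F x) * F y * F x.
Proof.
move=> cA hF hx hy; have hs := multb_star cA hx.
by rewrite (mhomX hF (multbM cA hs hy) hx) (mhomX hF hs hy) (mhom_star hF hx).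
Qed.

Definition rot I J K (T : bop ((I * J) * K)%type) : bop (I * (K * J))%type :=
  opq (leg (fun n => ((n.1, n.2.2), n.2.1)) (fun=> tt) T).
Lemma bij_rot I J K : bijective (fun n : I * (K * J) => (((n.1, n.2.2), n.2.1), tt)).
Proof. by exists (fun m => (m.1.1.1, (m.1.2, m.1.1.2))) => [[a [b c]]|[[[a b] c] []]]. Qed.
Lemma uhom_rot I J K : uhom (@rot I J K). Proof. exact: uhom_leg (bij_rot I J K). Qed.
Lemma rotE I J K (T : bop ((I * J) * K)%type) p q :
  rot T p q = T ((p.1, p.2.2), p.2.1) ((q.1, q.2.2), q.2.1).
Proof. by rewrite /rot opqE legE ?eqxx ?mulr1 //; exact: bij_inj (bij_rot I J K). Qed.
Lemma rot_t1 I J K (T : bop (I * J)%type) : rot (t1 K T) = l13 K T.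
Proof. by apply: bopP => p q; rewrite rotE t1E l13E. Qed.
Lemma rot_r13 I J K (T : bop (I * K)%type) : rot (r13 J T) = l12 J T.
Proof. by apply: bopP => p q; rewrite rotE r13E l12E. Qed.
Lemma rot_r23 I J K (T : bop (J * K)%type) : rot (r23 I T) = t2 I (sw T).
Proof. by apply: bopP => p q; rewrite rotE r23E t2E swE mulrC. Qed.

Variables (W : bop (L * L)%type) (A Ah : set (bop L)) (D Dh : bop L -> bop (L * L)%type).
Hypothesis G : qg W A Ah D Dh.
Variables (P Q : choiceType).
Variables (Ap : set (bop P)) (Vp : bop (P * L)%type) (Dp : bop P -> bop (P * P)%type) (Lp : bop P -> bop L).
Variables (Aq : set (bop Q)) (Vq : bop (Q * L)%type) (Dq : bop Q -> bop (Q * Q)%type) (Lq : bop Q -> bop L).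
Hypotheses (Up : udual A Ah D W Ap Vp Dp Lp) (Uq : udual Ah A Dh (sw (star W)) Aq Vq Dq Lq).
Variable Wu : bop (P * Q)%type.
Hypotheses (Wum : multb (bat Ap Aq) Wu) (Wul : star Wu * Wu = 1) (Wur : Wu * star Wu = 1).
Hypotheses (Wu_r : amp2 Dq Wu = l12 Q Wu * l13 Q Wu) (Wu_l : asc (amp1 Dp Wu) = t2 P Wu * l13 P Wu).
Hypothesis Wu_lift : amp1 Lp (amp2 Lq Wu) = W.
Let cA := qg_A G. Let cAh := qg_Ah G. Let cAp := ud_A Up. Let cAq := ud_A Uq.
Let cA' := proj1 cA. Let cAh' := proj1 cAh. Let cAp' := proj1 cAp. Let cAq' := proj1 cAq.

(** The flipped adjoint T of (Lp (x) id) Wu is a character for Dq that reduces to [Wh]. On the dual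
    side [Du_bichar] for T and [V_pentagon] for Vq evaluate the same operator, and cancelling [Wh]
    in legs 2 and 3 gives T = Vq. *)
Lemma Wu_half : amp1 Lp Wu = sw (star Vq).
Proof.
have hLp := ud_hL Up; have hLq := ud_hL Uq; have hDq := ud_hD Uq.
have hX := mhom_amp1 cAp cAh hLp cAq; set X := amp1 Lp Wu.
have mX : multb (bat Ah Aq) X := mhomM hX Wum.
have mXs := multb_star (calg_bat cAh' cAq') mX; have mT := sw_multb_bat mXs.
set Wh := sw (star W); have wl : star Wh * Wh = 1 by rewrite -sw_star starK -swM (qg_r G) sw1.
have wr : Wh * star Wh = 1 by rewrite -sw_star starK -swM (qg_l G) sw1.
have bW k l := multb_blk k l cAp' cAq Wum.
have e1 : amp2 Dq X = l12 Q X * l13 Q X.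
  rewrite /X -(amp12 cAp cAh cAq (calgn_bat cAq cAq) hLp hDq Wum) Wu_r.
  have hh := mhom_amp1 cAp cAh hLp (calgn_bat cAq cAq).
  rewrite (mhomX hh (mhomM (mhom_l12 cAp cAq cAq) Wum) (mhomM (mhom_l13 cAp cAq cAq) Wum)).
  by rewrite (amp1_l12 cAp hLp) // (amp1_l13 cAp hLp).
have h2 := mhom_amp2 cAh cAq (calgn_bat cAq cAq) hDq.
have e2 : amp1 Dq (sw (star X)) = r23 Q (sw (star X)) * r13 Q (sw (star X)).
  have -> : amp1 Dq (sw (star X)) = sw (amp2 Dq (star X)) by rewrite /amp2 swK.
  rewrite (mhom_star h2 mX) e1 starM swM -(uhom_star _ (uhom_l12 R L Q Q)) -(uhom_star _ (uhom_l13 R L Q Q)).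
  by rewrite sw_l12 sw_l13.
have e3 : amp1 Lq (sw (star X)) = Wh.
  have -> : amp1 Lq (sw (star X)) = sw (amp2 Lq (star X)) by rewrite /amp2 swK.
  rewrite (mhom_star (mhom_amp2 cAh cAq cA hLq) mX) /X.
  by rewrite -(amp12 cAp cAh cAq cA hLp hLq Wum) Wu_lift.
have hbc := @Du_bichar R L Q Wh Ah A Dh cAh (qg_Dh G) wl (Dh_conj G) Aq Vq Dq Lq cAq cA (ud_M Uq)
   (ud_l Uq) (ud_r Uq).
have Ab : Aq `<=` bcspan [set x | exists k l, x = rblock k l Vq] by rewrite {1}(ud_b Uq).
have := hbc Ab (ud_D Uq) hDq (ud_DV Uq) hLq (ud_L Uq) L Ah _ cAh mT e2.
have := @V_pentagon R L Q Wh Ah Dh cAh (qg_Dh G) wl (Dh_conj G) Aq Vq cAq (ud_M Uq) (ud_l Uq) (ud_D Uq).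
rewrite e3 => -> e4.
have e5 : r13 L Vq = r13 L (sw (star X)).
  have := congr1 (fun Y => Y * r23 Q (star Wh)) e4; rewrite -!mulrA -(uhomM _ _ (uhom_r23 R Q L L)) wr.
  by have [_ ->] := uhom_r23 R Q L L; rewrite !mulr1.
have e6 : Vq = sw (star X).
  by apply: bopP => -[a b] [a' b']; have := congr1 (fun Y : bop ((Q * L) * L)%type => Y ((a, b), b) ((a', b), b')) e5; rewrite !r13E !eqxx !mulr1.
by rewrite e6 -sw_star starK swK.
Qed.

Variables (H K : choiceType) (rho : bop P -> bop H) (pi : bop Q -> bop K).
Hypotheses (hrho : mhom Ap (@Kc R H) rho) (hpi : mhom Aq (@Kc R K) pi).

Definition Zof : bop (H * K)%type := star (amp1 rho (amp2 pi Wu)).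
Let mZ := mhom_comp (calgn_bat cAp cAq) (calgn_bat cAp (calgn_Kc R K)) (calgn_bat (calgn_Kc R H) (calgn_Kc R K))
  (mhom_amp2 cAp cAq (calgn_Kc R K) hpi) (mhom_amp1 cAp (calgn_Kc R H) hrho (calgn_Kc R K)).
Let mWs : multb (bat Ap Aq) (star Wu) := multb_star (calg_bat cAp' cAq') Wum.

Lemma Z_l : star Zof * Zof = 1.
Proof.
rewrite /Zof starK -(mhom_star mZ Wum) -(mhomX mZ Wum mWs) Wur.
by case: mZ.
Qed.
Lemma Z_r : Zof * star Zof = 1.
Proof.
rewrite /Zof starK -(mhom_star mZ Wum) -(mhomX mZ mWs Wum) Wul.
by case: mZ.
Qed.

(* The canonical unitary Z measures the failure of the corepresentations U and V
   to commute: V_23 U_13 = U_13 V_23 Z_12. *)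
Lemma heisenberg : let U := amp1 rho Vp in let V := amp1 pi Vq in
  t2 H V * l13 K U = l13 K U * t2 H V * l12 L Zof.
Proof.
move=> U V; have cK := calgn_Kc R; have bW k l := multb_blk k l cAp' cAq Wum.
(* On the legs P, L, Q this says that X_23 conjugated by Vp_12 is Wu_13 X_23, where X is the flipped
   adjoint of Vq by [Wu_half]. Applying rho and pi to the outer legs and moving L to the end by
   [rot] gives the relation. *)
have E := @Du_bichar R L P W A Ah D cA (qg_D G) (qg_l G) (D_conj G) Ap Vp Dp Lp cAp cAh (ud_M Up)
   (ud_l Up) (ud_r Up).
have Ab : Ap `<=` bcspan [set x | exists k l, x = rblock k l Vp] by rewrite {1}(ud_b Up).
have eW : amp1 Dp Wu = r23 P Wu * r13 P Wu by rewrite -[LHS]ascK Wu_l asrM asr_t2 asr_l13.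
have {}E := E Ab (ud_D Up) (ud_hD Up) (ud_DV Up) (ud_hL Up) (ud_L Up) Q Aq Wu cAq Wum eW.
rewrite Wu_half in E; set X := sw (star Vq) in E.
have mV : multb (bat Ap (@Kc R L)) Vp := (multb_batK cAp' cA (ud_M Up)).
have mVq : multb (bat Aq (@Kc R L)) (star Vq).
  by apply: multb_star; [exact: calg_bat cAq' (proj1 (cK L))|exact: (multb_batK cAq' cAh (ud_M Uq))].
have mX : multb (bat (@Kc R L) Aq) X := sw_multb_bat mVq.
have cPL := calgn_bat cAp (cK L); have cHL := calgn_bat (cK H) (cK L).
have m1 := mhomM (mhom_t1 cPL cAq) mV; have m2 := mhomM (mhom_r23 cAp (cK L) cAq) mX.
have m3 := mhomM (mhom_r13 cAp (cK L) cAq) Wum.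
have m1s := multb_star (proj1 (calgn_bat cPL cAq)) m1.
have hr := mhom_amp1 cAp (cK H) hrho (cK L).
have f1 := mhom_amp1 cPL cHL hr cAq; have f2 := mhom_amp2 cHL cAq (cK K) hpi.
have hf := mhom_comp (calgn_bat cPL cAq) (calgn_bat cHL cAq) (calgn_bat cHL (cK K)) f1 f2.
have := etrans (esym (mhom_conj (proj1 (calgn_bat cPL cAq)) hf m1 m2)) (etrans (congr1 _ E) (mhomX hf m3 m2)); cbv beta.
rewrite (amp1_t1 _ cPL hr mV) (amp2_t1 cAq hpi) (amp1_amp1_r23 cAp (cK H) hrho).
have bX k l : multb Aq (lblock k l X) := multb_lblk k l (cK L) cAq' mX.
rewrite (amp2_r23 cAq hpi) // (amp1_amp1_r13 cAp (cK H) hrho) //.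
have mWr := mhomM (mhom_amp1 cAp (cK H) hrho cAq) Wum.
rewrite (amp2_r13 cAq hpi); last by move=> k l; exact: (multb_lblk k l (cK H) cAq' mWr).
have -> : amp2 pi X = sw (star V).
  rewrite /amp2 /X swK (mhom_star (mhom_amp1 cAq (cK K) hpi (cK L))) //.
  exact: (multb_batK cAq' cAh (ud_M Uq)).
rewrite -(amp12 cAp (cK H) cAq (cK K) hrho hpi Wum) -[amp1 rho (amp2 pi Wu)]starK -/Zof -/U => e.
have uM x y := uhomM x y (uhom_rot H L K).
have := congr1 (fun Y => rot Y) e; rewrite (uM (star (t1 K U) * r23 H (sw (star V)))) (uM (star (t1 K U))) (uM (r13 L (star Zof))).
rewrite (uhom_star _ (uhom_rot H L K)) rot_t1 rot_r13 rot_r23 swK => {}e.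
have VV : star V * V = 1.
  have hp := mhom_amp1 cAq (cK K) hpi cAh; have mq := ud_M Uq.
  rewrite /V -(mhom_star hp mq) -(mhomX hp (multb_star (calg_bat cAq' cAh') mq) mq) (ud_l Uq).
  by case: hp.
have UU : U * star U = 1.
  have hp := mhom_amp1 cAp (cK H) hrho cA; have mq := ud_M Up.
  rewrite /U -(mhom_star hp mq) -(mhomX hp mq (multb_star (calg_bat cAp' cA') mq)) (ud_r Up).
  by case: hp.
have VV' : V * star V = 1.
  have hp := mhom_amp1 cAq (cK K) hpi cAh; have mq := ud_M Uq.
  rewrite /V -(mhom_star hp mq) -(mhomX hp mq (multb_star (calg_bat cAq' cAh') mq)) (ud_r Uq).
  by case: hp.
set u := l13 K U in e *; set v := t2 H V; set z := l12 L Zof.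
have ez : l12 L (star Zof) = star z by rewrite (uhom_star _ (uhom_l12 R H K L)).
have ev : t2 H (star V) = star v by exact: t2_star.
have uu : u * star u = 1.
  rewrite /u -(uhom_star _ (uhom_l13 R H K L)) -(uhomM _ _ (uhom_l13 R H K L)) UU.
  by case: (uhom_l13 R H K L).
have vv : star v * v = 1 by rewrite /v -t2_star -t2M VV t2_1.
have vv' : v * star v = 1 by rewrite /v -t2_star -t2M VV' t2_1.
have zz : star z * z = 1.
  rewrite -ez /z -(uhomM _ _ (uhom_l12 R H K L)) Z_l.
  by case: (uhom_l12 R H K L).
rewrite ez ev in e.
have e1 : star v * u = u * (star z * star v) by rewrite -e !mulrA uu mul1r.
have e2 : u = v * (u * (star z * star v)) by rewrite -e1 mulrA vv' mul1r.
by rewrite {2}e2 -!mulrA (mulrA (star v) v) vv mul1r zz mulr1.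
Qed.
End Heisenberg.

(** * Concrete and canonical models of twisted tensor products *)

Section TwistedProducts.
Variables (R : realType) (L : choiceType).
Local Notation bop := (bop R).
Local Notation E := (Emx R).
Local Notation Kc := (@Kc R).
Implicit Types (I J K H N : choiceType).

(** A nondegenerate algebra approximates the unit on each column, so A K = K and A acts as a
    morphism into K. Coactions are thereby viewed with values in M(C (x) K(L)), where coactions of A
    and of its dual live side by side. *)
Lemma mhom_Kc_id N (A : set (bop N)) : calgn A -> mhom A (Kc N) id.
Proof.
move=> [cA nA]; split=> // [m hm|x]; first exact: multb_Kc.
move: x; apply: bcspan_sub; first exact: bcdot_csub.
move=> _ [k [l ->]]; apply: (csub_lim (bcdot_csub _ _)) => e e0.
have [a ha da] := nondeg_dense k cA nA e0; exists (a * E k l); first by apply: bcdot_in; [exists a|exact: Kc_in].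
have -> : E k l - a * E k l = - ((a - 1) * E k k * E k l).
  by rewrite -mulrA Emx_mul eqxx scale1r mulrBl mul1r opprB.
by rewrite nrmN; apply: le_trans (nrmM _ _) _; rewrite nrmEmx mulr1.
Qed.
Lemma mhom_bat_Kc I N (C : set (bop I)) (A : set (bop N)) : calgn C -> calgn A ->
  mhom (bat C A) (bat C (Kc N)) id.
Proof.
move=> cC cA; have h := mhom_amp2 cC cA (calgn_Kc R N) (mhom_Kc_id cA).
apply: (mhomE (proj1 (calgn_bat cC cA)) _ h) => x hx; rewrite (amp2_id (proj1 cA)) // => i i'.
exact: (multb_lblk i i' cC (proj1 cA) hx).
Qed.
Lemma mhom_coact I N (C : set (bop I)) (A : set (bop N)) (g : bop I -> bop (I * N)%type) :
  calgn C -> calgn A -> mhom C (bat C A) g -> mhom C (bat C (Kc N)) g.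
Proof.
move=> cC cA hg; exact: (mhom_comp cC (calgn_bat cC cA) (calgn_bat cC (calgn_Kc R N)) hg (mhom_bat_Kc cC cA)).
Qed.

Lemma amp2_amp1_l13 I J J' K (B : set (bop J)) (B' : set (bop J')) F (X : bop (I * K)%type) :
  calgn B -> calgn B' -> mhom B B' F -> amp2 (amp1 F) (l13 J X) = l13 J' X.
Proof.
move=> cB cB' hF; have cK := calgn_Kc R K; have h := mhom_amp1 cB cB' hF cK.
have hb x : multb (bat B (Kc K)) (t2 J x).
  by apply: (mhomM (mhom_t2 cB cK)); exact: multb_Kc.
apply: lblock_inj => i i'; rewrite (lblock_amp2 (calgn_bat cB cK) h).
  by rewrite !lblock_l13 (amp1_t2 cB hF).
by move=> k k'; rewrite lblock_l13.
Qed.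

Lemma l13_t2_commute I J K (X : bop (I * K)%type) (y : bop J) :
  l13 J X * t2 I (t1 K y) = t2 I (t1 K y) * l13 J X.
Proof. by apply: lblock_inj => i i'; rewrite (lblock_t2l (t1 K y) (l13 J X)) (lblock_t2r (t1 K y) (l13 J X)) lblock_l13; apply/esym; exact: bten_commute. Qed.

(* Conjugation by U_13 V_23 carries inl(c)_12 and inr(y)_12 to the images of
   g(c)_13 and d(y)_23, so that [can], the closed span of the products
   g(c)_13 d(y)_23 in M(C (x) D (x) K(L)), is a model of the twisted tensor product
   that depends on no choice of covariant representations. *)
Definition g3 I J (g : bop I -> bop (I * L)%type) (c : bop I) : bop (I * (J * L))%type := l13 J (g c).
Definition d3 I J (d : bop J -> bop (J * L)%type) (y : bop J) : bop (I * (J * L))%type := t2 I (d y).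
Definition can I J (C : set (bop I)) g (D : set (bop J)) d : set (bop (I * (J * L))%type) :=
  bcdot (@g3 I J g @` C) (@d3 I J d @` D).
Definition binl I H K (phi : bop I -> bop H) (c : bop I) : bop (H * K)%type := t1 K (phi c).
Definition binr J H K (psi : bop J -> bop K) (Z : bop (H * K)%type) (y : bop J) : bop (H * K)%type :=
  Z * t2 H (psi y) * star Z.
Definition twalg I J H K (C : set (bop I)) (D : set (bop J)) (phi : bop I -> bop H) (psi : bop J -> bop K) Z :=
  bcdot (binl K phi @` C) (binr psi Z @` D).

Variables (A Ah : set (bop L)).
Hypotheses (cA : calgn A) (cAh : calgn Ah).

(** What is used of the covariant representations behind one model; [tw_R] is the Heisenberg
    relation. [tw_L] guards against an empty L, for which adding a third leg would erase
    everything. *)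
Record tw I J H K (C : set (bop I)) g (D : set (bop J)) d (phi : bop I -> bop H) (U : bop (H * L)%type)
  (psi : bop J -> bop K) (V : bop (K * L)%type) (Z : bop (H * K)%type) : Prop := Tw {
  tw_C : calgn C; tw_D : calgn D;
  tw_g : mhom C (bat C A) g; tw_d : mhom D (bat D Ah) d;
  tw_p : mhom C (Kc H) phi; tw_phii : forall c, C c -> phi c = 0 -> c = 0;
  tw_q : mhom D (Kc K) psi; tw_psii : forall y, D y -> psi y = 0 -> y = 0;
  tw_Ul : star U * U = 1; tw_Ur : U * star U = 1;
  tw_Vl : star V * V = 1; tw_Vr : V * star V = 1;
  tw_Zl : star Z * Z = 1; tw_Zr : Z * star Z = 1;
  tw_cu : forall c, C c -> amp1 phi (g c) = U * t1 L (phi c) * star U;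
  tw_cv : forall y, D y -> amp1 psi (d y) = V * t1 L (psi y) * star V;
  tw_R : t2 H V * l13 K U = l13 K U * t2 H V * l12 L Z;
  tw_L : forall X : bop (H * K)%type, l12 L X = 0 -> X = 0 }.

Section One.
Variables (I J H K : choiceType) (C : set (bop I)) (g : bop I -> bop (I * L)%type).
Variables (D : set (bop J)) (d : bop J -> bop (J * L)%type) (phi : bop I -> bop H) (U : bop (H * L)%type).
Variables (psi : bop J -> bop K) (V : bop (K * L)%type) (Z : bop (H * K)%type).
Hypothesis T : tw C g D d phi U psi V Z.
Let cC := tw_C T. Let cD := tw_D T.
Let cK N := calgn_Kc R N.
Let cCDK := calgn_bat cC (calgn_bat cD (cK L)).
Let cHKL := calgn_bat (cK H) (calgn_bat (cK K) (cK L)).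
Let CC := multb_in (proj1 cC). Let DD := multb_in (proj1 cD).
Local Notation M := (multb (bat C (bat D (Kc L)))).
Local Notation g3 := (@g3 I J g).
Local Notation d3 := (@d3 I J d).
Local Notation can := (can C g D d).
Local Notation inl := (binl K phi).
Local Notation inr := (binr psi Z).
Local Notation alg := (twalg C D phi psi Z).

Let hgK := mhom_coact cC cA (tw_g T).
Let hdK := mhom_coact cD cAh (tw_d T).
Lemma mhom_g3 : mhom C (bat C (bat D (Kc L))) g3.
Proof. exact: (mhom_comp cC (calgn_bat cC (cK L)) cCDK hgK (mhom_l13 cC cD (cK L))). Qed.
Lemma mhom_d3 : mhom D (bat C (bat D (Kc L))) d3.
Proof. exact: (mhom_comp cD (calgn_bat cD (cK L)) cCDK hdK (mhom_t2 cC (calgn_bat cD (cK L)))). Qed.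

Definition Phi (X : bop (I * (J * L))%type) : bop (H * (K * L))%type := opq (amp1 phi (amp2 (amp1 psi) X)).
Let h1 := mhom_amp1 cD (cK K) (tw_q T) (cK L).
Let h2 := mhom_amp2 cC (calgn_bat cD (cK L)) (calgn_bat (cK K) (cK L)) h1.
Let h3 := mhom_amp1 cC (cK H) (tw_p T) (calgn_bat (cK K) (cK L)).
Lemma mhom_Phi : mhom (bat C (bat D (Kc L))) (bat (Kc H) (bat (Kc K) (Kc L))) Phi.
Proof.
have h := mhom_comp cCDK (calgn_bat cC (calgn_bat (cK K) (cK L))) cHKL h2 h3.
by apply: (mhomE (proj1 cCDK) _ h) => x _; rewrite /Phi opqE.
Qed.
Lemma Phi_inj m : M m -> Phi m = 0 -> m = 0.
Proof.
move=> hm; rewrite /Phi opqE => e; have hm2 := mhomM h2 hm.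
have hb k l : multb C (rblock k l (amp2 (amp1 psi) m)).
  exact: (multb_blk k l (proj1 cC) (calgn_bat (cK K) (cK L)) hm2).
have e2 := amp1_inj cC (cK H) (tw_p T) (tw_phii T) hb e.
have inj y : bat D (Kc L) y -> amp1 psi y = 0 -> y = 0.
  move=> hy; apply: (amp1_inj cD (cK K) (tw_q T) (tw_psii T)) => k l.
  apply: (multb_blk k l (proj1 cD) (cK L)); apply: multb_in hy.
  exact: proj1 (calgn_bat cD (cK L)).
apply: (amp2_inj (calgn_bat cD (cK L)) (calgn_bat (cK K) (cK L)) h1 inj _ e2) => i i'.
exact: (multb_lblk i i' cC (proj1 (calgn_bat cD (cK L))) hm).
Qed.

Definition Y : bop (H * (K * L))%type := opq (l13 K U * t2 H V).
(** [Sd], on the concrete model, and [Phi], on the canonical one, are injective maps into the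
    operators on the three legs H, K, L. They send corresponding products of generators to the same
    operators, so each can be inverted on the image of the other. *)
Definition Sd (X : bop (H * K)%type) : bop (H * (K * L))%type := opq (Y * l12 L X * star Y).
Let u13 := uhom_l13 R H K L. Let u12 := uhom_l12 R H K L.
Lemma Y_l : star Y * Y = 1.
Proof.
rewrite /Y opqE starM -mulrA (mulrA (star (l13 K U))) -(uhom_star _ u13) -(uhomM _ _ u13) (tw_Ul T).
have [_ ->] := u13; by rewrite mul1r -t2_star -t2M (tw_Vl T) t2_1.
Qed.
Lemma Sd_hom : shom setT Sd.
Proof.
have h : shom setT (fun X => star (star Y) * l12 L X * star Y).
  apply: (shom_comp (Q := setT) (G := fun X => star (star Y) * X * star Y) (uhom_pre _ u12)) => //.
  by apply: shom_ad; rewrite starK; exact: Y_l.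
have e X : Sd X = star (star Y) * l12 L X * star Y by rewrite /Sd opqE starK.
by have [a1 a2 a3] := h; split=> [c x y hx hy|x y hx hy|x hx]; rewrite !e; [exact: a1|exact: a2|exact: a3].
Qed.
Lemma Sd_inj X : Sd X = 0 -> X = 0.
Proof.
rewrite /Sd opqE => e; apply: (tw_L T).
have := congr1 (fun W => star Y * W * Y) e.
by rewrite mulr0 mul0r !mulrA Y_l mul1r -mulrA Y_l mulr1.
Qed.
(** V_23 commutes with phi(c) in leg 1, and covariance of (phi, U) turns conjugation by U_13 into
    the coaction. *)
Lemma Sd_inl c : C c -> Sd (inl c) = Phi (g3 c).
Proof.
move=> hc; have hg k l : multb C (rblock k l (g c)).
  exact: (multb_blk k l (proj1 cC) cA (mhomM (tw_g T) (CC hc))).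
have -> : Phi (g3 c) = l13 K (amp1 phi (g c)).
  rewrite /Phi opqE /g3 -(amp1_l13 cC (tw_p T)) //; congr (amp1 phi _).
  exact: (amp2_amp1_l13 _ cD (cK K) (tw_q T)).
rewrite (tw_cu T hc) /Sd /Y /binl !opqE starM l12_t1 !(uhomM _ _ u13) (uhom_star _ u13) l13_t1.
set u := l13 K U; set v := t2 H V; set x := t1 _ (phi c).
have vx : v * x = x * v by apply/esym; exact: bten_commute.
have vv : v * star v = 1 by rewrite /v -t2_star -t2M (tw_Vr T) t2_1.
by rewrite -(mulrA u v x) vx !mulrA -(mulrA (u * x) v) vv mulr1.
Qed.
(** The Heisenberg relation replaces U_13 V_23 Z_12 by V_23 U_13; then U_13 commutes with psi(y) in
    leg 2, and covariance of (psi, V) produces the coaction. *)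
Lemma Sd_inr y : D y -> Sd (inr y) = Phi (d3 y).
Proof.
move=> hy; have mdy := mhomM hdK (DD hy).
have -> : Phi (d3 y) = t2 H (amp1 psi (d y)).
  by rewrite /Phi opqE /d3 (amp2_t2 _ (calgn_bat cD (cK L)) h1) // (amp1_t2 cC (tw_p T)).
have e : Y * l12 L Z = t2 H V * l13 K U by rewrite /Y opqE (tw_R T).
rewrite /Sd opqE /binr !(uhomM _ _ u12) (uhom_star _ u12) l12_t2.
have -> : Y * (l12 L Z * t2 H (t1 L (psi y)) * star (l12 L Z)) * star Y =
  (Y * l12 L Z) * t2 H (t1 L (psi y)) * star (Y * l12 L Z) by rewrite starM !mulrA.
rewrite e starM (tw_cv T hy) !t2M t2_star -!mulrA; congr (_ * _).
have -> : l13 K U * (t2 H (t1 L (psi y)) * (star (l13 K U) * star (t2 H V))) =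
  t2 H (t1 L (psi y)) * (l13 K U * star (l13 K U)) * star (t2 H V).
  by rewrite !mulrA (l13_t2_commute U).
rewrite -(uhom_star _ u13) -(uhomM _ _ u13) (tw_Ur T).
by have [_ ->] := u13; rewrite mulr1.
Qed.

Let can_in c y : C c -> D y -> can (g3 c * d3 y).
Proof. by move=> hc hy; apply: bcdot_in; [exists c|exists y]. Qed.
Let alg_in c y : C c -> D y -> alg (inl c * inr y).
Proof. by move=> hc hy; apply: bcdot_in; [exists c|exists y]. Qed.
Lemma canM : can `<=` M.
Proof.
have [[hM _ _] _] : calg M /\ True by split=> //; exact: calg_multb (proj1 cCDK).
apply: bcdot_sub => // _ _ [c hc <-] [y hy <-]; apply: (multbM (proj1 cCDK)).
  by apply: (mhomM mhom_g3); exact: CC.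
by apply: (mhomM mhom_d3); exact: DD.
Qed.
Let Mcg c : C c -> M (g3 c). Proof. by move=> /CC; exact: (mhomM mhom_g3). Qed.
Let Mdy y : D y -> M (d3 y). Proof. by move=> /DD; exact: (mhomM mhom_d3). Qed.
Let PhiE c y : C c -> D y -> Phi (g3 c * d3 y) = Sd (inl c * inr y).
Proof.
move=> hc hy; have [_ sM _] := Sd_hom; rewrite sM // Sd_inl // Sd_inr //.
by rewrite (mhomX mhom_Phi (Mcg hc) (Mdy hy)).
Qed.
Let PhiE' c y : C c -> D y -> Phi (d3 y * g3 c) = Sd (inr y * inl c).
Proof.
move=> hc hy; have [_ sM _] := Sd_hom; rewrite sM // Sd_inl // Sd_inr //.
by rewrite (mhomX mhom_Phi (Mdy hy) (Mcg hc)).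
Qed.

(** Phi is injective, hence isometric, so the image of [can] is closed and only products of
    generators have to be matched. *)
Lemma alg_to_can X : alg X -> exists2 m, can m & Phi m = Sd X.
Proof.
have cM := calg_multb (proj1 cCDK).
have hI : csub (Phi @` can).
  exact: (hom_image_csub cM (mhomS mhom_Phi) Phi_inj (bcdot_csub _ _) canM).
have [sL sM sS] := Sd_hom.
move: X; apply: bcdot_sub.
  have bS : blinear Sd.
    split=> [a x y|]; first exact: sL.
    by exists 1 => // x; rewrite mul1r; exact: (hom_contr (calg_setT R _) Sd_hom Logic.I).
  exact: (csub_pre bS hI).
move=> _ _ [c hc <-] [y hy <-] /=; exists (g3 c * d3 y); first exact: can_in.
exact: PhiE.
Qed.
Lemma can_to_alg m : can m -> exists2 X, alg X & Sd X = Phi m.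
Proof.
have cM := calg_multb (proj1 cCDK); have [hM _ _] := cM.
have hI : csub (Sd @` alg).
  by apply: (hom_image_csub (calg_setT R _) Sd_hom (fun x _ => @Sd_inj x) (bcdot_csub _ _)).
suff hs : can `<=` [set m | M m /\ (Sd @` alg) (Phi m)] by move=> /hs[].
apply: bcdot_sub; first exact: (pcsub_pre hM (pblin_shom cM (mhomS mhom_Phi)) hI).
move=> _ _ [c hc <-] [y hy <-]; split; first by apply: canM; exact: can_in.
by exists (inl c * inr y); [exact: alg_in|rewrite PhiE].
Qed.

(** In an algebra closed under adjoints, the reversed product is the adjoint of a product of
    adjoints. The conclusion concerns the canonical model, so it serves for every other choice of
    covariant representations. *)
Lemma swap_of_calg : calg alg -> forall c y, C c -> D y -> can (d3 y * g3 c).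
Proof.
move=> cg c y hc hy; have [_ _ AS] := cg.
have hr : alg (inr y * inl c).
  have -> : inr y * inl c = star (inl (star c) * inr (star y)).
    have [_ _ p3] := shomS CC (mhomS (tw_p T)); have [_ _ q3] := shomS DD (mhomS (tw_q T)).
    rewrite starM /binr /binl !starM starK q3 // p3 // !t1_star !t2_star !starK.
    by rewrite !mulrA.
  apply: (AS); apply: alg_in.
    by case: cC => -[_ _ h] _; exact: h.
  by case: cD => -[_ _ h] _; exact: h.
have [m hm e] := alg_to_can hr.
have hdg : M (d3 y * g3 c) by apply: (multbM (proj1 cCDK)); [exact: Mdy|exact: Mcg].
suff -> : d3 y * g3 c = m by [].
have cM := calg_multb (proj1 cCDK); have [hM _ _] := cM.
apply/eqP; rewrite -subr_eq0; apply/eqP; apply: Phi_inj; first exact: (csub_sub hM hdg (canM hm)).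
by rewrite (homB (mhomS mhom_Phi) hdg (canM hm)) e PhiE' // subrr.
Qed.

Hypothesis swapc : forall c y, C c -> D y -> can (d3 y * g3 c).

Let fg := mhom_faithful cC cCDK mhom_g3.
Let fd := mhom_faithful cD cCDK mhom_d3.
Let g31 : g3 1 = 1. Proof. by case: mhom_g3. Qed.
Let d31 : d3 1 = 1. Proof. by case: mhom_d3. Qed.
Lemma calgn_can : calgn can.
Proof. exact: (swap_calgn cC cD (mhomS mhom_g3) (mhomS mhom_d3) fg fd swapc). Qed.
Lemma mhom_can1 : mhom C can g3.
Proof. exact: (swap_mhom1 cC cD (mhomS mhom_g3) (mhomS mhom_d3) g31 swapc). Qed.
Lemma mhom_can2 : mhom D can d3.
Proof. exact: (swap_mhom2 cC cD (mhomS mhom_g3) (mhomS mhom_d3) d31 swapc). Qed.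

(** The commutation goes back from the canonical model to the concrete one through [can_to_alg] and
    injectivity of [Sd]. *)
Lemma swap_alg c y : C c -> D y -> alg (inr y * inl c).
Proof.
move=> hc hy; have [X hX e] := can_to_alg (swapc hc hy).
suff -> : inr y * inl c = X by [].
apply/eqP; rewrite -subr_eq0; apply/eqP; apply: Sd_inj.
by rewrite (homB Sd_hom) // e PhiE' // subrr.
Qed.

Let hin : mhom C (bat (Kc H) (Kc K)) inl :=
  mhom_comp cC (cK H) (calgn_bat (cK H) (cK K)) (tw_p T) (mhom_t1 (cK H) (cK K)).
Let hin2 : mhom D (bat (Kc H) (Kc K)) (fun y => t2 H (psi y)) :=
  mhom_comp cD (cK K) (calgn_bat (cK H) (cK K)) (tw_q T) (mhom_t2 (cK H) (cK K)).
Let fin := mhom_faithful cC (calgn_bat (cK H) (cK K)) hin.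
Let hr : shom (multb D) inr.
Proof.
have h := @shom_ad R _ setT (star Z); rewrite starK in h.
exact: (shom_comp (Q := setT) (G := fun x => Z * x * star Z) (mhomS hin2) (fun _ _ => Logic.I) (h (tw_Zl T))).
Qed.
Let fr : faithful_on D inr.
Proof.
move=> X h; have e : star Z * X = 0.
  apply: (mhom_faithful cD (calgn_bat (cK H) (cK K)) hin2) => y hy.
  have := congr1 (fun W => star Z * W) (h _ hy).
  by rewrite mulr0 /binr !mulrA (tw_Zl T) mul1r.
by rewrite -[X]mul1r -(tw_Zr T) -mulrA e mulr0.
Qed.
Let in1 : inl 1 = 1. Proof. by case: hin. Qed.
Let ir1 : inr 1 = 1.
Proof. by case: hin2 => _ _ e _; rewrite /binr e mulr1 (tw_Zr T). Qed.
Lemma calgn_alg : calgn alg.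
Proof. exact: (swap_calgn cC cD (mhomS hin) hr fin fr swap_alg). Qed.
Lemma mhom_inl : mhom C alg inl.
Proof. exact: (swap_mhom1 cC cD (mhomS hin) hr in1 swap_alg). Qed.
Lemma mhom_inr : mhom D alg inr.
Proof. exact: (swap_mhom2 cC cD (mhomS hin) hr ir1 swap_alg). Qed.
Lemma alg_comm : alg = bcdot (inr @` D) (inl @` C).
Proof. exact: (swap_comm cC cD (mhomS hin) hr swap_alg). Qed.

Lemma alg_lift M (Q : set (bop M)) f F1 F2 : calgn Q -> shom alg f -> mhom C Q F1 -> mhom D Q F2 ->
  (forall c y, C c -> D y -> f (inl c * inr y) = F1 c * F2 y) ->
  exists F, [/\ mhom alg Q F, (forall x, alg x -> F x = f x),
    (forall c, multb C c -> F (inl c) = F1 c) & (forall y, multb D y -> F (inr y) = F2 y)].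
Proof. exact: (swap_lift cC cD (mhomS hin) hr in1 ir1 fin fr swap_alg). Qed.
(** The isomorphism onto the canonical model: [Sd] followed by the inverse of [Phi], extended to
    multipliers. *)
Lemma kappa_ex : exists k, [/\ mhom alg can k, (forall x, alg x -> can (k x) /\ (k x = 0 -> x = 0)),
  (forall c, multb C c -> k (inl c) = g3 c) & (forall y, multb D y -> k (inr y) = d3 y)].
Proof.
have cg := proj1 calgn_alg; have cc := proj1 calgn_can; have hS := shomS (fun x _ => Logic.I : setT x) Sd_hom.
have injP x : can x -> Phi x = 0 -> x = 0 by move=> /canM; exact: Phi_inj.
have [f [hf fc fe]] := lift_hom cg cc (hS alg) (shomS canM (mhomS mhom_Phi)) injP alg_to_can.
have fE c y : C c -> D y -> f (inl c * inr y) = g3 c * d3 y.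
  move=> hc hy; have hm := fc _ (alg_in hc hy); have hm' := can_in hc hy.
  apply/eqP; rewrite -subr_eq0; apply/eqP; apply: injP; first exact: (csub_sub (bcdot_csub _ _)).
  rewrite (homB (mhomS mhom_Phi)) ?fe ?PhiE ?subrr //; [exact: alg_in|exact: canM|exact: canM].
have [F [hF Ff F1 F2]] := alg_lift calgn_can hf mhom_can1 mhom_can2 fE.
exists F; split=> // x hx; rewrite Ff //; split=> [|e]; first exact: fc.
by apply: Sd_inj; rewrite -fe // e (hom0 _ (mhomS mhom_Phi)) //; apply: canM; case: (bcdot_csub (@g3 @` C) (@d3 @` D)).
Qed.
Lemma kappa'_ex : exists k, [/\ mhom can alg k,
  (forall c, multb C c -> k (g3 c) = inl c) & (forall y, multb D y -> k (d3 y) = inr y)].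
Proof.
have cg := proj1 calgn_alg; have cc := proj1 calgn_can; have hS := shomS (fun x _ => Logic.I : setT x) Sd_hom.
have [f [hf fc fe]] := lift_hom cc cg (shomS canM (mhomS mhom_Phi)) (hS alg) (fun x _ => @Sd_inj x) can_to_alg.
have fE c y : C c -> D y -> f (g3 c * d3 y) = inl c * inr y.
  move=> hc hy; have hm := fc _ (can_in hc hy); have hm' := alg_in hc hy.
  apply/eqP; rewrite -subr_eq0; apply/eqP; apply: Sd_inj.
  by rewrite (homB Sd_hom) // fe ?PhiE ?subrr //; exact: can_in.
have [F [hF Ff F1 F2]] := swap_lift cC cD (mhomS mhom_g3) (mhomS mhom_d3) g31 d31 fg fd swapc calgn_alg hf mhom_inl mhom_inr fE.
by exists F.
Qed.
End One.
End TwistedProducts.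

(** * Commutation of the two legs of a twisted tensor product *)

Lemma conj_move (T : pzRingType) (z u v vs : T) : v * vs = 1 -> z * u = u * z ->
  z * (u * v) = u * v * (vs * z * v).
Proof. by move=> e uz; rewrite !mulrA -(mulrA u v vs) e mulr1 uz. Qed.

Section SwapRegular.
Variables (R : realType) (L : choiceType).
Local Notation bop := (bop R).
Local Notation Kc := (@Kc R).
Variables (W : bop (L * L)%type) (A Ah : set (bop L)) (D Dh : bop L -> bop (L * L)%type).
Hypothesis G : qg W A Ah D Dh.
Variables (J : choiceType) (B : set (bop J)) (d : bop J -> bop (J * L)%type).
Hypotheses (cB : calgn B) (hd : mhom B (bat B Ah) d).
Hypothesis podles : bcdot (d @` B) (@t2 R J L @` Ah) `<=` bat B Ah.
Hypothesis coact : forall y, B y -> amp2 Dh (d y) = asc (amp1 d (d y)).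
Let cA := qg_A G. Let cAh := qg_Ah G.

Local Notation N := (L * (L * (J * L)))%type.
(** With the legs of N numbered from 0 to 3, [lift] puts an operator with three legs on 0, 1, 3 and
    [lam] puts one on 2, 3, 0. *)
Let lift (T : bop (L * (L * L))%type) : bop N :=
  opq (leg (fun n => (n.1, (n.2.1, n.2.2.2))) (fun n => n.2.2.1) T).
Let bij_lift : bijective (fun n : N => ((n.1, (n.2.1, n.2.2.2)), n.2.2.1)).
Proof. by exists (fun m => (m.1.1, (m.1.2.1, (m.2, m.1.2.2)))) => [[a [b [c e]]]|[[a [b c]] e]]. Qed.
Let ul : uhom lift := uhom_leg R bij_lift.
Let liftE T p q : lift T p q =
  T (p.1, (p.2.1, p.2.2.2)) (q.1, (q.2.1, q.2.2.2)) * (p.2.2.1 == q.2.2.1)%:R.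
Proof. by rewrite /lift opqE legE //; exact: bij_inj bij_lift. Qed.
Let lam (T : bop ((J * L) * L)%type) : bop N :=
  opq (leg (fun n => ((n.2.2.1, n.2.2.2), n.1)) (fun n => n.2.1) T).
Let bij_lam : bijective (fun n : N => (((n.2.2.1, n.2.2.2), n.1), n.2.1)).
Proof. by exists (fun m => (m.1.2, (m.2, (m.1.1.1, m.1.1.2)))) => [[a [b [c e]]]|[[[a b] c] e]]. Qed.
Let um : uhom lam := uhom_leg R bij_lam.
Let lamE T p q : lam T p q =
  T ((p.2.2.1, p.2.2.2), p.1) ((q.2.2.1, q.2.2.2), q.1) * (p.2.1 == q.2.1)%:R.
Proof. by rewrite /lam opqE legE //; exact: bij_inj bij_lam. Qed.

Let lam_t1 T : lam (t1 L T) = t2 L (t2 L T).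
Proof.
apply: bopP => -[a [b [c e]]] [a' [b' [c' e']]]; rewrite lamE t1E !t2E /=.
by rewrite -mulrA mulrC -mulrA.
Qed.
Let lam_t2 x : lam (t2 (J * L)%type x) = t1 (L * (J * L))%type x.
Proof.
apply: bopP => -[a [b [c e]]] [a' [b' [c' e']]]; rewrite lamE t1E !t2E /= !xpair_eqE.
by rewrite mulrC mulrA mulrC -natrM mulnb.
Qed.
Let lam_r23 X : lam (r23 J (sw X)) = lift (l13 L X).
Proof.
apply: bopP => -[a [b [c e]]] [a' [b' [c' e']]]; rewrite lamE liftE r23E swE l13E /=.
by rewrite mulrAC.
Qed.
Let lblock_lift i j T : lblock i j (lift T) = l13 J (lblock i j T).
Proof. by apply: bopP => -[b [c e]] [b' [c' e']]; rewrite lblockE liftE l13E lblockE. Qed.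
Let lift_t1 x : lift (t1 (L * L)%type x) = t1 (L * (J * L))%type x.
Proof.
apply: bopP => -[a [b [c e]]] [a' [b' [c' e']]]; rewrite liftE !t1E /= !xpair_eqE.
by rewrite -mulrA -natrM mulnb -andbA [(e == e') && _]andbC.
Qed.

Let w := l12 L W * l13 L W.
(** By [coact], (d (x) id) d(y) is a conjugate of d(y) by the dual unitary. Relabelled by [lam], it
    is d(y)_23 conjugated by the adjoint of W_03; the other factor W_01 of the lifted w commutes
    with d(y)_23. *)
Lemma regular_key y : B y -> t2 L (t2 L (d y)) * lift w = lift w * lam (amp1 d (d y)).
Proof.
move=> hy; have hdy := mhomM hd (multb_in (proj1 cB) hy).
have e1 : amp1 d (d y) = r23 J (sw (star W)) * t1 L (d y) * r23 J (star (sw (star W))).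
  rewrite -[LHS]ascK -coact //.
  rewrite (amp2_Ad cAh (qg_Dh G) (Dh_conj G)); last by move=> k l; exact: (multb_lblk k l cB (proj1 cAh) hdy).
  by rewrite (asrM (t2 J _ * l12 L _)) (asrM (t2 J _)) !asr_t2 asr_l12.
set X := l13 L W; have XX : lift (star X) * lift X = 1.
  rewrite -(uhomM _ _ ul) -(uhom_star _ (uhom_l13 R L L L)) -(uhomM _ _ (uhom_l13 R L L L)) (qg_l G).
  by have [_ ->] := uhom_l13 R L L L; have [_ ->] := ul.
have XX' : lift X * lift (star X) = 1.
  rewrite -(uhomM _ _ ul) -(uhom_star _ (uhom_l13 R L L L)) -(uhomM _ _ (uhom_l13 R L L L)) (qg_r G).
  by have [_ ->] := uhom_l13 R L L L; have [_ ->] := ul.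
have e2 : lam (amp1 d (d y)) = lift (star X) * t2 L (t2 L (d y)) * lift X.
  rewrite e1 !(uhomM _ _ um) lam_r23 lam_t1 -sw_star starK lam_r23.
  by rewrite -(uhom_star _ (uhom_l13 R L L L)).
rewrite e2 /w -/X (uhomM _ _ ul).
set v := lift X in XX XX' *; set vs := lift (star X) in XX XX' *; set u := lift (l12 L W); set z := t2 L _.
have uz : z * u = u * z.
  apply: lblock_inj => i j; rewrite /z (lblock_t2l _ u) (lblock_t2r _ u) /u lblock_lift lblock_l12 l13_t1.
  by apply/esym; exact: bten_commute.
exact: conj_move XX' uz.
Qed.

(* In one more leg 0, d(y)_23 ((id (x) D) W)_013 = ((id (x) D) W)_013 ((d (x) id) d(y))_230,
   and slicing leg 0 of (id (x) D) W gives the elements D(a). *)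
Lemma swap_regular a y : A a -> B y -> can A D B d (t2 L (d y) * l13 J (D a)).
Proof.
move=> ha hy; have hP : csub (can A D B d) by exact: bcdot_csub.
have cM := calg_multb (proj1 cA); have [hA _ _] := proj1 cA; have AM := multb_in (proj1 cA).
have cB' := proj1 cB; have BM := multb_in cB'.
have cBA := calgn_bat cB cAh; have cBAL := calgn_bat cBA cAh.
suff hs : A `<=` [set a | A a /\ can A D B d (t2 L (d y) * l13 J (D a))] by have [] := hs _ ha.
rewrite {1}(qg_Ab G); apply: bcspan_sub.
  apply: (pcsub_pre (f := fun a => t2 L (d y) * l13 J (D a)) hA _ hP).
  apply: pblin_sub AM _; apply: (pblin_compl (f := D) (g := fun x => t2 L (d y) * l13 J x) (pblin_shom cM (mhomS (qg_D G)))).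
  exact: (blinear_comp (blinear_uhom (uhom_l13 R L J L)) (blinear_mull _)).
move=> _ [i [j ->]]; split; first exact: (W_lblock G).
have -> : t2 L (d y) * l13 J (D (lblock i j W)) = lblock i j (t2 L (t2 L (d y)) * lift w).
  rewrite (lblock_t2l _ (lift w)) lblock_lift /w -(qg_DW G) (lblock_amp2 cA (qg_D G)) //.
  by move=> k l; apply: AM; exact: (W_lblock G).
apply: (slice_lim G hP) => x hx; rewrite regular_key // -mulrA -lam_t2.
have hd2 := mhom_amp1 cB cBA hd cAh.
have mx : multb (bat B Ah) (t2 J x) by apply: (mhomM (mhom_t2 cB cAh)); exact: multb_in (proj1 cAh) _ hx.
have hdy := mhomM hd (BM _ hy).
rewrite -(uhomM _ _ um) -(amp1_t2 cB hd) -(mhomX hd2 hdy mx).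
have : bat B Ah (d y * t2 J x) by apply: podles; apply: bcdot_in; [exists y|exists x].
move: (d y * t2 J x) => X hX.
have cM2 := calg_multb (proj1 (calgn_bat cB cAh)); have [hM2 _ _] := cM2.
suff hs : bat B Ah `<=` [set X | multb (bat B Ah) X /\ can A D B d (lblock i j (lift w * lam (amp1 d X)))].
  by have [] := hs _ hX.
apply: bat_sub.
  apply: (pcsub_pre (f := fun X => lblock i j (lift w * lam (amp1 d X))) hM2 _ hP).
  apply: (pblin_compl (f := amp1 d) (g := fun X => lblock i j (lift w * lam X)) (pblin_shom cM2 (mhomS hd2))).
  exact: (blinear_comp (blinear_comp (blinear_uhom um) (blinear_mull _)) (blinear_lblock R _ i j)).
move=> b x' hb hx'; split; first by apply: (multb_in (proj1 (calgn_bat cB cAh))); exact: bat_in.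
rewrite /= (amp1_bten (calg_multb cB') (mhomS hd) x' (BM _ hb)) btenK (uhomM _ _ um) lam_t1 lam_t2.
rewrite -(bten_commute x') mulrA -lift_t1 -(uhomM _ _ ul) (lblock_t2r _ (lift _)) lblock_lift.
rewrite /w (D_slice G) //; apply: bcdot_in; last by exists b.
by exists (lblock i j (W * t1 L x')) => //; exact: (W_slice G).
Qed.
End SwapRegular.

(** * Inheritance of the commutation by iterated products *)

Section SwapProducts.
Variables (R : realType) (L : choiceType).
Local Notation bop := (bop R).
Local Notation Kc := (@Kc R).
Variables (A Ah : set (bop L)).
Hypotheses (cA : calgn A) (cAh : calgn Ah).
Let cK N := calgn_Kc R N.

Section Left.
Variables (I I' J : choiceType) (C : set (bop I)) (g : bop I -> bop (I * L)%type).
Variables (C' : set (bop I')) (g' : bop I' -> bop (I' * L)%type) (B : set (bop J)) (d : bop J -> bop (J * L)%type).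
Variables (i1 i2 : bop I -> bop I').
Hypotheses (cC : calgn C) (cC' : calgn C') (cB : calgn B).
Hypotheses (hg : mhom C (bat C A) g) (hg' : mhom C' (bat C' A) g') (hd : mhom B (bat B Ah) d).
Hypotheses (h1 : mhom C C' i1) (h2 : mhom C C' i2) (E : C' = bcdot (i1 @` C) (i2 @` C)).
Hypotheses (e1 : forall c, C c -> g' (i1 c) = amp1 i1 (g c)) (e2 : forall c, C c -> g' (i2 c) = amp1 i2 (g c)).
Hypothesis sw : forall c y, C c -> B y -> can C g B d (t2 I (d y) * l13 J (g c)).
Let CC := multb_in (proj1 cC).
Let CC' := multb_in (proj1 cC').
Let BM := multb_in (proj1 cB).

(** Apply i to the first leg of the relation for C and B; equivariance rewrites the image of g as g'
    after i. *)
Lemma swap_left_one (i : bop I -> bop I') c y : mhom C C' i -> (forall c, C c -> g' (i c) = amp1 i (g c)) ->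
  C c -> B y ->
  bcdot ((fun c => l13 J (g' (i c))) @` C) (@d3 R L I' J d @` B) (t2 I' (d y) * l13 J (g' (i c))).
Proof.
move=> hi ei hc hy; have cBK := calgn_bat cB (cK L).
have hF := mhom_amp1 cC cC' hi cBK; have cM := calg_multb (proj1 (calgn_bat cC cBK)).
have hgK := mhom_coact cC cA hg; have hdK := mhom_coact cB cAh hd.
have mg c0 : C c0 -> multb (bat C (bat B (Kc L))) (l13 J (g c0)).
  by move=> /CC h; apply: (mhomM (mhom_l13 cC cB (cK L))); exact: (mhomM hgK).
have md y0 : B y0 -> multb (bat C (bat B (Kc L))) (t2 I (d y0)).
  by move=> /BM h; apply: (mhomM (mhom_t2 cC cBK)); exact: (mhomM hdK).
have Fg c0 : C c0 -> amp1 i (l13 J (g c0)) = l13 J (g' (i c0)).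
  move=> h; rewrite (amp1_l13 cC hi) ?ei // => k l.
  exact: (multb_blk k l (proj1 cC) cA (mhomM hg (CC h))).
have Fd y0 : amp1 i (t2 I (d y0)) = t2 I' (d y0) by exact: (amp1_t2 cC hi).
have [hM _ _] := cM.
suff hs : can C g B d `<=` [set X | multb (bat C (bat B (Kc L))) X /\
    bcdot ((fun c => l13 J (g' (i c))) @` C) (@d3 R L I' J d @` B) (amp1 i X)].
  have [_] := hs _ (sw hc hy); rewrite /= (mhomX hF (md _ hy) (mg _ hc)) Fd Fg //.
apply: bcdot_sub; first exact: (pcsub_pre hM (pblin_shom cM (mhomS hF)) (bcdot_csub _ _)).
move=> _ _ [c0 hc0 <-] [y0 hy0 <-]; split.
  by apply: (multbM (proj1 (calgn_bat cC cBK))); [exact: mg|exact: md].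
by rewrite /= (mhomX hF (mg _ hc0) (md _ hy0)) /g3 /d3 Fd Fg //; apply: bcdot_in; [exists c0|exists y0].
Qed.

(** d(y) is moved past i1 and then past i2, each time at the cost of a new y, and the products i1(a)
    i2(b) span C'. *)
Lemma swap_left c y : C' c -> B y -> can C' g' B d (t2 I' (d y) * l13 J (g' c)).
Proof.
move=> + hy; have hP : csub (can C' g' B d) by exact: bcdot_csub.
have cM := calg_multb (proj1 cC'); have [hC' _ _] := proj1 cC'.
suff hs : C' `<=` [set c | C' c /\ can C' g' B d (t2 I' (d y) * l13 J (g' c))] by move=> /hs[].
rewrite {1}E; apply: bcdot_sub.
  apply: (pcsub_pre (f := fun c => t2 I' (d y) * l13 J (g' c)) hC' _ hP).
  apply: pblin_sub CC' _; apply: (pblin_compl (f := g') (g := fun x => t2 I' (d y) * l13 J x) (pblin_shom cM (mhomS hg'))).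
  exact: (blinear_comp (blinear_uhom (uhom_l13 R I' J L)) (blinear_mull _)).
have C'in a b : C a -> C b -> C' (i1 a * i2 b) by move=> ha hb; rewrite E; apply: bcdot_in; [exists a|exists b].
have gM a b : C a -> C b -> l13 J (g' (i1 a * i2 b)) = l13 J (g' (i1 a)) * l13 J (g' (i2 b)).
  by move=> ha hb; rewrite (mhomX hg' (mhomM h1 (CC ha)) (mhomM h2 (CC hb))) (uhomM _ _ (uhom_l13 R I' J L)).
move=> _ _ [a ha <-] [b hb <-]; split; first exact: C'in.
rewrite /= gM // mulrA; move: (swap_left_one h1 e1 ha hy); move: (_ * l13 J (g' (i1 a))).
apply: bcdot_sub; first exact: csub_pre (blinear_mulr _) hP.
move=> _ _ [a' ha' <-] [y' hy' <-] /=; rewrite -mulrA /d3; move: (swap_left_one h2 e2 hb hy').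
move: (_ * l13 J (g' (i2 b))); apply: bcdot_sub; first exact: csub_pre (blinear_mull _) hP.
move=> _ _ [b' hb' <-] [y'' hy'' <-] /=; rewrite mulrA -gM //.
by apply: bcdot_in; [exists (i1 a' * i2 b') => //; exact: C'in|exists y''].
Qed.
End Left.

Section Right.
Variables (I J J' : choiceType) (C : set (bop I)) (g : bop I -> bop (I * L)%type).
Variables (B : set (bop J)) (d : bop J -> bop (J * L)%type) (B' : set (bop J')) (d' : bop J' -> bop (J' * L)%type).
Variables (i1 i2 : bop J -> bop J').
Hypotheses (cC : calgn C) (cB' : calgn B') (cB : calgn B).
Hypotheses (hg : mhom C (bat C A) g) (hd' : mhom B' (bat B' Ah) d') (hd : mhom B (bat B Ah) d).
Hypotheses (h1 : mhom B B' i1) (h2 : mhom B B' i2) (E : B' = bcdot (i1 @` B) (i2 @` B)).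
Hypotheses (e1 : forall c, B c -> d' (i1 c) = amp1 i1 (d c)) (e2 : forall c, B c -> d' (i2 c) = amp1 i2 (d c)).
Hypothesis sw : forall c y, C c -> B y -> can C g B d (t2 I (d y) * l13 J (g c)).
Let CC := multb_in (proj1 cC).
Let BB' := multb_in (proj1 cB').
Let BM := multb_in (proj1 cB).

Lemma swap_right_one (i : bop J -> bop J') c y : mhom B B' i -> (forall c, B c -> d' (i c) = amp1 i (d c)) ->
  C c -> B y ->
  bcdot (@g3 R L I J' g @` C) ((fun y => t2 I (d' (i y))) @` B) (t2 I (d' (i y)) * l13 J' (g c)).
Proof.
move=> hi ei hc hy; have cBK := calgn_bat cB (cK L); have cBK' := calgn_bat cB' (cK L).
have hi1 := mhom_amp1 cB cB' hi (cK L).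
have hF := mhom_amp2 cC cBK cBK' hi1; have cM := calg_multb (proj1 (calgn_bat cC cBK)).
have hgK := mhom_coact cC cA hg; have hdK := mhom_coact cB cAh hd.
have mg c0 : C c0 -> multb (bat C (bat B (Kc L))) (l13 J (g c0)).
  by move=> /CC h; apply: (mhomM (mhom_l13 cC cB (cK L))); exact: (mhomM hgK).
have md y0 : B y0 -> multb (bat C (bat B (Kc L))) (t2 I (d y0)).
  by move=> /BM h; apply: (mhomM (mhom_t2 cC cBK)); exact: (mhomM hdK).
have Fg c0 : amp2 (amp1 i) (l13 J (g c0)) = l13 J' (g c0) by exact: (amp2_amp1_l13 _ cB cB' hi).
have Fd y0 : B y0 -> amp2 (amp1 i) (t2 I (d y0)) = t2 I (d' (i y0)).
  by move=> h; rewrite (amp2_t2 _ cBK hi1) ?ei //; exact: (mhomM hdK (BM h)).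
have [hM _ _] := cM.
suff hs : can C g B d `<=` [set X | multb (bat C (bat B (Kc L))) X /\
    bcdot (@g3 R L I J' g @` C) ((fun y => t2 I (d' (i y))) @` B) (amp2 (amp1 i) X)].
  by have [_] := hs _ (sw hc hy); rewrite /= (mhomX hF (md _ hy) (mg _ hc)) Fd // Fg.
apply: bcdot_sub; first exact: (pcsub_pre hM (pblin_shom cM (mhomS hF)) (bcdot_csub _ _)).
move=> _ _ [c0 hc0 <-] [y0 hy0 <-]; split.
  by apply: (multbM (proj1 (calgn_bat cC cBK))); [exact: mg|exact: md].
by rewrite /= (mhomX hF (mg _ hc0) (md _ hy0)) /g3 /d3 Fd // Fg; apply: bcdot_in; [exists c0|exists y0].
Qed.

(** The mirror image: g(c) is moved to the left past the i2 factor first and the i1 factor second,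
    so that the order i1, i2 inside B' is preserved. *)
Lemma swap_right c y : C c -> B' y -> can C g B' d' (t2 I (d' y) * l13 J' (g c)).
Proof.
move=> hc; have hP : csub (can C g B' d') by exact: bcdot_csub.
have cM := calg_multb (proj1 cB'); have [hB' _ _] := proj1 cB'.
suff hs : B' `<=` [set y | B' y /\ can C g B' d' (t2 I (d' y) * l13 J' (g c))] by move=> /hs[].
rewrite {1}E; apply: bcdot_sub.
  apply: (pcsub_pre (f := fun y => t2 I (d' y) * l13 J' (g c)) hB' _ hP).
  apply: pblin_sub BB' _; apply: (pblin_compl (f := d') (g := fun x => t2 I x * l13 J' (g c)) (pblin_shom cM (mhomS hd'))).
  exact: (blinear_comp (blinear_uhom (uhom_t2 R I (J' * L)%type)) (blinear_mulr _)).
have B'in a b : B a -> B b -> B' (i1 a * i2 b) by move=> ha hb; rewrite E; apply: bcdot_in; [exists a|exists b].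
have dM a b : B a -> B b -> t2 I (d' (i1 a * i2 b)) = t2 I (d' (i1 a)) * t2 I (d' (i2 b)).
  by move=> ha hb; rewrite (mhomX hd' (mhomM h1 (BM ha)) (mhomM h2 (BM hb))) t2M.
move=> _ _ [a ha <-] [b hb <-]; split; first exact: B'in.
rewrite /= dM // -mulrA; move: (swap_right_one h2 e2 hc hb); move: (t2 I (d' (i2 b)) * _).
apply: bcdot_sub; first exact: csub_pre (blinear_mull _) hP.
move=> _ _ [c' hc' <-] [b' hb' <-] /=; rewrite mulrA /g3; move: (swap_right_one h1 e1 hc' ha).
move: (t2 I (d' (i1 a)) * _); apply: bcdot_sub; first exact: csub_pre (blinear_mulr _) hP.
move=> _ _ [c'' hc'' <-] [a' ha' <-] /=; rewrite -mulrA -dM //.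
by apply: bcdot_in; [exists c''|exists (i1 a' * i2 b') => //; exact: B'in].
Qed.
End Right.
End SwapProducts.

(** * The bosonization *)

Section SpanCalculus.
Variable R : realType.
Implicit Types (I J K N : choiceType).
Local Notation bop := (bop R).

Lemma bcdotA I (X Y Z : set (bop I)) : bcdot (bcdot X Y) Z = bcdot X (bcdot Y Z).
Proof.
apply/seteqP; split; apply: bcdot_sub; try exact: bcdot_csub.
- move=> x z + hz; move: x; apply: bcdot_sub; first exact: csub_pre (blinear_mulr z) (bcdot_csub _ _).
  by move=> x y hx hy /=; rewrite -mulrA; apply: bcdot_in => //; exact: bcdot_in.
- move=> x z hx; move: z; apply: bcdot_sub; first exact: csub_pre (blinear_mull x) (bcdot_csub _ _).
  by move=> y z hy hz /=; rewrite mulrA; apply: bcdot_in => //; exact: bcdot_in.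
Qed.
Lemma bcdot_spanl I (X Y : set (bop I)) : bcdot (bcspan X) Y = bcdot X Y.
Proof.
apply/seteqP; split; last by apply: bcdotS => // x; exact: bcspan_in.
apply: bcdot_sub; first exact: bcdot_csub.
move=> x y + hy; move: x; apply: bcspan_sub; first exact: csub_pre (blinear_mulr y) (bcdot_csub _ _).
by move=> x hx; exact: bcdot_in.
Qed.
Lemma bcdot_spanr I (X Y : set (bop I)) : bcdot X (bcspan Y) = bcdot X Y.
Proof.
apply/seteqP; split; last by apply: bcdotS => // x; exact: bcspan_in.
apply: bcdot_sub; first exact: bcdot_csub.
move=> x y hx; move: y; apply: bcspan_sub; first exact: csub_pre (blinear_mull x) (bcdot_csub _ _).
by move=> y hy; exact: bcdot_in.
Qed.
Lemma bcspan_img I J (P : set (bop I)) (f : bop I -> bop J) (X Y : set (bop I)) :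
  calg P -> shom P f -> X `<=` P -> Y `<=` P -> bcspan (f @` bcdot X Y) = bcdot (f @` X) (f @` Y).
Proof.
move=> cP hf XP YP; have [hP PM _] := cP; have [_ fM _] := hf; apply/seteqP; split.
- apply: bcspan_sub; first exact: bcdot_csub.
  move=> _ [z hz <-].
  suff H : bcdot X Y `<=` [set z | P z /\ bcdot (f @` X) (f @` Y) (f z)] by have [] := H _ hz.
  apply: bcdot_sub; first exact: (pcsub_pre hP (pblin_shom cP hf) (bcdot_csub _ _)).
  move=> x y hx hy; split; first by apply: PM; auto.
  by rewrite /= fM ?(XP, YP) //; [apply: bcdot_in; [exists x|exists y]|exact: XP|exact: YP].
- apply: bcdot_sub; first exact: bcspan_csub.
  move=> _ _ [x hx <-] [y hy <-]; apply: bcspan_in; exists (x * y); first exact: bcdot_in.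
  by apply: fM; auto.
Qed.
Lemma bcdot_img_eq I J (P : set (bop I)) (f : bop I -> bop J) (X Y X' Y' : set (bop I)) :
  calg P -> shom P f -> X `<=` P -> Y `<=` P -> X' `<=` P -> Y' `<=` P ->
  bcdot X Y = bcdot X' Y' -> bcdot (f @` X) (f @` Y) = bcdot (f @` X') (f @` Y').
Proof. by move=> cP hf h1 h2 h3 h4 e; rewrite -(bcspan_img cP hf h1 h2) e (bcspan_img cP hf h3 h4). Qed.
Lemma bat_dot I J (A : set (bop I)) (B : set (bop J)) : bat A B = bcdot (@t1 R I J @` A) (@t2 R I J @` B).
Proof.
apply/seteqP; split.
- apply: bat_sub; first exact: bcdot_csub.
  by move=> a b ha hb; rewrite btenK; apply: bcdot_in; [exists a|exists b].
- apply: bcdot_sub; first exact: csub_bat.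
  by move=> _ _ [a ha <-] [b hb <-]; rewrite -btenK; exact: bat_in.
Qed.
Lemma t12_dot I J (T1 T2 : Type) (F : T1 -> bop I) (F' : T2 -> bop J) (X : set T1) (Y : set T2) :
  bcdot ((fun a => t1 J (F a)) @` X) ((fun b => t2 I (F' b)) @` Y) =
  bcdot ((fun b => t2 I (F' b)) @` Y) ((fun a => t1 J (F a)) @` X).
Proof.
apply/seteqP; split; apply: bcdot_sub; try exact: bcdot_csub.
- by move=> _ _ [a ha <-] [b hb <-]; rewrite bten_commute; apply: bcdot_in; [exists b|exists a].
- by move=> _ _ [b hb <-] [a ha <-]; rewrite -bten_commute; apply: bcdot_in; [exists a|exists b].
Qed.
Lemma img_comp (S T U : Type) (f : S -> T) (g : T -> U) (X : set S) :
  g @` (f @` X) = (fun x => g (f x)) @` X.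
Proof. by rewrite image_comp. Qed.
Lemma img_eq (S T : Type) (f g : S -> T) (X : set S) : (forall x, X x -> f x = g x) -> f @` X = g @` X.
Proof.
move=> e; apply/seteqP; split=> _ [x hx <-]; exists x => //; [by rewrite e|exact: e].
Qed.
(** Transports an identity of spans of products along a homomorphism while renaming the images of
    the four families; conditions on A and on B become identities in M(C (x) C) in this way. *)
Lemma bcdot_img4 I J (T1 T2 T3 T4 : Type) (S1 : set T1) (S2 : set T2) (S3 : set T3) (S4 : set T4)
    (P : set (bop I)) (f : bop I -> bop J) x1 x2 x3 x4 F1 F2 F3 F4 : calg P -> shom P f ->
  (forall s, S1 s -> P (x1 s) /\ f (x1 s) = F1 s) -> (forall s, S2 s -> P (x2 s) /\ f (x2 s) = F2 s) ->
  (forall s, S3 s -> P (x3 s) /\ f (x3 s) = F3 s) -> (forall s, S4 s -> P (x4 s) /\ f (x4 s) = F4 s) ->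
  bcdot (x1 @` S1) (x2 @` S2) = bcdot (x3 @` S3) (x4 @` S4) ->
  bcdot (F1 @` S1) (F2 @` S2) = bcdot (F3 @` S3) (F4 @` S4).
Proof.
move=> cP hf.
have aux T (S : set T) x F : (forall s, S s -> P (x s) /\ f (x s) = F s) ->
    x @` S `<=` P /\ F @` S = f @` (x @` S).
  move=> h; split; first by move=> _ [s /h[? _] <-].
  by rewrite img_comp; apply: img_eq => s /h[].
move=> /aux[p1 ->] /aux[p2 ->] /aux[p3 ->] /aux[p4 ->]; exact: (bcdot_img_eq cP hf p1 p2 p3 p4).
Qed.
Lemma D_bisimp1 (L : choiceType) (W : bop (L * L)%type) A Ah D Dh : qg W A Ah D Dh ->
  bcdot (D @` A) (@t1 R L L @` A) = bat A A.
Proof.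
move=> G; have [cA nA] := qg_A G; have [_ _ AS] := cA; have AM := multb_in cA.
have [_ _ BS] := calg_bat cA cA; have DS a : A a -> D (star a) = star (D a).
  by move=> ha; exact: (mhom_star (qg_D G) (AM _ ha)).
apply/seteqP; split.
- apply: bcdot_sub; first exact: csub_bat.
  move=> _ _ [a ha <-] [b hb <-]; rewrite -[X in bat _ _ X]starK starM; apply: (BS).
  rewrite -DS // -t1_star -(D_bisimp1l G).
  by apply: bcdot_in; [exists (star b); auto|exists (star a); auto].
- move=> x /BS; rewrite -(D_bisimp1l G) -{2}[x]starK; move: (star x).
  apply: bcspan_star => _ [_ [b hb <-] [_ [a ha <-] ->]]; rewrite starM -DS // -t1_star.
  by apply: bcdot_in; [exists (star a); auto|exists (star b); auto].
Qed.
End SpanCalculus.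

(** * Bisimplifiability *)

Section Bosonization.
Variables (R : realType) (L J N P : choiceType).
Local Notation bop := (bop R).
Variables (W : bop (L * L)%type) (A Ah : set (bop L)) (D Dh : bop L -> bop (L * L)%type).
Hypothesis G : qg W A Ah D Dh.
Variables (B : set (bop J)) (beta : bop J -> bop (J * L)%type).
Hypotheses (cB : calgn B) (hb : mhom B (bat B A) beta).
Variables (BB : set (bop P)) (i1 i2 DB : bop J -> bop P).
Hypotheses (cBB : calgn BB) (hi1 : mhom B BB i1) (hi2 : mhom B BB i2) (hDB : mhom B BB DB).
Hypotheses (BB12 : BB = bcdot (i1 @` B) (i2 @` B)) (BB21 : BB = bcdot (i2 @` B) (i1 @` B)).
Variables (C : set (bop N)) (iA : bop L -> bop N) (iB : bop J -> bop N).
Hypotheses (cC : calgn C) (hA : mhom A C iA) (hB : mhom B C iB).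
Hypotheses (CAB : C = bcdot (iA @` A) (iB @` B)) (CBA : C = bcdot (iB @` B) (iA @` A)).
Variables (DC : bop N -> bop (N * N)%type) (Th : bop P -> bop (N * N)%type).
Hypotheses (hDC : mhom C (bat C C) DC) (hTh : mhom BB (bat C C) Th).
Hypotheses (DCA : forall a, A a -> DC (iA a) = amp1 iA (amp2 iA (D a))).
Hypotheses (DCB : forall b, B b -> DC (iB b) = Th (DB b)).
Hypotheses (Th1 : forall b, B b -> Th (i1 b) = amp1 iB (amp2 iA (beta b))).
Hypotheses (Th2 : forall b, B b -> Th (i2 b) = t2 N (iB b)).
Let cA := qg_A G.
Let AM := multb_in (proj1 cA).
Let BM := multb_in (proj1 cB).
Let CM := multb_in (proj1 cC).

Section Bisimplifiable.
Hypotheses (podles : bcdot (beta @` B) (@t2 R J L @` A) = bat B A).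
Hypotheses (bs1 : bcdot (DB @` B) (i1 @` B) = BB) (bs2 : bcdot (DB @` B) (i2 @` B) = BB).
(** Subsets of M(C (x) C): in [a1], [a2], [b1], [b2] the digit is the leg holding the copy of A or
    B, [dA] and [dB] are the images of A and B under DC, and [th1] is the image under Theta of the
    first copy of B. *)
Let a1 : set (bop (N * N)%type) := (fun a => t1 N (iA a)) @` A.
Let a2 : set (bop (N * N)%type) := (fun a => t2 N (iA a)) @` A.
Let b1 : set (bop (N * N)%type) := (fun a => t1 N (iB a)) @` B.
Let b2 : set (bop (N * N)%type) := (fun a => t2 N (iB a)) @` B.
Let dA : set (bop (N * N)%type) := (fun a => DC (iA a)) @` A.
Let dB : set (bop (N * N)%type) := (fun a => DC (iB a)) @` B.
Let th1 : set (bop (N * N)%type) := (fun a => Th (i1 a)) @` B.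

Let hAA := mhom_comp (calgn_bat cA cA) (calgn_bat cA cC) (calgn_bat cC cC)
  (mhom_amp2 cA cA cC hA) (mhom_amp1 cA cC hA cC).
Let hBA := mhom_comp (calgn_bat cB cA) (calgn_bat cB cC) (calgn_bat cC cC)
  (mhom_amp2 cB cA cC hA) (mhom_amp1 cB cC hB cC).
Let imgM (I K : choiceType) (X : set (bop I)) (Y : set (bop K)) F : calgn X -> mhom X Y F -> F @` X `<=` multb Y.
Proof. by move=> [cX _] hF _ [x hx <-]; apply: (mhomM hF); exact: multb_in. Qed.

Let E_t2 : bcdot b2 a2 = bcdot a2 b2.
Proof.
apply: (bcdot_img4 (calg_setT R N) (uhom_pre _ (uhom_t2 R N N)) (x1 := iB) (x2 := iA) (x3 := iA) (x4 := iB)) => //.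
by rewrite -CBA.
Qed.
Let E_t1 : bcdot b1 a1 = bcdot a1 b1.
Proof.
apply: (bcdot_img4 (calg_setT R N) (uhom_pre _ (uhom_t1 R N N)) (x1 := iB) (x2 := iA) (x3 := iA) (x4 := iB)) => //.
by rewrite -CBA.
Qed.
Let E_Th X Y X' Y' : mhom B BB X -> mhom B BB Y -> mhom B BB X' -> mhom B BB Y' ->
  bcdot (X @` B) (Y @` B) = bcdot (X' @` B) (Y' @` B) ->
  bcdot ((fun a => Th (X a)) @` B) ((fun a => Th (Y a)) @` B) =
  bcdot ((fun a => Th (X' a)) @` B) ((fun a => Th (Y' a)) @` B).
Proof.
move=> hX hY hX' hY'; apply: (bcdot_img4 (calg_multb (proj1 cBB)) (mhomS hTh)) => s /BM hs; split=> //.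
- exact: mhomM hX hs.
- exact: mhomM hY hs.
- exact: mhomM hX' hs.
- exact: mhomM hY' hs.
Qed.
Let E_dB : dB = (fun a => Th (DB a)) @` B. Proof. exact: img_eq. Qed.
Let E_b2 : b2 = (fun a => Th (i2 a)) @` B. Proof. by apply: img_eq => x hx; rewrite Th2. Qed.
(** The Podles condition for beta, transported by iB (x) iA. *)
Let E_beta : bcdot th1 a2 = bcdot b1 a2.
Proof.
have tA a : A a -> multb (bat B A) (t2 J a) /\ amp1 iB (amp2 iA (t2 J a)) = t2 N (iA a).
  move=> /AM ha; split; first exact: (mhomM (mhom_t2 cB cA) ha).
  by rewrite (amp2_t2 _ cA hA ha) (amp1_t2 cB hB).
apply: (bcdot_img4 (calg_multb (proj1 (calgn_bat cB cA))) (mhomS hBA) (x1 := beta) (x2 := @t2 R J L)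
  (x3 := @t1 R J L) (x4 := @t2 R J L)) => //.
- by move=> s hs; split; [exact: (mhomM hb (BM hs))|rewrite Th1].
- move=> s /BM hs; split; first exact: (mhomM (mhom_t1 cB cA) hs).
  by rewrite (amp2_t1 cA hA) (amp1_t1 _ cB hB hs).
- by rewrite podles bat_dot.
Qed.
Let tA2 a : A a -> multb (bat A A) (t2 L a) /\ amp1 iA (amp2 iA (t2 L a)) = t2 N (iA a).
Proof.
move=> /AM ha; split; first exact: (mhomM (mhom_t2 cA cA) ha).
by rewrite (amp2_t2 _ cA hA ha) (amp1_t2 cA hA).
Qed.
Let tA1 a : A a -> multb (bat A A) (t1 L a) /\ amp1 iA (amp2 iA (t1 L a)) = t1 N (iA a).
Proof.
move=> /AM ha; split; first exact: (mhomM (mhom_t1 cA cA) ha).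
by rewrite (amp2_t1 cA hA) (amp1_t1 _ cA hA ha).
Qed.
Let tD a : A a -> multb (bat A A) (D a) /\ amp1 iA (amp2 iA (D a)) = DC (iA a).
Proof. by move=> ha; split; [exact: (mhomM (qg_D G) (AM ha))|rewrite DCA]. Qed.
Let E_D2 : bcdot dA a2 = bcdot a1 a2.
Proof.
apply: (bcdot_img4 (calg_multb (proj1 (calgn_bat cA cA))) (mhomS hAA) tD tA2 tA1 tA2).
by rewrite -bat_dot; exact: (D_bisimp2 G).
Qed.
Let E_D1 : bcdot dA a1 = bcdot a1 a2.
Proof.
apply: (bcdot_img4 (calg_multb (proj1 (calgn_bat cA cA))) (mhomS hAA) tD tA1 tA1 tA2).
by rewrite -bat_dot; exact: (D_bisimp1 G).
Qed.
Let E_a1a2 : bcdot a1 a2 = bcdot a2 a1.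
Proof. exact: t12_dot. Qed.
Let E_b1a2 : bcdot b1 a2 = bcdot a2 b1.
Proof. exact: t12_dot. Qed.
Let E_b1b2 : bcdot b1 b2 = bcdot b2 b1.
Proof. exact: t12_dot. Qed.
Let E_a1b2 : bcdot a1 b2 = bcdot b2 a1.
Proof. exact: t12_dot. Qed.

Let span_DC X Y : bcdot (X @` C) (Y @` C) = bcdot (bcspan (X @` C)) (bcspan (Y @` C)) :> set (bop (N * N)%type).
Proof. by rewrite bcdot_spanl bcdot_spanr. Qed.
Let span_img X I I' (F : bop I -> bop N) (F' : bop I' -> bop N) (S : set (bop I)) (S' : set (bop I')) :
  shom (multb C) X -> F @` S `<=` multb C -> F' @` S' `<=` multb C -> C = bcdot (F @` S) (F' @` S') ->
  bcspan (X @` C) = bcdot ((fun a => X (F a)) @` S) ((fun a => X (F' a)) @` S') :> set (bop (N * N)%type).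
Proof.
by move=> hX h1 h2 e; rewrite e (bcspan_img (calg_multb (proj1 cC)) hX h1 h2) !img_comp.
Qed.
Let s_t1 : bcspan (@t1 R N N @` C) = bcdot a1 b1.
Proof. exact: span_img (uhom_pre _ (uhom_t1 R N N)) (imgM cA hA) (imgM cB hB) CAB. Qed.
Let s_t2 : bcspan (@t2 R N N @` C) = bcdot b2 a2.
Proof. exact: span_img (uhom_pre _ (uhom_t2 R N N)) (imgM cB hB) (imgM cA hA) CBA. Qed.
Let s_CC : bat C C = bcdot (bcdot a1 b1) (bcdot b2 a2).
Proof. by rewrite bat_dot span_DC s_t1 s_t2. Qed.

Lemma boson_bisimp2 : bcdot (DC @` C) (@t2 R N N @` C) = bat C C.
Proof.
have e1 : bcdot dB b2 = bcdot th1 b2.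
  by rewrite E_dB {1}E_b2 (E_Th hDB hi2 hi1 hi2) -?E_b2 // bs2.
have e2 : bcdot (bcdot th1 b2) a2 = bcdot (bcdot a2 b1) b2.
  by rewrite bcdotA E_t2 -bcdotA E_beta E_b1a2.
have e3 : bcdot (bcdot a1 b1) (bcdot b2 a2) = bcdot (bcdot a1 a2) (bcdot b1 b2).
  by rewrite E_t2 bcdotA -(bcdotA b1) E_b1a2 (bcdotA a2) -(bcdotA a1).
rewrite s_CC span_DC s_t2 (span_img (mhomS hDC) (imgM cA hA) (imgM cB hB) CAB) -/dA -/dB e3.
by rewrite (bcdotA dA) -(bcdotA dB) e1 e2 (bcdotA a2) -(bcdotA dA) E_D2.
Qed.
(** The generators of C are taken in the order B, A, so that [dA] meets [a1]. Then dB dA a1 b1 = dB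
    a1 a2 b1 = dB th1 a2 a1 = b2 th1 a2 a1 = b2 b1 a2 a1; the Podles condition is used first
    backwards, to create the factor [th1] that [dB] needs on its right, and then forwards. *)
Lemma boson_bisimp1 : bcdot (DC @` C) (@t1 R N N @` C) = bat C C.
Proof.
have e1 : bcdot dB th1 = bcdot b2 th1.
  by rewrite E_dB (E_Th hDB hi1 hi2 hi1) -?E_b2 // bs1 BB21.
have e2 : bcdot (bcdot a1 a2) b1 = bcdot (bcdot th1 a2) a1.
  by rewrite E_a1a2 (bcdotA a2 a1) -E_t1 -(bcdotA a2 b1) -E_b1a2 -E_beta.
have e3 : bcdot (bcdot b2 th1) (bcdot a2 a1) = bcdot (bcdot b2 a2) (bcdot a1 b1).
  by rewrite (bcdotA b2 th1) -(bcdotA th1) E_beta E_b1a2 (bcdotA a2) E_t1 -(bcdotA b2).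
have s_CC' : bat C C = bcdot (bcdot b2 a2) (bcdot a1 b1).
  by rewrite bat_dot (t12_dot id id) span_DC s_t1 s_t2.
rewrite s_CC' span_DC s_t1 (span_img (mhomS hDC) (imgM cB hB) (imgM cA hA) CBA) -/dA -/dB -e3.
by rewrite (bcdotA dB) -(bcdotA dA) E_D1 e2 (bcdotA th1) -(bcdotA dB) e1.
Qed.
End Bisimplifiable.
End Bosonization.

Section TensorProductMorphism.
Variable R : realType.
Implicit Types (I J K N : choiceType).
Local Notation bop := (bop R).

Definition tens I J I' J' (F : bop I -> bop I') (G : bop J -> bop J') (T : bop (I * J)%type) :
  bop (I' * J')%type := opq (amp1 F (amp2 G T)).

Section Basic.
Variables (I J I' J' : choiceType) (A : set (bop I)) (A' : set (bop I')) (B : set (bop J)) (B' : set (bop J')).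
Variables (F : bop I -> bop I') (G : bop J -> bop J').
Hypotheses (cA : calgn A) (cA' : calgn A') (cB : calgn B) (cB' : calgn B') (hF : mhom A A' F) (hG : mhom B B' G).
Lemma mhom_tens : mhom (bat A B) (bat A' B') (tens F G).
Proof.
have h := mhom_comp (calgn_bat cA cB) (calgn_bat cA cB') (calgn_bat cA' cB')
  (mhom_amp2 cA cB cB' hG) (mhom_amp1 cA cA' hF cB').
by apply: (mhomE (proj1 (calgn_bat cA cB)) _ h) => x _; rewrite /tens opqE.
Qed.
Lemma tens_bten x y : multb A x -> multb B y -> tens F G (bten x y) = bten (F x) (G y).
Proof.
move=> hx hy; rewrite /tens opqE (amp2_bten cB hG x hy).
by rewrite (amp1_bten (calg_multb (proj1 cA)) (mhomS hF)).
Qed.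
Lemma tens_t2 y : multb B y -> tens F G (t2 I y) = t2 I' (G y).
Proof. by move=> hy; rewrite /tens opqE (amp2_t2 _ cB hG hy) (amp1_t2 cA hF). Qed.
Lemma tens_eq F' G' T : (forall x, multb A x -> F' x = F x) -> (forall y, multb B y -> G' y = G y) ->
  multb (bat A B) T -> tens F' G' T = tens F G T.
Proof.
move=> eF eG hT; have hF' := mhomE (proj1 cA) eF hF; have hG' := mhomE (proj1 cB) eG hG.
have hb k l := multb_lblk k l cA (proj1 cB) hT.
have e := amp2_eq (proj1 cB) (mhomS hG') eG hb.
have hT2 := mhomM (mhom_amp2 cA cB cB' hG) hT.
have hc k l := multb_blk k l (proj1 cA) cB' hT2.
have e2 := amp1_eq (proj1 cA) (mhomS hF') eF hc.
exact: (etrans (opqE _) (etrans (congr1 (amp1 F') e) (etrans e2 (esym (opqE _))))).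
Qed.
End Basic.

Lemma tens_comp I J I' J' I'' J'' (A : set (bop I)) (A' : set (bop I')) (B : set (bop J)) (B' : set (bop J'))
  (A'' : set (bop I'')) (B'' : set (bop J'')) F G F' G' T :
  calgn A -> calgn A' -> calgn B -> calgn B' -> calgn A'' -> calgn B'' ->
  mhom A A' F -> mhom B B' G -> mhom A' A'' F' -> mhom B' B'' G' -> multb (bat A B) T ->
  tens F' G' (tens F G T) = tens (fun x => F' (F x)) (fun y => G' (G y)) T.
Proof.
move=> cA cA' cB cB' cA'' cB'' hF hG hF' hG'; move: T.
have hF2 := mhom_comp cA cA' cA'' hF hF'; have hG2 := mhom_comp cB cB' cB'' hG hG'.
have t1 := mhom_tens cA cA' cB cB' hF hG; have t2 := mhom_tens cA' cA'' cB' cB'' hF' hG'.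
have t12 := mhom_comp (calgn_bat cA cB) (calgn_bat cA' cB') (calgn_bat cA'' cB'') t1 t2.
apply: (mhom_bat_uniq cA cB (calgn_bat cA'' cB'') t12 (mhom_tens cA cA'' cB cB'' hF2 hG2)) => a b ha hb.
have ma := multb_in (proj1 cA) ha; have mb := multb_in (proj1 cB) hb.
by rewrite (tens_bten cA cB hF hG ma mb) (tens_bten cA' cB' hF' hG' (mhomM hF ma) (mhomM hG mb))
  (tens_bten cA cB hF2 hG2 ma mb).
Qed.
Lemma tens_idr I J I' (A : set (bop I)) (A' : set (bop I')) (B : set (bop J)) F T :
  calgn A -> calgn A' -> calgn B -> mhom A A' F -> multb (bat A B) T -> amp1 F T = tens F id T.
Proof.
move=> cA cA' cB hF hT; rewrite /tens opqE (amp2_id (proj1 cB)) // => k l.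
exact: (multb_lblk k l cA (proj1 cB) hT).
Qed.
Lemma tens_idl I J J' (A : set (bop I)) (B : set (bop J)) (B' : set (bop J')) G T :
  calgn A -> calgn B -> calgn B' -> mhom B B' G -> multb (bat A B) T -> amp2 G T = tens id G T.
Proof.
move=> cA cB cB' hG hT; rewrite /tens opqE (amp1_id (proj1 cA)) // => k l.
exact: (multb_blk k l (proj1 cA) cB' (mhomM (mhom_amp2 cA cB cB' hG) hT)).
Qed.
Lemma tens_asc I J K I' J' K' (A : set (bop I)) (A' : set (bop I')) (B : set (bop J)) (B' : set (bop J'))
  (C : set (bop K)) (C' : set (bop K')) F G H T :
  calgn A -> calgn A' -> calgn B -> calgn B' -> calgn C -> calgn C' ->
  mhom A A' F -> mhom B B' G -> mhom C C' H -> multb (bat (bat A B) C) T ->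
  asc (tens (tens F G) H T) = tens F (tens G H) (asc T).
Proof.
move=> cA cA' cB cB' cC cC' hF hG hH; have cAB := calgn_bat cA cB; have cBC := calgn_bat cB cC.
have cAB' := calgn_bat cA' cB'; have cBC' := calgn_bat cB' cC'.
have hFG := mhom_tens cA cA' cB cB' hF hG; have hGH := mhom_tens cB cB' cC cC' hG hH.
have h1 := mhom_comp (calgn_bat cAB cC) (calgn_bat cAB' cC') (calgn_bat cA' cBC')
  (mhom_tens cAB cAB' cC cC' hFG hH) (mhom_asc cA' cB' cC').
have h2 := mhom_comp (calgn_bat cAB cC) (calgn_bat cA cBC) (calgn_bat cA' cBC')
  (mhom_asc cA cB cC) (mhom_tens cA cA' cBC cBC' hF hGH).
have AM := multb_in (proj1 cA); have BM := multb_in (proj1 cB); have CM := multb_in (proj1 cC).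
move: T; apply: (mhom_uniq (calgn_bat cAB cC) (calgn_bat cA' cBC') h1 h2) => x hx.
have cM := calg_multb (proj1 (calgn_bat cAB cC)).
suff hs : bat (bat A B) C `<=` [set x | multb (bat (bat A B) C) x /\
   asc (tens (tens F G) H x) = tens F (tens G H) (asc x)] by have [] := hs _ hx.
apply: bat3l_sub; first exact: (hom_closed_eq cM (mhomS h1) (mhomS h2)).
move=> a b c /AM ha /BM hb /CM hc.
have mab := multb_bten ha hb; have mbc := multb_bten hb hc.
split; first exact: multb_bten.
rewrite (tens_bten cAB cC hFG hH mab hc) (tens_bten cA cB hF hG ha hb) !asc_bten.
by rewrite (tens_bten cA cBC hF hGH ha mbc) (tens_bten cB cC hG hH hb hc).
Qed.
Lemma tens_asc_t2 I J I' J' K (A : set (bop I)) (A' : set (bop I')) (B : set (bop J)) (B' : set (bop J'))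
  (C : set (bop K)) F G T :
  calgn A -> calgn A' -> calgn B -> calgn B' -> calgn C ->
  mhom A A' F -> mhom B B' G -> multb (bat A B) T ->
  asc (tens (fun x => t2 K (F x)) G T) = t2 K (tens F G T).
Proof.
move=> cA cA' cB cB' cC hF hG hT; have h2 := mhom_t2 cC cA'.
rewrite /tens !opqE -(amp1_comp cA cA' hF h2); last first.
  by move=> k l; exact: (multb_blk k l (proj1 cA) cB' (mhomM (mhom_amp2 cA cB cB' hG) hT)).
by rewrite amp1_t2E asc_r23.
Qed.
Lemma asc_t2 I J K (x : bop K) : asc (t2 (I * J)%type x) = t2 I (t2 J x).
Proof. by apply: bopP => -[a [b c]] [a' [b' c']]; rewrite ascE !t2E /= xpair_eqE mulrA -natrM mulnb. Qed.
End TensorProductMorphism.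

(** * Coassociativity *)

Section Coassociativity.
Variables (R : realType) (L J N P : choiceType).
Local Notation bop := (bop R).
Variables (W : bop (L * L)%type) (A Ah : set (bop L)) (D Dh : bop L -> bop (L * L)%type).
Hypothesis G : qg W A Ah D Dh.
Variables (B : set (bop J)) (beta : bop J -> bop (J * L)%type).
Hypotheses (cB : calgn B) (hb : mhom B (bat B A) beta).
Hypothesis (bco : forall b, B b -> amp2 D (beta b) = asc (amp1 beta (beta b))).
Variables (BB : set (bop P)) (i1 i2 DB : bop J -> bop P) (bBB : bop P -> bop (P * L)%type).
Hypotheses (cBB : calgn BB) (hi1 : mhom B BB i1) (hi2 : mhom B BB i2) (hDB : mhom B BB DB).
Hypotheses (BB12 : BB = bcdot (i1 @` B) (i2 @` B)) (hbBB : mhom BB (bat BB A) bBB).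
Hypotheses (eq1 : forall b, B b -> bBB (i1 b) = amp1 i1 (beta b)).
Hypotheses (eq2 : forall b, B b -> bBB (i2 b) = amp1 i2 (beta b)).
Hypotheses (eqD : forall b, B b -> bBB (DB b) = amp1 DB (beta b)).
Variables (C : set (bop N)) (iA : bop L -> bop N) (iB : bop J -> bop N).
Hypotheses (cC : calgn C) (hA : mhom A C iA) (hB : mhom B C iB).
Hypotheses (CAB : C = bcdot (iA @` A) (iB @` B)).
Variables (Q : choiceType) (E : set (bop Q)) (eA : bop L -> bop Q) (eB : bop P -> bop Q).
Hypotheses (cE : calgn E) (hEA : mhom A E eA) (hEB : mhom BB E eB).
Variables (DC : bop N -> bop (N * N)%type) (Psi : bop Q -> bop (N * N)%type).
Hypotheses (hDC : mhom C (bat C C) DC) (hPsi : mhom E (bat C C) Psi).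
Let Th y := Psi (eB y).
Hypotheses (PsiA : forall a, A a -> Psi (eA a) = amp1 iA (amp2 iA (D a))).
Hypotheses (DCA : forall a, A a -> DC (iA a) = Psi (eA a)).
Hypotheses (DCB : forall b, B b -> DC (iB b) = Th (DB b)).
Hypotheses (Th1 : forall b, B b -> Th (i1 b) = amp1 iB (amp2 iA (beta b))).
Hypotheses (Th2 : forall b, B b -> Th (i2 b) = t2 N (iB b)).
Variables (Ml Mm : choiceType) (LL : set (bop Ml)) (MM : set (bop Mm)).
Variables (lL : bop P -> bop Ml) (rL : bop J -> bop Ml) (lM : bop J -> bop Mm) (rM : bop P -> bop Mm).
Variables (Dl : bop P -> bop Ml) (Dr : bop P -> bop Mm) (F : bop Ml -> bop Mm).
Hypotheses (cL : calgn LL) (cM : calgn MM) (hlL : mhom BB LL lL) (hrL : mhom B LL rL).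
Hypotheses (hlM : mhom B MM lM) (hrM : mhom BB MM rM) (hDl : mhom BB LL Dl) (hDr : mhom BB MM Dr) (hF : mhom LL MM F).
Hypotheses (Dl1 : forall b, B b -> Dl (i1 b) = lL (DB b)) (Dl2 : forall b, B b -> Dl (i2 b) = rL b).
Hypotheses (Dr1 : forall b, B b -> Dr (i1 b) = lM b) (Dr2 : forall b, B b -> Dr (i2 b) = rM (DB b)).
Hypotheses (F1 : forall b, B b -> F (lL (i1 b)) = lM b) (F2 : forall b, B b -> F (lL (i2 b)) = rM (i1 b)).
Hypotheses (F3 : forall b, B b -> F (rL b) = rM (i2 b)).
Hypothesis (bcoas : forall b, B b -> F (Dl (DB b)) = Dr (DB b)).
Variable G3 : bop Mm -> bop (J * Q)%type.
Hypotheses (hG3 : mhom MM (bat B E) G3).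
Hypotheses (G3l : forall b, B b -> G3 (lM b) = amp2 eA (beta b)).
Hypotheses (G3r : forall y, multb BB y -> G3 (rM y) = t2 J (eB y)).

Let cA := qg_A G. Let hD := qg_D G.
Let AM := multb_in (proj1 cA).
Let BM := multb_in (proj1 cB).
Let CM := multb_in (proj1 cC).
Let cCC := calgn_bat cC cC. Let cC3 := calgn_bat cC cCC. Let cAA := calgn_bat cA cA.
Let cBA := calgn_bat cB cA.
Let hTh : mhom BB (bat C C) Th := mhom_comp cBB cE cCC hEB hPsi.
Let hAA := mhom_tens cA cC cA cC hA hA.
Let hBA := mhom_tens cB cC cA cC hB hA.
Let mb b : B b -> multb (bat B A) (beta b). Proof. by move=> /BM; exact: (mhomM hb). Qed.
Let idA := mhom_id cA. Let idB := mhom_id cB. Let idC := mhom_id cC.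

Let DCAe a : multb A a -> DC (iA a) = tens iA iA (D a).
Proof.
move: a; apply: (mhom_uniq cA cCC (mhom_comp cA cC cCC hA hDC) (mhom_comp cA cAA cCC hD hAA)) => a ha.
by rewrite DCA // PsiA // /tens opqE.
Qed.
Let PsiAe a : multb A a -> Psi (eA a) = tens iA iA (D a).
Proof.
move: a; apply: (mhom_uniq cA cCC (mhom_comp cA cE cCC hEA hPsi) (mhom_comp cA cAA cCC hD hAA)) => a ha.
by rewrite PsiA // /tens opqE.
Qed.
Let DCBe b : multb B b -> DC (iB b) = Th (DB b).
Proof. by move: b; exact: (mhom_uniq cB cCC (mhom_comp cB cC cCC hB hDC) (mhom_comp cB cBB cCC hDB hTh)). Qed.
Let Th1e b : multb B b -> Th (i1 b) = tens iB iA (beta b).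
Proof.
move: b; apply: (mhom_uniq cB cCC (mhom_comp cB cBB cCC hi1 hTh) (mhom_comp cB cBA cCC hb hBA)) => b hb'.
by rewrite Th1 // /tens opqE.
Qed.
Let Th2e b : multb B b -> Th (i2 b) = t2 N (iB b).
Proof. by move: b; exact: (mhom_uniq cB cCC (mhom_comp cB cBB cCC hi2 hTh) (mhom_comp cB cC cCC hB (mhom_t2 cC cC))). Qed.

Let P1 (c : bop (N * N)%type) : bop (N * (N * N))%type := asc (amp1 DC c).
Let P2 (c : bop (N * N)%type) : bop (N * (N * N))%type := amp2 DC c.
Let hP1 : mhom (bat C C) (bat C (bat C C)) P1.
Proof. exact: (mhom_comp cCC (calgn_bat cCC cC) cC3 (mhom_amp1 cC cCC hDC cC) (mhom_asc cC cC cC)). Qed.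
Let hP2 : mhom (bat C C) (bat C (bat C C)) P2 := mhom_amp2 cC cC cCC hDC.
Let Q1 y := P1 (Th y). Let Q2 y := P2 (Th y).
Let hQ1 : mhom BB (bat C (bat C C)) Q1 := mhom_comp cBB cCC cC3 hTh hP1.
Let hQ2 : mhom BB (bat C (bat C C)) Q2 := mhom_comp cBB cCC cC3 hTh hP2.
(** The map from the triple product to M(C (x) C (x) C) in two stages: G3 unfolds the first factor
    by beta into B (x) (A [x] B [x] B), then iB and Psi are applied. *)
Let Th3 x := tens iB Psi (G3 x).
Let hTh3 : mhom MM (bat C (bat C C)) Th3 :=
  mhom_comp cM (calgn_bat cB cE) cC3 hG3 (mhom_tens cB cC cE cCC hB hPsi).

Let on_A a : A a -> P1 (DC (iA a)) = P2 (DC (iA a)).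
Proof.
move=> ha; have hDa := mhomM hD (AM ha); rewrite (DCAe (AM ha)) /P1 /P2.
have hT := mhomM hAA hDa.
rewrite (tens_idr cC cCC cC hDC hT) (tens_idl cC cC cCC hDC hT).
rewrite (tens_comp cA cC cA cC cCC cC hA hA hDC idC hDa) (tens_comp cA cC cA cC cC cCC hA hA idC hDC hDa).
have hDA := mhom_comp cA cAA cCC hD hAA.
rewrite (tens_eq cA cA cC hDA hA DCAe (fun _ _ => erefl) hDa) (tens_eq cA cA cCC hA hDA (fun _ _ => erefl) DCAe hDa).
rewrite -(tens_comp cA cAA cA cA cCC cC hD idA hAA hA hDa) -(tens_comp cA cA cA cAA cC cCC idA hD hA hAA hDa).
have hDDa := mhomM (mhom_amp1 cA cAA hD cA) hDa.
rewrite -(tens_idr cA cAA cA hD hDa) -(tens_idl cA cA cAA hD hDa).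
by rewrite (tens_asc cA cC cA cC cA cC hA hA hA hDDa) (D_coassoc G) //; exact: AM.
Qed.

Let Th3l b : B b -> Th3 (lM b) = tens iB (fun a => tens iA iA (D a)) (beta b).
Proof.
move=> hb'; have e1 : G3 (lM b) = tens id eA (beta b).
  by rewrite (G3l hb'); exact: (tens_idl cB cA cE hEA (mb hb')).
have e2 := tens_comp cB cB cA cE cC cCC idB hEA hB hPsi (mb hb').
have e3 := tens_eq (F' := fun x => iB (id x)) (G' := fun y => Psi (eA y)) cB cA cCC hB
  (mhom_comp cA cAA cCC hD hAA) (fun _ _ => erefl) PsiAe (mb hb').
exact: (etrans (congr1 (tens iB Psi) e1) (etrans e2 e3)).
Qed.
Let Th3r y : multb BB y -> Th3 (rM y) = t2 N (Th y).
Proof.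
move=> hy; rewrite /Th3 (G3r hy); exact: (tens_t2 cB cE hB hPsi (mhomM hEB hy)).
Qed.

Let genBB (U : choiceType) (X : set (bop U)) f g : calgn X -> mhom BB X f -> mhom BB X g ->
  (forall b, B b -> f (i1 b) = g (i1 b)) -> (forall b, B b -> f (i2 b) = g (i2 b)) ->
  forall y, multb BB y -> f y = g y.
Proof.
move=> cX hf hg e1 e2; apply: (mhom_gen (X := i1 @` B) (Y := i2 @` B) cBB cX hf hg).
- by move=> _ [b hb' <-]; exact: (mhomM hi1 (BM hb')).
- by move=> _ [b hb' <-]; exact: (mhomM hi2 (BM hb')).
- by rewrite -BB12.
- by move=> _ [b hb' <-]; exact: e1.
- by move=> _ [b hb' <-]; exact: e2.
Qed.

(** On the first copy of B this is DC o iA = (iA (x) iA) o D applied in the second leg of beta(b);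
    on the second copy it is the formula for DC on B. *)
Let Q2E y : multb BB y -> Q2 y = Th3 (Dr y).
Proof.
move: y; apply: (genBB cC3 hQ2 (mhom_comp cBB cM cC3 hDr hTh3)) => b hb'.
  rewrite (Dr1 hb') (Th3l hb') /Q2 /P2 (Th1e (BM hb')).
  rewrite (tens_idl cC cC cCC hDC (mhomM hBA (mb hb'))).
  rewrite (tens_comp cB cC cA cC cC cCC hB hA idC hDC (mb hb')).
  exact: (tens_eq cB cA cCC hB (mhom_comp cA cAA cCC hD hAA) (fun _ _ => erefl) DCAe (mb hb')).
rewrite (Dr2 hb') (Th3r (mhomM hDB (BM hb'))).
by rewrite /Q2 /P2 (Th2e (BM hb')) (amp2_t2 _ cC hDC (mhomM hB (BM hb'))) (DCBe (BM hb')).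
Qed.

Let Q3 y := asc (tens Th iA (bBB y)).
Let hQ3 : mhom BB (bat C (bat C C)) Q3.
Proof.
exact: (mhom_comp cBB (calgn_bat cCC cC) cC3 (mhom_comp cBB (calgn_bat cBB cA) (calgn_bat cCC cC) hbBB
  (mhom_tens cBB cCC cA cC hTh hA)) (mhom_asc cC cC cC)).
Qed.
(** The first two factors of the triple product are treated as one element y of B [x] B through its
    coaction of A; coassociativity of beta enters on the first copy. Having the formula for all y,
    and not only for the two copies, permits y = DB b afterwards. *)
Let Q3E y : multb BB y -> Th3 (F (lL y)) = Q3 y.
Proof.
have hT3L := mhom_comp cBB cM cC3 (mhom_comp cBB cL cM hlL hF) hTh3.
move: y; apply: (genBB cC3 hT3L hQ3) => b hb'; have hbb := mb hb'.
  rewrite (F1 hb') (Th3l hb') /Q3 (eq1 hb') (tens_idr cB cBB cA hi1 hbb).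
  rewrite (tens_comp cB cBB cA cA cCC cC hi1 idA hTh hA hbb).
  have hBb := mhom_comp cB cBA cCC hb hBA.
  have e1 := tens_eq (F' := fun x => Th (i1 x)) (G' := fun x => iA (id x)) cB cA cC hBb hA Th1e (fun _ _ => erefl) hbb.
  have e2 := tens_comp cB cBA cA cA cCC cC hb idA hBA hA hbb.
  have e3 := tens_idr cB cBA cA hb hbb.
  have e4 := tens_asc cB cC cA cC cA cC hB hA hA (mhomM (mhom_amp1 cB cBA hb cA) hbb).
  have e5 : asc (amp1 beta (beta b)) = tens id D (beta b).
    exact: (etrans (esym (bco hb')) (tens_idl cB cA cAA hD hbb)).
  have e6 := tens_comp cB cB cA cAA cC cCC idB hD hB hAA hbb.
  rewrite e1 -[X in asc X]e2 -e3 e4 e5; exact: esym e6.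
rewrite (F2 hb') (Th3r (mhomM hi1 (BM hb'))).
rewrite (Th1e (BM hb')) /Q3 (eq2 hb') (tens_idr cB cBB cA hi2 hbb).
rewrite (tens_comp cB cBB cA cA cCC cC hi2 idA hTh hA hbb).
rewrite (tens_eq cB cA cC (mhom_comp cB cC cCC hB (mhom_t2 cC cC)) hA Th2e (fun _ _ => erefl) hbb).
by rewrite (tens_asc_t2 cB cC cA cC cC hB hA hbb).
Qed.
(** On the first copy Dl produces lL (DB b), so [Q3E] is used at DB b, and equivariance of DB
    rewrites the coaction of DB b by beta(b). *)
Let Q1E y : multb BB y -> Q1 y = Th3 (F (Dl y)).
Proof.
have hT3D := mhom_comp cBB cM cC3 (mhom_comp cBB cL cM hDl hF) hTh3.
move: y; apply: (genBB cC3 hQ1 hT3D) => b hb'; have hbb := mb hb'.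
  rewrite (Dl1 hb') (Q3E (mhomM hDB (BM hb'))).
  rewrite /Q1 /P1 (Th1e (BM hb')) (tens_idr cC cCC cC hDC (mhomM hBA hbb)).
  rewrite (tens_comp cB cC cA cC cCC cC hB hA hDC idC hbb).
  rewrite (tens_eq cB cA cC (mhom_comp cB cBB cCC hDB hTh) hA DCBe (fun _ _ => erefl) hbb).
  rewrite /Q3 (eqD hb') (tens_idr cB cBB cA hDB hbb).
  by rewrite (tens_comp cB cBB cA cA cCC cC hDB idA hTh hA hbb).
rewrite (Dl2 hb') (F3 hb') (Th3r (mhomM hi2 (BM hb'))).
by rewrite /Q1 /P1 (Th2e (BM hb')) (amp1_t2 cC hDC) asc_t2.
Qed.

(** On A this is coassociativity of D. On B the two sides are values of Th3 at the two sides of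
    braided coassociativity. *)
Lemma boson_coassoc c : C c -> asc (amp1 DC (DC c)) = amp2 DC (DC c).
Proof.
move=> hc; have h1 := mhom_comp cC cCC cC3 hDC hP1; have h2 := mhom_comp cC cCC cC3 hDC hP2.
apply: (mhom_gen (X := iA @` A) (Y := iB @` B) cC cC3 h1 h2 _ _ _ _ _ (CM hc)).
- by move=> _ [b hb' <-]; exact: (mhomM hA (AM hb')).
- by move=> _ [b hb' <-]; exact: (mhomM hB (BM hb')).
- by rewrite -CAB.
- by move=> _ [b hb' <-]; exact: on_A.
move=> _ [b hb' <-]; have hDb := mhomM hDB (BM hb').
rewrite (DCBe (BM hb')).
by have := Q1E hDb; have := Q2E hDb; rewrite /Q1 /Q2 => -> ->; rewrite bcoas.
Qed.
End Coassociativity.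

(** * Morphisms built through the canonical models *)

Section TripleProduct.
Variables (R : realType) (L J P : choiceType).
Local Notation bop := (bop R).
Local Notation Kc := (@Kc R).
Variables (W : bop (L * L)%type) (A Ah : set (bop L)) (D Dh : bop L -> bop (L * L)%type).
Hypothesis G : qg W A Ah D Dh.
Let cA := qg_A G. Let cAh := qg_Ah G. Let hD := qg_D G.
Variables (B : set (bop J)) (beta : bop J -> bop (J * L)%type) (delta : bop J -> bop (J * L)%type).
Hypotheses (cB : calgn B) (hb : mhom B (bat B A) beta).
Hypothesis (bco : forall b, B b -> amp2 D (beta b) = asc (amp1 beta (beta b))).
Variables (BB : set (bop P)) (dBB : bop P -> bop (P * L)%type) (DB : bop J -> bop P).
Hypotheses (cBB : calgn BB) (hDB : mhom B BB DB).
Let cK N := calgn_Kc R N.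

Variables (H1 K1 : choiceType) (phi1 : bop L -> bop H1) (U1 : bop (H1 * L)%type)
  (psi1 : bop P -> bop K1) (V1 : bop (K1 * L)%type) (Z1 : bop (H1 * K1)%type).
Hypothesis TE : tw A Ah A D BB dBB phi1 U1 psi1 V1 Z1.
Hypothesis swapE : forall c y, A c -> BB y -> can A D BB dBB (@d3 R L L P dBB y * @g3 R L L P D c).
Local Notation E := (twalg A BB phi1 psi1 Z1).
Local Notation lE := (binl K1 phi1).
Local Notation rE := (binr psi1 Z1).

Lemma asc_l13_asr (X : bop (J * (L * L))%type) : asc (l13 P (asr X)) = amp2 (@l13 R L P L) X.
Proof.
apply: lblock_inj => i i'; rewrite /amp2 rblock_sw (rblock_amp1 (calg_setT R _) (uhom_pre _ (uhom_l13 R L P L))) //.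
apply: bopP => -[a [b c]] [a' [b' c']]; rewrite lblockE ascE !l13E asrE rblockE swE /=.
by [].
Qed.

(* Coassociativity of DB is transported to DC along (i_B (x) Psi) o G3. *)
Lemma triple_ex (H K : choiceType) (phi : bop J -> bop H) (U : bop (H * L)%type)
    (psi : bop P -> bop K) (V : bop (K * L)%type) (Z : bop (H * K)%type) :
  tw A Ah B beta BB dBB phi U psi V Z ->
  (forall c y, B c -> BB y -> can B beta BB dBB (@d3 R L J P dBB y * @g3 R L J P beta c)) ->
  exists G3, [/\ mhom (twalg B BB phi psi Z) (bat B E) G3,
    (forall b, multb B b -> G3 (binl K phi b) = amp2 lE (beta b)) &
    (forall y, multb BB y -> G3 (binr psi Z y) = t2 J (rE y))].
Proof.
move=> TM swapM; have [k [hk kc k1 k2]] := kappa_ex cA cAh TM swapM.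
have [k' [hk' k'1 k'2]] := kappa'_ex cA cAh TE swapE.
have cE := calgn_alg cA cAh TE swapE; have hlE := mhom_inl cA cAh TE swapE; have hrE := mhom_inr cA cAh TE swapE.
have cC := calgn_can cA cAh TE swapE; have h1 := mhom_can1 cA cAh TE swapE; have h2 := mhom_can2 cA cAh TE swapE.
have cM := calgn_alg cA cAh TM swapM; set M := twalg B BB phi psi Z in hk kc cM *.
set CE := can A D BB dBB in cC h1 h2 hk'.
have cBK := calgn_bat cBB (cK L); have cBA := calgn_bat cB cA; have cBBK := calgn_bat cB cBK.
have BM := multb_in (proj1 cB); have BBM := multb_in (proj1 cBB).
have hbe := mhom_amp1 cB cBA hb cBK.
have cMC := canM cA cAh TM.
have cBC := calgn_bat cB cC; have cBE := calgn_bat cB cE.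
have hkE := mhom_amp2 cB cC cE hk'.
(* In canonical models G3 is beta (x) id (x) id. Coassociativity of beta turns beta(b) into (id (x)
   D) beta(b), so the image lies in the multipliers of B tensored with the model CE of A [x] (B [x]
   B); k and k' translate from and to the concrete models. *)
pose f0 (X : bop (J * (P * L))%type) : bop (J * (L * (P * L)))%type := asc (amp1 beta X).
have s0 : shom (multb (bat B (bat BB (Kc L)))) f0.
  apply: (shom_comp (Q := setT) (F := amp1 beta) (G := fun x => asc x) (mhomS hbe)) => //.
  exact: uhom_pre _ (uhom_asc R _ _ _).
have cM0 := calg_multb (proj1 cBBK); have [hM0 M0M _] := cM0.
have mb b : B b -> multb (bat B A) (beta b) by move=> /BM; exact: (mhomM hb).
have hg3 := mhom_g3 cA TM; have hd3 := mhom_d3 cAh TM.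
have f0g b : B b -> f0 (g3 P beta b) = amp2 (@g3 R L L P D) (beta b).
  move=> hb'; rewrite /f0 /g3 (amp1_l13 cB hb); last by move=> i j; exact: (multb_blk i j (proj1 cB) cA (mb b hb')).
  have e : amp1 beta (beta b) = asr (amp2 D (beta b)) by rewrite (bco hb') ascK.
  rewrite e asc_l13_asr.
  apply: (amp2_comp (B := A) (B' := bat A A) (B'' := bat A (bat (Kc P) A)) cA (calgn_bat cA cA) hD).
    exact: (mhom_l13 cA (cK P) cA).
  by move=> i j; exact: (multb_lblk i j cB (proj1 cA) (mb b hb')).
have f0d y : f0 (d3 J dBB y) = t2 J (@d3 R L L P dBB y).
  by rewrite /f0 /d3 (amp1_t2 cB hb) asc_t2.
have f0M m : can B beta BB dBB m -> multb (bat B CE) (f0 m).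
  move=> hm; suff hs : can B beta BB dBB `<=` [set m | multb (bat B (bat BB (Kc L))) m /\ multb (bat B CE) (f0 m)].
    by have [] := hs _ hm.
  apply: bcdot_sub.
    apply: (pcsub_pre hM0 (pblin_shom cM0 s0)); apply: csub_multb.
    exact: csub_bat.
  move=> _ _ [b hb' <-] [y hy <-]; have m1 := mhomM hg3 (BM _ hb'); have m2 := mhomM hd3 (BBM _ hy).
  split; first exact: M0M.
  have [_ f0X _] := s0; rewrite /= (f0X _ _ m1 m2) (f0g _ hb') f0d.
  apply: (multbM (proj1 cBC)); first exact: (mhomM (mhom_amp2 cB cA cC h1) (mb _ hb')).
  by apply: (mhomM (mhom_t2 cB cC)); exact: (mhomM h2 (BBM _ hy)).
pose f X := amp2 k' (f0 (k X)).
have MM := multb_in (proj1 cM).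
have sf : shom M f.
  have c1 x : M x -> multb (bat B (bat BB (Kc L))) (k x) by move=> hx; have [hx' _] := kc _ hx; exact: cMC _ hx'.
  have c2 x : M x -> multb (bat B CE) (f0 (k x)) by move=> hx; have [hx' _] := kc _ hx; exact: f0M _ hx'.
  have sk : shom M (fun X => f0 (k X)) by exact: (shom_comp (shomS MM (mhomS hk)) c1 s0).
  exact: (shom_comp sk c2 (mhomS hkE)).
have hF1 : mhom B (bat B E) (fun b => amp2 lE (beta b)).
  exact: (mhom_comp cB cBA cBE hb (mhom_amp2 cB cA cE hlE)).
have hF2 : mhom BB (bat B E) (fun y => t2 J (rE y)).
  exact: (mhom_comp cBB cE cBE hrE (mhom_t2 cB cE)).
have fE b y : B b -> BB y -> f (binl K phi b * binr psi Z y) = amp2 lE (beta b) * t2 J (rE y).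
  move=> hb' hy; have m1 := mhomM (mhom_inl cA cAh TM swapM) (BM _ hb').
  have m2 := mhomM (mhom_inr cA cAh TM swapM) (BBM _ hy).
  have n1 := mhomM hg3 (BM _ hb'); have n2 := mhomM hd3 (BBM _ hy).
  have [_ f0X _] := s0.
  rewrite /f (mhomX hk m1 m2) (k1 _ (BM _ hb')) (k2 _ (BBM _ hy)) (f0X _ _ n1 n2) (f0g _ hb') f0d.
  have p1 := mhomM (mhom_amp2 cB cA cC h1) (mb _ hb').
  have p2 := mhomM (mhom_t2 cB cC) (mhomM h2 (BBM _ hy)).
  rewrite (mhomX hkE p1 p2) (amp2_t2 _ cC hk' (mhomM h2 (BBM _ hy))) (k'2 _ (BBM _ hy)).
  have hl i j : multb A (lblock i j (beta b)) by exact: (multb_lblk i j cB (proj1 cA) (mb _ hb')).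
  have e1 : amp2 k' (amp2 (@g3 R L L P D) (beta b)) = amp2 (fun a => k' (g3 P D a)) (beta b).
    exact: (amp2_comp cA cC h1 hk' hl).
  have e2 : amp2 (fun a => k' (g3 P D a)) (beta b) = amp2 lE (beta b).
    exact: (amp2_eq (proj1 cA) (mhomS (mhom_comp cA cC cE h1 hk')) k'1 hl).
  by rewrite e1 e2.
have [F [hF _ F1 F2]] := alg_lift cA cAh TM swapM cBE sf hF1 hF2 fE.
by exists F.
Qed.

(** Equivariance of DB for the dual coaction gives kE o h = [amp2 (amp1 DB)] o k on generators. An
    amplification of an injective morphism is injective because it acts block by block, and k is
    injective. *)
Lemma boxed_inj (H K : choiceType) (phi : bop L -> bop H) (U : bop (H * L)%type)
    (psi : bop J -> bop K) (V : bop (K * L)%type) (Z : bop (H * K)%type) h :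
  tw A Ah A D B delta phi U psi V Z ->
  (forall c y, A c -> B y -> can A D B delta (@d3 R L L J delta y * @g3 R L L J D c)) ->
  mhom (twalg A B phi psi Z) E h ->
  (forall a, A a -> h (binl K phi a) = lE a) -> (forall b, B b -> h (binr psi Z b) = rE (DB b)) ->
  (forall b, B b -> dBB (DB b) = amp1 DB (delta b)) ->
  (forall b, B b -> DB b = 0 -> b = 0) -> forall X, twalg A B phi psi Z X -> h X = 0 -> X = 0.
Proof.
move=> TC swapC hh hl hr eqD inj X hX hX0.
have [k [hk kc k1 k2]] := kappa_ex cA cAh TC swapC; have [kE [hkE kEc kE1 kE2]] := kappa_ex cA cAh TE swapE.
have cC := calgn_alg cA cAh TC swapC; have cE := calgn_alg cA cAh TE swapE.
have cBK := calgn_bat cB (cK L); have cBBK := calgn_bat cBB (cK L).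
have BM := multb_in (proj1 cB); have AM := multb_in (proj1 cA).
have cABK := calgn_bat cA cBK; have cABBK := calgn_bat cA cBBK.
have hDK := mhom_amp1 cB cBB hDB (cK L); have hF3 := mhom_amp2 cA cBK cBBK hDK.
have mC := canM cA cAh TC; have [e0 e1] := kc _ hX.
apply: e1; have mkX := mC _ e0.
have injK y : bat B (Kc L) y -> amp1 DB y = 0 -> y = 0.
  move=> hy; apply: (amp1_inj cB cBB hDB inj) => i j.
  apply: (multb_blk i j (proj1 cB) (cK L)); exact: (multb_in (proj1 cBK) hy).
apply: (amp2_inj cBK cBBK hDK injK (T := k X)).
  by move=> i j; exact: (multb_lblk i j cA (proj1 cBK) mkX).
have CM := multb_in (proj1 cC).
have s1 : shom (twalg A B phi psi Z) (fun X => kE (h X)).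
  exact: (shom_comp (shomS CM (mhomS hh)) (fun x hx => mhomM hh (CM x hx)) (mhomS hkE)).
have s2 : shom (twalg A B phi psi Z) (fun X => amp2 (amp1 DB) (k X)).
  exact: (shom_comp (shomS CM (mhomS hk)) (fun x hx => mC _ (proj1 (kc x hx))) (mhomS hF3)).
suff hs : twalg A B phi psi Z `<=` [set X | twalg A B phi psi Z X /\ kE (h X) = amp2 (amp1 DB) (k X)].
  have [_ <-] := hs _ hX; rewrite hX0; apply: (hom0 _ (mhomS hkE)).
  by have [[m0 _ _] _ _] := calg_multb (proj1 cE).
apply: bcdot_sub; first exact: (hom_closed_eq (proj1 cC) s1 s2).
move=> _ _ [a ha <-] [b hb' <-]; split; first by apply: bcdot_in; [exists a|exists b].
have m1 := mhomM (mhom_inl cA cAh TC swapC) (AM _ ha); have m2 := mhomM (mhom_inr cA cAh TC swapC) (BM _ hb').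
have n1 := mhomM (mhom_g3 cA TC) (AM _ ha); have n2 := mhomM (mhom_d3 cAh TC) (BM _ hb').
have hDb := mhomM hDB (BM _ hb').
have p1 := mhomM (mhom_inl cA cAh TE swapE) (AM _ ha); have p2 := mhomM (mhom_inr cA cAh TE swapE) hDb.
rewrite /= (mhomX hh m1 m2) (hl _ ha) (hr _ hb') (mhomX hkE p1 p2) (kE1 _ (AM _ ha)) (kE2 _ hDb).
rewrite (mhomX hk m1 m2) (k1 _ (AM _ ha)) (k2 _ (BM _ hb')) (mhomX hF3 n1 n2).
rewrite /g3 /d3 (amp2_amp1_l13 _ cB cBB hDB) (eqD _ hb').
have hdl : multb (bat B (Kc L)) (delta b) := mhomM (mhom_coact cB cAh (tw_d TC)) (BM _ hb').
by rewrite (amp2_t2 _ cBK hDK hdl).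
Qed.
End TripleProduct.

(** * Comparison with C*-algebras given by matrices *)

Section SetsOfOperators.
Variable R : realType.
Implicit Types (I J K H N : choiceType).
Local Notation bop := (bop R).
Local Notation op := (op R).

Lemma l2P I (x : vec R I) : l2 x <-> exists b : R, forall F, nF F x <= b.
Proof.
split=> [hx|[b hb]].
- have f0 : (0 <= l2sq x)%E by apply: esum_ge0 => i _; rewrite lee_fin sqn_ge0.
  have fin : l2sq x \is a fin_num by rewrite ge0_fin_numE.
  exists (Num.sqrt (fine (l2sq x))) => F; rewrite /nF ler_sqrt ?fine_ge0 //.
  rewrite -lee_fin fineK //; apply: esum_ge; exists [set` F]; first by split=> //; exact: finite_fset.
  by rewrite fsum_fsbig.
- rewrite /l2 /= /l2sq; apply: (@le_lt_trans _ _ (b ^+ 2)%:E); last exact: ltry.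
  apply: ge_ereal_sup => _ [X [finX _] <-]; rewrite -(fset_setK finX) fsum_fsbig lee_fin.
  have := hb (fset_set X); have b0 : 0 <= b by apply: le_trans (hb fset0); rewrite sqrtr_ge0.
  by move=> h; rewrite -(@ler_sqrt _ _ (b ^+ 2)) ?sqr_ge0 // sqrtr_sqr ger0_norm.
Qed.

(** Only bounded matrices survive. For families satisfying [bdd] nothing is lost, and by [bset_inj]
    equality of sets may be checked after [bset]. *)
Definition bset I (A : set (op I)) : set (bop I) := fun T => A (bval T).

Lemma mkbD c I (S T : op I) : bounded_op S -> bounded_op T ->
  bval (c *: mkb S + mkb T) = fun i j => c * S i j + T i j.
Proof.
move=> hS hT; apply/funext => i; apply/funext => j.
by rewrite bvalD bvalZ !mkbE.
Qed.
Lemma bvalL c I (S T : bop I) : bval (c *: S + T) = fun i j => c * S i j + T i j.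
Proof. by apply/funext => i; apply/funext => j; rewrite bvalD bvalZ. Qed.
Lemma bvalS I (S T : bop I) : bval (S - T) = fun i j => S i j - T i j.
Proof. by apply/funext => i; apply/funext => j; rewrite bvalB. Qed.

Lemma lspanL I (S : set (op I)) c x y : lspan S x -> lspan S y ->
  lspan S (fun i j => c * x i j + y i j).
Proof.
move=> [n [a [t [ht ->]]]] [m [b [u [hu ->]]]].
exists (n + m)%N, (fun k => match fintype.split k with inl i => c * a i | inr j => b j end),
  (fun k => match fintype.split k with inl i => t i | inr j => u j end); split.
  by move=> k; case: fintype.split.
apply/funext => i; apply/funext => j; rewrite big_split_ord /=; congr (_ + _).
  rewrite mulr_sumr; apply: eq_bigr => k _.
  by case: (split_ordP (lshift m k)) => k' e; [rewrite (lshift_inj e) mulrA|have := eq_lrshift k k'; rewrite e eqxx].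
apply: eq_bigr => k _.
by case: (split_ordP (rshift n k)) => k' e; [have := eq_rlshift k k'; rewrite e eqxx|rewrite (rshift_inj e)].
Qed.
Lemma lspan0 I (S : set (op I)) : lspan S (fun _ _ => 0).
Proof.
exists 0%N, (fun=> 0), (fun _ _ _ => 0); split; first by case.
by apply/funext => i; apply/funext => j; rewrite big_ord0.
Qed.
Lemma lspan_in I (S : set (op I)) T : S T -> lspan S T.
Proof.
move=> hT; exists 1%N, (fun=> 1), (fun=> T); split=> //.
by apply/funext => i; apply/funext => j; rewrite big_ord1 mul1r.
Qed.
Lemma cspan_in I (S : set (op I)) T : S T -> cspan S T.
Proof.
move=> hT e e0; exists T; first exact: lspan_in.
have -> : (fun i j => T i j - T i j) = bval (0 : bop I).
  by apply/funext => i; apply/funext => j; rewrite subrr bval0.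
by apply/(opnorm_nrm _ (ltW e0)); rewrite nrm0 ltW.
Qed.

Lemma lspan_bop I (S : set (op I)) T : S `<=` @bounded_op R I -> lspan S T ->
  exists2 X : bop I, bcspan (bset S) X & bval X = T.
Proof.
move=> hS [n [c [t [ht ->]]]]; exists (\sum_(k < n) c k *: mkb (t k)).
  apply: (csub_sum _ (bcspan_csub _)) => k; apply: (csub_scale _ (bcspan_csub _)); apply: bcspan_in.
  by rewrite /bset mkbE //; apply: hS.
apply/funext => i; apply/funext => j; rewrite bval_sum; apply: eq_bigr => k _.
by rewrite bvalZ mkbE //; exact: hS.
Qed.
Lemma cspan_bounded I (S : set (op I)) : S `<=` @bounded_op R I -> cspan S `<=` @bounded_op R I.
Proof.
move=> hS T /(_ 1 ltr01)[T' /(lspan_bop hS)[X _ <-] h].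
have b : bounded_op (fun i j => T i j - X i j) by exists 1.
have -> : T = bval (mkb (fun i j => T i j - X i j) + X).
  by apply/funext => i; apply/funext => j; rewrite bvalD mkbE // subrK.
exact: bvalP.
Qed.
(** Operators approximable by the linear span within every e already form a closed subspace, by an e
    / 2 argument; so one closure step agrees with the smallest closed subspace. *)
Lemma cspanE I (S : set (op I)) : S `<=` @bounded_op R I -> bset (cspan S) = bcspan (bset S).
Proof.
move=> hS; apply/seteqP; split=> [T hT|].
- apply: (csub_lim (bcspan_csub _)) => e e0; have [T' /(lspan_bop hS)[X hX <-] h] := hT _ e0.
  by exists X => //; rewrite -bvalS in h; apply/(opnorm_nrm _ (ltW e0)).
- apply: bcspan_sub; last by move=> T; exact: cspan_in.
  split=> [e e0|c x y hx hy e e0|x hx e e0].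
  + exists (fun _ _ => 0); first exact: lspan0.
    have -> : (fun i j => (0 : bop I) i j - 0) = bval (0 : bop I).
      by apply/funext => i; apply/funext => j; rewrite subr0.
    by apply/(opnorm_nrm _ (ltW e0)); rewrite nrm0 ltW.
  + have c0 : 0 < cm c + 1 by rewrite ltr_wpDl ?cm_ge0.
    have e2 : 0 < e / 2 by rewrite divr_gt0.
    have e3 : 0 < e / 2 / (cm c + 1) by rewrite divr_gt0.
    have [T1 h1 n1] := hx _ e3; have [T2 h2 n2] := hy _ e2.
    exists (fun i j => c * T1 i j + T2 i j); first exact: lspanL.
    have [X1 _ E1] := lspan_bop hS h1; have [X2 _ E2] := lspan_bop hS h2; rewrite -E1 in n1 *; rewrite -E2 in n2 *.
    rewrite -bvalS in n1; rewrite -bvalS in n2.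
    have -> : (fun i j => (c *: x + y) i j - (c * X1 i j + X2 i j)) = bval (c *: x + y - (c *: X1 + X2)).
      by apply/funext => i; apply/funext => j; rewrite bvalB !bvalD !bvalZ.
    move/(opnorm_nrm _ (ltW e3)): n1 => n1; move/(opnorm_nrm _ (ltW e2)): n2 => n2.
    apply/(opnorm_nrm _ (ltW e0)).
    have -> : c *: x + y - (c *: X1 + X2) = c *: (x - X1) + (y - X2) by blin.
    apply: le_trans (nrmD _ _) _; rewrite [e]splitr lerD // nrmZ.
    apply: le_trans (ler_wpM2l (cm_ge0 c) n1) _.
    by rewrite mulrA ler_pdivrMr // mulrC ler_wpM2l ?(ltW e2) // lerDl.
  + have e2 : 0 < e / 2 by rewrite divr_gt0.
    have [y hy n1] := hx _ e2; have [T hT n2] := hy _ e2; exists T => //.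
    have [X _ E] := lspan_bop hS hT; rewrite -E in n2 *; rewrite -bvalS in n2; rewrite -bvalS.
    move/(opnorm_nrm _ (ltW e2)): n2 => n2; apply/(opnorm_nrm _ (ltW e0)).
    exact: nrm_tri n1 n2.
Qed.

Lemma opmul_bounded I (S T : op I) : bounded_op S -> bounded_op T -> bounded_op (S ** T).
Proof. by move=> hS hT; rewrite -(mkbE hS) -(mkbE hT) -bvalM; exact: bvalP. Qed.
Definition bdd I (A : set (op I)) := A `<=` @bounded_op R I.

Lemma cdot_bdd I (X Y : set (op I)) : bdd X -> bdd Y -> bdd (cdot X Y).
Proof. by move=> hX hY; apply: cspan_bounded => _ [S hS [T hT ->]]; apply: opmul_bounded; [exact: hX|exact: hY]. Qed.
Lemma cdotE I (X Y : set (op I)) : bdd X -> bdd Y -> bset (cdot X Y) = bcdot (bset X) (bset Y).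
Proof.
move=> hX hY; rewrite /cdot cspanE; last first.
  by move=> _ [S hS [T hT ->]]; apply: opmul_bounded; [exact: hX|exact: hY].
congr bcspan; apply/seteqP; split=> [T [S hS [S' hS' e]]|_ [a ha [b hb ->]]].
  exists (mkb S); first by rewrite /bset mkbE //; exact: hX.
  exists (mkb S'); first by rewrite /bset mkbE //; exact: hY.
  by apply: bval_inj; rewrite bvalM !mkbE //; [exact: hY|exact: hX].
by exists (bval a) => //; exists (bval b) => //; exact: bvalM.
Qed.

Lemma optensE I J (S : bop I) (T : bop J) : bval S ⊗ bval T = bval (bten S T).
Proof. by apply/funext => p; apply/funext => q; rewrite btenE. Qed.
Lemma optens_bounded I J (S : op I) (T : op J) : bounded_op S -> bounded_op T -> bounded_op (S ⊗ T).
Proof. by move=> hS hT; rewrite -(mkbE hS) -(mkbE hT) optensE; exact: bvalP. Qed.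
Lemma atens_bdd I J (X : set (op I)) (Y : set (op J)) : bdd X -> bdd Y -> bdd (atens X Y).
Proof. by move=> hX hY; apply: cspan_bounded => _ [S hS [T hT ->]]; apply: optens_bounded; [exact: hX|exact: hY]. Qed.
Lemma atensE I J (X : set (op I)) (Y : set (op J)) : bdd X -> bdd Y ->
  bset (atens X Y) = bat (bset X) (bset Y).
Proof.
move=> hX hY; rewrite /atens cspanE; last first.
  by move=> _ [S hS [T hT ->]]; apply: optens_bounded; [exact: hX|exact: hY].
congr bcspan; apply/seteqP; split=> [T [S hS [S' hS' e]]|_ [a ha [b hb ->]]].
  exists (mkb S); first by rewrite /bset mkbE //; exact: hX.
  exists (mkb S'); first by rewrite /bset mkbE //; exact: hY.
  by apply: bval_inj; rewrite -optensE !mkbE //; [exact: hY|exact: hX].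
by exists (bval a) => //; exists (bval b) => //; rewrite optensE.
Qed.

Lemma col_l2 I (X : bop I) j : l2 (fun i => X i j).
Proof.
have [M hM] := bop_opb X; apply/l2P; exists M => F.
have := opb_col F [fset j]%fset (dlt R j) hM.
have -> : nF F (fun i => \sum_(j0 <- [fset j]%fset) X i j0 * dlt R j j0) = nF F (fun i => X i j).
  by congr Num.sqrt; apply: eq_bigr => i _; rewrite big_seq_fset1 /dlt eqxx mulr1.
move=> h; apply: le_trans h _; rewrite ler_piMr //; first by case: hM.
exact: nF_dlt.
Qed.
Lemma rank1_col I (x : vec R I) j : l2 x ->
  exists2 X : bop I, (forall i k, X i k = x i * (k == j)%:R) & True.
Proof.
move=> /l2P[b hb]; have hd := @nF_dlt R I j; exists (mkb (fun i k => x i * conjc (dlt R j k))) => // i k.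
by rewrite mkbE; [rewrite /dlt rmorph_nat|exact: rank1_bounded hb hd].
Qed.

Lemma cstar_bdd I (A : set (op I)) : is_cstar A -> bdd A.
Proof. by case. Qed.
(** Nondegeneracy on vectors is applied to the columns of X, which are square summable. *)
Lemma cstarP I (A : set (op I)) : is_cstar A -> calgn (bset A).
Proof.
move=> [hA hc AM AS nA]; split; first split.
- have -> : bset A = bset (cspan A).
    by apply/seteqP; split=> T hT; [exact: cspan_in|exact: hc].
  by rewrite cspanE //; exact: bcspan_csub.
- by move=> x y hx hy; rewrite /bset bvalM; exact: AM.
- by move=> x hx; rewrite /bset bval_star; exact: AS.
- move=> X h; apply: bopP => i j; rewrite bval0.
  have := nA (fun i => X i j) (col_l2 X j); move=> /(_ _)/(congr1 (fun f => f i)); apply=> T hT.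
  apply/funext => k; have hb := hA _ hT.
  have := h (mkb T); rewrite /bset mkbE // => /(_ hT)/(congr1 (fun Y : bop I => Y k j)).
  by rewrite bvalME bval0 mkbE.
Qed.
(** A null vector becomes an operator having it as its only nonzero column. *)
Lemma cstar_of I (A : set (op I)) : bdd A -> calgn (bset A) -> is_cstar A.
Proof.
move=> hA [[hc AM AS] nA].
have toA T : bounded_op T -> bset A (mkb T) -> A T by move=> hT; rewrite /bset mkbE.
have ofA T : A T -> bset A (mkb T) by move=> hT; rewrite /bset mkbE //; exact: hA.
split=> //.
- move=> T hT; apply: toA; first exact: cspan_bounded hA _ hT.
  suff : bset (cspan A) (mkb T) by rewrite cspanE //; apply: bcspan_sub.
  by rewrite /bset mkbE //; exact: cspan_bounded hA _ hT.
- move=> S T hS hT; have := AM _ _ (ofA _ hS) (ofA _ hT).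
  by rewrite /bset bvalM !mkbE //; exact: hA.
- move=> T hT; have := AS _ (ofA _ hT); by rewrite /bset bval_star mkbE //; exact: hA.
- move=> x hx h; apply/funext => i; have [X hX _] := rank1_col i hx.
  suff : X = 0 by move=> /(congr1 (fun Y : bop I => Y i i)); rewrite hX eqxx mulr1 bval0.
  apply: nA => a ha; apply: bopP => k l; rewrite bvalME bval0.
  have -> : csum (fun j => a k j * X j l) = (l == i)%:R * csum (fun j => a k j * x j).
    case: eqP => [->|ne]; last by rewrite mul0r csum0 // => j; rewrite hX (introF eqP ne) mulr0 mulr0.
    by rewrite mul1r; congr csum; apply/funext => j; rewrite hX eqxx mulr1.
  by have /(congr1 (fun f => f k)) := h _ ha; rewrite /opapp => ->; rewrite mulr0.
Qed.

Lemma multbE I (A : set (op I)) : bdd A -> bset (mult A) = multb (bset A).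
Proof.
move=> hA; apply/seteqP; split=> [T [_ hT] a ha|T hT].
  by have [h1 h2] := hT _ ha; rewrite /bset !bvalM.
split=> [|a ha]; first exact: bvalP.
have := hT (mkb a); rewrite /bset !bvalM mkbE; last exact: hA.
exact.
Qed.

Lemma compacts_bdd H : bdd (@compacts R H).
Proof.
apply: cspan_bounded => _ [x [y [/l2P[a ha] /l2P[b hb] ->]]].
exact: rank1_bounded ha hb.
Qed.
Lemma compactsE H : bset (@compacts R H) = Kc H.
Proof.
rewrite /compacts cspanE; last first.
  by move=> _ [x [y [/l2P[a ha] /l2P[b hb] ->]]]; exact: rank1_bounded ha hb.
apply/seteqP; split; apply: bcspan_sub; try exact: bcspan_csub.
- move=> T [x [y [hx hy e]]]; have [[j _]|nj] := pselect (exists j : H, True); last first.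
    have -> : T = 0 by apply: bopP => i; case: nj; exists i.
    by case: (csub_Kc R H).
  have [X hX _] := rank1_col j hx; have [Y hY _] := rank1_col j hy.
  have -> : T = X * Emx R j j * star Y.
    apply: bopP => k l; rewrite bvalME (csum1 (i0 := j)) => [|i /negPf ij].
      by rewrite mulEmx starE hX hY !eqxx !mulr1 e.
    by rewrite mulEmx ij mulr0 mul0r.
  by apply: Kc_mulr; apply: Kc_mull; exact: Kc_in.
- move=> _ [k [l ->]]; apply: bcspan_in; exists (dlt R k), (dlt R l); split.
  + by apply/l2P; exists 1 => F; exact: nF_dlt.
  + by apply/l2P; exists 1 => F; exact: nF_dlt.
  + by apply/funext => i; apply/funext => j; rewrite EmxE /dlt rmorph_nat.
Qed.
Lemma compacts_cstar H : is_cstar (@compacts R H).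
Proof. by apply: cstar_of; [exact: compacts_bdd|rewrite compactsE; exact: calgn_Kc]. Qed.
Lemma atens_cstar I J (A : set (op I)) (B : set (op J)) : is_cstar A -> is_cstar B -> is_cstar (atens A B).
Proof.
move=> cA cB; apply: cstar_of; first by apply: atens_bdd; exact: cstar_bdd.
by rewrite atensE; [apply: calgn_bat; exact: cstarP|exact: cstar_bdd|exact: cstar_bdd].
Qed.
End SetsOfOperators.

(** * Morphisms, their extensions and slices *)

Section Translation.
Variable R : realType.
Implicit Types (I J K H N : choiceType).
Local Notation bop := (bop R).
Local Notation op := (op R).

Lemma mult_bounded I (A : set (op I)) T : mult A T -> bounded_op T.
Proof. by case. Qed.
Lemma img_bdd I J (A : set (op I)) (B : set (op J)) f : (forall a, A a -> mult B (f a)) -> bdd (f @` A).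
Proof. by move=> h _ [a /h/mult_bounded hb <-]. Qed.

Lemma is_mor_mor I J (A : set (op I)) (B : set (op J)) (f : op I -> op J) :
  is_cstar A -> is_cstar B -> is_mor A B f ->
  mor (bset A) (bset B) (fun a => mkb (f (bval a))) /\
  forall a, bset A a -> bval (mkb (f (bval a))) = f (bval a).
Proof.
move=> cA cB [fm fL fM fS fn]; have hA := cstar_bdd cA; have hB := cstar_bdd cB.
have fE a : bset A a -> bval (mkb (f (bval a))) = f (bval a).
  by move=> ha; rewrite mkbE //; apply: mult_bounded (fm _ ha).
have [[[_ AL _] AM AS] _] := cstarP cA.
split=> //; split; first split.
- move=> c x y hx hy; apply: bval_inj; rewrite fE; last exact: AL.
  by rewrite bvalL fL // bvalL !fE.
- move=> x y hx hy; apply: bval_inj; rewrite fE; last exact: AM.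
  by rewrite !bvalM fM // !fE.
- move=> x hx; apply: bval_inj; rewrite fE; last exact: AS.
  by rewrite !bval_star fS // !fE.
- by move=> a ha; rewrite -(multbE hB) /bset fE //; exact: fm.
rewrite -{1}fn cdotE //; last exact: img_bdd fm.
apply: bcdotS => // x; rewrite /bset /= => -[a ha e]; have hb := hA _ ha.
by exists (mkb a); rewrite ?/bset ?mkbE //; apply: bval_inj; rewrite mkbE // e; exact: bvalP.
Qed.

Lemma mhom_is_mor I J (A : set (op I)) (B : set (op J)) (F : bop I -> bop J) (f : op I -> op J) :
  is_cstar A -> is_cstar B -> mhom (bset A) (bset B) F ->
  (forall a, bset A a -> f (bval a) = bval (F a)) -> is_mor A B f.
Proof.
move=> cA cB hF e; have hA := cstar_bdd cA; have hB := cstar_bdd cB.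
have [[[_ AL _] AM AS] _] := cstarP cA; have mA := multb_in (proj1 (cstarP cA)).
have [[FL FM FS] FB _ Fn] := hF.
have ofA T : A T -> bset A (mkb T) by move=> hT; rewrite /bset mkbE //; exact: hA.
have fE T : A T -> f T = bval (F (mkb T)) by move=> hT; rewrite -e ?mkbE //; [exact: hA|exact: ofA].
have fm a : A a -> mult B (f a).
  move=> ha; have := FB _ (mA _ (ofA _ ha)); rewrite -(multbE hB) /bset -fE //.
split=> //.
- move=> c a a' ha ha'; have := AL c _ _ (ofA _ ha) (ofA _ ha').
  rewrite {1}/bset mkbD; [move=> hL|exact: hA|exact: hA].
  rewrite !fE // -bvalL -FL; try exact: mA _ (ofA _ _).
  by congr (bval (F _)); apply: bval_inj; rewrite mkbE ?mkbD //; [exact: hA|exact: hA|exact: hA].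
- move=> a a' ha ha'; have := AM _ _ (ofA _ ha) (ofA _ ha'); rewrite {1}/bset bvalM !mkbE; try exact: hA.
  move=> hL; rewrite !fE // -bvalM -FM; try exact: mA _ (ofA _ _).
  by congr (bval (F _)); apply: bval_inj; rewrite bvalM !mkbE //; exact: hA.
- move=> a ha; have := AS _ (ofA _ ha); rewrite {1}/bset bval_star !mkbE; try exact: hA.
  move=> hL; rewrite !fE // -bval_star -FS; try exact: mA _ (ofA _ _).
  by congr (bval (F _)); apply: bval_inj; rewrite bval_star !mkbE //; exact: hA.
have E : bset (cdot (f @` A) B) = bset B.
  rewrite cdotE //; last exact: img_bdd fm.
  apply/seteqP; split.
    apply: bcdot_sub; first by have [[hc _ _] _] := cstarP cB.
    move=> x b hx hb; move: hx; rewrite {1}/bset => -[a ha ex].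
    have -> : x = F (mkb a) by apply: bval_inj; rewrite -fE // ex.
    by have [] := FB _ (mA _ (ofA _ ha)) _ hb.
  move=> b /Fn; apply: bcdotS => // _ [a ha <-].
  by exists (bval a) => //; rewrite e.
have toset T (X : set (op J)) : bdd X -> X T -> bset X (mkb T) by move=> hX hT; rewrite /bset mkbE //; exact: hX.
have hcd : bdd (cdot (f @` A) B) by apply: cdot_bdd => //; exact: img_bdd fm.
apply/seteqP; split=> T hT.
  by have := toset _ _ hcd hT; rewrite E /bset mkbE //; exact: hcd.
by have := toset _ _ hB hT; rewrite -E /bset mkbE //; exact: hB.
Qed.

Lemma is_mor_id I (A : set (op I)) : is_cstar A -> is_mor A A id.
Proof. by move=> cA; apply: (mhom_is_mor cA cA (mhom_id (cstarP cA))). Qed.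

Definition bext I J (A : set (op I)) (B : set (op J)) f (m : bop I) : bop J := mkb (ext A B f (bval m)).

(** Any multiplier satisfying the defining equation of [ext] equals the one from [ext_ex], because
    f(A) is nondegenerate; the value chosen by [xget] is therefore determined. *)
Lemma extP I J (A : set (op I)) (B : set (op J)) f : is_cstar A -> is_cstar B -> is_mor A B f ->
  [/\ mhom (bset A) (bset B) (bext A B f), (forall a, bset A a -> f (bval a) = bval (bext A B f a)) &
     forall m, multb (bset A) m -> ext A B f (bval m) = bval (bext A B f m)].
Proof.
move=> cA cB mf; have hA := cstar_bdd cA; have hB := cstar_bdd cB.
have [hm fE] := is_mor_mor cA cB mf; have bA := cstarP cA; have bB := cstarP cB.
have [F [hF Ff]] := ext_ex bA bB hm; have mA := multb_in (proj1 bA).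
have ofA T : A T -> bset A (mkb T) by move=> hT; rewrite /bset mkbE //; exact: hA.
have FE a : bset A a -> f (bval a) = bval (F a) by move=> ha; rewrite Ff // fE.
have eE m : multb (bset A) m -> ext A B f (bval m) = bval (F m).
  move=> hmm; apply: xget_unique; first split.
  - by have := mhomM hF hmm; rewrite -(multbE hB).
  - move=> a ha; have hb := hA _ ha; have hb' := ofA _ ha.
    rewrite -{1 2}(mkbE hb) FE // -bvalM -(mhomX hF hmm (mA _ hb')) -FE; last by have [] := hmm _ hb'.
    by rewrite bvalM.
  move=> T [hT h]; have bT := mult_bounded hT; rewrite -(mkbE bT); congr bval.
  apply/eqP; rewrite -subr_eq0; apply/eqP.
  apply: (faithfulR (proj1 bA) (shomS mA (mhomS hF)) (mhom_faithful bA bB hF)) => a ha.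
  rewrite mulrBl -(mhomX hF hmm (mA _ ha)); apply/eqP; rewrite subr_eq0; apply/eqP.
  apply: bval_inj; rewrite bvalM mkbE // -FE // h // -bvalM FE //.
  by have [] := hmm _ ha.
have E m : multb (bset A) m -> bext A B f m = F m by move=> hmm; rewrite /bext eE // mkb_val.
split; [exact: (mhomE (proj1 bA) E hF)| |].
- by move=> a ha; rewrite E ?FE //; exact: mA.
- by move=> m hmm; rewrite E ?eE.
Qed.

Lemma bext_id I (A : set (op I)) m : is_cstar A -> multb (bset A) m -> bext A A id m = m.
Proof.
move=> cA; have [h1 h2 _] := extP cA cA (is_mor_id cA).
apply: (mhom_uniq (cstarP cA) (cstarP cA) h1 (mhom_id (cstarP cA))) => a ha.
by apply: bval_inj; rewrite -h2.
Qed.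

(** [tens] shows that the set from which [tmor] chooses is inhabited, and the values on elementary
    tensors determine every choice. *)
Lemma textE I J K N (A : set (op I)) (C : set (op J)) (B : set (op K)) (D : set (op N)) f g m :
  is_cstar A -> is_cstar C -> is_cstar B -> is_cstar D -> is_mor A B f -> is_mor C D g ->
  multb (bat (bset A) (bset C)) m ->
  text A C B D f g (bval m) = bval (tens (bext A B f) (bext C D g) m).
Proof.
move=> cA cC cB cD mf mg hm; have [hF Ff _] := extP cA cB mf; have [hG Gg _] := extP cC cD mg.
have bA := cstarP cA; have bB := cstarP cB; have bC := cstarP cC; have bD := cstarP cD.
have cAC := atens_cstar cA cC; have cBD := atens_cstar cB cD.
have AM := multb_in (proj1 bA); have CM := multb_in (proj1 bC).
have eAC : bset (atens A C) = bat (bset A) (bset C) by rewrite atensE //; exact: cstar_bdd.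
have eBD : bset (atens B D) = bat (bset B) (bset D) by rewrite atensE //; exact: cstar_bdd.
have hT := mhom_tens bA bB bC bD hF hG; rewrite -eAC -eBD in hT.
set h := tmor A C B D f g; have [mh hv] : is_mor (atens A C) (atens B D) h /\
     forall a c, A a -> C c -> h (a ⊗ c) = f a ⊗ g c.
  apply: (@xgetPex _ (fun _ _ _ => 0) [set h | is_mor (atens A C) (atens B D) h /\
     forall a c, A a -> C c -> h (a ⊗ c) = f a ⊗ g c]).
  exists (fun T => bval (tens (bext A B f) (bext C D g) (mkb T))); split.
    by apply: (mhom_is_mor cAC cBD hT) => a _; rewrite mkb_val.
  move=> a c ha hc; have ba := cstar_bdd cA ha; have bc := cstar_bdd cC hc.
  rewrite -(mkbE ba) -(mkbE bc) optensE mkb_val.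
  have ha' : bset A (mkb a) by rewrite /bset mkbE.
  have hc' : bset C (mkb c) by rewrite /bset mkbE.
  by rewrite (tens_bten bA bC hF hG (AM _ ha') (CM _ hc')) -optensE -Ff // -Gg.
have [hH Hh He] := extP cAC cBD mh; rewrite eAC in He Hh.
rewrite /text He //; congr bval; rewrite eAC eBD in hH hT.
apply: (mhom_bat_uniq bA bC (calgn_bat bB bD) hH hT _ hm) => a c ha hc.
apply: bval_inj; rewrite -Hh; last exact: bat_in.
by rewrite -optensE hv // (tens_bten bA bC hF hG (AM _ ha) (CM _ hc)) -optensE -Ff // -Gg.
Qed.

Lemma textEl I J K (A : set (op I)) (C : set (op J)) (B : set (op K)) f m :
  is_cstar A -> is_cstar C -> is_cstar B -> is_mor A B f -> multb (bat (bset A) (bset C)) m ->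
  text A C B C f id (bval m) = bval (amp1 (bext A B f) m).
Proof.
move=> cA cC cB mf hm; rewrite textE //; last exact: is_mor_id.
have [hF _ _] := extP cA cB mf; have bA := cstarP cA; have bB := cstarP cB; have bC := cstarP cC.
have e := tens_eq (F' := bext A B f) (G' := bext C C id) bA bC bC hF (mhom_id bC)
  (fun x _ => erefl) (fun y hy => bext_id cC hy) hm.
by rewrite e (tens_idr bA bB bC hF hm).
Qed.
Lemma textEr I J K (A : set (op I)) (C : set (op J)) (D : set (op K)) g m :
  is_cstar A -> is_cstar C -> is_cstar D -> is_mor C D g -> multb (bat (bset A) (bset C)) m ->
  text A C A D id g (bval m) = bval (amp2 (bext C D g) m).
Proof.
move=> cA cC cD mg hm; rewrite textE //; last exact: is_mor_id.
have [hG _ _] := extP cC cD mg; have bA := cstarP cA; have bC := cstarP cC; have bD := cstarP cD.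
have e := tens_eq (F' := bext A A id) (G' := bext C D g) bA bC bD (mhom_id bA) hG
  (fun y hy => bext_id cA hy) (fun x _ => erefl) hm.
by rewrite e (tens_idl bA bC bD hG hm).
Qed.

Lemma leg12E I J K (T : bop (I * J)%type) : leg12 K (bval T) = bval (l12 K T).
Proof. by apply/funext => p; apply/funext => q; rewrite l12E. Qed.
Lemma leg13E I J K (T : bop (I * K)%type) : leg13 J (bval T) = bval (l13 J T).
Proof. by apply/funext => p; apply/funext => q; rewrite l13E. Qed.
Lemma leg23E I J K (T : bop (J * K)%type) : leg23 I (bval T) = bval (t2 I T).
Proof. by apply/funext => p; apply/funext => q; rewrite t2E. Qed.
Lemma assocE I J K (T : bop ((I * J) * K)%type) : assoc (bval T) = bval (asc T).
Proof. by apply/funext => p; apply/funext => q; rewrite ascE. Qed.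
Lemma flipE I J (T : bop (I * J)%type) : flip (bval T) = bval (sw T).
Proof. by apply/funext => p; apply/funext => q; rewrite swE. Qed.
Lemma tens1E I J (T : bop I) : bval T ⊗ (op1 : op J) = bval (t1 J T).
Proof. by apply/funext => p; apply/funext => q; rewrite t1E. Qed.
Lemma tens1lE I J (T : bop J) : (op1 : op I) ⊗ bval T = bval (t2 I T).
Proof. by apply/funext => p; apply/funext => q; rewrite t2E. Qed.
Lemma unitaryE I (T : bop I) : unitary (bval T) -> T * star T = 1 /\ star T * T = 1.
Proof.
move=> [_ h1 h2]; split; apply: bval_inj; by rewrite bvalM bval_star bval1.
Qed.

(* A normal functional is a limit of functionals supported on finitely many matrix
   units; here this is read off from the columns [a], [b] representing its two
   square summable families. *)
Lemma lslicesE I J (X : bop (I * J)%type) :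
  bset (lslices (bval X)) = bcspan [set x | exists i i', x = lblock i i' X].
Proof.
set Q := bcspan _; have hQ : csub Q by exact: bcspan_csub.
have lQ i i' : Q (lblock i i' X) by apply: bcspan_in; exists i, i'.
(* A sequence of vectors is one vector of l^2(nat * I). Amplifying X by the identity of l^2(nat)
   thus reduces normal functionals to functionals given by two vectors. *)
pose Y : bop ((nat * I) * J)%type := r23 nat X.
have YQ p q : Q (lblock p q Y) by rewrite lblock_r23; exact: (csub_scale _ hQ).
have slice (w : op I -> R[i]) : normal w -> exists2 T : bop J, Q T &
    bval T = fun j j' => w (fun i i' => bval X (i, j) (i', j')).
  (* p is an arbitrary index, at which the two vectors are placed as columns; if there is no index,
     the functional is zero. *)
  move=> [x [y [hx hy ->]]]; have [[p _]|np] := pselect (exists p : (nat * I)%type, True); last first.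
    exists 0; first by case: hQ.
    apply/funext => j; apply/funext => j'; rewrite bval0 /inner csum0 // => p.
    by case: np; exists p.
  have [a ha _] := rank1_col p hx; have [b hb' _] := rank1_col p hy.
  exists (lblock p p (star (t1 J a) * (Y * t1 J b))).
    have hS := csub_star hQ.
    rewrite -[X in lblock _ _ X]starK starM starK lblock_star.
    apply: (lblock_mul_in hS) => k l /=; rewrite -lblock_star starK; exact: (lblock_mul_in hQ YQ).
  apply/funext => j; apply/funext => j'; rewrite lblockE.
  have -> : (star (t1 J a) * (Y * t1 J b)) (p, j) (p, j') = (star a * (rblock j j' Y * b)) p p.
    by rewrite -t1_star -rblockE rblock_t1l rblock_t1r.
  rewrite bvalME /inner; congr csum; apply/funext => q.
  rewrite starE ha eqxx mulr1; congr (_ * _); rewrite bvalME /Y rblock_r23.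
  rewrite (csum_inj (h := fun i => (q.1, i))) => [|i i' [] //|n hn].
    congr csum; apply/funext => i; rewrite t2E /= eqxx mul1r rblockE hb' eqxx mulr1.
    by [].
  rewrite t2E; case: eqP => [e|_]; last by rewrite !mul0r.
  by case: (hn n.2); rewrite e -surjective_pairing.
have hb : [set T | exists2 w, @normal R I w & T = fun j j' => w (fun i i' => bval X (i, j) (i', j'))] `<=` @bounded_op R J.
  by move=> _ [w /slice[T _ <-] ->]; exact: bvalP.
rewrite /lslices (cspanE hb); apply/seteqP; split; apply: bcspan_sub; try exact: bcspan_csub.
  move=> T [w hw e]; have [T' hT' e'] := slice _ hw.
  by have -> : T = T' by apply: bval_inj; rewrite e e'.
move=> _ [i [i' ->]]; apply: bcspan_in.
(* Basis vectors with nat coordinate 0 give the functional that reads the entry (i, i'). *)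
pose x0 (k : I) : vec R (nat * I)%type := dlt R (0%N, k).
have l0 k : l2 (x0 k) by apply/l2P; exists 1 => F; exact: nF_dlt.
exists (fun T => inner (x0 i) (fun p => csum (fun j => T p.2 j * x0 i' (p.1, j)))); first by exists (x0 i), (x0 i').
apply/funext => j; apply/funext => j'; rewrite lblockE /inner (csum1 (i0 := (0%N, i))) => [|p hp].
  rewrite /x0 /dlt eqxx conjc1 mul1r (csum1 (i0 := i')) => [|k hk]; first by rewrite eqxx mulr1.
  by rewrite xpair_eqE (negPf hk) andbF mulr0.
by rewrite /x0 /dlt (negPf hp) conjc0 mul0r.
Qed.
Lemma rslicesE I J (X : bop (I * J)%type) :
  bset (rslices (bval X)) = bcspan [set x | exists i i', x = rblock i i' X].
Proof.
have -> : rslices (bval X) = lslices (flip (bval X)) by [].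
rewrite flipE lslicesE; congr bcspan; apply/seteqP; split=> x [i [i' ->]]; exists i, i'.
  by rewrite rblock_sw.
by rewrite rblock_sw.
Qed.
End Translation.

(** * Quantum groups, universal duals and coactions as bounded operators *)

Section Records.
Variable R : realType.
Implicit Types (I J K H N : choiceType).
Local Notation bop := (bop R).
Local Notation op := (op R).

Lemma umultE I (A : set (op I)) (U : op I) : bdd A -> umult A U ->
  [/\ bval (mkb U) = U, multb (bset A) (mkb U), star (mkb U) * mkb U = 1 & mkb U * star (mkb U) = 1].
Proof.
move=> hA [hm hu]; have e := mkbE (mult_bounded hm); rewrite -e in hu; have [h1 h2] := unitaryE hu.
by split=> //; rewrite -(multbE hA) /bset e.
Qed.
Lemma batE I J (A : set (op I)) (B : set (op J)) : is_cstar A -> is_cstar B ->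
  bset (atens A B) = bat (bset A) (bset B).
Proof. by move=> cA cB; rewrite atensE //; exact: cstar_bdd. Qed.
Lemma umult_bat I J (A : set (op I)) (B : set (op J)) (U : op (I * J)%type) : is_cstar A -> is_cstar B ->
  umult (atens A B) U ->
  [/\ bval (mkb U) = U, multb (bat (bset A) (bset B)) (mkb U), star (mkb U) * mkb U = 1 & mkb U * star (mkb U) = 1].
Proof.
move=> cA cB hU; have := umultE (cstar_bdd (atens_cstar cA cB)) hU.
by rewrite batE.
Qed.
Lemma bext_mhom2 I J K (A : set (op I)) (B : set (op J)) (C : set (op K)) f :
  is_cstar A -> is_cstar B -> is_cstar C -> is_mor A (atens B C) f ->
  mhom (bset A) (bat (bset B) (bset C)) (bext A (atens B C) f).
Proof.
by move=> cA cB cC hf; have [h _ _] := extP cA (atens_cstar cB cC) hf; rewrite -batE.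
Qed.

Lemma qg_of (G : qgroup R) : let A := qA G in let Ah := qAh G in
  bval (mkb (qW G)) = qW G /\
  qg (mkb (qW G)) (bset A) (bset Ah) (bext A (atens A A) (qDA G)) (bext Ah (atens Ah Ah) (qDAh G)).
Proof.
move=> A Ah; have cA : is_cstar A := qA_cstar G; have cAh : is_cstar Ah := qAh_cstar G.
have [e mW wl wr] := umult_bat cAh cA (qW_umult G); split=> //.
have bA := cstarP cA; have bAh := cstarP cAh.
have mD := qDA_mor G; have mDh := qDAh_mor G.
split=> //.
- have [_ p] := qW_mult G; rewrite -e !leg12E !leg13E !leg23E -!bvalM in p.
  exact: bval_inj p.
- by rewrite -lslicesE e.
- by rewrite -rslicesE e.
- exact: bext_mhom2 mD.
- exact: bext_mhom2 mDh.
- have p := qDA_W G; rewrite -e (textEr cAh cA (atens_cstar cA cA) mD mW) leg12E leg13E -bvalM in p.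
  exact: bval_inj p.
- have p := qDAh_W G; rewrite -e (textEl cAh cA (atens_cstar cAh cAh) mDh mW) leg23E leg13E -bvalM assocE in p.
  exact: bval_inj p.
Qed.

Lemma udual_of (L : choiceType) K (A : set (op L)) DA (Ah : set (op L)) (W : bop (L * L)%type) (Au : set (op K))
    V Du Lam : is_cstar A -> is_cstar Ah -> is_mor A (atens A A) DA ->
  universal_dual A DA Ah (bval W) Au V Du Lam ->
  [/\ bval (mkb V) = V, is_cstar Au,
  udual (bset A) (bset Ah) (bext A (atens A A) DA) W (bset Au) (mkb V) (bext Au (atens Au Au) Du) (bext Au Ah Lam),
  is_mor Au (atens Au Au) Du & is_mor Au Ah Lam].
Proof.
move=> cA cAh mD [[cAu [hV eV]] [hDV [_ [[mDu hDuV] [mL hL]]]]].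
have [e mV vl vr] := umult_bat cAu cA hV; have bA := cstarP cA; have bAu := cstarP cAu.
split=> //; split=> //.
- by rewrite -rslicesE e eV.
- rewrite -e (textEr cAu cA (atens_cstar cA cA) mD mV) leg12E leg13E -bvalM in hDV.
  exact: bval_inj hDV.
- exact: bext_mhom2 mDu.
- rewrite -e (textEl cAu cA (atens_cstar cAu cAu) mDu mV) leg23E leg13E -bvalM assocE in hDuV.
  exact: bval_inj hDuV.
- by have [h _ _] := extP cAu cAh mL.
- rewrite -e (textEl cAu cA cAh mL mV) in hL; exact: bval_inj hL.
Qed.

Lemma coactE (L : choiceType) J (A : set (op L)) DA (C : set (op J)) g :
  is_cstar A -> is_cstar C -> is_mor A (atens A A) DA -> coaction A DA C g ->
  let g' := bext C (atens C A) g in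
  [/\ mhom (bset C) (bat (bset C) (bset A)) g', (forall c, bset C c -> g' c = 0 -> c = 0),
     (forall c, bset C c -> amp2 (bext A (atens A A) DA) (g' c) = asc (amp1 g' (g' c))) &
     bcdot (g' @` bset C) (@t2 R J L @` bset A) = bat (bset C) (bset A)].
Proof.
move=> cA cC mD [mg gi gco gp] g'; have cCA := atens_cstar cC cA; have cAA := atens_cstar cA cA.
have hg := bext_mhom2 cC cC cA mg; have [_ gE _] := extP cC cCA mg.
have bA := cstarP cA; have bC := cstarP cC; have CM := multb_in (proj1 bC).
split=> //.
- move=> c hc e; apply: bval_inj; apply: gi => //.
    by have [[[h0 _ _] _ _] _] := bC.
  rewrite gE // -/g' e gE; last by have [[[h0 _ _] _ _] _] := bC.
  by rewrite (hom0 _ (mhomS hg)) //; apply: CM; have [[[h0 _ _] _ _] _] := bC.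
- move=> c hc; have mg' := mhomM hg (CM _ hc); have p := gco _ hc.
  rewrite (gE _ hc) (textEr cC cA cAA mD mg') (textEl cC cA cCA mg mg') assocE in p.
  exact: bval_inj p.
rewrite -batE // -gp cdotE; last first.
- by move=> _ [a ha <-]; apply: optens_bounded; [rewrite -bval1; exact: bvalP|exact: cstar_bdd ha].
- by have [gm _ _ _ _] := mg; exact: img_bdd gm.
congr bcdot; apply/seteqP; split=> x.
- by move=> [c hc <-]; exists (bval c) => //; rewrite gE.
- move=> [c hc e]; have hb := cstar_bdd cC hc; exists (mkb c); first by rewrite /bset mkbE.
  by apply: bval_inj; rewrite -gE ?/bset mkbE.
- by move=> [a ha <-]; exists (bval a) => //; exact: tens1lE.
- move=> [a ha e]; have hb := cstar_bdd cA ha; exists (mkb a); first by rewrite /bset mkbE.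
  by apply: bval_inj; rewrite -tens1lE mkbE.
Qed.

Lemma equivE (L : choiceType) J K (A : set (op L)) (C : set (op J)) g (D : set (op K)) d f :
  is_cstar A -> is_cstar C -> is_cstar D -> is_mor C (atens C A) g -> is_mor D (atens D A) d -> is_mor C D f ->
  equivariant A C g D d f ->
  forall c, bset C c -> bext D (atens D A) d (bext C D f c) = amp1 (bext C D f) (bext C (atens C A) g c).
Proof.
move=> cA cC cD mg md mf h c hc; have bC := cstarP cC; have CM := multb_in (proj1 bC).
have [hf fE _] := extP cC cD mf; have [_ _ dE] := extP cD (atens_cstar cD cA) md.
have [_ gE _] := extP cC (atens_cstar cC cA) mg; have hg := bext_mhom2 cC cC cA mg.
apply: bval_inj; rewrite -dE; last exact: (mhomM hf (CM _ hc)).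
by rewrite -fE // h // gE // textEl //; exact: (mhomM hg (CM _ hc)).
Qed.
End Records.

(** * Twisted tensor products as bounded operators *)

Section TwistedRecord.
Variables (R : realType) (G : qgroup R) (Un : universal_data G).
Local Notation bop := (bop R).
Local Notation op := (op R).
Local Notation L := (qI G).
Local Notation A := (qA G).
Local Notation Ah := (qAh G).
Local Notation W := (mkb (qW G)).
Let cA : is_cstar A := qA_cstar G.
Let cAh : is_cstar Ah := qAh_cstar G.
Let bG := proj2 (qg_of G).
Let eW := proj1 (qg_of G).

Variables (I J : choiceType) (C : set (op I)) (g : op I -> op (I * L)%type).
Variables (D : set (op J)) (d : op J -> op (J * L)%type) (T : twisted Un C g D d).
Definition tphi := bext C (@compacts R (twH T)) (tw_phi (t:=T)).
Definition tpsi := bext D (@compacts R (twK T)) (tw_psi (t:=T)).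
Definition tU := mkb (tw_U (t:=T)).
Definition tV := mkb (tw_V (t:=T)).
Definition tZ : bop (twH T * twK T)%type := mkb (twZ (T:=T)).
Definition tg := bext C (atens C A) g.
Definition td := bext D (atens D Ah) d.
Definition tinl := binl (twK T) tphi.
Definition tinr := binr tpsi tZ.
Hypotheses (cC : is_cstar C) (cD : is_cstar D) (mg : is_mor C (atens C A) g) (md : is_mor D (atens D Ah) d).
Hypothesis ginj : forall c, bset C c -> tg c = 0 -> c = 0.
Let cH := @compacts_cstar R (twH T).
Let cK := @compacts_cstar R (twK T).
Let bC := cstarP cC. Let bD := cstarP cD.
Let CM := multb_in (proj1 bC). Let DM := multb_in (proj1 bD).

Let mphi : is_mor C (@compacts R (twH T)) (tw_phi (t:=T)). Proof. by case: (tw_cov_l T). Qed.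
Let mpsi : is_mor D (@compacts R (twK T)) (tw_psi (t:=T)). Proof. by case: (tw_cov_r T). Qed.
Let hphi : mhom (bset C) (@Kc R (twH T)) tphi.
Proof. by have [h _ _] := extP cC cH mphi; rewrite -compactsE. Qed.
Let hpsi : mhom (bset D) (@Kc R (twK T)) tpsi.
Proof. by have [h _ _] := extP cD cK mpsi; rewrite -compactsE. Qed.
Let phiE c : bset C c -> tw_phi (t:=T) (bval c) = bval (tphi c).
Proof. by have [_ h _] := extP cC cH mphi; exact: h. Qed.
Let psiE c : bset D c -> tw_psi (t:=T) (bval c) = bval (tpsi c).
Proof. by have [_ h _] := extP cD cK mpsi; exact: h. Qed.
Let gE c : bset C c -> g (bval c) = bval (tg c).
Proof. by have [_ h _] := extP cC (atens_cstar cC cA) mg; exact: h. Qed.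
Let dE c : bset D c -> d (bval c) = bval (td c).
Proof. by have [_ h _] := extP cD (atens_cstar cD cAh) md; exact: h. Qed.
Let hg : mhom (bset C) (bat (bset C) (bset A)) tg := bext_mhom2 cC cC cA mg.
Let hd : mhom (bset D) (bat (bset D) (bset Ah)) td := bext_mhom2 cD cD cAh md.
Let z0 N (X : set (op N)) : is_cstar X -> bset X 0.
Proof. by move=> /cstarP[[[h _ _] _ _] _]. Qed.
Let inj0 N M (X : set (op N)) (f : op N -> op M) (f' : bop N -> bop M) : is_cstar X ->
  (forall c, bset X c -> f (bval c) = bval (f' c)) -> shom (multb (bset X)) f' -> inj_on X f ->
  forall c, bset X c -> f' c = 0 -> c = 0.
Proof.
move=> cX e hf h c hc e0; apply: bval_inj; apply: h => //; first exact: z0.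
rewrite !e ?e0 //; last exact: z0.
by rewrite (hom0 _ hf) //; apply: (multb_in (proj1 (cstarP cX))); exact: z0.
Qed.

(** Covariance is translated directly, and the Heisenberg relation comes from the universal data.
    Whether the span of products is an algebra is still open at this point, so [tw] makes no claim
    about it. *)
Lemma tw_of : tw (bset A) (bset Ah) (bset C) tg (bset D) td tphi tU tpsi tV tZ /\ bval tZ = twZ (T:=T).
Proof.
have [_ phii [hU _] covl] := tw_cov_l T; have [_ psii [hV _] covr] := tw_cov_r T.
have [eU mU ul ur] := umult_bat cH cA hU; have [eV mV vl vr] := umult_bat cK cAh hV.
rewrite -/tU in eU mU ul ur; rewrite -/tV in eV mV vl vr.
have eWh : qWh G = bval (sw (star W)) by rewrite -flipE bval_star eW.
have hu1 := uhA_univ Un; have hu2 := uA_univ Un; rewrite -eW in hu1; rewrite eWh in hu2.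
have [eVp cAp Up _ mLp] := udual_of cA cAh (qDA_mor G) hu1.
have [eVq cAq Uq mDq mLq] := udual_of cAh cA (qDAh_mor G) hu2.
have mDp : is_mor (uhA Un) (atens (uhA Un) (uhA Un)) (uhD Un) by have [] := udual_of cA cAh (qDA_mor G) hu1.
have [eWu mWu wul wur] := umult_bat cAp cAq (uW_umult Un).
have mrho := tw_rho_mor T; have mpi := tw_pi_mor T.
have hrho : mhom (bset (uhA Un)) (@Kc R (twH T)) (bext (uhA Un) (@compacts R (twH T)) (tw_rho (t:=T))).
  by have [h _ _] := extP cAp cH mrho; rewrite -compactsE.
have hpi : mhom (bset (uA Un)) (@Kc R (twK T)) (bext (uA Un) (@compacts R (twK T)) (tw_pi (t:=T))).
  by have [h _ _] := extP cAq cK mpi; rewrite -compactsE.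
have Wr : amp2 (bext (uA Un) (atens (uA Un) (uA Un)) (uD Un)) (mkb (uW Un)) = l12 _ (mkb (uW Un)) * l13 _ (mkb (uW Un)).
  have p := uW_bichar_r Un; rewrite -eWu (textEr cAp cAq (atens_cstar cAq cAq) mDq mWu) leg12E leg13E -bvalM in p.
  exact: bval_inj p.
have Wl : asc (amp1 (bext (uhA Un) (atens (uhA Un) (uhA Un)) (uhD Un)) (mkb (uW Un))) = t2 _ (mkb (uW Un)) * l13 _ (mkb (uW Un)).
  have p := uW_bichar_l Un; rewrite -eWu (textEl cAp cAq (atens_cstar cAp cAp) mDp mWu) leg23E leg13E -bvalM assocE in p.
  exact: bval_inj p.
have Wlift : amp1 (bext (uhA Un) Ah (uhL Un)) (amp2 (bext (uA Un) A (uL Un)) (mkb (uW Un))) = W.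
  have p := uW_lift Un; rewrite -eWu (textE cAp cAq cAh cA mLp mLq mWu) -eW in p.
  by have := bval_inj p; rewrite /tens opqE.
have pZ := textE cAp cAq cH cK mrho mpi mWu; rewrite eWu in pZ.
have eZ0 : twZ (T:=T) = bval (star (tens (bext (uhA Un) (@compacts R (twH T)) (tw_rho (t:=T))) (bext (uA Un) (@compacts R (twK T)) (tw_pi (t:=T))) (mkb (uW Un)))).
  by rewrite /twZ pZ bval_star.
have eZ : tZ = Zof (mkb (uW Un)) (bext (uhA Un) (@compacts R (twH T)) (tw_rho (t:=T))) (bext (uA Un) (@compacts R (twK T)) (tw_pi (t:=T))).
  rewrite /tZ eZ0 mkb_val; exact: (congr1 (fun X => star X) (opqE _)).
have eU' : amp1 (bext (uhA Un) (@compacts R (twH T)) (tw_rho (t:=T))) (mkb (uhV Un)) = tU.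
  have p := tw_rho_U T; rewrite -eVp (textEl cAp cA cH mrho (ud_M Up)) -eU in p; exact: bval_inj p.
have eV' : amp1 (bext (uA Un) (@compacts R (twK T)) (tw_pi (t:=T))) (mkb (uV Un)) = tV.
  have p := tw_pi_V T; rewrite -eVq (textEl cAq cAh cK mpi (ud_M Uq)) -eV in p; exact: bval_inj p.
have Rel := heisenberg bG Up Uq mWu wur Wr Wl Wlift hrho hpi.
have Zl := Z_l Up Uq mWu wur hrho hpi; have Zr := Z_r Up Uq mWu wul hrho hpi.
rewrite -eZ in Zl Zr; rewrite /= -eZ eU' eV' in Rel.
split; last by rewrite /tZ eZ0 mkb_val.
split=> //.
- exact: (inj0 cC phiE (mhomS hphi) phii).
- exact: (inj0 cD psiE (mhomS hpsi) psii).
- move=> c hc; have p := covl _ hc; have mc := mhomM hg (CM hc).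
  rewrite (gE hc) (textEl cC cA cH mphi mc) (phiE hc) -eU tens1E -!bvalM -bval_star -bvalM in p.
  exact: bval_inj p.
- move=> c hc; have p := covr _ hc; have mc := mhomM hd (DM hc).
  rewrite (dE hc) (textEl cD cAh cK mpsi mc) (psiE hc) -eV tens1E -!bvalM -bval_star -bvalM in p.
  exact: bval_inj p.
(* Removing the third leg takes an index in L. If L is empty, injectivity of the coaction gives C =
   0, nondegeneracy of phi gives K(H) = 0, and so H is empty. *)
- move=> X hX; have [[l _]|nl] := pselect (exists l : L, True).
    apply: bopP => -[a b] [a' b']; have := congr1 (fun Y : bop (twH T * (twK T * L))%type => Y (a, (b, l)) (a', (b', l))) hX.
    by rewrite l12E eqxx mulr1 !bval0.
  have nb (N : choiceType) (Y : bop (N * L)%type) : Y = 0 by apply: bopP => -[a l]; case: nl; exists l.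
  have nC c : bset C c -> c = 0 by move=> hc; apply: ginj.
  have [_ _ _ nd] := hphi.
  apply: bopP => -[a b]; exfalso.
  have h0 : Emx R a a = 0.
    have hin : bcdot (tphi @` bset C) (@Kc R (twH T)) (Emx R a a) by apply: nd; exact: Kc_in.
    apply: (bcdot_sub (csub_zero R (twH T)) _ hin) => _ y [c /nC -> <-] _ /=.
    by rewrite (hom0 _ (mhomS hphi)) ?mul0r //; apply: CM; exact: z0.
  have := congr1 (fun Y : bop (twH T) => Y a a) h0; rewrite EmxE eqxx mulr1 bval0.
  by move/eqP; rewrite oner_eq0.
Qed.

Lemma tinlE c : bset C c -> tw_inl T (bval c) = bval (tinl c).
Proof. by move=> hc; rewrite /tw_inl phiE // tens1E. Qed.
Lemma tinrE c : bset D c -> tw_inr T (bval c) = bval (tinr c).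
Proof.
move=> hc; have [_ eZ] := tw_of.
by rewrite /tw_inr psiE // -eZ tens1lE -!bvalM -bval_star -bvalM.
Qed.
Lemma tw_bdd : bdd (tw_inl T @` C) /\ bdd (tw_inr T @` D).
Proof.
split=> _ [c hc <-].
  have hb := cstar_bdd cC hc; rewrite -(mkbE hb) tinlE; first exact: bvalP.
  by rewrite /bset mkbE.
have hb := cstar_bdd cD hc; rewrite -(mkbE hb) tinrE; first exact: bvalP.
by rewrite /bset mkbE.
Qed.
Lemma tw_algE : bset (tw_alg T) = twalg (bset C) (bset D) tphi tpsi tZ.
Proof.
have [b1 b2] := tw_bdd; rewrite /tw_alg cdotE //; congr bcdot; apply/seteqP; split=> x.
- move=> [c hc e]; have hb := cstar_bdd cC hc; have hc' : bset C (mkb c) by rewrite /bset mkbE.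
  by exists (mkb c) => //; apply: bval_inj; rewrite -tinlE // mkbE.
- by move=> [c hc <-]; exists (bval c) => //; rewrite tinlE.
- move=> [c hc e]; have hb := cstar_bdd cD hc; have hc' : bset D (mkb c) by rewrite /bset mkbE.
  by exists (mkb c) => //; apply: bval_inj; rewrite -tinrE // mkbE.
- by move=> [c hc <-]; exists (bval c) => //; rewrite tinrE.
Qed.
Lemma tw_alg_bdd : bdd (tw_alg T).
Proof. by have [b1 b2] := tw_bdd; exact: cdot_bdd. Qed.

Hypothesis swp : forall c y, bset C c -> bset D y ->
  can (bset C) tg (bset D) td (@d3 R L I J td y * @g3 R L I J tg c).
Let bA := cstarP cA. Let bAh := cstarP cAh.
Let TW := proj1 tw_of.
Lemma tw_alg_cstar : is_cstar (tw_alg T).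
Proof. by apply: cstar_of; [exact: tw_alg_bdd|rewrite tw_algE; exact: (calgn_alg bA bAh TW swp)]. Qed.
Lemma tw_inl_mor : is_mor C (tw_alg T) (tw_inl T).
Proof.
apply: (mhom_is_mor (F := tinl) cC tw_alg_cstar _ tinlE); rewrite tw_algE.
exact: (mhom_inl bA bAh TW swp).
Qed.
Lemma tw_inr_mor : is_mor D (tw_alg T) (tw_inr T).
Proof.
apply: (mhom_is_mor (F := tinr) cD tw_alg_cstar _ tinrE); rewrite tw_algE.
exact: (mhom_inr bA bAh TW swp).
Qed.
Lemma bext_inl c : multb (bset C) c -> bext C (tw_alg T) (tw_inl T) c = tinl c.
Proof.
have [h1 h2 _] := extP cC tw_alg_cstar tw_inl_mor; have h3 := mhom_inl bA bAh TW swp.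
have bT := cstarP tw_alg_cstar; move: c; apply: (mhom_uniq bC bT h1 h3) => c hc.
by apply: bval_inj; rewrite -h2 // tinlE.
Qed.
Lemma bext_inr c : multb (bset D) c -> bext D (tw_alg T) (tw_inr T) c = tinr c.
Proof.
have [h1 h2 _] := extP cD tw_alg_cstar tw_inr_mor; have h3 := mhom_inr bA bAh TW swp.
have bT := cstarP tw_alg_cstar; move: c; apply: (mhom_uniq bD bT h1 h3) => c hc.
by apply: bval_inj; rewrite -h2 // tinrE.
Qed.
Lemma mhom_tinl : mhom (bset C) (bset (tw_alg T)) tinl.
Proof. by rewrite tw_algE; exact: (mhom_inl bA bAh TW swp). Qed.
Lemma mhom_tinr : mhom (bset D) (bset (tw_alg T)) tinr.
Proof. by rewrite tw_algE; exact: (mhom_inr bA bAh TW swp). Qed.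
Lemma tw_alg_lr : bset (tw_alg T) = bcdot (tinl @` bset C) (tinr @` bset D).
Proof. exact: tw_algE. Qed.
Lemma tw_alg_rl : bset (tw_alg T) = bcdot (tinr @` bset D) (tinl @` bset C).
Proof. by rewrite tw_algE; exact: (alg_comm bA bAh TW swp). Qed.
End TwistedRecord.

(** * Assembly of the proof *)

Section Final.
Variable R : realType.
Local Notation bop := (bop R).
Local Notation op := (op R).

Lemma equivE' (L : choiceType) (J K : choiceType) (A : set (op L)) (C : set (op J)) g (D : set (op K)) d f
    (f' : bop J -> bop K) :
  is_cstar A -> is_cstar C -> is_cstar D -> is_mor C (atens C A) g -> is_mor D (atens D A) d -> is_mor C D f ->
  (forall x, multb (bset C) x -> bext C D f x = f' x) -> equivariant A C g D d f ->
  forall c, bset C c -> bext D (atens D A) d (f' c) = amp1 f' (bext C (atens C A) g c).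
Proof.
move=> cA cC cD mg md mf e h c hc; have bC := cstarP cC; have CM := multb_in (proj1 bC).
have [hf _ _] := extP cC cD mf; have hg := bext_mhom2 cC cC cA mg.
have p := equivE cA cC cD mg md mf h hc; rewrite (e _ (CM _ hc)) in p; rewrite p.
apply: (amp1_eq (proj1 bC) (mhomS hf) e) => k l.
exact: (multb_blk k l (proj1 bC) (cstarP cA) (mhomM hg (CM _ hc))).
Qed.
Lemma D_inj (L : choiceType) (W : bop (L * L)%type) A Ah D Dh : qg W A Ah D Dh ->
  forall a, A a -> D a = 0 -> a = 0.
Proof.
move=> G a ha; rewrite (D_conj G); last exact: (multb_in (proj1 (qg_A G))).
move=> /(congr1 (fun X => star W * X * W)); rewrite mulr0 mul0r !mulrA (qg_l G) mul1r -mulrA (qg_l G) mulr1.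
move=> e; apply: bopP => i j; have := congr1 (fun X : bop (L * L)%type => X (i, i) (j, i)) e.
by rewrite t1E eqxx mulr1 !bval0.
Qed.
Lemma eq_sub T (X Y : set T) : X = Y -> X `<=` Y.
Proof. by move->. Qed.
Lemma extV I J (A : set (op I)) (B : set (op J)) f m : is_cstar A -> is_cstar B -> is_mor A B f ->
  multb (bset A) m -> ext A B f (bval m) = bval (bext A B f m).
Proof. by move=> cA cB mf hm; have [_ _ h] := extP cA cB mf; exact: h. Qed.
Lemma morV I J (A : set (op I)) (B : set (op J)) f m : is_cstar A -> is_cstar B -> is_mor A B f ->
  bset A m -> f (bval m) = bval (bext A B f m).
Proof. by move=> cA cB mf hm; have [_ h _] := extP cA cB mf; exact: h. Qed.
Lemma bset_img I J (A : set (op I)) (f : op I -> op J) (f' : bop I -> bop J) : bdd A ->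
  (forall a, bset A a -> f (bval a) = bval (f' a)) -> bset (f @` A) = f' @` bset A.
Proof.
move=> hA e; apply/seteqP; split=> x.
  move=> [a ha ex]; have hb := hA _ ha; have ha' : bset A (mkb a) by rewrite /bset mkbE.
  by exists (mkb a) => //; apply: bval_inj; rewrite -e // mkbE.
by move=> [a ha <-]; exists (bval a) => //; rewrite e.
Qed.
Lemma bset_inj I (A B : set (op I)) : bdd A -> bdd B -> bset A = bset B -> A = B.
Proof.
move=> hA hB e; apply/seteqP; split=> T hT.
  have : bset A (mkb T) by rewrite /bset mkbE //; exact: hA.
  by rewrite e /bset mkbE //; exact: hA.
have : bset B (mkb T) by rewrite /bset mkbE //; exact: hB.
by rewrite -e /bset mkbE //; exact: hB.
Qed.
Lemma img_bdd' I J (A : set (op I)) (f : op I -> op J) (f' : bop I -> bop J) : bdd A ->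
  (forall a, bset A a -> f (bval a) = bval (f' a)) -> bdd (f @` A).
Proof.
move=> hA e _ [a ha <-]; have hb := hA _ ha; have ha' : bset A (mkb a) by rewrite /bset mkbE.
by rewrite -(mkbE hb) e //; exact: bvalP.
Qed.
Lemma bset_cdot_img I J K (A : set (op I)) (B : set (op J)) (f : op I -> op K) (g : op J -> op K) f' g' :
  bdd A -> bdd B -> (forall a, bset A a -> f (bval a) = bval (f' a)) ->
  (forall b, bset B b -> g (bval b) = bval (g' b)) ->
  bset (cdot (f @` A) (g @` B)) = bcdot (f' @` bset A) (g' @` bset B) /\ bdd (cdot (f @` A) (g @` B)).
Proof.
move=> hA hB ef eg; have h1 := img_bdd' hA ef; have h2 := img_bdd' hB eg; split; last exact: cdot_bdd.
by rewrite cdotE // (bset_img hA ef) (bset_img hB eg).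
Qed.
Lemma inj_onP I J (A : set (op I)) (f : op I -> op J) (f' : bop I -> bop J) : is_cstar A ->
  (forall a, bset A a -> f (bval a) = bval (f' a)) -> shom (multb (bset A)) f' ->
  inj_on A f <-> (forall a, bset A a -> f' a = 0 -> a = 0).
Proof.
move=> cA e hf; have bA := cstarP cA; have AM := multb_in (proj1 bA); have hA := cstar_bdd cA.
have [[hcs _ _] _] := bA; have [A0 _ _] := hcs.
split=> [h a ha e0|h a a' ha ha' ee].
  by apply: bval_inj; apply: h => //; rewrite !e // e0 (hom0 (AM _ A0) hf).
have hb := hA _ ha; have hb' := hA _ ha'; rewrite -(mkbE hb) -(mkbE hb'); congr bval.
have ma : bset A (mkb a) by rewrite /bset mkbE.
have ma' : bset A (mkb a') by rewrite /bset mkbE.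
apply/eqP; rewrite -subr_eq0; apply/eqP; apply: h; first exact: csub_sub.
rewrite (homB hf (AM _ ma) (AM _ ma')); apply/eqP; rewrite subr_eq0; apply/eqP.
by apply: bval_inj; rewrite -!e // !mkbE.
Qed.

Section Good.
Variables (G : qgroup R) (Un : universal_data G).
Local Notation L := (qI G).
Local Notation A := (qA G).
Local Notation Ah := (qAh G).
Let cA : is_cstar A := qA_cstar G.
Let cAh : is_cstar Ah := qAh_cstar G.

(* A twisted tensor product whose closed linear span is a C*-algebra; the commutation
   [gd_sw] of the two legs is what makes it so. *)
Record good (I J : choiceType) (C : set (op I)) (g : op I -> op (I * L)%type) (D : set (op J))
  (d : op J -> op (J * L)%type) (T : twisted Un C g D d) : Prop := Good {
  gd_C : is_cstar C; gd_D : is_cstar D; gd_g : is_mor C (atens C A) g; gd_d : is_mor D (atens D Ah) d;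
  gd_inj : forall c, bset C c -> tg C g c = 0 -> c = 0;
  gd_sw : forall c y, bset C c -> bset D y ->
    can (bset C) (tg C g) (bset D) (td D d) (t2 I (td D d y) * l13 J (tg C g c));
  gd_alg : is_cstar (tw_alg T);
  gd_inl : mhom (bset C) (bset (tw_alg T)) (tinl T);
  gd_inr : mhom (bset D) (bset (tw_alg T)) (tinr T);
  gd_lr : bset (tw_alg T) = bcdot (tinl T @` bset C) (tinr T @` bset D);
  gd_rl : bset (tw_alg T) = bcdot (tinr T @` bset D) (tinl T @` bset C);
  gd_lE : forall c, bset C c -> tw_inl T (bval c) = bval (tinl T c);
  gd_rE : forall c, bset D c -> tw_inr T (bval c) = bval (tinr T c);
  gd_ml : is_mor C (tw_alg T) (tw_inl T);
  gd_mr : is_mor D (tw_alg T) (tw_inr T);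
  gd_bl : forall c, multb (bset C) c -> bext C (tw_alg T) (tw_inl T) c = tinl T c;
  gd_br : forall c, multb (bset D) c -> bext D (tw_alg T) (tw_inr T) c = tinr T c }.

Lemma goodP (I J : choiceType) (C : set (op I)) (g : op I -> op (I * L)%type) (D : set (op J))
  (d : op J -> op (J * L)%type) (T : twisted Un C g D d) :
  is_cstar C -> is_cstar D -> is_mor C (atens C A) g -> is_mor D (atens D Ah) d ->
  (forall c, bset C c -> tg C g c = 0 -> c = 0) ->
  (forall c y, bset C c -> bset D y ->
    can (bset C) (tg C g) (bset D) (td D d) (t2 I (td D d y) * l13 J (tg C g c))) ->
  good T.
Proof.
move=> cC cD mg md ginj sw.
exact (Good (T:=T) cC cD mg md ginj sw (tw_alg_cstar T cC cD mg md ginj sw) (mhom_tinl T cC cD mg md ginj sw)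
  (mhom_tinr T cC cD mg md ginj sw) (tw_alg_lr T cC cD mg md ginj) (tw_alg_rl T cC cD mg md ginj sw)
  (tinlE T cC) (tinrE T cC cD mg md ginj) (tw_inl_mor T cC cD mg md ginj sw)
  (tw_inr_mor T cC cD mg md ginj sw) (bext_inl T cC cD mg md ginj sw) (bext_inr T cC cD mg md ginj sw)).
Qed.

Lemma gd_lV (I J : choiceType) (C : set (op I)) g (D : set (op J)) d (T : twisted Un C g D d) m :
  good T -> multb (bset C) m -> ext C (tw_alg T) (tw_inl T) (bval m) = bval (tinl T m).
Proof. by move=> gT hm; rewrite (extV (gd_C gT) (gd_alg gT) (gd_ml gT) hm) (gd_bl gT hm). Qed.
Lemma gd_rV (I J : choiceType) (C : set (op I)) g (D : set (op J)) d (T : twisted Un C g D d) m :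
  good T -> multb (bset D) m -> ext D (tw_alg T) (tw_inr T) (bval m) = bval (tinr T m).
Proof. by move=> gT hm; rewrite (extV (gd_D gT) (gd_alg gT) (gd_mr gT) hm) (gd_br gT hm). Qed.

Lemma twmapE (I1 J1 I2 J2 : choiceType) (C1 : set (op I1)) g1 (D1 : set (op J1)) d1 (C2 : set (op I2)) g2
    (D2 : set (op J2)) d2 (T1 : twisted Un C1 g1 D1 d1) (T2 : twisted Un C2 g2 D2 d2) f k h :
  good T1 -> good T2 -> is_mor C1 C2 f -> is_mor D1 D2 k -> is_twmap T1 T2 f k h ->
  let h' := bext (tw_alg T1) (tw_alg T2) h in
  [/\ mhom (bset (tw_alg T1)) (bset (tw_alg T2)) h',
      (forall c, bset C1 c -> h' (tinl T1 c) = tinl T2 (bext C1 C2 f c)) &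
      (forall y, bset D1 y -> h' (tinr T1 y) = tinr T2 (bext D1 D2 k y))].
Proof.
move=> g1' g2' mf mk [mh hl hr] h'; have [hh _ _] := extP (gd_alg g1') (gd_alg g2') mh.
have [hf _ _] := extP (gd_C g1') (gd_C g2') mf; have [hk _ _] := extP (gd_D g1') (gd_D g2') mk.
have CM := multb_in (proj1 (cstarP (gd_C g1'))); have DM := multb_in (proj1 (cstarP (gd_D g1'))).
split=> // [c hc|y hy].
- have p := hl _ hc; rewrite (gd_lE g1' hc) (morV (gd_C g1') (gd_C g2') mf hc) in p.
  rewrite (gd_lV g2' (mhomM hf (CM _ hc))) (extV (gd_alg g1') (gd_alg g2') mh (mhomM (gd_inl g1') (CM _ hc))) in p.
  exact: bval_inj p.
- have p := hr _ hy; rewrite (gd_rE g1' hy) (morV (gd_D g1') (gd_D g2') mk hy) in p.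
  rewrite (gd_rV g2' (mhomM hk (DM _ hy))) (extV (gd_alg g1') (gd_alg g2') mh (mhomM (gd_inr g1') (DM _ hy))) in p.
  exact: bval_inj p.
Qed.
End Good.
End Final.

Theorem theorem6p7 (R : realType) (G : qgroup R) (Un : universal_data G)
    (J : choiceType) (B : set (op R J))
    (beta : op R J -> op R (J * qI G)%type)
    (betah : op R J -> op R (J * qI G)%type)
    (BB : twisted Un B beta B betah)
    (betaBB : op R (twI BB) -> op R (twI BB * qI G)%type)
    (betahBB : op R (twI BB) -> op R (twI BB * qI G)%type)
    (DeltaB : op R J -> op R (twI BB))
    (hB : braided_bialgebra betaBB betahBB DeltaB)
    (AB : twisted Un (qA G) (qDA G) B betah)
    (ABB : twisted Un (qA G) (qDA G) (tw_alg BB) betahBB)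
    (idA_DeltaB : op R (twI AB) -> op R (twI ABB))
    (hid : is_twmap AB ABB id DeltaB idA_DeltaB)
    (Psi : op R (twI ABB) -> op R (twI AB * twI AB)%type)
    (hPsi : is_Psi AB ABB Psi) :
  let C := tw_alg AB in
  let DeltaC := fun c =>
    ext (tw_alg ABB) (atens C C) Psi (idA_DeltaB c) in
  (braided_bisimplifiable DeltaB ->
     is_bialgebra C DeltaC /\ bisimplifiable C DeltaC) /\
  (inj_on B DeltaB <-> inj_on C DeltaC).
Proof.
move=> C DeltaC.
have cA : is_cstar (qA G) := qA_cstar G; have cAh : is_cstar (qAh G) := qAh_cstar G.
have bA := cstarP cA; have bAh := cstarP cAh; have bG := proj2 (qg_of G).
have AM := multb_in (proj1 bA).
have mDA := qDA_mor G; have mDAh := qDAh_mor G.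
have [[[cB coB cohB _] [[cBB coBB cohBB _] eq1 eq2 eqh1 eqh2]] mDB eqD eqhD hco] := hB.
have bB := cstarP cB; have bBB := cstarP cBB; have BM := multb_in (proj1 bB).
have [mb _ _ _] := coB; have [mbh _ _ _] := cohB; have [mbB _ _ _] := coBB; have [mbhB _ _ _] := cohBB.
have [hb binj bco bpod] := coactE cA cB mDA coB.
have [hd _ dco dpod] := coactE cAh cB mDAh cohB.
have [hbB bBinj _ _] := coactE cA cBB mDA coBB.
have [hdB _ dBco dBpod] := coactE cAh cBB mDAh cohBB.
have Dinj := D_inj bG.
have [TBB _] := tw_of BB cB cB mb mbh binj.
have eBB := tw_algE BB cB cB mb mbh binj.
(* B [x] B is a C*-algebra by the Yetter-Drinfeld hypothesis. This yields the commutation of its two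
   legs in the canonical model, free of the covariant representations fixed in BB. *)
have cgBB := proj1 bBB; rewrite eBB in cgBB.
have swBB := swap_of_calg bA bAh TBB cgBB.
have gBB : good BB by apply: goodP.
have h1 := gd_inl gBB; have h2 := gd_inr gBB.
(* With first factor A the commutation comes from W and from the Podles condition of the dual
   coaction, for B here and for B [x] B below. *)
have swAB a y (ha : bset (qA G) a) (hy : bset B y) := swap_regular bG bB hd (eq_sub dpod) dco ha hy.
have gAB : good AB by apply: goodP.
have swABB a y (ha : bset (qA G) a) (hy : bset (tw_alg BB) y) := swap_regular bG bBB hdB (eq_sub dBpod) dBco ha hy.
have gABB : good ABB by apply: goodP.
have q1 := equivE' cA cB cBB mb mbB (gd_ml gBB) (fun x hx => gd_bl gBB hx) eq1.
have q2 := equivE' cA cB cBB mb mbB (gd_mr gBB) (fun x hx => gd_br gBB hx) eq2.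
have qh1 := equivE' cAh cB cBB mbh mbhB (gd_ml gBB) (fun x hx => gd_bl gBB hx) eqh1.
have qh2 := equivE' cAh cB cBB mbh mbhB (gd_mr gBB) (fun x hx => gd_br gBB hx) eqh2.
have qD := equivE cA cB cBB mb mbB mDB eqD.
have qhD := equivE cAh cB cBB mbh mbhB mDB eqhD.
have [hDB _ _] := extP cB cBB mDB.
have [Lt [Mt [Dl [Dr [F [tDl tDr tF hcoas]]]]]] := hco.
(* The triple products inherit the commutation: the two copies of B span B [x] B, and their
   embeddings are equivariant for both coactions. *)
have swL c y (hc : bset (tw_alg BB) c) (hy : bset B y) :=
  swap_left bA bAh bB bBB bB hb hbB hd h1 h2 (gd_lr gBB) q1 q2 swBB hc hy.
have swM c y (hc : bset B c) (hy : bset (tw_alg BB) y) :=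
  swap_right bA bAh bB bBB bB hb hdB hd h1 h2 (gd_lr gBB) qh1 qh2 swBB hc hy.
have gL : good Lt by apply: goodP.
have gM : good Mt by apply: goodP.
have [hh hA1 hA2] := twmapE gAB gABB (is_mor_id cA) mDB hid.
have [hDl Dl1 Dl2] := twmapE gBB gL mDB (is_mor_id cB) tDl.
have [hDr Dr1 Dr2] := twmapE gBB gM (is_mor_id cB) mDB tDr.
have [mPsi _ P1 P2 P3] := hPsi.
have cC : is_cstar C := gd_alg gAB; have cE := gd_alg gABB.
have cCC := atens_cstar cC cC; have cAA := atens_cstar cA cA; have cBA := atens_cstar cB cA.
have bC := cstarP cC; have bE := cstarP cE; have bCC := calgn_bat bC bC.
have CM := multb_in (proj1 bC); have BBM := multb_in (proj1 bBB).
have hPs := bext_mhom2 cE cC cC mPsi.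
have hiA := gd_inl gAB; have hiB := gd_inr gAB; have hEA := gd_inl gABB; have hEB := gd_inr gABB.
set Psi' := bext _ (atens C C) Psi in hPs.
have PsiA a : bset (qA G) a ->
    Psi' (tinl ABB a) = amp1 (tinl AB) (amp2 (tinl AB) (bext (qA G) (atens (qA G) (qA G)) (qDA G) a)).
  move=> ha; have hDa := mhomM (qg_D bG) (AM _ ha); have p := P1 _ ha.
  rewrite (gd_lE gABB ha) (morV cA cAA mDA ha) (extV cE cCC mPsi (mhomM hEA (AM _ ha))) in p.
  rewrite (textE cA cA cC cC (gd_ml gAB) (gd_ml gAB) hDa) in p.
  have e := tens_eq bA bA bC hiA hiA (fun x hx => gd_bl gAB hx) (fun x hx => gd_bl gAB hx) hDa.
  by rewrite e in p; have := bval_inj p; rewrite /tens opqE.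
have PsiB1 x : bset B x ->
    Psi' (tinr ABB (tinl BB x)) = amp1 (tinr AB) (amp2 (tinl AB) (bext B (atens B (qA G)) beta x)).
  move=> hx; have hbx := mhomM hb (BM _ hx); have p := P2 _ hx; have h1x := mhomM h1 (BM _ hx).
  rewrite (gd_lE gBB hx) (gd_rV gABB h1x) (extV cE cCC mPsi (mhomM hEB h1x)) in p.
  rewrite (morV cB cBA mb hx) (textE cB cA cC cC (gd_mr gAB) (gd_ml gAB) hbx) in p.
  have e := tens_eq bB bA bC hiB hiA (fun x hx => gd_br gAB hx) (fun x hx => gd_bl gAB hx) hbx.
  by rewrite e in p; have := bval_inj p; rewrite /tens opqE.
have PsiB2 x : bset B x -> Psi' (tinr ABB (tinr BB x)) = t2 (twI AB) (tinr AB x).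
  move=> hx; have p := P3 _ hx; have h2x := mhomM h2 (BM _ hx).
  rewrite (gd_rE gBB hx) (gd_rV gABB h2x) (extV cE cCC mPsi (mhomM hEB h2x)) in p.
  rewrite (gd_rE gAB hx) tens1lE in p; exact: bval_inj p.
have hDC := mhom_comp bC bE bCC hh hPs.
set h' := bext _ (tw_alg ABB) idA_DeltaB in hh hA1 hA2 hDC; set DB := bext B _ DeltaB in hDB.
(* Delta_C and Theta on bounded operators, already extended to multipliers. *)
pose DC x := Psi' (h' x); pose Th y := Psi' (tinr ABB y).
have hTh : mhom (bset (tw_alg BB)) (bat (bset C) (bset C)) Th := mhom_comp bBB bE bCC hEB hPs.
have DeltaCE c : bset C c -> DeltaC (bval c) = bval (DC c).
  move=> hc; have [mh _ _] := hid; rewrite /DeltaC (morV cC cE mh hc).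
  exact: (extV cE cCC mPsi (mhomM hh (CM _ hc))).
have mDC : is_mor C (atens C C) DeltaC.
  have e := batE cC cC; have := hDC; rewrite -e => hDC'.
  exact: (mhom_is_mor cC cCC hDC' DeltaCE).
have DCE c : multb (bset C) c -> bext C (atens C C) DeltaC c = DC c.
  move: c; apply: (mhom_uniq bC bCC (bext_mhom2 cC cC cC mDC) hDC) => c hc.
  by apply: bval_inj; rewrite -(morV cC cCC mDC hc) DeltaCE.
have DCA a : bset (qA G) a -> DC (tinl AB a) = Psi' (tinl ABB a).
  by move=> ha; have e := hA1 _ ha; rewrite (bext_id cA (AM _ ha)) in e; exact: (congr1 Psi' e).
have DCB b : bset B b -> DC (tinr AB b) = Th (DB b).
  by move=> hb'; exact: (congr1 Psi' (hA2 _ hb')).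
have [TE _] := tw_of ABB cA cBB mDA mbhB Dinj.
have eE := tw_algE ABB cA cBB mDA mbhB Dinj.
have DBE b : bset B b -> DeltaB (bval b) = bval (DB b) by move=> hb'; exact: morV.
split.
  move=> bis; split; first split=> //.
    move=> c0 hc0; have hb0 := cstar_bdd cC hc0; have e0 := mkbE hb0; move: (mkb c0) e0 => c e0.
    have hc : bset C c by rewrite /bset e0.
    rewrite -e0 (DeltaCE _ hc).
    have mDc := mhomM hDC (CM _ hc).
    rewrite (textEl cC cC cCC mDC mDc) (textEr cC cC cCC mDC mDc) assocE; congr bval.
    have hbD := mhomS (bext_mhom2 cC cC cC mDC).
    have e1 := amp1_eq (proj1 bC) hbD DCE (fun k l => multb_blk k l (proj1 bC) bC mDc).
    have e2 := amp2_eq (proj1 bC) hbD DCE (fun k l => multb_lblk k l bC (proj1 bC) mDc).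
    rewrite e1 e2.
    have [mF _ _ hF] := tF; have cL := gd_alg gL; have cM := gd_alg gM.
    have [hF' _ _] := extP cL cM mF; set F' := bext _ _ F in hF'.
    have [mDl _ _] := tDl; have [mDr _ _] := tDr.
    have F1 b : bset B b -> F' (tinl Lt (tinl BB b)) = tinl Mt b.
      move=> hb'; have [p _ _] := hF _ hb'; have h1b := mhomM h1 (BM _ hb').
      rewrite (gd_lE gBB hb') (gd_lV gL h1b) (extV cL cM mF (mhomM (gd_inl gL) h1b)) (gd_lE gM hb') in p.
      exact: bval_inj p.
    have F2 b : bset B b -> F' (tinl Lt (tinr BB b)) = tinr Mt (tinl BB b).
      move=> hb'; have [_ p _] := hF _ hb'; have h1b := mhomM h1 (BM _ hb'); have h2b := mhomM h2 (BM _ hb').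
      rewrite (gd_lE gBB hb') (gd_rE gBB hb') (gd_lV gL h2b) (extV cL cM mF (mhomM (gd_inl gL) h2b)) in p.
      rewrite (gd_rV gM h1b) in p; exact: bval_inj p.
    have F3 b : bset B b -> F' (tinr Lt b) = tinr Mt (tinr BB b).
      move=> hb'; have [_ _ p] := hF _ hb'; have h2b := mhomM h2 (BM _ hb').
      rewrite (gd_rE gL hb') (gd_rE gBB hb') (extV cL cM mF (mhomM (gd_inr gL) (BM _ hb'))) in p.
      rewrite (gd_rV gM h2b) in p; exact: bval_inj p.
    have bcoas b : bset B b -> F' (bext (tw_alg BB) (tw_alg Lt) Dl (DB b)) = bext (tw_alg BB) (tw_alg Mt) Dr (DB b).
      move=> hb'; have p := hcoas _ hb'; have hDb := mhomM hDB (BM _ hb').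
      rewrite (morV cB cBB mDB hb') (extV cBB cL mDl hDb) (extV cL cM mF (mhomM hDl hDb)) (extV cBB cM mDr hDb) in p.
      exact: bval_inj p.
    have [TM _] := tw_of Mt cB cBB mb mbhB binj.
    have [G3 [hG3 G3l G3r]] := triple_ex bG bB hb bco bBB TE swABB TM swM.
    have eM := tw_algE Mt cB cBB mb mbhB binj.
    rewrite -eM -eE in hG3.
    have Dl2' b : bset B b -> bext (tw_alg BB) (tw_alg Lt) Dl (tinr BB b) = tinr Lt b.
      move=> hb'; have e := Dl2 _ hb'; rewrite (bext_id cB (BM _ hb')) in e; exact: e.
    have Dr1' b : bset B b -> bext (tw_alg BB) (tw_alg Mt) Dr (tinl BB b) = tinl Mt b.
      move=> hb'; have e := Dr1 _ hb'; rewrite (bext_id cB (BM _ hb')) in e; exact: e.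
    exact: (boson_coassoc bG bB hb bco bBB h1 h2 hDB (gd_lr gBB) hbB q1 q2 qD bC hiA hiB (gd_lr gAB)
      bE hEA hEB hDC hPs PsiA DCA DCB PsiB1 PsiB2 (cstarP cL) (cstarP cM) (gd_inl gL) hDl hDr hF'
      Dl1 Dl2' Dr1' Dr2 F1 F2 F3 bcoas hG3 (fun b hb => G3l b (BM b hb)) G3r hc).
  have hC := cstar_bdd cC; have hB0 := cstar_bdd cB; have [b1 b2] := bis.
  have DCA' a (ha : bset (qA G) a) := etrans (DCA a ha) (PsiA a ha).
  have [p1 _] := bset_cdot_img hB0 hB0 DBE (gd_lE gBB); rewrite b1 in p1.
  have [p2 _] := bset_cdot_img hB0 hB0 DBE (gd_rE gBB); rewrite b2 in p2.
  have [e1 d1] := bset_cdot_img (f' := DC) (g := optens op1) (g' := fun c => t2 (twI AB) c) hC hC DeltaCE (fun c _ => tens1lE (twI AB) c).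
  have [e2 d2] := bset_cdot_img (f' := DC) (g := fun c : op R (twI AB) => c ⊗ op1) (g' := fun c => t1 (twI AB) c) hC hC DeltaCE (fun c _ => tens1E (twI AB) c).
  split; apply: bset_inj => //; try exact: (cstar_bdd cCC).
    rewrite e1 (batE cC cC).
    exact: (boson_bisimp2 bG bB hb bBB h1 h2 hDB (gd_lr gBB) bC hiA hiB (gd_lr gAB) (gd_rl gAB) hDC hTh
      DCA' DCB PsiB1 PsiB2 bpod (esym p2)).
  rewrite e2 (batE cC cC).
  exact: (boson_bisimp1 bG bB hb bBB h1 h2 hDB (gd_rl gBB) bC hiA hiB (gd_lr gAB) (gd_rl gAB) hDC hTh
    DCA' DCB PsiB1 PsiB2 bpod (esym p1)).
have [TC _] := tw_of AB cA cB mDA mbh Dinj; have eC := tw_algE AB cA cB mDA mbh Dinj.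
apply: (iff_trans (inj_onP cB DBE (mhomS hDB))); apply: (iff_trans _ (iff_sym (inj_onP cC DeltaCE (mhomS hDC)))).
split=> inj.
  move=> c hc e; have hhc := mhomM hh (CM _ hc).
  have Pinj := (iffLR (inj_onP cE (fun a => morV cE cCC mPsi) (mhomS hPs))) (let: And5 _ p _ _ _ := hPsi in p).
  have e0 := mhom_inj bE bCC hPs Pinj hhc e.
  have hh2 := hh; rewrite eC eE in hh2; have hc2 := hc; rewrite /C eC in hc2.
  have hA1' a : bset (qA G) a -> h' (tinl AB a) = tinl ABB a.
    by move=> ha; have e2 := hA1 _ ha; rewrite (bext_id cA (AM _ ha)) in e2.
  exact: (boxed_inj bG bB bBB hDB TE swABB TC swAB hh2 hA1' hA2 qhD inj hc2 e0).
move=> b hb' e; have hBb := mhomM hiB (BM _ hb').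
(* [tinr AB b] is only a multiplier of C, so injectivity of Delta_C is applied to the products of
   iA(a) with it. These lie in C and are sent to 0; nondegeneracy of iA(A) then gives the claim. *)
have i0 : tinr AB b = 0.
  apply: (mhom_faithful bA bC hiA) => a ha; have hAa := mhomM hiA (AM _ ha).
  apply: inj; first by rewrite (gd_lr gAB); apply: bcdot_in; [exists a|exists b].
  have q : DC (tinl AB a * tinr AB b) = DC (tinl AB a) * DC (tinr AB b) := mhomX hDC hAa hBb.
  have m0 : multb (bset (tw_alg BB)) 0 by apply: BBM; have [[[z _ _] _ _] _] := bBB.
  have m0' : multb (bset (tw_alg ABB)) 0 by rewrite -(hom0 m0 (mhomS hEB)); exact: (mhomM hEB m0).
  have t0 : Th 0 = 0 by rewrite /Th (hom0 m0 (mhomS hEB)) (hom0 m0' (mhomS hPs)).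
  by rewrite q (DCB _ hb') e t0 mulr0.
have p0 : t2 (twH AB) (tpsi AB b) = 0.
  have := congr1 (fun X => star (tZ AB) * X * tZ AB) i0; rewrite mulr0 mul0r /tinr /binr.
  by rewrite !mulrA (tw_Zl TC) mul1r -mulrA (tw_Zl TC) mulr1.
have [[k _]|nH] := pselect (exists k : twH AB, True).
  apply: (tw_psii TC hb'); apply: bopP => i j; have := congr1 (fun X : bop R _ => X (k, i) (k, j)) p0.
  by rewrite t2E eqxx mul1r !bval0.
(* If the carrier of the first leg is empty, then A, hence l^2 of its index set,
   vanishes, and injectivity of the coaction leaves B = 0. *)
have A0 a : bset (qA G) a -> a = 0.
  by move=> ha; apply: (tw_phii TC ha); apply: bopP => i; case: nH; exists i.
have z1 : (1 : bop R (qI G)) = 0.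
  by apply: (nondegR (proj1 bA) (proj2 bA)) => a /A0 ->; rewrite mulr0.
apply: binj => //; apply: bopP => -[i l] ?.
have := congr1 (fun X : bop R (qI G) => X l l) z1; rewrite bval1 bval0 /op1 eqxx => /eqP.
by rewrite oner_eq0.
Qed.
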